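(* Each of the following twelve sets of oriented Reidemeister moves is a minimal generating set: $\{3a,2a,1a,1b\}$, $\{3a,2a,1a,1c\}$, $\{3a,2a,1b,1d\}$, $\{3a,2b,1a,1b\}$, $\{3a,2b,1a,1c\}$, $\{3a,2b,1b,1d\}$, $\{3h,2a,1a,1c\}$, $\{3h,2a,1b,1d\}$, $\{3h,2a,1c,1d\}$, $\{3h,2b,1a,1c\}$, $\{3h,2b,1b,1d\}$, $\{3h,2b,1c,1d\}$.
   Context: Moves. Diagrams are oriented tangle/link diagrams (generic oriented plane curves with transverse double points and over/under information). A Reidemeister move is a local replacement, usable in both directions, supported inside an embedded oriented disk (the changing disk of the move). A crossing is positive if (direction of over-strand, direction of under-strand) is a positively oriented basis of the plane, and negative otherwise. Type I moves replace a crossingless arc by an arc with one crossing forming a small loop: 1a (positive crossing, loop oriented clockwise), 1b (positive, counterclockwise), 1c (negative, clockwise), 1d (negative, counterclockwise). Type II moves replace two disjoint crossingless arcs by two arcs having two crossings and forming a bigon, one arc lying over the other at both crossings. In 2a and 2b the two arcs run in the same direction (draw both upward): in 2a the arc that is on the right before the move is the over-arc, in 2b the arc on the left is the over-arc. In 2c and 2d the two arcs run in opposite directions, and the boundary of the bigon is a coherently oriented cycle: counterclockwise in 2c, clockwise in 2d. Type III moves involve three pairwise crossing arcs $T$ (over both others), $M$ (over $B$), $B$ (under both); one arc is moved across the crossing of the other two. The move is determined by the signs of the crossings ($TM$, $TB$, $MB$): 3a $(+,-,+)$, 3b $(+,+,+)$, 3c $(+,-,-)$, 3d $(-,+,+)$,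 3e $(+,+,-)$, 3f $(-,-,+)$, 3g $(-,-,-)$, 3h $(-,+,-)$. Generation. Let $\mathcal{R}$ be the set of all sixteen moves. A set $S\subset\mathcal{R}$ is a generating set if for every move $m\in\mathcal{R}$ the two sides of $m$ are related by a finite sequence of plane isotopies and moves from $S$ (in either direction) performed inside the changing disk of $m$. A generating set $S$ is minimal if for every $m\in S$ the set $S\setminus\{m\}$ is not a generating set. *)

(* Defs.v *)
From Stdlib Require Import Relations.
From HB Require Import structures.
From mathcomp Require Import all_boot all_order all_algebra.
From mathcomp Require Import all_classical all_reals all_analysis.

Set Implicit Arguments.
Unset Strict Implicit.
Unset Printing Implicit Defensive.

Import Order.TTheory GRing.Theory Num.Theory numFieldNormedType.Exports.
Local Open Scope classical_set_scope.
Local Open Scope ring_scope.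

(* Oriented tangle diagrams are polygonal. An arc is the list of its vertices
   in the order of its orientation. The integer attached to a vertex is the
   level of the edge that leaves it (so the integer of a last vertex is not
   used): where two edges cross, the one of higher level is the over-strand.
   Only these comparisons matter, see [isotopy] below. Move sequences starting
   from a diagram made of arcs never meet closed components, so there are none. *)
Definition point (R : realType) : Type := (R * R)%type.
Definition vertex (R : realType) : Type := (point R * int)%type.
Definition arc (R : realType) : Type := seq (vertex R).
Definition diagram (R : realType) : Type := seq (arc R).

Definition nb_vertices (R : realType) (D : diagram R) (i : nat) : nat :=
  size (nth [::] D i).

Definition vtx (R : realType) (D : diagram R) (i j : nat) : vertex R :=
  nth ((0, 0), 0) (nth [::] D i) j.

Definition pos (R : realType) (D : diagram R) (i j : nat) : point R :=
  (vtx D i j).1.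

Definition last_pos (R : realType) (D : diagram R) (i : nat) : point R :=
  pos D i (nb_vertices D i).-1.

(* The edge (i, j) joins the vertices j and j + 1 of the arc i. *)
Definition is_edge (R : realType) (D : diagram R) (e : nat * nat) : Prop :=
  (e.2.+1 < nb_vertices D e.1)%N.

Definition level (R : realType) (D : diagram R) (e : nat * nat) : int :=
  (vtx D e.1 e.2).2.

Definition lerp (R : realType) (t : R) (p q : point R) : point R :=
  ((1 - t) * p.1 + t * q.1, (1 - t) * p.2 + t * q.2).

Definition on_edge (R : realType) (D : diagram R) (e : nat * nat) :
    set (point R) :=
  [set z | exists2 t : R, 0 <= t <= 1 &
     z = lerp t (pos D e.1 e.2) (pos D e.1 e.2.+1)].

Definition trace (R : realType) (D : diagram R) : set (point R) :=
  [set z | exists2 e, is_edge D e & on_edge D e z].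

(* Equal or consecutive edges. *)
Definition adjacent (e f : nat * nat) : bool :=
  [&& e.1 == f.1, (e.2 <= f.2.+1)%N & (f.2 <= e.2.+1)%N].

Definition crossing (R : realType) (D : diagram R) (e f : nat * nat) : Prop :=
  [/\ is_edge D e, is_edge D f, ~~ adjacent e f &
      on_edge D e `&` on_edge D f !=set0].

(* By [generic_vertices], an arc never folds back onto itself at a vertex, and
   two edges that meet elsewhere than at a common endpoint cross transversely
   at one point interior to both. *)
Record generic (R : realType) (D : diagram R) : Prop := Generic {
  generic_size : forall i, (i < size D)%N -> (1 < nb_vertices D i)%N;
  generic_edges : forall e, is_edge D e -> pos D e.1 e.2 <> pos D e.1 e.2.+1;
  generic_vertices : forall (i j : nat) e,
    (j < nb_vertices D i)%N -> is_edge D e -> on_edge D e (pos D i j) ->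
    e.1 = i /\ (e.2 = j \/ e.2.+1 = j);
  generic_no_triple : forall e f g z,
    is_edge D e -> is_edge D f -> is_edge D g ->
    e <> f -> f <> g -> e <> g ->
    on_edge D e z -> on_edge D f z -> ~ on_edge D g z;
  generic_levels : forall e f, crossing D e f -> level D e <> level D f }.

(* The model changing disk is the square [-1, 1]^2. *)
Definition disk (R : realType) : set (point R) :=
  [set z | `|z.1| <= 1 /\ `|z.2| <= 1].

Definition open_disk (R : realType) : set (point R) :=
  [set z | `|z.1| < 1 /\ `|z.2| < 1].

(* Each arc lies in the disk and meets its boundary exactly at the two ends
   of the arc. *)
Record tangle (R : realType) (D : diagram R) : Prop := Tangle {
  tangle_generic : generic D;
  tangle_disk : forall e z, is_edge D e -> on_edge D e z -> disk z;
  tangle_ends : forall e z, is_edge D e -> on_edge D e z ->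
    (~ open_disk z <-> z = pos D e.1 0 \/ z = last_pos D e.1) }.

(* Plane isotopy in the disk, relative to the boundary: a continuous motion
   through generic diagrams that keeps the over/under information. The motion
   has a fixed number of vertices; [subdivision] changes that number. *)
Definition isotopy (R : realType) (D D' : diagram R) : Prop :=
  exists F : R -> diagram R,
    [/\ F 0 = D /\ F 1 = D',
        forall t, 0 <= t <= 1 -> tangle (F t) /\ shape (F t) = shape D,
        forall i j,
          {within `[0, 1], continuous (fun t : R => (pos (F t) i j).1)} /\
          {within `[0, 1], continuous (fun t : R => (pos (F t) i j).2)},
        forall t i, 0 <= t <= 1 ->
          pos (F t) i 0 = pos D i 0 /\ last_pos (F t) i = last_pos D i &
        forall t e f, 0 <= t <= 1 -> crossing (F t) e f ->
          (level (F t) e < level (F t) f) = (level D e < level D f)].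

(* The same plane curves, with one more vertex inside an edge. *)
Definition subdivision (R : realType) (D D' : diagram R) : Prop :=
  exists (D1 D2 : diagram R) (s1 s2 : arc R) (a b : vertex R) (t : R),
    [/\ 0 < t < 1,
        D = D1 ++ (s1 ++ [:: a, b & s2]) :: D2 &
        D' = D1 ++ (s1 ++ [:: a, (lerp t a.1 b.1, a.2), b & s2]) :: D2].

Inductive move : Type :=
  | R1a | R1b | R1c | R1d
  | R2a | R2b | R2c | R2d
  | R3a | R3b | R3c | R3d | R3e | R3f | R3g | R3h.

(* One upward arc, without crossing. *)
Definition straight (R : realType) : diagram R :=
  [:: [:: ((0, -1), 0); ((0, 1), 0)]].

(* An upward arc with one loop: [s] is the sign of the crossing, and [o] is 1
   if the loop is counterclockwise and -1 if it is clockwise. The first edge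
   has direction (- o, 3), the last one (o, 3), and their determinant has sign
   - o; hence the crossing has sign o if the last edge is over, - o if it is
   under, and the level s * o of the last edge makes this sign equal to s. *)
Definition kink (R : realType) (s o : int) : diagram R :=
  [:: [:: ((0, -1), 0);
          ((- o%:~R / 2, 1 / 2), 0);
          ((- o%:~R / 2, - (1 / 2)), s * o);
          ((0, 1), 0)]].

(* From (x, -1) to (x, 1) through (y, 0) if d = 1, backwards if d = -1. *)
Definition strand (R : realType) (x y : R) (d l : int) : arc R :=
  [:: ((x, - d%:~R), l); ((y, 0), l); ((x, d%:~R), l)].

(* Left and right vertical arcs, of directions dl, dr (1 is upward) and levels
   ll, lr; in [two_bigon] each one has been pushed across the other. *)
Definition two_apart (R : realType) (dl dr ll lr : int) : diagram R :=
  [:: strand (- (1 / 2)) (- (1 / 2)) dl ll; strand (1 / 2) (1 / 2) dr lr].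

Definition two_bigon (R : realType) (dl dr ll lr : int) : diagram R :=
  [:: strand (- (1 / 2)) (1 / 2) dl ll; strand (1 / 2) (- (1 / 2)) dr lr].

(* The arc T goes in the direction (1, 0), and passes above or below the
   crossing (0, 0) of the arcs M and B according to the sign of h. For signs
   tm, tb, mb (equal to 1 or -1), put c = tm * tb * mb / 2. Then M and B are
   straight, with directions tm * (c, 1) and tb * (- c, 1), so the determinants
   of the directions of (T, M), (T, B) and (M, B) are
   tm, tb and 2 * c * tm * tb = mb. *)
Definition triangle (R : realType) (tm tb mb : int) (h : R) : diagram R :=
  let c : R := (tm * tb * mb)%:~R / 2 in
  let line (s : R) (c : R) (l : int) : arc R :=
    [:: ((- (s * c), - s), l); ((s * c, s), l)] in
  [:: [:: ((-1, 0), 2); ((0, h), 2); ((1, 0), 2)];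
      line tm%:~R c 1;
      line tb%:~R (- c) 0].

Definition type1 (R : realType) (s o : int) : diagram R * diagram R :=
  (straight R, kink R s o).

Definition type2 (R : realType) (dl dr ll lr : int) : diagram R * diagram R :=
  (two_apart R dl dr ll lr, two_bigon R dl dr ll lr).

Definition type3 (R : realType) (tm tb mb : int) : diagram R * diagram R :=
  (triangle tm tb mb (1 / 2 : R), triangle tm tb mb (- (1 / 2) : R)).

(* The two sides of a move. In [two_bigon] the right part of the bigon belongs
   to the left arc, hence the directions in R2c and R2d; there, rotating the
   picture by a half-turn exchanges the over-arc and the under-arc, so it does
   not matter which one is over. *)
Definition sides (R : realType) (m : move) : diagram R * diagram R :=
  match m with
  | R1a => type1 R 1 (-1)
  | R1b => type1 R 1 1
  | R1c => type1 R (-1) (-1)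
  | R1d => type1 R (-1) 1
  | R2a => type2 R 1 1 0 1
  | R2b => type2 R 1 1 1 0
  | R2c => type2 R 1 (-1) 1 0
  | R2d => type2 R (-1) 1 1 0
  | R3a => type3 R 1 (-1) 1
  | R3b => type3 R 1 1 1
  | R3c => type3 R 1 (-1) (-1)
  | R3d => type3 R (-1) 1 1
  | R3e => type3 R 1 1 (-1)
  | R3f => type3 R (-1) (-1) 1
  | R3g => type3 R (-1) (-1) (-1)
  | R3h => type3 R (-1) 1 (-1)
  end.

(* A move is performed in the image of the model disk by an affine embedding.
   Embedded disks of other shapes bring nothing new, since isotopies before
   and after the move can shrink any changing disk to an affine one. *)
Definition oriented_affine (R : realType) (phi : point R -> point R) : Prop :=
  exists a b c d u v : R, 0 < a * d - b * c /\
    forall z, phi z = (a * z.1 + b * z.2 + u, c * z.1 + d * z.2 + v).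

Definition transport (R : realType) (phi : point R -> point R)
    (D : diagram R) : diagram R :=
  map (map (fun v : vertex R => (phi v.1, v.2))) D.

(* A diagram with holes: [inr k] stands for the arc k of a local picture. *)
Definition context (R : realType) : Type := seq (seq (vertex R + nat)).

Definition holes (R : realType) (C : context R) : seq nat :=
  pmap (fun x => if x is inr k then Some k else None) (flatten C).

Definition fill (R : realType) (C : context R) (P : diagram R) : diagram R :=
  map (fun w => flatten (map (fun x =>
    match x with inl v => [:: v] | inr k => nth [::] P k end) w)) C.

(* In the image of the open disk, D is the transported picture P. *)
Definition looks_like (R : realType) (phi : point R -> point R)
    (D P : diagram R) : Prop :=
  forall z, open_disk z ->
    (trace D (phi z) <-> trace (transport phi P) (phi z)).

Definition apply_move (R : realType) (m : move) (D D' : diagram R) : Prop :=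
  exists (phi : point R -> point R) (C : context R),
    let P := (sides R m).1 in
    let P' := (sides R m).2 in
    [/\ oriented_affine phi,
        forall z, disk z -> disk (phi z),
        perm_eq (holes C) (iota 0 (size P)),
        D = fill C (transport phi P) /\ D' = fill C (transport phi P') &
        looks_like phi D P /\ looks_like phi D' P'].

Definition step (R : realType) (S : set move) (D D' : diagram R) : Prop :=
  [/\ tangle D, tangle D' &
      [\/ isotopy D D', subdivision D D' | exists2 m, S m & apply_move m D D']].

Definition generating_set (R : realType) (S : set move) : Prop :=
  forall m : move,
    clos_refl_sym_trans (diagram R) (step S) (sides R m).1 (sides R m).2.

Definition minimal_generating_set (R : realType) (S : set move) : Prop :=
  generating_set R S /\ forall m, S m -> ~ generating_set R (S `\ m).

(* Main.v *)
From HB Require Import structures.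
From Stdlib Require Import ZArith Relations.
Require Import Defs.
From mathcomp Require Import all_boot all_order all_algebra.
From mathcomp Require Import all_classical all_reals all_analysis.
From mathcomp Require Import ring lra zify ssrZ.

(** A set of moves generates if the two sides of each of the sixteen moves are
    joined by steps that use this set only.

    Minimality. Each of the twelve sets consists of one move of type III, one
    of type II and two of type I, and each of the four is the only one of its
    set that changes a certain sum over the crossings. The number [mutual] of
    the crossings of two arcs is changed by the moves of type II only. The sum
    [ordered] of the products of the signs of a crossing of the first arc with
    the second one and a later crossing of the first arc with the third one is
    changed by the moves of type III only. The signed numbers [self_sum] of the
    self-crossings that an arc first passes over, or first passes under, tell
    R1a and R1d from R1b and R1c. These sums do not change in an isotopy
    ([isotopy_same_crossings]: proper crossings are given by strict
    inequalities, and disjoint segments are strictly separated, so crossings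
    neither appear nor disappear), in a subdivision ([subdivision_sums]), and
    in the other moves ([apply_move_sums]: the rest of the diagram does not
    enter the changing disk, [outer_avoids]).

    Generation. Three families of derivations suffice. A strand is pushed by a
    move of type II across the far side of the loop of a kink, then slid by a
    move of type III across the crossing of the kink, and removing the kink
    leaves another move of type II. A zigzag of one arc is turned by R2c or R2d
    into two kinks; the removal of one of them leaves a new move of type I. A
    move of type III between a move of type II and its inverse is a move of type
    III in which one crossing has changed its sign. Each derivation is a list of
    explicit diagrams on an integer grid, where one vertex moves at a time. Then
    the position of a vertex with respect to a line depends affinely on the
    time, so that strict inequalities at the start and at the end hold all along
    ([motion_isotopy]), and a derivation is verified by computation
    ([certifies_reaches]). A derivation may use moves that have been derived
    before: what can be done in a disk can be done in an affine copy of this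
    disk inside a larger diagram ([localize]). Going several times through the
    list [derivations] reaches all the moves from each of the twelve sets. *)

Set Implicit Arguments.
Unset Strict Implicit.
Unset Printing Implicit Defensive.
Import Order.TTheory GRing.Theory Num.Theory numFieldNormedType.Exports.
Import Defs.
Local Open Scope classical_set_scope.
Local Open Scope ring_scope.
Delimit Scope Z_scope with BZ.

(** * Segments in the plane *)

(** Twice the signed area of the triangle a, b, c. *)
Definition orient (T : comPzRingType) (a b c : T * T) : T :=
  (b.1 - a.1) * (c.2 - a.2) - (b.2 - a.2) * (c.1 - a.1).

(** The ends of each of the segments ab and cd are strictly on different sides
    of the line of the other one. *)
Definition proper (T : realDomainType) (a b c d : T * T) : bool :=
  (orient a b c * orient a b d < 0) && (orient c d a * orient c d b < 0).

Definition segment (R : realType) (a b : point R) : set (point R) :=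
  [set z | exists2 t : R, 0 <= t <= 1 & z = lerp t a b].

Section Segments.
Variable R : realType.
Implicit Types a b c d p q z : point R.

Lemma point_eqP p q : p.1 = q.1 -> p.2 = q.2 -> p = q.
Proof. by case: p q => [? ?] [? ?] /= -> ->. Qed.

Lemma lerp0 a b : lerp 0 a b = a.
Proof. by apply: point_eqP; rewrite /=; ring. Qed.

Lemma lerp1 a b : lerp 1 a b = b.
Proof. by apply: point_eqP; rewrite /=; ring. Qed.

Lemma lerpC (t : R) a b : lerp t a b = lerp (1 - t) b a.
Proof. by apply: point_eqP; rewrite /=; ring. Qed.

Lemma segment_l a b : segment a b a.
Proof. by exists 0; [rewrite lexx ler01 | rewrite lerp0]. Qed.

Lemma segment_r a b : segment a b b.
Proof. by exists 1; [rewrite lexx ler01 | rewrite lerp1]. Qed.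

Lemma segmentC a b z : segment a b z -> segment b a z.
Proof. by case=> t tI ->; exists (1 - t); [lra | rewrite lerpC]. Qed.

Lemma orient_lerp (t : R) a b p q :
  orient p q (lerp t a b) = (1 - t) * orient p q a + t * orient p q b.
Proof. by rewrite /orient /lerp /=; ring. Qed.

Lemma orientCl a b c : orient b a c = - orient a b c.
Proof. by rewrite /orient; ring. Qed.

Lemma orient_cycle a b c : orient b c a = orient a b c.
Proof. by rewrite /orient; ring. Qed.

Lemma orient_aba a b : orient a b a = 0.
Proof. by rewrite /orient; ring. Qed.

Lemma orient_abb a b : orient a b b = 0.
Proof. by rewrite /orient; ring. Qed.

Lemma orient_seg a b z : segment a b z -> orient a b z = 0.
Proof. by case=> t _ ->; rewrite orient_lerp orient_aba orient_abb; ring. Qed.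

Lemma properC a b c d : proper a b c d = proper c d a b.
Proof. by rewrite /proper andbC. Qed.

Lemma proper_share a b c d :
  [|| a == c, a == d, b == c | b == d] -> proper a b c d = false.
Proof.
by rewrite /proper => /or4P[] /eqP->;
  rewrite ?orient_aba ?orient_abb ?mul0r ?mulr0 ltxx ?andbF.
Qed.

(** The point where the first segment meets the line of the second one. *)
Definition meet_time a b c d : R :=
  orient c d a / (orient c d a - orient c d b).

Lemma proper_meet a b c d (s := meet_time a b c d) (u := meet_time c d a b) :
  proper a b c d -> [/\ 0 < s < 1, 0 < u < 1 & lerp s a b = lerp u c d].
Proof.
rewrite /proper => /andP[h1 h2].
have half (x y : R) : x * y < 0 -> 0 < x / (x - y) < 1.
  move=> xy; have [x0|x0|x0] := ltgtP x 0; last by rewrite x0 mul0r ltxx in xy.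
    have y0 : 0 < y by rewrite -(nmulr_rlt0 _ x0).
    have xy0 : 0 < y - x by lra.
    rewrite -[x / _]opprK -mulrN -invrN opprB -mulNr.
    by rewrite divr_gt0 //= ?ltr_pdivrMr //; lra.
  have y0 : y < 0 by rewrite -(pmulr_rlt0 _ x0).
  have xy0 : 0 < x - y by lra.
  by rewrite divr_gt0 //= ltr_pdivrMr //; lra.
split; [exact: half | exact: half |].
have /lt0r_neq0 n1 : 0 < - (orient a b c * orient a b d) by rewrite oppr_gt0.
have d1 : orient c d a - orient c d b != 0.
  apply/eqP => e; have e' : orient c d a = orient c d b by lra.
  by have := sqr_ge0 (orient c d b); rewrite expr2 -{1}e' leNgt h2.
have d2 : orient a b c - orient a b d != 0.
  apply/eqP => e; have e' : orient a b c = orient a b d by lra.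
  by have := sqr_ge0 (orient a b d); rewrite expr2 -{1}e' leNgt h1.
rewrite /s /u /meet_time /lerp; apply: point_eqP => /=.
all: move: d1 d2; rewrite /orient => d1 d2; field; apply/andP; split => //.
Qed.

Lemma proper_uniq a b c d (t : R) : proper a b c d ->
  orient c d (lerp t a b) = 0 -> t = meet_time a b c d.
Proof.
rewrite orient_lerp /meet_time => /andP[_ h2] e.
have d1 : orient c d a - orient c d b != 0.
  apply/eqP => e'; have e2 : orient c d a = orient c d b by lra.
  by have := sqr_ge0 (orient c d b); rewrite expr2 -{1}e2 leNgt h2.
by apply: (mulIf d1); rewrite divfK //; lra.
Qed.

Lemma proper_inter a b c d z z' : proper a b c d ->
  segment a b z -> segment c d z -> segment a b z' -> segment c d z' -> z = z'.
Proof.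
move=> h [t _ ->] zc [t' _ ->] z'c.
by rewrite (proper_uniq h (orient_seg zc)) (proper_uniq h (orient_seg z'c)).
Qed.

(* On a line, two overlapping segments contain an endpoint of one another. *)
(** If two intervals of a line have a common point, one of them contains an end
    of the other one; here they are [0, 1] and the interval from s - u * l to
    s + (1 - u) * l, with the common point s. *)
Lemma overlap1 (s u l : R) : 0 <= s <= 1 -> 0 <= u <= 1 -> l != 0 ->
  [\/ 0 <= s - u * l <= 1, 0 <= s + (1 - u) * l <= 1,
      0 <= - (s - u * l) / l <= 1 | 0 <= (1 - (s - u * l)) / l <= 1].
Proof.
move=> /andP[s0 s1] /andP[u0 u1] l0.
set x := s - u * l; have ex : x + l = s + (1 - u) * l by rewrite /x; ring.
have [lp|ln] : 0 < l \/ l < 0 by case: ltgtP l0; auto.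
- have ul : 0 <= u * l by rewrite mulr_ge0 // ltW.
  have ul' : 0 <= (1 - u) * l by rewrite mulr_ge0 // ?subr_ge0 // ltW.
  have [xn|xp] := ltP x 0.
    by apply: Or43; rewrite ler_pdivlMr // ler_pdivrMr // -/x; lra.
  by apply: Or41; rewrite -/x; lra.
- have ul : 0 <= u * - l by rewrite mulr_ge0 //; lra.
  have ul' : 0 <= (1 - u) * - l by rewrite mulr_ge0 //; lra.
  have [xn|xp] := ltP 1 x.
    by apply: Or44; rewrite ler_ndivlMr // ler_ndivrMr // -/x; lra.
  by apply: Or41; rewrite -/x; lra.
Qed.

(** Two segments that meet away from their endpoints cross properly: if the
    intersection were not transverse, the segments would overlap and one of
    them would contain an endpoint of the other one. *)
Lemma meet_proper a b c d z : a <> b -> c <> d ->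
    segment a b z -> segment c d z ->
    ~ segment a b c -> ~ segment a b d -> ~ segment c d a -> ~ segment c d b ->
  proper a b c d.
Proof.
move=> nab ncd [s sI zs] [u uI zu] nc nd na nb.
pose D := (b.1 - a.1) * (d.2 - c.2) - (b.2 - a.2) * (d.1 - c.1).
have e1 := congr1 fst zs; have e2 := congr1 snd zs.
rewrite zu /= in e1 e2.
have f1 : c.1 - a.1 = s * (b.1 - a.1) - u * (d.1 - c.1) by lra.
have f2 : c.2 - a.2 = s * (b.2 - a.2) - u * (d.2 - c.2) by lra.
have oc : orient a b c = - u * D.
  by rewrite /orient /D f1 f2; ring.
have od : orient a b d = (1 - u) * D.
  rewrite /orient /D.
  have -> : d.2 - a.2 = s * (b.2 - a.2) + (1 - u) * (d.2 - c.2) by lra.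
  have -> : d.1 - a.1 = s * (b.1 - a.1) + (1 - u) * (d.1 - c.1) by lra.
  ring.
have oa : orient c d a = s * D.
  rewrite /orient /D.
  have -> : a.2 - c.2 = u * (d.2 - c.2) - s * (b.2 - a.2) by lra.
  have -> : a.1 - c.1 = u * (d.1 - c.1) - s * (b.1 - a.1) by lra.
  ring.
have ob : orient c d b = - (1 - s) * D.
  rewrite /orient /D.
  have -> : b.2 - c.2 = u * (d.2 - c.2) + (1 - s) * (b.2 - a.2) by lra.
  have -> : b.1 - c.1 = u * (d.1 - c.1) + (1 - s) * (b.1 - a.1) by lra.
  ring.
have u0 : u != 0.
  by apply/eqP => u0; apply: nc; exists s => //; rewrite -zs zu u0 lerp0.
have u1 : u != 1.
  by apply/eqP => u1; apply: nd; exists s => //; rewrite -zs zu u1 lerp1.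
have s0 : s != 0.
  by apply/eqP => s0; apply: na; exists u => //; rewrite -zu zs s0 lerp0.
have s1 : s != 1.
  by apply/eqP => s1; apply: nb; exists u => //; rewrite -zu zs s1 lerp1.
have [D0|D0] := eqVneq D 0; last first.
  have D2 : 0 < D * D by rewrite -expr2 exprn_even_gt0.
  have su (x : R) : 0 <= x <= 1 -> x != 0 -> x != 1 -> 0 < x * (1 - x).
    move=> /andP[x0 x1] n0 n1.
    by rewrite mulr_gt0 // ?subr_gt0 lt_neqAle ?n1 // eq_sym n0.
  rewrite /proper oc od oa ob.
  have -> : - u * D * ((1 - u) * D) = - ((u * (1 - u)) * (D * D)) by ring.
  have -> : s * D * (- (1 - s) * D) = - ((s * (1 - s)) * (D * D)) by ring.
  by rewrite !oppr_lt0; apply/andP; split; apply: mulr_gt0 => //; apply: su.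
exfalso.
(* the direction of the second segment is l times that of the first one *)
have [l [l0 d1 d2]] : exists l : R,
    [/\ l != 0, d.1 - c.1 = l * (b.1 - a.1) & d.2 - c.2 = l * (b.2 - a.2)].
  have [x0|x0] := eqVneq (b.1 - a.1) 0.
    have y0 : b.2 - a.2 != 0.
      by apply/eqP => y0; apply: nab; apply: point_eqP; lra.
    have dx : d.1 - c.1 = 0.
      by apply: (mulfI y0); move: D0; rewrite /D x0; lra.
    exists ((d.2 - c.2) / (b.2 - a.2)); rewrite divfK // x0 mulr0; split => //.
    apply: mulf_neq0; rewrite ?invr_neq0 //; apply/eqP => dy.
    by apply: ncd; apply: point_eqP; lra.
  exists ((d.1 - c.1) / (b.1 - a.1)); rewrite divfK //; split => //.
    apply: mulf_neq0; rewrite ?invr_neq0 //; apply/eqP => dx.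
    have dy : d.2 - c.2 = 0.
      by apply: (mulfI x0); move: D0; rewrite /D dx; lra.
    by apply: ncd; apply: point_eqP; lra.
  apply: (mulfI x0); rewrite [RHS]mulrCA [RHS]mulrA divfK //.
  by move: D0; rewrite /D; lra.
have c1E : c.1 = a.1 + (s - u * l) * (b.1 - a.1) by rewrite d1 in f1; lra.
have c2E : c.2 = a.2 + (s - u * l) * (b.2 - a.2) by rewrite d2 in f2; lra.
have d1E : d.1 = c.1 + l * (b.1 - a.1) by lra.
have d2E : d.2 = c.2 + l * (b.2 - a.2) by lra.
have [h|h|h|h] := overlap1 sI uI l0.
- by apply: nc; exists (s - u * l) => //; apply: point_eqP => /=; lra.
- by apply: nd; exists (s + (1 - u) * l) => //; apply: point_eqP => /=; lra.
- apply: na; exists (- (s - u * l) / l) => //.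
  by apply: point_eqP => /=; rewrite ?d1E ?d2E ?c1E ?c2E; field.
- apply: nb; exists ((1 - (s - u * l)) / l) => //.
  by apply: point_eqP => /=; rewrite ?d1E ?d2E ?c1E ?c2E; field.
Qed.

End Segments.

Section Separation.
Variable R : realType.
Implicit Types a b c d p q z v : point R.

Lemma collinear_lerp a b z : a <> b -> orient a b z = 0 ->
  exists m : R, z = lerp m a b.
Proof.
move=> nab; rewrite /orient => o.
have [x0|x0] := eqVneq (b.1 - a.1) 0.
  have y0 : b.2 - a.2 != 0.
    by apply/eqP => y0; apply: nab; apply: point_eqP; lra.
  have zx : z.1 - a.1 = 0 by apply: (mulfI y0); move: o; rewrite x0; lra.
  exists ((z.2 - a.2) / (b.2 - a.2)); apply: point_eqP => /=.
    by have -> : b.1 = a.1 by [lra]; lra.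
  by field.
exists ((z.1 - a.1) / (b.1 - a.1)); apply: point_eqP => /=; first by field.
apply: (mulfI x0).
have -> : (b.1 - a.1) * ((1 - (z.1 - a.1) / (b.1 - a.1)) * a.2 +
   (z.1 - a.1) / (b.1 - a.1) * b.2) =
   (b.1 - a.1) * a.2 + (z.1 - a.1) * (b.2 - a.2) by field.
by lra.
Qed.

Lemma lerp_inj a b (s t : R) : a <> b -> lerp s a b = lerp t a b -> s = t.
Proof.
move=> nab e; have e1 := congr1 fst e; have e2 := congr1 snd e.
rewrite /= in e1 e2.
have [x0|x0] := eqVneq (b.1 - a.1) 0.
  have y0 : b.2 - a.2 != 0.
    by apply/eqP => y0; apply: nab; apply: point_eqP; lra.
  by apply: (mulIf y0); lra.
by apply: (mulIf x0); lra.
Qed.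

Definition dot v z : R := v.1 * z.1 + v.2 * z.2.

(** Disjoint segments are strictly separated by the line of one of them, or,
    if they lie on one line, along that line. *)
Lemma disjoint_separated a b c d : a <> b -> c <> d ->
    (forall z, segment a b z -> ~ segment c d z) ->
  [\/ 0 < orient a b c * orient a b d, 0 < orient c d a * orient c d b |
      exists v, [/\ dot v a < dot v c, dot v a < dot v d,
                    dot v b < dot v c & dot v b < dot v d]].
Proof.
move=> nab ncd dis.
have [h1|h1] := ltP 0 (orient a b c * orient a b d); first exact: Or31.
have [h2|h2] := ltP 0 (orient c d a * orient c d b); first exact: Or32.
pose D := (b.1 - a.1) * (d.2 - c.2) - (b.2 - a.2) * (d.1 - c.1).
have eD : orient a b d = orient a b c + D by rewrite /orient /D; ring.
have eD' : orient c d b = orient c d a - D by rewrite /orient /D; ring.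
have unit (x : R) : D != 0 -> x * (x - D) <= 0 -> 0 <= x / D <= 1.
  move=> D0 xD; have D2 : 0 < D * D by rewrite -expr2 exprn_even_gt0.
  have [y xE] : exists y, x = y * D by exists (x / D); rewrite divfK.
  move: xD; rewrite {x}xE mulfK // => xD.
  have yy : y * (y - 1) <= 0.
    rewrite -(pmulr_lle0 _ D2); move: xD.
    by have -> : y * D * (y * D - D) = y * (y - 1) * (D * D) by ring.
  apply/andP; split.
    rewrite leNgt; apply/negP => y0.
    by have : 0 < (- y) * (1 - y) by [apply: mulr_gt0; lra]; lra.
  rewrite leNgt; apply/negP => y1.
  by have : 0 < y * (y - 1) by [apply: mulr_gt0; lra]; lra.
have [D0|D0] := eqVneq D 0; last first.
  have uI : 0 <= - orient a b c / D <= 1.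
    apply: unit => //; move: h1; rewrite eD.
    by have -> : - orient a b c * (- orient a b c - D) =
      orient a b c * (orient a b c + D) by ring.
  have sI : 0 <= orient c d a / D <= 1 by apply: unit => //; rewrite -eD'.
  exfalso; apply: (dis (lerp (orient c d a / D) a b)).
    by exists (orient c d a / D).
  exists (- orient a b c / D) => //; move: D0; rewrite /D /orient => D0.
  by apply: point_eqP => /=; field.
have o1 : orient a b c = 0.
  by apply/eqP; rewrite -sqrf_eq0 expr2 eq_le -expr2 sqr_ge0 andbT expr2;
     move: h1; rewrite eD D0 addr0.
have o2 : orient a b d = 0 by rewrite eD o1 D0 addr0.
have [m cE] := collinear_lerp nab o1; have [n dE] := collinear_lerp nab o2.
pose w := (b.1 - a.1, b.2 - a.2) : point R.
have w2 : 0 < dot w w.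
  rewrite lt_neqAle; apply/andP; split; last by rewrite addr_ge0 // -expr2 sqr_ge0.
  apply/eqP => e; apply: nab.
  have e1 : w.1 * w.1 = 0.
    by apply/eqP; rewrite eq_le -expr2 sqr_ge0 andbT;
       have := sqr_ge0 w.2; move: e; rewrite /dot -!expr2; lra.
  have e2 : w.2 * w.2 = 0.
    by apply/eqP; rewrite eq_le -expr2 sqr_ge0 andbT;
       have := sqr_ge0 w.1; move: e; rewrite /dot -!expr2; lra.
  move/eqP: e1; move/eqP: e2; rewrite !mulf_eq0 !orbb => /eqP e2 /eqP e1.
  by apply: point_eqP; move: e1 e2; rewrite /w /=; lra.
have dw (t : R) : dot w (lerp t a b) = dot w a + t * dot w w.
  by rewrite /dot /=; ring.
have db : dot w b = dot w a + dot w w by rewrite -{1}(lerp1 a b) dw mul1r.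
have nc : ~ 0 <= m <= 1.
  by move=> mI; apply: (dis c); [exists m | exact: segment_l].
have nd : ~ 0 <= n <= 1.
  by move=> nI; apply: (dis d); [exists n | exact: segment_r].
have [m1|m1] := ltP 1 m; last first.
  have m0 : m < 0.
    by rewrite ltNge; apply/negP => m0; apply: nc; rewrite m0.
  have [n0|n0] := ltP n 0.
    have N (x : point R) : dot (- w.1, - w.2) x = - dot w x.
      by rewrite /dot /=; ring.
    apply: Or33; exists (- w.1, - w.2); rewrite !N cE dE !dw db.
    have mw : 0 < - m * dot w w by apply: mulr_gt0 => //; lra.
    have nw : 0 < - n * dot w w by apply: mulr_gt0 => //; lra.
    by split; lra.
  exfalso; apply: (dis a); first exact: segment_l.
  have nm : 0 < n - m by lra.
  exists (- m / (n - m)); last first.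
    by rewrite cE dE; apply: point_eqP => /=; field; rewrite gt_eqF.
  by rewrite ler_pdivlMr // ler_pdivrMr //; lra.
have [n0|n0] := ltP 1 n.
  apply: Or33; exists w; rewrite cE dE !dw db.
  have mw : 0 < (m - 1) * dot w w by apply: mulr_gt0 => //; lra.
  have nw : 0 < (n - 1) * dot w w by apply: mulr_gt0 => //; lra.
  by split; lra.
have n1 : n < 0.
  by rewrite ltNge; apply/negP => n1; apply: nd; rewrite n1.
exfalso; apply: (dis a); first exact: segment_l.
have nm : n - m < 0 by lra.
exists (- m / (n - m)); last first.
  by rewrite cE dE; apply: point_eqP => /=; field; rewrite lt_eqF.
by rewrite ler_ndivlMr // ler_ndivrMr //; lra.
Qed.

Lemma separated_not_proper a b c d v :
  dot v a < dot v c -> dot v a < dot v d ->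
  dot v b < dot v c -> dot v b < dot v d -> proper a b c d = false.
Proof.
move=> h1 h2 h3 h4; apply/negP => /proper_meet[].
move: (meet_time a b c d) (meet_time c d a b) => s u sI uI e.
have E (t : R) (x y : point R) :
    dot v (lerp t x y) = (1 - t) * dot v x + t * dot v y.
  by rewrite /dot /=; ring.
have := congr1 (dot v) e; rewrite !E => e'; clear E e.
move: (dot v a) (dot v b) (dot v c) (dot v d) h1 h2 h3 h4 e' => A B C D h1 h2 h3 h4 e'.
have [h|h] := leP A B; have [h'|h'] := leP C D.
- have k1 : 0 <= (1 - s) * (B - A) by apply: mulr_ge0; lra.
  have k2 : 0 <= u * (D - C) by apply: mulr_ge0; lra.
  lra.
- have k1 : 0 <= (1 - s) * (B - A) by apply: mulr_ge0; lra.
  have k2 : 0 <= (1 - u) * (C - D) by apply: mulr_ge0; lra.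
  lra.
- have k1 : 0 <= s * (A - B) by apply: mulr_ge0; lra.
  have k2 : 0 <= u * (D - C) by apply: mulr_ge0; lra.
  lra.
- have k1 : 0 <= s * (A - B) by apply: mulr_ge0; lra.
  have k2 : 0 <= (1 - u) * (C - D) by apply: mulr_ge0; lra.
  lra.
Qed.

(** Two consecutive segments with a second common point fold back. *)
Lemma fold_share a b c z : segment a b z -> segment b c z -> z <> b ->
  segment b c a \/ segment a b c.
Proof.
move=> /segmentC[s sI zs] [u uI zu] zb.
have s0 : s != 0 by apply/eqP => s0; apply: zb; rewrite zs s0 lerp0.
have u0 : u != 0 by apply/eqP => u0; apply: zb; rewrite zu u0 lerp0.
have s1 : 0 < s by rewrite lt0r s0; lra.
have u1 : 0 < u by rewrite lt0r u0; lra.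
have e : lerp u b c = lerp s b a by rewrite -zu.
have e1 := congr1 fst e; have e2 := congr1 snd e; rewrite /= in e1 e2.
have [su|us] := leP s u; last first.
  left; exists (u / s).
    by rewrite ler_pdivlMr // ler_pdivrMr // mul0r mul1r ltW //= ltW.
  apply: point_eqP => /=; apply: (mulfI s0).
    have -> : s * ((1 - u / s) * b.1 + u / s * c.1) =
      (s - u) * b.1 + u * c.1 by field.
    lra.
  have -> : s * ((1 - u / s) * b.2 + u / s * c.2) =
    (s - u) * b.2 + u * c.2 by field.
  lra.
right; apply: segmentC; exists (s / u).
  by rewrite ler_pdivlMr // ler_pdivrMr // mul0r mul1r su ltW.
apply: point_eqP => /=; apply: (mulfI u0).
  have -> : u * ((1 - s / u) * b.1 + s / u * a.1) =
    (u - s) * b.1 + s * a.1 by field.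
  lra.
have -> : u * ((1 - s / u) * b.2 + s / u * a.2) =
  (u - s) * b.2 + s * a.2 by field.
lra.
Qed.

End Separation.

Section Continuity.
Variable R : realType.
Local Notation cont01 f := {within `[0, 1], continuous (f : R -> R)}.

Lemma cont01D (f g : R -> R) : cont01 f -> cont01 g ->
  cont01 (fun t => f t + g t).
Proof. by move=> cf cg x; exact: (continuousD (cf x) (cg x)). Qed.

Lemma cont01N (f : R -> R) : cont01 f -> cont01 (fun t => - f t).
Proof. by move=> cf x; exact: (continuousN (cf x)). Qed.

Lemma cont01M (f g : R -> R) : cont01 f -> cont01 g ->
  cont01 (fun t => f t * g t).
Proof. by move=> cf cg x; exact: (continuousM (cf x) (cg x)). Qed.

Lemma cont01_cst (k : R) : cont01 (fun=> k).
Proof. by move=> x; exact: cst_continuous. Qed.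

Lemma cont01_near (f : R -> R) (t : R) : cont01 f -> 0 <= t <= 1 -> 0 < f t ->
  \forall s \near within `[0, 1] (nbhs t), 0 < f s.
Proof.
move=> /subspace_continuousP cf tI ft.
have /cf fc : `[0, 1]%classic t by rewrite /= in_itv.
exact: (cvgr_gt (f t) fc).
Qed.

(** The intermediate value theorem. *)
Lemma cont01_sign (f : R -> R) (t : R) : cont01 f ->
  (forall s, 0 <= s <= 1 -> f s != 0) -> 0 <= t <= 1 -> (0 < f 0) = (0 < f t).
Proof.
move=> cf nz tI.
have cft : {within `[0, t], continuous f}.
  by apply: continuous_subspaceW cf => s /=; rewrite !in_itv /=; lra.
have n0 : f 0 != 0 by apply: nz; lra.
have n1 : f t != 0 by apply: nz; lra.
have t0 : 0 <= t by lra.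
have no_zero : ~ (Num.min (f 0) (f t) <= 0 <= Num.max (f 0) (f t)).
  move=> /(IVT t0 cft)[s]; rewrite in_itv /= => sI /eqP; apply/negP.
  by apply: nz; lra.
move: no_zero; rewrite /Num.min /Num.max.
by case: ltP n0 n1; case: ltgtP; case: ltgtP => //; lra.
Qed.

(** The interval is connected: the real function equal to 1 or -1 according to
    Q is continuous and does not vanish. *)
Lemma locally_constant01 (Q : R -> bool) :
  (forall t : R, 0 <= t <= 1 -> \forall s \near within `[0, 1] (nbhs t), Q s = Q t) ->
  forall t : R, 0 <= t <= 1 -> Q 0 = Q t.
Proof.
move=> lc t tI.
have cf : cont01 (fun t => (-1) ^+ Q t).
  apply/subspace_continuousP => s; rewrite /= in_itv /= => sI.
  apply: cvg_near_cst.
  by apply: filterS (lc _ sI) => s' e; rewrite /from_subspace e.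
have nz (s : R) : 0 <= s <= 1 -> ((-1) ^+ Q s : R) != 0 by rewrite signr_eq0.
have := cont01_sign cf nz tI.
by case: (Q 0); case: (Q t); rewrite ?expr1 ?expr0 ?ltr0N1 ?ltr01.
Qed.

End Continuity.

(** * Generic diagrams *)

Section Generic.
Variable R : realType.
Implicit Types (D : diagram R) (e f g : nat * nat).

Definition crosses D e f : bool :=
  proper (pos D e.1 e.2) (pos D e.1 e.2.+1) (pos D f.1 f.2) (pos D f.1 f.2.+1).

Lemma adjacentC e f : adjacent e f = adjacent f e.
Proof. by rewrite /adjacent eq_sym; congr (_ && _); rewrite andbC. Qed.

Lemma adjacentP e f : adjacent e f ->
  [\/ e = f, f = (e.1, e.2.+1) | e = (f.1, f.2.+1)].
Proof.
case: e f => [i j] [i' j'] /and3P[/= /eqP<- h1 h2].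
have [->|[->|->]] : j = j' \/ j' = j.+1 \/ j = j'.+1 by lia.
- exact: Or31.
- exact: Or32.
- exact: Or33.
Qed.

Lemma adjacent_crossesF D e f : adjacent e f -> crosses D e f = false.
Proof.
by move/adjacentP => [->|->|->]; apply: proper_share => /=; rewrite eqxx ?orbT.
Qed.

Lemma crossesC D e f : crosses D e f = crosses D f e.
Proof. exact: properC. Qed.

Section Fixed.
Variable D : diagram R.
Hypothesis gD : generic D.

Lemma is_edge_nb e : is_edge D e -> (e.2 < nb_vertices D e.1)%N.
Proof. by rewrite /is_edge => /ltnW. Qed.

(** A common point is either an end of one of the edges, which is then a vertex
    of both, or interior to both, and [meet_proper] applies. *)
Lemma generic_meet e f z : is_edge D e -> is_edge D f ->
  on_edge D e z -> on_edge D f z -> adjacent e f \/ crosses D e f.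
Proof.
move=> He Hf ez fz.
have inc (e' : nat * nat) j f' : (j < nb_vertices D e'.1)%N ->
    j = e'.2 \/ j = e'.2.+1 -> is_edge D f' ->
    on_edge D f' (pos D e'.1 j) -> adjacent e' f'.
  move=> jn je Hf' /(generic_vertices gD jn Hf')[e1 e2].
  by rewrite /adjacent e1 eqxx /=; case: je e2 => ->; lia.
have [af|af] := boolP (adjacent e f); [by left | right].
have naf : ~ adjacent e f by apply/negP.
apply: (meet_proper _ _ ez fz).
- exact: generic_edges.
- exact: generic_edges.
- by move=> h; apply: naf; rewrite adjacentC; apply: (inc f f.2) => //; auto;
     exact: is_edge_nb.
- by move=> h; apply: naf; rewrite adjacentC; apply: (inc f f.2.+1) => //; auto.
- by move=> h; apply: naf; apply: (inc e e.2) => //; auto; exact: is_edge_nb.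
- by move=> h; apply: naf; apply: (inc e e.2.+1) => //; auto.
Qed.

Lemma crosses_crossing e f : is_edge D e -> is_edge D f ->
  crosses D e f <-> crossing D e f.
Proof.
move=> He Hf; split=> [h|[_ _ naf [z [ez fz]]]].
  split=> //; first by apply/negP => /(adjacent_crossesF D); rewrite h.
  have [sI uI e0] := proper_meet h.
  exists (lerp (meet_time (pos D e.1 e.2) (pos D e.1 e.2.+1)
                          (pos D f.1 f.2) (pos D f.1 f.2.+1))
               (pos D e.1 e.2) (pos D e.1 e.2.+1)).
  by split; [eexists; last reflexivity | rewrite e0; eexists; last reflexivity];
     lra.
by have [af|//] := generic_meet He Hf ez fz; rewrite af in naf.
Qed.

Lemma generic_two_points e f z z' : is_edge D e -> is_edge D f -> e <> f ->
  on_edge D e z -> on_edge D f z -> on_edge D e z' -> on_edge D f z' -> z = z'.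
Proof.
move=> He Hf nef ez fz ez' fz'.
have [af|h] := generic_meet He Hf ez fz; last exact: proper_inter h ez fz ez' fz'.
have main e0 : is_edge D e0 -> is_edge D (e0.1, e0.2.+1) -> forall y,
    on_edge D e0 y -> on_edge D (e0.1, e0.2.+1) y -> y = pos D e0.1 e0.2.+1.
  move=> H0 H1 y y0 y1; apply: contrapT => /(fold_share y0 y1)[] h.
    have [_] := generic_vertices gD (is_edge_nb H0) H1 h.
    by rewrite /=; lia.
  have [_] := @generic_vertices _ D gD e0.1 e0.2.+2 e0 H1 H0 h.
  lia.
case: (adjacentP af) => E; first by [].
- by rewrite E in Hf fz fz'; rewrite (main e He Hf z) // (main e He Hf z').
- by rewrite E in He ez ez'; rewrite (main f Hf He z) // (main f Hf He z').
Qed.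

(** A vertex on an edge is an end of this edge, so two vertices with the same
    position would be the ends of a degenerate edge. *)
Lemma pos_inj i j i' j' : (j < nb_vertices D i)%N -> (j' < nb_vertices D i')%N ->
  pos D i j = pos D i' j' -> (i, j) = (i', j').
Proof.
move=> Hj Hj' E.
have sz : (1 < nb_vertices D i')%N.
  by apply: (generic_size gD); rewrite ltnNge; apply/negP => h;
     move: Hj'; rewrite /nb_vertices nth_default.
(* an edge of which (i', j') is an endpoint *)
have [k [kj He]] : exists k, (k = j' \/ k.+1 = j') /\ is_edge D (i', k).
  case: j' Hj' {E} => [|j'] Hj'; first by exists 0%N; auto.
  by exists j'; auto.
have on : on_edge D (i', k) (pos D i j).
  rewrite E; case: kj => [->|<-]; [exact: segment_l | exact: segment_r].
have [/= Ei Ek] := generic_vertices gD Hj He on.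
have ne := generic_edges gD He; rewrite /= in ne.
have [Ej|nj] := eqVneq j j'; first by rewrite -Ei Ej.
exfalso; apply: ne; rewrite -Ei in E *.
case: kj Ek => [Ek|Ek] [Ek'|Ek']; subst; move: nj E; rewrite ?eqxx //.
Qed.

End Fixed.
End Generic.

(** * Isotopies preserve the crossings *)

Section Isotopy.
Variable R : realType.
Implicit Types (D : diagram R) (e f g : nat * nat).

Lemma nb_vertices_shape D D' i :
  shape D = shape D' -> nb_vertices D i = nb_vertices D' i.
Proof.
have E (X : diagram R) : nb_vertices X i = nth 0%N (shape X) i.
  have [h|h] := ltnP i (size X); first by rewrite (nth_map [::]).
  by rewrite /nb_vertices !nth_default ?size_map.
by rewrite !E => ->.
Qed.

Lemma is_edge_shape D D' e : shape D = shape D' -> is_edge D e -> is_edge D' e.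
Proof. by move=> s; rewrite /is_edge (nb_vertices_shape _ s). Qed.

Definition continuous_points (p : R -> point R) : Prop :=
  {within `[0, 1], continuous (fun t => (p t).1)} /\
  {within `[0, 1], continuous (fun t => (p t).2)}.

Lemma cont01_orient (p q r : R -> point R) :
  continuous_points p -> continuous_points q -> continuous_points r ->
  {within `[0, 1], continuous (fun t => orient (p t) (q t) (r t))}.
Proof.
move=> [p1 p2] [q1 q2] [r1 r2]; rewrite /orient.
apply: cont01D; last apply: cont01N; apply: cont01M;
  by apply: cont01D => //; exact: cont01N.
Qed.

Lemma cont01_dot v (p q : R -> point R) :
  continuous_points p -> continuous_points q ->
  {within `[0, 1], continuous (fun t => dot v (q t) - dot v (p t))}.
Proof.
move=> [p1 p2] [q1 q2]; rewrite /dot.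
apply: cont01D; last apply: cont01N; apply: cont01D; apply: cont01M => //;
  exact: cont01_cst.
Qed.

Section Along.
Variable F : R -> diagram R.
Variable D0 : diagram R.
Hypothesis Fgen : forall t : R, 0 <= t <= 1 -> generic (F t) /\ shape (F t) = shape D0.
Hypothesis Fcont : forall i j, continuous_points (fun t => pos (F t) i j).

Let I01 (t : R) : 0 <= t <= 1 -> forall e, is_edge D0 e -> is_edge (F t) e.
Proof. by move=> tI e; apply: is_edge_shape; have [_ ->] := Fgen tI. Qed.

(** Whether two edges cross is an open condition, because proper crossings are
    given by strict inequalities, and a closed one, because disjoint edges are
    strictly separated. *)
Lemma crosses_constant e f (t1 : R) : is_edge D0 e -> is_edge D0 f ->
  0 <= t1 <= 1 -> crosses (F 0) e f = crosses (F t1) e f.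
Proof.
move=> He Hf.
have [af|naf] := boolP (adjacent e f); first by rewrite !adjacent_crossesF.
move: t1; apply: (@locally_constant01 _ (fun t => crosses (F t) e f)) => t tI.
have FF : Filter (within `[0, 1]%classic (nbhs t)) by exact: within_filter.
have [gt _] := Fgen tI.
set a := fun t => pos (F t) e.1 e.2; set b := fun t => pos (F t) e.1 e.2.+1.
set c := fun t => pos (F t) f.1 f.2; set d := fun t => pos (F t) f.1 f.2.+1.
have E s : crosses (F s) e f = proper (a s) (b s) (c s) (d s) by [].
have cab : continuous_points a /\ continuous_points b by split; exact: Fcont.
have ccd : continuous_points c /\ continuous_points d by split; exact: Fcont.
have o1 := cont01M (cont01_orient cab.1 cab.2 ccd.1) (cont01_orient cab.1 cab.2 ccd.2).
have o2 := cont01M (cont01_orient ccd.1 ccd.2 cab.1) (cont01_orient ccd.1 ccd.2 cab.2).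
have [h|h] := boolP (crosses (F t) e f).
  move: (h); rewrite E => /andP[]; rewrite -!oppr_gt0 => h1 h2.
  have n1 := cont01_near (cont01N o1) tI h1.
  have n2 := cont01_near (cont01N o2) tI h2.
  apply: filterS2 n1 n2 => s; rewrite !oppr_gt0 E /proper => k1 k2.
  by apply/andP.
have nc : forall z, segment (a t) (b t) z -> ~ segment (c t) (d t) z.
  move=> z ez fz; have [af|cr] := generic_meet gt (I01 tI He) (I01 tI Hf) ez fz.
    by rewrite af in naf.
  by rewrite cr in h.
have nab := generic_edges gt (I01 tI He); have ncd := generic_edges gt (I01 tI Hf).
have [k|k|[v [v1 v2 v3 v4]]] := disjoint_separated nab ncd nc.
- apply: filterS (cont01_near o1 tI k) => s ks; rewrite E /proper.
  by apply/negbTE; rewrite negb_and -!leNgt ltW.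
- apply: filterS (cont01_near o2 tI k) => s ks; rewrite E /proper.
  by apply/negbTE; rewrite negb_and -!leNgt (ltW ks) orbT.
- have near p q : continuous_points p -> continuous_points q ->
      dot v (p t) < dot v (q t) ->
      \forall s \near within `[0, 1]%classic (nbhs t), dot v (p s) < dot v (q s).
    move=> cp cq pq; rewrite -subr_gt0 in pq.
    have near_pq := cont01_near (cont01_dot (v := v) cp cq) tI pq.
    by apply: filterS near_pq => s; rewrite subr_gt0.
  have n1 := near _ _ cab.1 ccd.1 v1; have n2 := near _ _ cab.1 ccd.2 v2.
  have n3 := near _ _ cab.2 ccd.1 v3; have n4 := near _ _ cab.2 ccd.2 v4.
  apply: filterS2 (filterI n1 n2) (filterI n3 n4) => s [k1 k2] [k3 k4].
  by rewrite E (separated_not_proper k1 k2 k3 k4).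
Qed.
End Along.

End Isotopy.

(** * Crossing sums *)

Definition edge (R : realType) : Type := (vertex R * vertex R)%type.

Section Edges.
Variable R : realType.
Implicit Types (D : diagram R) (x y e f g : edge R) (w : arc R).

Definition edges w : seq (edge R) := zip w (behead w).

Lemma edges_cat (s1 s2 : arc R) (a : vertex R) :
  edges (s1 ++ a :: s2) = edges (rcons s1 a) ++ edges (a :: s2).
Proof.
rewrite /edges; elim: s1 => [|b s1 IH] //=.
by case: s1 IH => [|c s1] //= ->.
Qed.

Definition iedge D (i : nat * nat) : edge R := (vtx D i.1 i.2, vtx D i.1 i.2.+1).

Lemma edges_index D i :
  edges (nth [::] D i) = [seq iedge D (i, j) | j <- iota 0 (nb_vertices D i).-1].
Proof.
rewrite /nb_vertices /iedge /vtx /=; move: (nth [::] D i) => w.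
apply: (@eq_from_nth _ (((0, 0), 0), ((0, 0), 0))).
  by rewrite size_map size_iota size_zip size_behead; apply/minn_idPr; exact: leq_pred.
move=> j hj; have := hj; rewrite size_zip size_behead (minn_idPr (leq_pred _)) => hj'.
by rewrite nth_zip_cond hj nth_behead (nth_map 0%N) ?size_iota // nth_iota.
Qed.

Definition ecross e f : bool := proper e.1.1 e.2.1 f.1.1 f.2.1.

(** The sign of the determinant of the directions, at a proper crossing. *)
Definition sgnx e f : int :=
  if ecross e f then (if 0 < orient e.1.1 e.2.1 f.2.1 then 1 else -1) else 0.

Definition etime e f : R := meet_time e.1.1 e.2.1 f.1.1 f.2.1.

Lemma sgnx_eq0 e f : (sgnx e f == 0) = ~~ ecross e f.
Proof. by rewrite /sgnx; case: ifP => //; case: ifP. Qed.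

(** Sums over the pairs that occur in the given order. *)
Fixpoint osum (T : Type) (y : T -> T -> int) (s : seq T) : int :=
  if s is e :: s' then \sum_(f <- s') y e f + osum y s' else 0.

Lemma osum_cat T (y : T -> T -> int) s1 s2 : osum y (s1 ++ s2) =
  osum y s1 + osum y s2 + \sum_(e <- s1) \sum_(f <- s2) y e f.
Proof.
elim: s1 => [|e s1 IH] /=; first by rewrite big_nil addr0 add0r.
rewrite big_cat big_cons IH /=; ring.
Qed.

Lemma osum_map T U (h : U -> T) (y : T -> T -> int) s :
  osum y (map h s) = osum (fun u v => y (h u) (h v)) s.
Proof. by elim: s => [|e s IH] //=; rewrite big_map IH. Qed.

Lemma eq_osum (T : eqType) (y y' : T -> T -> int) s :
  {in s &, y =2 y'} -> osum y s = osum y' s.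
Proof.
elim: s => [|e s IH] //= E; rewrite IH.
  by congr (_ + _); apply: eq_big_seq => f fs; apply: E; rewrite inE ?eqxx ?fs ?orbT.
by move=> f g fs gs; apply: E; rewrite inE ?fs ?gs orbT.
Qed.

Definition pair_sum (y : edge R -> edge R -> int) D i j : int :=
  \sum_(e <- edges (nth [::] D i)) \sum_(f <- edges (nth [::] D j)) y e f.

(** Number of crossings of the first two arcs. *)
Definition mutual D : int := pair_sum (fun e f => `|sgnx e f|) D 0 1.

(** Signed number of the self-crossings of the first arc that it first passes
    over, or first passes under. *)
Definition sgn_if (over : bool) e f : int :=
  if (if over then f.1.2 < e.1.2 else e.1.2 < f.1.2) then sgnx e f else 0.

Definition self_sum (over : bool) D : int :=
  osum (sgn_if over) (edges (nth [::] D 0)).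

(** Signed number of the pairs formed by a crossing of the first arc with the
    second one and a later crossing of the first arc with the third one. The
    second term deals with pairs of crossings on one edge. *)
Definition ordered_at e f g : int :=
  if etime e f < etime e g then sgnx e f * sgnx e g else 0.

Definition ordered D : int :=
  osum (fun e e' => (\sum_(f <- edges (nth [::] D 1)) sgnx e f) *
                    (\sum_(g <- edges (nth [::] D 2)) sgnx e' g))
       (edges (nth [::] D 0)) +
  \sum_(e <- edges (nth [::] D 0)) \sum_(f <- edges (nth [::] D 1))
    \sum_(g <- edges (nth [::] D 2)) ordered_at e f g.

End Edges.

(** * Isotopy invariance of the crossing sums *)

Section IsotopyInvariance.
Variable R : realType.
Implicit Types (D : diagram R) (e f g : nat * nat).

Section Motion.
Variables (F : R -> diagram R) (D0 : diagram R).
Hypothesis Fgen : forall t : R, 0 <= t <= 1 -> generic (F t) /\ shape (F t) = shape D0.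
Hypothesis Fcont : forall i j, continuous_points (fun t => pos (F t) i j).

Let cst := crosses_constant Fgen Fcont.

Lemma motion_sgnx e f : is_edge D0 e -> is_edge D0 f ->
  sgnx (iedge (F 0) e) (iedge (F 0) f) = sgnx (iedge (F 1) e) (iedge (F 1) f).
Proof.
move=> He Hf; rewrite /sgnx.
have E (t : R) : ecross (iedge (F t) e) (iedge (F t) f) = crosses (F t) e f by [].
have I1 : 0 <= (1 : R) <= 1 by rewrite ler01 lexx.
rewrite !E -(cst He Hf I1); case: ifP => // h.
pose o (t : R) := orient (pos (F t) e.1 e.2) (pos (F t) e.1 e.2.+1) (pos (F t) f.1 f.2.+1).
have co : {within `[0, 1], continuous o} by apply: cont01_orient; exact: Fcont.
have -> // : (0 < o 0) = (0 < o 1).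
apply: (cont01_sign co) => // t tI; apply/eqP => o0.
move: h; rewrite (cst He Hf tI) /crosses /proper.
by rewrite [X in _ * X < 0](_ : _ = 0) // mulr0 ltxx.
Qed.

(** The order in which e meets f and g cannot change in an isotopy: all three
    edges would have a common point at the time of the change. *)
Lemma motion_etime e f g : is_edge D0 e -> is_edge D0 f -> is_edge D0 g ->
    crosses (F 0) e f -> crosses (F 0) e g -> f <> g ->
  (etime (iedge (F 0) e) (iedge (F 0) f) < etime (iedge (F 0) e) (iedge (F 0) g)) =
  (etime (iedge (F 1) e) (iedge (F 1) f) < etime (iedge (F 1) e) (iedge (F 1) g)).
Proof.
move=> He Hf Hg ef eg nfg.
pose A h (t : R) := orient (pos (F t) h.1 h.2) (pos (F t) h.1 h.2.+1) (pos (F t) e.1 e.2).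
pose B h (t : R) := orient (pos (F t) h.1 h.2) (pos (F t) h.1 h.2.+1) (pos (F t) e.1 e.2.+1).
have cA h : {within `[0, 1], continuous (A h)} by apply: cont01_orient; exact: Fcont.
have cB h : {within `[0, 1], continuous (B h)} by apply: cont01_orient; exact: Fcont.
have E h (t : R) : etime (iedge (F t) e) (iedge (F t) h) = A h t / (A h t - B h t) by [].
have nz h (t : R) : is_edge D0 h -> crosses (F 0) e h -> 0 <= t <= 1 ->
    A h t - B h t != 0.
  move=> Hh eh tI; move: eh; rewrite (cst He Hh tI) => /andP[_ AB].
  apply/eqP => e0; have AB' : A h t = B h t by lra.
  by move: AB; rewrite -/(A h t) -/(B h t) AB' -expr2 ltNge sqr_ge0.
pose P (t : R) := (A f t * B g t - A g t * B f t) * ((A f t - B f t) * (A g t - B g t)).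
have EP (t : R) : 0 <= t <= 1 ->
    (etime (iedge (F t) e) (iedge (F t) f) < etime (iedge (F t) e) (iedge (F t) g)) =
    (0 < P t).
  move=> tI; have nf := nz f t Hf ef tI; have ng := nz g t Hg eg tI.
  rewrite !E -subr_gt0; pose d := (A f t - B f t) * (A g t - B g t).
  have d2 : 0 < d ^+ 2 by rewrite exprn_even_gt0 //= mulf_neq0.
  rewrite -(pmulr_lgt0 _ d2); congr (0 < _); rewrite /P /d; field.
  by rewrite nf ng.
rewrite !EP //; try lra.
apply: cont01_sign => //; last by lra.
  rewrite /P; apply: cont01M.
    by apply: cont01D; [|apply: cont01N]; apply: cont01M.
  by apply: cont01M; apply: cont01D => //; apply: cont01N.
move=> t tI; apply/negP => P0.
have [gt sh] := Fgen tI.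
have He' := is_edge_shape (esym sh) He; have Hf' := is_edge_shape (esym sh) Hf.
have Hg' := is_edge_shape (esym sh) Hg.
have nf := nz f t Hf ef tI; have ng := nz g t Hg eg tI.
have ft := ef; have gt' := eg; rewrite (cst He Hf tI) in ft; rewrite (cst He Hg tI) in gt'.
have Eq : etime (iedge (F t) e) (iedge (F t) f) = etime (iedge (F t) e) (iedge (F t) g).
  rewrite !E; apply/eqP; rewrite eqr_div //; apply/eqP.
  move: P0; rewrite /P mulf_eq0 mulf_eq0 (negbTE nf) (negbTE ng) !orbF => /eqP; lra.
have [s1 u1 z1] := proper_meet ft; have [s2 u2 z2] := proper_meet gt'.
have nef : e <> f by move=> eqn; move: ft; rewrite eqn adjacent_crossesF // /adjacent eqxx leqnSn.
have neg : e <> g by move=> eqn; move: gt'; rewrite eqn adjacent_crossesF // /adjacent eqxx leqnSn.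
have U (x : R) : 0 < x < 1 -> 0 <= x <= 1 by lra.
apply: (generic_no_triple gt He' Hf' Hg' nef nfg neg).
- by exists (etime (iedge (F t) e) (iedge (F t) f)); [exact: U | reflexivity].
- by rewrite z1; eexists; [exact: U u1 | reflexivity].
- rewrite -/(etime (iedge (F t) e) (iedge (F t) f)) Eq z2.
  by eexists; [exact: U u2 | reflexivity].
Qed.
End Motion.

(** What the crossing sums depend on. *)
Definition same_crossings D D' : Prop :=
  shape D = shape D' /\ forall e f, is_edge D e -> is_edge D f ->
  [/\ sgnx (iedge D e) (iedge D f) = sgnx (iedge D' e) (iedge D' f),
      crosses D e f -> (level D e < level D f) = (level D' e < level D' f) &
      forall g, is_edge D g -> crosses D e f -> crosses D e g -> f <> g ->
        (etime (iedge D e) (iedge D f) < etime (iedge D e) (iedge D g)) =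
        (etime (iedge D' e) (iedge D' f) < etime (iedge D' e) (iedge D' g))].

Lemma isotopy_same_crossings D D' : isotopy D D' -> same_crossings D D'.
Proof.
move=> [F [[F0 F1] FT Fc _ Fl]].
have Fg (t : R) : 0 <= t <= 1 -> generic (F t) /\ shape (F t) = shape D.
  by move=> /FT[[gt _ _] ->].
have Fc' i j : continuous_points (fun t => pos (F t) i j) by exact: Fc.
have I0 : 0 <= (0 : R) <= 1 by rewrite ler01 lexx.
have I1 : 0 <= (1 : R) <= 1 by rewrite ler01 lexx.
split; first by rewrite -F1 (Fg _ I1).2.
move=> e f He Hf; split.
- by rewrite -F0 -F1 in He Hf Fg *; exact: (motion_sgnx Fg Fc').
- move=> ef; rewrite -F1; apply/esym/Fl => //.
  have [gt sh] := Fg _ I1.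
  apply/(crosses_crossing gt); try exact: is_edge_shape (esym sh) _.
  by rewrite -(crosses_constant Fg Fc' He Hf I1) F0.
- move=> g Hg; rewrite -F0 -F1 => ef eg nfg; rewrite -F0 in He Hf Hg Fg.
  exact: (motion_etime Fg Fc').
Qed.

End IsotopyInvariance.

Section SameCrossings.
Variable R : realType.
Variables D D' : diagram R.
Hypothesis SC : same_crossings D D'.

Let nbE i : nb_vertices D' i = nb_vertices D i.
Proof. by rewrite (nb_vertices_shape i SC.1). Qed.

Let iota_edge i j : j \in iota 0 (nb_vertices D i).-1 -> is_edge D (i, j).
Proof. by rewrite mem_iota /is_edge /=; lia. Qed.

Let sg i j k l : j \in iota 0 (nb_vertices D i).-1 -> l \in iota 0 (nb_vertices D k).-1 ->
  sgnx (iedge D (i, j)) (iedge D (k, l)) = sgnx (iedge D' (i, j)) (iedge D' (k, l)).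
Proof. by move=> /iota_edge h1 /iota_edge h2; have [] := SC.2 _ _ h1 h2. Qed.

Lemma mutual_same : mutual D = mutual D'.
Proof.
rewrite /mutual /pair_sum !edges_index !big_map !nbE.
apply: eq_big_seq => j hj; rewrite !big_map; apply: eq_big_seq => l hl.
by rewrite (sg hj hl).
Qed.

Lemma self_sum_same over : self_sum over D = self_sum over D'.
Proof.
rewrite /self_sum !edges_index !osum_map !nbE; apply: eq_osum => j l hj hl.
rewrite /sgn_if -(sg hj hl).
have [cr|/negbTE ncr] := boolP (ecross (iedge D (0, j)) (iedge D (0, l))); last first.
  by rewrite /sgnx ncr !if_same.
have [_ /(_ cr) l1 _] := SC.2 _ _ (iota_edge hj) (iota_edge hl).
have := cr; rewrite [ecross _ _]crossesC => cr'.
have [_ /(_ cr') l2 _] := SC.2 _ _ (iota_edge hl) (iota_edge hj).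
by move: l1 l2; rewrite /level /iedge /= => -> ->.
Qed.

Lemma ordered_same : ordered D = ordered D'.
Proof.
rewrite /ordered !edges_index !osum_map !nbE; congr (_ + _).
  apply: eq_osum => j l hj hl; rewrite !big_map.
  by congr (_ * _); apply: eq_big_seq => k hk; exact: sg.
rewrite !big_map; apply: eq_big_seq => j hj; rewrite !big_map.
apply: eq_big_seq => k hk; rewrite !big_map; apply: eq_big_seq => l hl.
rewrite /ordered_at -(sg hj hk) -(sg hj hl).
have [cr|/negbTE ncr] := boolP (ecross (iedge D (0, j)) (iedge D (1, k))); last first.
  by rewrite [sgnx _ (iedge D (1, k))]/sgnx ncr !mul0r !if_same.
have [cr'|/negbTE ncr] := boolP (ecross (iedge D (0, j)) (iedge D (2, l))); last first.
  by rewrite [sgnx _ (iedge D (2, l))]/sgnx ncr !mulr0 !if_same.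
have [_ _ h] := SC.2 _ _ (iota_edge hj) (iota_edge hk).
by rewrite (h _ (iota_edge hl)).
Qed.

End SameCrossings.

(** * Subdivision invariance of the crossing sums *)

Section Split.
Variable R : realType.
Implicit Types a b c d p : point R.

(** Exactly one part of a divided segment takes over a crossing. *)
Lemma proper_split (t : R) a b c d (p := lerp t a b) :
    0 < t < 1 -> ~ segment c d p ->
  [/\ proper a b c d = proper a p c d || proper p b c d,
      ~~ (proper a p c d && proper p b c d),
      proper a p c d -> t * meet_time a p c d = meet_time a b c d &
      proper p b c d ->
        t + (1 - t) * meet_time p b c d = meet_time a b c d].
Proof.
move=> tI ncd.
have oc : orient a p c = t * orient a b c by rewrite /p /orient /=; ring.
have od : orient a p d = t * orient a b d by rewrite /p /orient /=; ring.
have oc' : orient p b c = (1 - t) * orient a b c by rewrite /p /orient /=; ring.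
have od' : orient p b d = (1 - t) * orient a b d by rewrite /p /orient /=; ring.
have op : orient c d p = (1 - t) * orient c d a + t * orient c d b.
  exact: orient_lerp.
have t2 : 0 < t ^+ 2 by rewrite exprn_gt0 //; lra.
have t2' : 0 < (1 - t) ^+ 2 by rewrite exprn_gt0 //; lra.
have pcd : (orient a p c * orient a p d < 0) = (orient a b c * orient a b d < 0).
  rewrite oc od [X in (X < 0) = _](_ : _ = t ^+ 2 * (orient a b c * orient a b d)); last by ring.
  by rewrite pmulr_rlt0.
have pcd' : (orient p b c * orient p b d < 0) = (orient a b c * orient a b d < 0).
  rewrite oc' od' [X in (X < 0) = _](_ : _ = (1 - t) ^+ 2 * (orient a b c * orient a b d)); last by ring.
  by rewrite pmulr_rlt0.
rewrite /proper pcd pcd'.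
have [ocd|_] := boolP (orient a b c * orient a b d < 0); last by [].
have op0 : orient c d p != 0.
  apply/eqP => o0; have ncd' : c <> d.
    by move=> E; move: ocd; rewrite E -expr2 ltNge sqr_ge0.
  have [m pE] := collinear_lerp ncd' o0; apply: ncd; exists m => //.
  have ab0 : orient a b p = 0 by rewrite /p orient_lerp orient_aba orient_abb; ring.
  move: ab0; rewrite pE orient_lerp.
  move: (orient a b c) (orient a b d) ocd => x y xy e.
  have [x0|x0|x0] := ltgtP x 0; last by move: xy; rewrite x0 mul0r ltxx.
    have y0 : 0 < y by rewrite -(nmulr_rlt0 _ x0).
    apply/andP; split; rewrite leNgt; apply/negP => m0.
      by have k1 : 0 < - m * (y - x) by [apply: mulr_gt0; lra]; lra.
    by have k1 : 0 < (m - 1) * (y - x) by [apply: mulr_gt0; lra]; lra.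
  have y0 : y < 0 by rewrite -(pmulr_rlt0 _ x0).
  apply/andP; split; rewrite leNgt; apply/negP => m0.
    by have k1 : 0 < - m * (x - y) by [apply: mulr_gt0; lra]; lra.
  by have k1 : 0 < (m - 1) * (x - y) by [apply: mulr_gt0; lra]; lra.
move: op op0; rewrite /meet_time.
move: (orient c d p) (orient c d a) (orient c d b) => z x y zE z0 /=.
have sgn2 (u v : R) : (u * v < 0) = ((u < 0) && (0 < v)) || ((0 < u) && (v < 0)).
  have [u0|u0|->] := ltgtP u 0; last by rewrite mul0r ltxx.
    by rewrite nmulr_rlt0 // orbF.
  by rewrite pmulr_rlt0.
have neq (u v : R) : u * v < 0 -> u - v != 0.
  move=> uv; apply/eqP => e; have E : u = v by lra.
  by move: uv; rewrite E -expr2 ltNge sqr_ge0.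
have e1 : x - z = t * (x - y) by rewrite zE; ring.
have e2 : z - y = (1 - t) * (x - y) by rewrite zE; ring.
have t0 : t != 0 by rewrite gt_eqF //; lra.
have t1 : 1 - t != 0 by rewrite gt_eqF //; lra.
have nonneg : 0 <= x -> 0 <= y -> 0 < z.
  move=> x0 y0; rewrite lt0r z0 zE.
  by rewrite addr_ge0 // mulr_ge0 //; lra.
have nonpos : x <= 0 -> y <= 0 -> z < 0.
  move=> x0 y0; rewrite lt_neqAle z0 zE -oppr_ge0 opprD -!mulrN.
  by rewrite addr_ge0 // mulr_ge0 //; lra.
split.
- rewrite !sgn2; have [zn|zp|zz] := ltgtP z 0; last by rewrite zz eqxx in z0.
    rewrite ?andbT ?andbF ?orbF ?orFb /=.
    have no : 0 <= x -> 0 <= y -> False.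
      by move=> x0 y0; have := lt_trans zn (nonneg x0 y0); rewrite ltxx.
    have [x0|x0|x0] := ltgtP x 0; have [y0|y0|y0] := ltgtP y 0 => //=;
      by case: no; rewrite ?x0 ?y0 ?lexx // ltW.
  rewrite ?andbT ?andbF ?orbF ?orFb /=.
  have no : x <= 0 -> y <= 0 -> False.
    by move=> x0 y0; have := lt_trans zp (nonpos x0 y0); rewrite ltxx.
  have [x0|x0|x0] := ltgtP x 0; have [y0|y0|y0] := ltgtP y 0 => //=;
    by case: no; rewrite ?x0 ?y0 ?lexx // ltW.
- by rewrite !sgn2; have [z'|z'|z'] := ltgtP z 0; rewrite ?andbF ?andbT ?orbF //=;
     apply/negP => /andP[]; lra.
- by move=> /neq; rewrite e1 mulf_eq0 negb_or => /andP[_ xy]; field; rewrite t0 xy.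
- move=> /neq; rewrite e2 mulf_eq0 negb_or => /andP[_ xy].
  by rewrite zE; field; rewrite t1 xy.
Qed.

Lemma sgnxC (e f : edge R) : sgnx f e = - sgnx e f.
Proof.
rewrite /sgnx /ecross properC; case: ifP => [|_]; last by rewrite oppr0.
case: e f => [[a la] [b lb]] [[c lc] [d ld]] /=; rewrite /proper => /andP[].
have -> : orient c d b = orient c d a - (orient a b d - orient a b c).
  by rewrite /orient; ring.
move: (orient a b c) (orient a b d) (orient c d a) => x y z h1 h2.
have [y0|y0] := ltP 0 y; have [z0|z0] := ltP 0 (z - (y - x)) => //; exfalso.
- have x0 : x < 0 by rewrite -(pmulr_llt0 _ y0).
  have z1 : z < 0 by rewrite -(pmulr_llt0 _ z0).
  lra.
- have [y1|y1|y1] := ltgtP y 0; [|lra|by move: h1; rewrite y1 mulr0 ltxx].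
  have x0 : 0 < x by rewrite -(nmulr_llt0 _ y1).
  have [z1|z1|z1] := ltgtP (z - (y - x)) 0; [|lra|by move: h2; rewrite z1 mulr0 ltxx].
  have z2 : 0 < z by rewrite -(nmulr_llt0 _ z1).
  lra.
Qed.

Section OneEdge.
Variables (va vb : vertex R) (t : R).
Hypothesis tI : 0 < t < 1.
Let tp : 0 < t. Proof. by case/andP: tI. Qed.
Let tp' : 0 < 1 - t. Proof. by rewrite subr_gt0; case/andP: tI. Qed.
Let vp : vertex R := (lerp t va.1 vb.1, va.2).
Let e : edge R := (va, vb).
Let e1 : edge R := (va, vp).
Let e2 : edge R := (vp, vb).

Definition off (f : edge R) : Prop := ~ segment f.1.1 f.2.1 vp.1.

Let piece f := [|| f == e, f == e1 | f == e2].
Let ok f := off f \/ piece f.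

Let share f g : piece f -> piece g -> sgnx f g = 0.
Proof.
move=> hf hg; apply/eqP; rewrite sgnx_eq0 /ecross.
by case/or3P: hf => /eqP->; case/or3P: hg => /eqP->;
   rewrite proper_share //= ?eqxx ?orbT.
Qed.

Lemma sgnx_split f : off f ->
  sgnx e f = sgnx e1 f + sgnx e2 f /\ sgnx e1 f * sgnx e2 f = 0.
Proof.
move=> of_; have [p1 p2 _ _] := proper_split tI of_.
have o1 : (0 < orient va.1 vp.1 f.2.1) = (0 < orient va.1 vb.1 f.2.1).
  by rewrite -[RHS](pmulr_rgt0 _ tp); congr (0 < _); rewrite /orient /=; ring.
have o2 : (0 < orient vp.1 vb.1 f.2.1) = (0 < orient va.1 vb.1 f.2.1).
  by rewrite -[RHS](pmulr_rgt0 _ tp'); congr (0 < _); rewrite /orient /=; ring.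
rewrite /sgnx /ecross /= p1 o1 o2; move: p2.
by case: (proper va.1 _ _ _); case: (proper _ vb.1 _ _); case: ifP;
   rewrite //= ?addr0 ?add0r ?mulr0 ?mul0r.
Qed.

Let addl f : ok f -> sgnx e f = sgnx e1 f + sgnx e2 f.
Proof.
case=> [/sgnx_split[]//|pf].
by rewrite !share // /piece eqxx ?orbT.
Qed.

Let addr f : ok f -> sgnx f e = sgnx f e1 + sgnx f e2.
Proof. by move=> /addl h; rewrite !(sgnxC _ f) h opprD. Qed.

Let abs_addl f : ok f -> `|sgnx e f| = `|sgnx e1 f| + `|sgnx e2 f|.
Proof.
case=> [/sgnx_split[-> /eqP]|pf]; last by rewrite !share // /piece eqxx ?orbT.
by rewrite mulf_eq0 => /orP[] /eqP->; rewrite normr0 ?add0r ?addr0.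
Qed.

Let abs_addr f : ok f -> `|sgnx f e| = `|sgnx f e1| + `|sgnx f e2|.
Proof. by move=> /abs_addl h; rewrite !(sgnxC _ f) !normrN. Qed.

Let if_addl over f : ok f ->
  sgn_if over e f = sgn_if over e1 f + sgn_if over e2 f.
Proof. by move=> /addl h; rewrite /sgn_if /= h; case: ifP; case: ifP. Qed.

Let if_addr over f : ok f ->
  sgn_if over f e = sgn_if over f e1 + sgn_if over f e2.
Proof. by move=> /addr h; rewrite /sgn_if /= h; case: ifP; case: ifP. Qed.

Let etime1 f : etime f e1 = etime f e.
Proof.
rewrite /etime /meet_time /=.
have -> : orient va.1 vp.1 f.1.1 = t * orient va.1 vb.1 f.1.1 by rewrite /orient /=; ring.
have -> : orient va.1 vp.1 f.2.1 = t * orient va.1 vb.1 f.2.1 by rewrite /orient /=; ring.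
by rewrite -mulrBr -mulf_div divff ?mul1r // gt_eqF.
Qed.

Let etime2 f : etime f e2 = etime f e.
Proof.
rewrite /etime /meet_time /=.
have -> : orient vp.1 vb.1 f.1.1 = (1 - t) * orient va.1 vb.1 f.1.1 by rewrite /orient /=; ring.
have -> : orient vp.1 vb.1 f.2.1 = (1 - t) * orient va.1 vb.1 f.2.1 by rewrite /orient /=; ring.
by rewrite -mulrBr -mulf_div divff ?mul1r // gt_eqF.
Qed.

Let ordered_addf x g : ok x ->
  ordered_at x e g = ordered_at x e1 g + ordered_at x e2 g.
Proof.
by move=> /addr h; rewrite /ordered_at etime1 etime2 h; case: ifP; rewrite // mulrDl.
Qed.

Let ordered_addg x f : ok x ->
  ordered_at x f e = ordered_at x f e1 + ordered_at x f e2.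
Proof.
by move=> /addr h; rewrite /ordered_at etime1 etime2 h; case: ifP; rewrite // mulrDr.
Qed.

Let ordered_adde f g : ok f -> ok g -> ordered_at e f g =
  ordered_at e1 f g + ordered_at e2 f g + sgnx e1 f * sgnx e2 g.
Proof.
have pe : piece e /\ piece e1 /\ piece e2 by rewrite /piece !eqxx ?orbT.
case: pe => pe [pe1 pe2].
case=> [of_|pf]; last by move=> _; rewrite /ordered_at !(share _ pf) ?mul0r ?if_same.
case=> [og|pg]; last by rewrite /ordered_at !(share _ pg) ?mulr0 ?if_same.
have [pf1 pf2 tf1 tf2] := proper_split tI of_.
have [pg1 pg2 tg1 tg2] := proper_split tI og.
have [sf _] := sgnx_split of_; have [sg _] := sgnx_split og.
rewrite /ordered_at sf sg.
have z (x y : edge R) : ecross x y = false -> sgnx x y = 0 by rewrite /sgnx => ->.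
have in1 h : ecross e1 h -> 0 < etime e1 h < 1 by move=> /proper_meet[].
have in2 h : ecross e2 h -> 0 < etime e2 h < 1 by move=> /proper_meet[].
have T1 (u v : R) : (t * u < t * v) = (u < v) by rewrite ltr_pM2l.
have T2 (u v : R) : (t + (1 - t) * u < t + (1 - t) * v) = (u < v).
  by rewrite ltrD2l ltr_pM2l.
have lt1 (u : R) : 0 < u < 1 -> t * u < t.
  by move=> /andP[_ u1]; rewrite -[ltRHS]mulr1 ltr_pM2l.
have gt2 (u : R) : 0 < u < 1 -> t < t + (1 - t) * u.
  by move=> /andP[u0 _]; rewrite ltrDl mulr_gt0.
have [f1|f1] := boolP (ecross e1 f); have [f2|f2] := boolP (ecross e2 f).
- by move: pf2; rewrite [proper _ _ _ _]f1 [proper _ _ _ _]f2.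
- rewrite (z _ _ (negbTE f2)) addr0 mul0r if_same addr0.
  have [g1|g1] := boolP (ecross e1 g); have [g2|g2] := boolP (ecross e2 g).
  + by move: pg2; rewrite [proper _ _ _ _]g1 [proper _ _ _ _]g2.
  + rewrite (z _ _ (negbTE g2)) addr0 mulr0 addr0.
    by rewrite /etime -(tf1 f1) -(tg1 g1) T1.
  + rewrite (z _ _ (negbTE g1)) add0r mulr0 if_same add0r.
    rewrite /etime -(tf1 f1) -(tg2 g2) ifT //.
    exact: lt_trans (lt1 _ (in1 _ f1)) (gt2 _ (in2 _ g2)).
  + by rewrite (z _ _ (negbTE g1)) (z _ _ (negbTE g2)) addr0 mulr0 !if_same.
- rewrite (z _ _ (negbTE f1)) add0r !mul0r if_same add0r addr0.
  have [g1|g1] := boolP (ecross e1 g); have [g2|g2] := boolP (ecross e2 g).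
  + by move: pg2; rewrite [proper _ _ _ _]g1 [proper _ _ _ _]g2.
  + rewrite (z _ _ (negbTE g2)) addr0 mulr0 if_same.
    rewrite /etime -(tf2 f2) -(tg1 g1) ifF //; apply: lt_gtF.
    exact: lt_trans (lt1 _ (in1 _ g1)) (gt2 _ (in2 _ f2)).
  + rewrite (z _ _ (negbTE g1)) add0r.
    by rewrite /etime -(tf2 f2) -(tg2 g2) T2.
  + by rewrite (z _ _ (negbTE g1)) (z _ _ (negbTE g2)) addr0 mulr0 !if_same.
- by rewrite (z _ _ (negbTE f1)) (z _ _ (negbTE f2)) addr0 !mul0r !if_same.
Qed.

(** The edges of an arc before and after a subdivision. *)
Definition splits (E E' : seq (edge R)) : Prop :=
  E = E' \/ exists A B, E = A ++ e :: B /\ E' = A ++ [:: e1, e2 & B].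

Lemma splits_sum E E' (h : edge R -> int) : splits E E' ->
  h e = h e1 + h e2 -> \sum_(x <- E) h x = \sum_(x <- E') h x.
Proof.
case=> [->//|[A [B [-> ->]]]] he.
by rewrite !big_cat !big_cons /= he; ring.
Qed.

(** The pair formed by the two halves of the divided edge is new in an ordered
    sum; the term h accounts for it. *)
Lemma splits_osum E E' (y : edge R -> edge R -> int) (h : edge R -> int) :
  splits E E' -> (forall f, f \in E' -> ok f) ->
  (forall f, ok f -> y e f = y e1 f + y e2 f /\ y f e = y f e1 + y f e2) ->
  h e = h e1 + h e2 + y e1 e2 ->
  osum y E + \sum_(x <- E) h x = osum y E' + \sum_(x <- E') h x.
Proof.
case=> [->//|[A [B [-> ->]]]] okE' yE he.
have okA f : f \in A -> ok f by move=> fA; apply: okE'; rewrite mem_cat fA.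
have okB f : f \in B -> ok f.
  by move=> fB; apply: okE'; rewrite mem_cat !inE fB !orbT.
rewrite !osum_cat /= !big_cat !big_cons /= he.
have -> : \sum_(f <- B) y e f = \sum_(f <- B) y e1 f + \sum_(f <- B) y e2 f.
  by rewrite -big_split; apply: eq_big_seq => f /okB /yE[].
have -> : \sum_(f <- A) \sum_(g <- e :: B) y f g =
    \sum_(f <- A) \sum_(g <- [:: e1, e2 & B]) y f g.
  by apply: eq_big_seq => f /okA /yE[_ h']; rewrite !big_cons h' addrA.
ring.
Qed.

Section Diagrams.
Variables (E E' : nat -> seq (edge R)).
Hypothesis sE : forall i, splits (E i) (E' i).
Hypothesis okE' : forall i f, f \in E' i -> ok f.

Let ok_pieces : [/\ ok e, ok e1 & ok e2].
Proof. by split; right; rewrite /piece eqxx ?orbT. Qed.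

Let okE i f : f \in E i -> ok f.
Proof.
case: (sE i) => [->|[A [B [-> EB]]]]; first exact: okE'.
rewrite mem_cat inE => h; have [p _ _] := ok_pieces.
have [->//|ne] := eqVneq f e; apply: (@okE' i); rewrite EB mem_cat !inE.
by move: h; rewrite (negbTE ne) /= => /orP[->|->]; rewrite ?orbT.
Qed.

Lemma splits_mutual i j :
  \sum_(x <- E i) \sum_(f <- E j) `|sgnx x f| =
  \sum_(x <- E' i) \sum_(f <- E' j) `|sgnx x f|.
Proof.
transitivity (\sum_(x <- E i) \sum_(f <- E' j) `|sgnx x f|).
  by apply: eq_big_seq => x /okE ox; apply: splits_sum (sE j) _; exact: abs_addr.
apply: splits_sum (sE i) _; rewrite -big_split.
by apply: eq_big_seq => f /okE'; exact: abs_addl.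
Qed.

Lemma splits_self over i : osum (sgn_if over) (E i) = osum (sgn_if over) (E' i).
Proof.
have := @splits_osum _ _ (sgn_if over) (fun=> 0) (sE i) (@okE' i).
rewrite !big1 // !addr0; apply=> //.
  by move=> f fo; split; [exact: if_addl | exact: if_addr].
by rewrite /sgn_if share ?if_same ?addr0 // /piece eqxx ?orbT.
Qed.

Lemma splits_ordered i j k :
  osum (fun x x' => (\sum_(f <- E j) sgnx x f) * (\sum_(g <- E k) sgnx x' g)) (E i) +
  \sum_(x <- E i) \sum_(f <- E j) \sum_(g <- E k) ordered_at x f g =
  osum (fun x x' => (\sum_(f <- E' j) sgnx x f) * (\sum_(g <- E' k) sgnx x' g)) (E' i) +
  \sum_(x <- E' i) \sum_(f <- E' j) \sum_(g <- E' k) ordered_at x f g.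
Proof.
have S l x : ok x -> \sum_(f <- E l) sgnx x f = \sum_(f <- E' l) sgnx x f.
  by move=> ox; apply: splits_sum (sE l) _; exact: addr.
have SA l : \sum_(f <- E' l) sgnx e f =
    \sum_(f <- E' l) sgnx e1 f + \sum_(f <- E' l) sgnx e2 f.
  by rewrite -big_split; apply: eq_big_seq => f /okE'; exact: addl.
rewrite (@eq_osum _ _ (fun x x' => (\sum_(f <- E' j) sgnx x f) *
    (\sum_(g <- E' k) sgnx x' g))); last first.
  by move=> x x' /okE ox /okE ox'; rewrite (S _ _ ox) (S _ _ ox').
rewrite (@eq_big_seq _ _ _ _ _ _ (fun x => \sum_(f <- E' j) \sum_(g <- E' k)
    ordered_at x f g)); last first.
  move=> x /okE ox.
  transitivity (\sum_(f <- E j) \sum_(g <- E' k) ordered_at x f g).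
    by apply: eq_big_seq => f _; apply: splits_sum (sE k) _; exact: ordered_addg.
  apply: splits_sum (sE j) _; rewrite -big_split; apply: eq_big_seq => g _.
  exact: ordered_addf.
have [p _ _] := ok_pieces.
apply: splits_osum (sE i) (@okE' i) _ _.
  move=> f fo; rewrite !SA; split; first by rewrite mulrDl.
  by rewrite mulrDr.
rewrite big_distrl -!big_split /=; apply: eq_big_seq => f /okE' of_.
rewrite big_distrr -!big_split /=; apply: eq_big_seq => g /okE' og.
exact: ordered_adde.
Qed.

End Diagrams.
End OneEdge.
End Split.

Section Subdivision.
Variable R : realType.
Implicit Types D : diagram R.

Lemma subdivision_splits D D' : generic D' -> subdivision D D' ->
  exists (a b : vertex R) (t : R), 0 < t < 1 /\ forall i,
    splits a b t (edges (nth [::] D i)) (edges (nth [::] D' i)) /\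
    forall f, f \in edges (nth [::] D' i) ->
      off a b t f \/
      [|| f == (a, b), f == (a, (lerp t a.1 b.1, a.2)) |
          f == ((lerp t a.1 b.1, a.2), b)].
Proof.
move=> gD' [D1 [D2 [s1 [s2 [a [b [t [tI -> D'E]]]]]]]]; exists a, b, t.
split=> // i; set p := (lerp t a.1 b.1, a.2).
have N w : nth [::] (D1 ++ w :: D2) i =
    if i == size D1 then w else nth [::] (D1 ++ [::] :: D2) i.
  have [->|ni] := eqVneq i (size D1); first by rewrite nth_cat ltnn subnn.
  rewrite !nth_cat; case: ltnP => // hi.
  by rewrite -[(i - size D1)%N]prednK // subn_gt0 ltn_neqAle eq_sym ni.
split.
  rewrite D'E (N (s1 ++ [:: a, b & s2])) (N (s1 ++ [:: a, p, b & s2])).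
  case: eqP => _; last by left.
  right; exists (edges (rcons s1 a)), (edges (b :: s2)).
  by rewrite !edges_cat.
move=> f; rewrite edges_index => /mapP[j]; rewrite mem_iota add0n => hj ->.
have He : is_edge D' (i, j) by rewrite /is_edge /=; lia.
have [|nf] := boolP [|| _ == _, _ == _ | _]; first by right.
left=> on.
have vp k : vtx D' (size D1) k = nth ((0, 0), 0) (s1 ++ [:: a, p, b & s2]) k.
  by rewrite /vtx D'E nth_cat ltnn subnn.
have v0 : vtx D' (size D1) (size s1) = a by rewrite vp nth_cat ltnn subnn.
have v1 : vtx D' (size D1) (size s1).+1 = p.
  by rewrite vp nth_cat ltnNge leqnSn /= subSnn.
have v2 : vtx D' (size D1) (size s1).+2 = b.
  by rewrite vp -addn2 nth_cat ltnNge leq_addr /= addKn.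
have hp : ((size s1).+1 < nb_vertices D' (size D1))%N.
  by rewrite /nb_vertices D'E nth_cat ltnn subnn size_cat /=; lia.
have := generic_vertices gD' hp He; rewrite /pos v1 => /(_ on)[/= E1 E2].
move: nf; rewrite /iedge /= E1; case: E2 => [->|[->]].
  by rewrite v1 v2 eqxx !orbT.
by rewrite v0 v1 eqxx !orbT.
Qed.

Lemma subdivision_sums D D' : generic D' -> subdivision D D' ->
  [/\ mutual D = mutual D', forall over, self_sum over D = self_sum over D' &
      ordered D = ordered D'].
Proof.
move=> gD' /(subdivision_splits gD')[a [b [t [tI h]]]].
have h1 i := (h i).1; have h2 i f := (h i).2 f; split.
- exact: (splits_mutual tI h1 h2).
- by move=> over; exact: (splits_self tI h1 h2 over 0%N).
- exact: (splits_ordered tI h1 h2).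
Qed.

End Subdivision.

(** * Diagrams assembled from local pictures *)

Section Flatten.
Variable T : Type.
Implicit Types (ss : seq (seq T)) (x : T).

(** The position of the first letter of the word r in the concatenation. *)
Definition foff ss r : nat := size (flatten (take r ss)).

Lemma foffS ss r : (r < size ss)%N -> foff ss r.+1 = (foff ss r + size (nth [::] ss r))%N.
Proof.
move=> h; rewrite /foff (take_nth [::]) // -cats1 flatten_cat /= cats0 size_cat //.
Qed.

Lemma foff_le ss r r' : (r <= r')%N -> (foff ss r <= foff ss r')%N.
Proof.
move=> h; rewrite /foff -(cat_take_drop r (take r' ss)) take_takel // flatten_cat.
by rewrite size_cat leq_addr.
Qed.

Lemma nth_flat ss r c x : (r < size ss)%N -> (c < size (nth [::] ss r))%N ->
  (foff ss r + c < size (flatten ss))%N /\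
  nth x (flatten ss) (foff ss r + c) = nth x (nth [::] ss r) c.
Proof.
move=> hr hc.
have E : flatten ss = flatten (take r ss) ++ nth [::] ss r ++ flatten (drop r.+1 ss).
  by rewrite -{1}(cat_take_drop r ss) (drop_nth [::]) // flatten_cat.
split; first by rewrite E !size_cat ltn_add2l ltn_addr.
by rewrite E nth_cat ltnNge leq_addr /= addKn nth_cat hc.
Qed.

Lemma flat_index ss j : (j < size (flatten ss))%N ->
  exists r c, [/\ (r < size ss)%N, (c < size (nth [::] ss r))%N &
                  j = (foff ss r + c)%N].
Proof.
elim: ss j => [|s ss IH] j //=; rewrite size_cat.
have [h _|h jlt] := ltnP j (size s); first by exists 0%N, j.
have [|r [c [h1 h2 h3]]] := IH (j - size s)%N; first by rewrite ltn_subLR.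
exists r.+1, c; split=> //; rewrite /foff /= size_cat -addnA -[X in (_ + X)%N]h3.
by rewrite subnKC.
Qed.

Lemma foff_inj ss r c r' c' :
    (r < size ss)%N -> (c < size (nth [::] ss r))%N ->
    (r' < size ss)%N -> (c' < size (nth [::] ss r'))%N ->
  (foff ss r + c)%N = (foff ss r' + c')%N -> r = r' /\ c = c'.
Proof.
move=> hr hc hr' hc' E.
have lt a b ca cb : (a < size ss)%N -> (ca < size (nth [::] ss a))%N ->
    (foff ss a + ca)%N = (foff ss b + cb)%N -> (b <= a)%N.
  move=> ha hca Eab; rewrite leqNgt; apply/negP => /(foff_le ss).
  by rewrite foffS // leqNgt ltnNge -(leq_add2r cb) -Eab => /negP; apply;
     rewrite -ltnNge -addnA ltn_add2l ltn_addr.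
have Err : r = r' by apply/eqP; rewrite eqn_leq (lt r' r c' c) // (lt r r' c c').
by rewrite -Err in E *; split=> //; apply/eqP; rewrite -(eqn_add2l (foff ss r)) E.
Qed.

End Flatten.

Section Holes.
Variable R : realType.
Implicit Types (C : context R) (P Q : diagram R).

Definition block P (x : vertex R + nat) : arc R :=
  match x with inl v => [:: v] | inr k => nth [::] P k end.

Definition letter C i r : vertex R + nat := nth (inr 0%N) (nth [::] C i) r.

Definition has_letter C i r : bool := (r < size (nth [::] C i))%N.

Definition hole_at C k i r : Prop := has_letter C i r /\ letter C i r = inr k.

Lemma holes_unique C n k i r i' r' : perm_eq (holes C) (iota 0 n) ->
  hole_at C k i r -> hole_at C k i' r' -> (i, r) = (i', r').
Proof.
move=> pC [hr lr] [hr' lr'].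
have U : uniq (holes C) by rewrite (perm_uniq pC) iota_uniq.
have sz j s : has_letter C j s -> (j < size C)%N.
  by rewrite /has_letter; case: (ltnP j (size C)) => // h; rewrite nth_default.
have [p1 q1] := nth_flat (inr 0%N) (sz _ _ hr) hr.
have [p2 q2] := nth_flat (inr 0%N) (sz _ _ hr') hr'.
suff E : (foff C i + r)%N = (foff C i' + r')%N.
  by have [-> ->] := foff_inj (sz _ _ hr) hr (sz _ _ hr') hr' E.
rewrite -/(letter C i r) lr in q1; rewrite -/(letter C i' r') lr' in q2.
move: U p1 p2 q1 q2; rewrite /holes.
move: (foff C i + r)%N (foff C i' + r')%N (flatten C) => a b s.
elim: s a b => [|x s IH] [|a] [|b] //=.
- move=> U _ hb Ex Eb; exfalso; move: U; rewrite Ex /= => /andP[/negP kN _].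
  by apply: kN; rewrite mem_pmap; apply/mapP; exists (inr k) => //;
     rewrite -Eb mem_nth.
- move=> U ha _ Ea Ex; exfalso; move: U; rewrite Ex /= => /andP[/negP kN _].
  by apply: kN; rewrite mem_pmap; apply/mapP; exists (inr k) => //;
     rewrite -Ea mem_nth.
- move=> U ha hb Ea Eb; congr _.+1; apply: IH => //.
  by case: x U => [v|m] //= /andP[].
Qed.

Lemma holesP C n k : perm_eq (holes C) (iota 0 n) ->
  (k < n)%N <-> exists i r, hole_at C k i r.
Proof.
move=> pC.
have -> : (k < n)%N = (k \in holes C) by rewrite (perm_mem pC) mem_iota.
rewrite mem_pmap; split.
  move=> /mapP[x /(nthP (inr 0%N))[j hj Ej] Ex].
  have [i [r [hi hr E]]] := flat_index hj.
  have [_ q] := nth_flat (inr 0%N) hi hr.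
  exists i, r; split=> //; rewrite /letter -q -E Ej.
  by case: x Ex {Ej} => // m [->].
move=> [i [r [hr lr]]]; apply/mapP; exists (inr k) => //.
have hi : (i < size C)%N.
  by move: hr; rewrite /has_letter; case: (ltnP i (size C)) => // h; rewrite nth_default.
have [p q] := nth_flat (inr 0%N) hi hr.
by rewrite -lr /letter -q mem_nth.
Qed.

End Holes.

Section Fill.
Variable R : realType.
Variable C : context R.
Implicit Types P Q : diagram R.

Definition blocks P i : seq (arc R) := map (block P) (nth [::] C i).

Definition vindex P i r c : nat := (foff (blocks P i) r + c)%N.

Lemma nth_fill P i : nth [::] (fill C P) i = flatten (blocks P i).
Proof.
rewrite /fill /blocks; have [h|h] := ltnP i (size C).
  by rewrite (nth_map [::]).
by rewrite !(nth_default [::]) ?size_map.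
Qed.

Section Filled.
Variable P : diagram R.
Hypothesis holesC : perm_eq (holes C) (iota 0 (size P)).
Hypothesis sizeP : forall k, (k < size P)%N -> (1 < nb_vertices P k)%N.

Let D := fill C P.

Lemma nth_blocks i r : has_letter C i r -> nth [::] (blocks P i) r = block P (letter C i r).
Proof. by move=> h; rewrite /blocks (nth_map (inr 0%N)). Qed.

Lemma hole_size k i r : hole_at C k i r -> (1 < nb_vertices P k)%N.
Proof. by move=> h; apply: sizeP; apply/(holesP k holesC); exists i, r. Qed.

Lemma block_size i r : has_letter C i r -> (0 < size (block P (letter C i r)))%N.
Proof.
move=> h; case E : (letter C i r) => [v|k] //=.
by apply: ltnW; exact: (@hole_size k i r).
Qed.

Lemma fill_vertex i r c : has_letter C i r -> (c < size (block P (letter C i r)))%N ->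
  (vindex P i r c < nb_vertices D i)%N /\
  vtx D i (vindex P i r c) = nth ((0, 0), 0) (block P (letter C i r)) c.
Proof.
move=> hr hc; rewrite /nb_vertices /vtx nth_fill /vindex -(nth_blocks hr).
by apply: nth_flat; rewrite ?size_map // nth_blocks.
Qed.

Lemma fill_index i j : (j < nb_vertices D i)%N ->
  exists r c, [/\ has_letter C i r, (c < size (block P (letter C i r)))%N &
                  j = vindex P i r c].
Proof.
rewrite /nb_vertices nth_fill => /flat_index[r [c []]]; rewrite size_map => hr.
by rewrite nth_blocks // => hc E; exists r, c.
Qed.

Lemma vindex_inj i r c r' c' :
    has_letter C i r -> (c < size (block P (letter C i r)))%N ->
    has_letter C i r' -> (c' < size (block P (letter C i r')))%N ->
  vindex P i r c = vindex P i r' c' -> r = r' /\ c = c'.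
Proof.
by move=> hr hc hr' hc'; apply: foff_inj; rewrite ?size_map ?nth_blocks.
Qed.

Lemma vindex_next i r : has_letter C i r ->
  vindex P i r.+1 0 = (vindex P i r (size (block P (letter C i r))).-1).+1.
Proof.
move=> hr; rewrite /vindex addn0 foffS ?size_map // nth_blocks //.
by rewrite -addnS prednK // block_size.
Qed.

Lemma vindexS i r c : vindex P i r c.+1 = (vindex P i r c).+1.
Proof. by rewrite /vindex addnS. Qed.

(** The edges of the assembled diagram: those of the local picture, and those
    that join consecutive letters of a word of the context. *)
Definition inner_edge i r c : nat * nat := (i, vindex P i r c).

Definition outer_edge i r : nat * nat :=
  (i, vindex P i r (size (block P (letter C i r))).-1).

Lemma fill_edgeP e : is_edge D e <->
  (exists k r c, [/\ hole_at C k e.1 r, is_edge P (k, c) & e = inner_edge e.1 r c]) \/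
  (exists r, has_letter C e.1 r.+1 /\ e = outer_edge e.1 r).
Proof.
case: e => i j; rewrite /inner_edge /outer_edge /is_edge /=; split.
  move=> hj; have [r [c [hr hc E]]] := fill_index (ltnW hj).
  have [h|h] := ltnP c.+1 (size (block P (letter C i r))).
    left; move: h hc E; case L : (letter C i r) => [v|k] //= h hc E.
    by exists k, r, c; rewrite E.
  have Ec : c = (size (block P (letter C i r))).-1 by lia.
  right; exists r; rewrite E Ec; split=> //.
  rewrite /has_letter ltnNge; apply/negP => h'.
  have Er : r.+1 = size (nth [::] C i) by apply/eqP; rewrite eqn_leq h' andbT; exact: hr.
  move: hj; rewrite E Ec -vindex_next // /vindex addn0 Er.
  rewrite /nb_vertices nth_fill /foff -(size_map (block P) (nth [::] C i)) take_size.
  by rewrite ltnn.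
case=> [[k [r [c [[hr L] hc [->]]]]]|[r [hr [->]]]].
  by rewrite -vindexS; apply: (fill_vertex hr _).1; rewrite L.
have hr' : has_letter C i r by exact: ltnW hr.
by rewrite -vindex_next //; exact: (fill_vertex hr (block_size hr)).1.
Qed.

Lemma inner_pos k i r c : hole_at C k i r -> (c < nb_vertices P k)%N ->
  vtx D i (vindex P i r c) = vtx P k c.
Proof. by move=> [hr L] hc; rewrite (fill_vertex hr _).2 L. Qed.

Lemma inner_on k i r c : hole_at C k i r -> is_edge P (k, c) ->
  on_edge D (inner_edge i r c) = on_edge P (k, c).
Proof.
move=> h hc; rewrite /on_edge /pos /inner_edge /= -vindexS.
by rewrite !(inner_pos h) //; exact: ltnW.
Qed.

Definition block_last i r : vertex R := last ((0, 0), 0) (block P (letter C i r)).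
Definition block_head i r : vertex R := head ((0, 0), 0) (block P (letter C i r)).

Lemma outer_vtx i r : has_letter C i r.+1 ->
  vtx D i (outer_edge i r).2 = block_last i r /\
  vtx D i (outer_edge i r).2.+1 = block_head i r.+1.
Proof.
move=> hr; have hr' : has_letter C i r by exact: ltnW hr.
have s1 := block_size hr; have s2 := block_size hr'.
rewrite /outer_edge /= -vindex_next // (fill_vertex hr s1).2.
rewrite (fill_vertex hr' _).2 ?nth_last ?nth0 //.
by rewrite prednK.
Qed.

Lemma outer_neq_inner k i r c i' r' : hole_at C k i r -> is_edge P (k, c) ->
  has_letter C i' r'.+1 -> inner_edge i r c <> outer_edge i' r'.
Proof.
move=> [hr L] hc hr' [Ei Ec]; rewrite -{i'}Ei in hr' Ec.
have hr0 : has_letter C i r' by exact: ltnW hr'.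
have := vindex_inj hr _ hr0 _ Ec; rewrite L.
case; [exact: ltnW | by rewrite prednK // block_size |] => Er.
by rewrite -Er L /= => Ec'; move: hc; rewrite /is_edge /= Ec' prednK ?ltnn //;
   rewrite ltnW // (hole_size (conj hr L)).
Qed.

(** An outer edge cannot enter the region where the diagram looks like the
    local picture: it would share a segment with that picture, hence two points
    with one of its finitely many edges. *)
Section Region.
Variable U : set (point R).
Hypothesis U_open : forall z y, U z ->
  exists2 eps : R, 0 < eps <= 1 & forall t, 0 <= t <= eps -> U (lerp t z y).
Hypothesis U_looks : forall z, U z -> trace D z -> trace P z.
Hypothesis gD : generic D.

Lemma outer_avoids i r z : has_letter C i r.+1 -> on_edge D (outer_edge i r) z -> ~ U z.
Proof.
move=> hr on Uz; set f := outer_edge i r in on *.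
have Hf : is_edge D f by apply/fill_edgeP; right; exists r.
have nab := generic_edges gD Hf.
have [y [nzy ony]] : exists y, z <> y /\
    forall t, 0 <= t <= 1 -> on_edge D f (lerp t z y).
  have [s sI zE] := on.
  set a := pos D f.1 f.2 in nab zE; set b := pos D f.1 f.2.+1 in nab zE.
  have [zb|nzb] := pselect (z = b).
    exists a; split=> [za|t tI]; first by apply: nab; rewrite -za.
    by apply: segmentC; exists t; rewrite ?zb.
  exists b; split=> // t tI; exists (s + t * (1 - s)).
    have k1 : 0 <= t * (1 - s) by apply: mulr_ge0; lra.
    have k2 : 0 <= (1 - t) * (1 - s) by apply: mulr_ge0; lra.
    by apply/andP; split; lra.
  by rewrite zE; apply: point_eqP => /=; ring.
have [eps /andP[e0 e1] Ueps] := U_open y Uz.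
pose tn (n : nat) : R := eps / n.+1%:R.
have tnI n : 0 <= tn n <= eps.
  rewrite divr_ge0 ?(ltW e0) ?ler0n //= ler_pdivrMr ?ltr0n // ler_peMr ?(ltW e0) //.
  by rewrite ler1n.
have tn1 n : 0 <= tn n <= 1 by have /andP[-> h] := tnI n; exact: le_trans h e1.
have inP n : exists kc : nat * nat, is_edge P kc /\ on_edge P kc (lerp (tn n) z y).
  have [kc h1 h2] := U_looks (Ueps _ (tnI n)) (ex_intro2 _ _ f Hf (ony _ (tn1 n))).
  by exists kc.
have [g gE] := choice inP.
pose L := [seq (k, c) | k <- iota 0 (size P), c <- iota 0 (nb_vertices P k)].
have edgeP kc : is_edge P kc -> (kc.1 < size P)%N.
  by move=> h; rewrite ltnNge; apply/negP => h'; move: h; rewrite /is_edge /nb_vertices nth_default.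
have gL n : g n \in L.
  have [h _] := gE n; rewrite [g n]surjective_pairing; apply: allpairs_f_dep.
    by rewrite mem_iota /= edgeP.
  by rewrite mem_iota /=; exact: ltnW h.
have : (size (map g (iota 0 (size L).+1)) <= size L)%N.
  apply: uniq_leq_size; last by move=> kc /mapP[n _ ->].
  rewrite map_inj_uniq ?iota_uniq // => n m E.
  have [h1 h2] := gE n; have [_ h3] := gE m; rewrite -E in h3.
  have [i' [r' hk]] := (holesP (g n).1 holesC).1 (edgeP _ h1).
  rewrite [g n]surjective_pairing in h1 h2 h3.
  have He : is_edge D (inner_edge i' r' (g n).2).
    by apply/fill_edgeP; left; exists (g n).1, r', (g n).2.
  rewrite -(inner_on hk h1) in h2 h3.
  have Et := generic_two_points gD He Hf (outer_neq_inner hk h1 hr) h2 (ony _ (tn1 n))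
              h3 (ony _ (tn1 m)).
  have := lerp_inj nzy Et; rewrite /tn => /(mulfI (lt0r_neq0 e0)) /invr_inj /eqP.
  by rewrite eqr_nat => /eqP[].
by rewrite size_map size_iota ltnn.
Qed.

End Region.
End Filled.
End Fill.

(** * Diagrams on an integer grid *)

Definition zpoint : Type := (Z * Z)%type.
Definition zvertex : Type := (zpoint * int)%type.
Definition zarc : Type := seq zvertex.
Definition zdiagram : Type := seq zarc.

Section Grid.
Variable R : realType.
Implicit Types (N x y : Z) (a b c d : zpoint).

(** Integers are represented by [Z], with which computations are fast. *)
Definition zr x : R := (int_of_Z x)%:~R.

Lemma zrD x y : zr (x + y) = zr x + zr y.
Proof. by rewrite /zr !rmorphD. Qed.
Lemma zrN x : zr (- x) = - zr x.
Proof. by rewrite /zr !rmorphN. Qed.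
Lemma zrM x y : zr (x * y) = zr x * zr y.
Proof. by rewrite /zr !rmorphM. Qed.
Lemma zr0 : zr 0%BZ = 0. Proof. by []. Qed.
Lemma zr1 : zr 1%BZ = 1. Proof. by rewrite /zr rmorph1. Qed.
Lemma zr2 : zr 2%BZ = 2.
Proof. by rewrite (_ : 2%BZ = 1%BZ + 1%BZ :> Z) // zrD zr1. Qed.
Definition zrE := (zrD, zrN, zrM, zr0, zr1, zr2).

Lemma zr_gt0 x : (0 < zr x) = (0 < x).
Proof.
rewrite /zr ltr0z; apply/idP/idP => h.
  by rewrite -(int_of_ZK x); case: (int_of_Z x) h => // n; rewrite ltz_nat; lia.
by case: x h => [|p|p] //= _; rewrite ltz_nat; lia.
Qed.

Lemma zr_lt x y : (zr x < zr y) = (x < y).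
Proof. by rewrite -subr_gt0 -zrN -zrD zr_gt0 subr_gt0. Qed.

Lemma zr_le x y : (zr x <= zr y) = (x <= y).
Proof. by rewrite !leNgt zr_lt. Qed.

Lemma zr_eq x y : (zr x == zr y) = (x == y).
Proof. by rewrite !eq_le !zr_le. Qed.

(** The points of the grid of step 1 / N. *)
Definition emb N a : point R := (zr a.1 / zr N, zr a.2 / zr N).
Definition embv N (v : zvertex) : vertex R := (emb N v.1, v.2).
Definition embd N (D : zdiagram) : diagram R := map (map (embv N)) D.

Lemma orient_emb N a b c :
  orient (emb N a) (emb N b) (emb N c) = zr (orient a b c) / zr N ^+ 2 :> R.
Proof. by rewrite /orient /emb !zrE -exprVn /=; ring. Qed.

Variable N : Z.
Hypothesis N0 : 0 < N.

Let n2 : 0 < (zr N ^+ 2)^-1.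
Proof. by rewrite invr_gt0 exprn_gt0 ?zr_gt0. Qed.

Lemma orient_emb_gt0 a b c :
  (0 < orient (emb N a) (emb N b) (emb N c)) = (0 < orient a b c).
Proof. by rewrite orient_emb pmulr_lgt0 ?zr_gt0. Qed.

Lemma proper_emb a b c d :
  proper (emb N a) (emb N b) (emb N c) (emb N d) = proper a b c d.
Proof.
have E p q r p' q' r' :
    (orient (emb N p) (emb N q) (emb N r) * orient (emb N p') (emb N q') (emb N r') < 0)
    = (orient p q r * orient p' q' r' < 0).
  rewrite !orient_emb mulrACA pmulr_llt0 ?mulr_gt0 //.
  by rewrite -zrM -oppr_gt0 -zrN zr_gt0 oppr_gt0.
by rewrite /proper !E.
Qed.

End Grid.

Definition zedge : Type := (zvertex * zvertex)%type.

Definition zsgnx (e f : zedge) : int :=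
  if proper e.1.1 e.2.1 f.1.1 f.2.1
  then (if 0 < orient e.1.1 e.2.1 f.2.1 then 1 else -1) else 0.

Definition zedges (w : zarc) : seq zedge := zip w (behead w).

Definition embe (R : realType) N (e : zedge) : edge R := (embv R N e.1, embv R N e.2).

Lemma sgnx_emb (R : realType) N e f : 0 < N ->
  sgnx (embe R N e) (embe R N f) = zsgnx e f.
Proof. by move=> N0; rewrite /sgnx /ecross /= proper_emb // orient_emb_gt0. Qed.

Lemma edges_emb (R : realType) N w :
  edges (map (embv R N) w) = map (embe R N) (zedges w).
Proof.
rewrite /edges /zedges; case: w => [|v w] //=.
by elim: w v => [|u w IH] v //=; rewrite IH.
Qed.

(** The sides of the moves have half-integer coordinates. *)
Definition zstrand (x y d : Z) (l : int) : zarc :=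
  [:: ((x, - (2 * d)%BZ), l); ((y, 0%BZ), l); ((x, (2 * d)%BZ), l)].
Definition ztype1 (s o : Z) (l : int) : zdiagram * zdiagram :=
  ([:: [:: ((0%BZ, (-2)%BZ), 0); ((0%BZ, 2%BZ), 0)]],
   [:: [:: ((0%BZ, (-2)%BZ), 0); ((- o, 1%BZ), 0); ((- o, (-1)%BZ), l); ((0%BZ, 2%BZ), 0)]]).
Definition ztype2 (dl dr : Z) (ll lr : int) : zdiagram * zdiagram :=
  ([:: zstrand (-1)%BZ (-1)%BZ dl ll; zstrand 1%BZ 1%BZ dr lr],
   [:: zstrand (-1)%BZ 1%BZ dl ll; zstrand 1%BZ (-1)%BZ dr lr]).
Definition ztriangle (tm tb c h : Z) : zdiagram :=
  [:: [:: (((-2)%BZ, 0%BZ), 2); ((0%BZ, h), 2); ((2%BZ, 0%BZ), 2)];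
      [:: ((- (tm * c), - (2 * tm)%BZ), 1); ((tm * c, (2 * tm)%BZ), 1)];
      [:: ((tb * c, - (2 * tb)%BZ), 0); ((- (tb * c), (2 * tb)%BZ), 0)]].
Definition ztype3 (tm tb mb : Z) : zdiagram * zdiagram :=
  (ztriangle tm tb (tm * tb * mb) 1%BZ, ztriangle tm tb (tm * tb * mb) (-1)%BZ).

Definition zsides (m : move) : zdiagram * zdiagram :=
  match m with
  | R1a => ztype1 1 (-1)%BZ (-1)
  | R1b => ztype1 1 1 1
  | R1c => ztype1 (-1)%BZ (-1)%BZ 1
  | R1d => ztype1 (-1)%BZ 1 (-1)
  | R2a => ztype2 1 1 0 1
  | R2b => ztype2 1 1 1 0
  | R2c => ztype2 1 (-1)%BZ 1 0
  | R2d => ztype2 (-1)%BZ 1 1 0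
  | R3a => ztype3 1 (-1)%BZ 1
  | R3b => ztype3 1 1 1
  | R3c => ztype3 1 (-1)%BZ (-1)%BZ
  | R3d => ztype3 (-1)%BZ 1 1
  | R3e => ztype3 1 1 (-1)%BZ
  | R3f => ztype3 (-1)%BZ (-1)%BZ 1
  | R3g => ztype3 (-1)%BZ (-1)%BZ (-1)%BZ
  | R3h => ztype3 (-1)%BZ 1 (-1)%BZ
  end.

Lemma sides_emb (R : realType) m :
  sides R m = (embd R 2%BZ (zsides m).1, embd R 2%BZ (zsides m).2).
Proof.
have m1 : zr R (-1)%BZ = -1 by rewrite (_ : (-1)%BZ = - 1%BZ) // zrN zr1.
have m2 : zr R (-2)%BZ = -2 by rewrite (_ : (-2)%BZ = - 2%BZ) // zrN zr2.
have h2 : 2 / 2 = 1 :> R by rewrite divff.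
case: m; rewrite /= /type1 /type2 /type3 /straight /kink /two_apart /two_bigon
  /strand /triangle /embd /embv /emb /= ?m1 ?m2 ?zr0 ?zr1 ?zr2;
  rewrite ?(mulr1, mulrN1, mul1r, mulN1r, opprK, mulNr, mul0r, h2, oppr0,
            rmorphN, rmorph1, mulrN, rmorph0) /=; reflexivity.
Qed.

(** * Edges of an assembled diagram *)

Section Codes.
Variable R : realType.
Implicit Types (P Q : diagram R) (w : seq (vertex R + nat)) (e f : edge R).

Let v0 : vertex R := ((0, 0), 0).

Lemma edges_cat2 (s1 s2 : arc R) : (0 < size s1)%N -> (0 < size s2)%N ->
  edges (s1 ++ s2) = edges s1 ++ (last v0 s1, head v0 s2) :: edges s2.
Proof.
case: s2 => // b s2; elim: s1 => // a s1 IH _ _.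
case: s1 IH => [|c s1] //= IH; rewrite /edges /=; congr (_ :: _).
exact: IH.
Qed.

(** The edges of a word, as a word: the edges of a hole stay together. *)
Fixpoint codes P w : seq (edge R + nat) :=
  if w is x :: w' then
    (if x is inr k then [:: inr k] else [::]) ++
    (if w' is y :: _ then [:: inl (last v0 (block P x), head v0 (block P y))]
     else [::]) ++ codes P w'
  else [::].

Definition eblock P (u : edge R + nat) : seq (edge R) :=
  match u with inl e => [:: e] | inr k => edges (nth [::] P k) end.

Lemma edges_codes P w : (forall x, x \in w -> (0 < size (block P x))%N) ->
  edges (flatten (map (block P) w)) = flatten (map (eblock P) (codes P w)).
Proof.
elim: w => // x w IH pos; rewrite /= !map_cat !flatten_cat.
have px : (0 < size (block P x))%N by apply: pos; rewrite mem_head.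
have E : flatten (map (eblock P) (if x is inr k then [:: inr k] else [::])) =
    edges (block P x) by case: x {pos px} => //= k; rewrite cats0.
rewrite {}E; case: w IH pos => [|y w] IH pos; first by rewrite /= !cats0.
have py : (0 < size (block P y))%N by apply: pos; rewrite !inE eqxx orbT.
rewrite edges_cat2 // ?size_cat ?ltn_addr // IH /=; last first.
  by move=> z zw; apply: pos; rewrite inE zw orbT.
by case: (block P y) py.
Qed.

Lemma codes_hole P w k : (inr k \in codes P w) = (inr k \in w).
Proof.
elim: w => // x w IH; rewrite /= !mem_cat IH !inE.
case: x => [v|l] /=; case: w {IH} => [|y w]; rewrite ?inE ?orbF //=.
Qed.

Lemma codes_holes P w : pmap (fun u => if u is inr k then Some k else None) (codes P w) =
  pmap (fun x => if x is inr k then Some k else None) w.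
Proof.
elim: w => // x w IH; rewrite /= !pmap_cat IH.
by case: x => [v|l] /=; case: w {IH} => [|y w].
Qed.

Lemma codes_outer P w e : inl e \in codes P w ->
  exists r, (r.+1 < size w)%N /\
    e = (last v0 (block P (nth (inr 0%N) w r)), head v0 (block P (nth (inr 0%N) w r.+1))).
Proof.
elim: w => // x w IH; rewrite /= !mem_cat => /or3P[].
- by case: x.
- by case: w {IH} => // y w; rewrite inE => /eqP[->]; exists 0%N.
- by move=> /IH[r [hr ->]]; exists r.+1.
Qed.

Lemma codes_eq P Q w :
    (forall x, x \in w -> last v0 (block P x) = last v0 (block Q x) /\
                          head v0 (block P x) = head v0 (block Q x)) ->
  codes P w = codes Q w.
Proof.
elim: w => // x w IH h /=; rewrite IH; last first.
  by move=> y yw; apply: h; rewrite inE yw orbT.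
case: w {IH} h => // y w h; have [-> _] := h x (mem_head _ _).
by have [|_ ->] := h y; first by rewrite !inE eqxx orbT.
Qed.

Lemma osum_flatten (T U : Type) (g : U -> seq T) (y : T -> T -> int) (s : seq U) :
  osum y (flatten (map g s)) =
  osum (fun u v => \sum_(e <- g u) \sum_(f <- g v) y e f) s + \sum_(u <- s) osum y (g u).
Proof.
elim: s => [|u s IH] /=; first by rewrite big_nil addr0.
rewrite osum_cat IH big_cons.
have -> : \sum_(e <- g u) \sum_(f <- flatten (map g s)) y e f =
    \sum_(v <- s) \sum_(e <- g u) \sum_(f <- g v) y e f.
  rewrite [RHS]exchange_big /=; apply: eq_bigr => e _.
  by rewrite big_flatten big_map.
ring.
Qed.

Lemma sum_flatten (T U : Type) (g : U -> seq T) (h : T -> int) (s : seq U) :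
  \sum_(e <- flatten (map g s)) h e = \sum_(u <- s) \sum_(e <- g u) h e.
Proof. by rewrite big_flatten big_map. Qed.

End Codes.

(** * Crossing sums and local replacements *)

Section Replace.
Variable R : realType.
Variables (P P' : diagram R) (n : nat) (W : nat -> seq (edge R + nat)).
Implicit Types (y : edge R -> edge R -> int).

Let hole_of (u : edge R + nat) := if u is inr k then Some k else None.

Hypothesis W_lt : forall i k, inr k \in W i -> (k < n)%N.
Hypothesis W_uniq : forall i, uniq (pmap hole_of (W i)).
Hypothesis W_disj : forall i j k, i <> j -> inr k \in W i -> inr k \notin W j.

Let E i := flatten (map (eblock P) (W i)).
Let E' i := flatten (map (eblock P') (W i)).

Definition separate y : Prop := forall i j k f, inr k \in W i -> inl f \in W j ->
  forall e, e \in edges (nth [::] P k) \/ e \in edges (nth [::] P' k) ->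
  y e f = 0 /\ y f e = 0.

Definition block_sum y (X : diagram R) (u v : edge R + nat) : int :=
  \sum_(e <- eblock X u) \sum_(f <- eblock X v) y e f.

Definition hole_sums_agree y : Prop := forall k l, (k < n)%N -> (l < n)%N -> k <> l ->
  block_sum y P (inr k) (inr l) = block_sum y P' (inr k) (inr l).

Lemma block_sum_eq y i j u v : separate y -> hole_sums_agree y ->
  u \in W i -> v \in W j -> (forall k, u = inr k -> v <> inr k) ->
  block_sum y P u v = block_sum y P' u v.
Proof.
move=> sy hy; rewrite /block_sum.
case: u => [e|k] hu; case: v => [f|l] hv ne //=.
- rewrite !big_seq1 !big1_seq // => g /andP[_ hg].
    by apply: (sy _ _ _ _ hv hu g _).2; right.
  by apply: (sy _ _ _ _ hv hu g _).2; left.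
- rewrite !big1_seq // => g /andP[_ hg]; rewrite big_seq1.
    by apply: (sy _ _ _ _ hu hv g _).1; right.
  by apply: (sy _ _ _ _ hu hv g _).1; left.
- by apply: hy; [exact: W_lt hu | exact: W_lt hv | move=> kl; case: (ne k); rewrite ?kl].
Qed.

(** The edges outside the changing disk keep their crossings with each other and
    have none with the edges inside, so a sum over all pairs of edges of two arcs
    changes as its part in the disk does. *)
Lemma replace_sum y i j : i <> j -> separate y -> hole_sums_agree y ->
  \sum_(e <- E i) \sum_(f <- E j) y e f = \sum_(e <- E' i) \sum_(f <- E' j) y e f.
Proof.
move=> ij sy hy; rewrite !sum_flatten; apply: eq_big_seq => u hu.
transitivity (\sum_(v <- W j) block_sum y P u v).
  by rewrite /block_sum [RHS]exchange_big /=; apply: eq_bigr => e _; rewrite sum_flatten.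
transitivity (\sum_(v <- W j) block_sum y P' u v); last first.
  by rewrite /block_sum exchange_big /=; apply: eq_bigr => e _; rewrite sum_flatten.
apply: eq_big_seq => v hv; apply: (block_sum_eq sy hy hu hv) => k uk vk.
by move: hv; rewrite vk; apply/negP; apply: (W_disj ij); rewrite -uk.
Qed.

Lemma eq_osum_uniq (y y' : edge R + nat -> edge R + nat -> int) s :
    uniq (pmap hole_of s) ->
    (forall u v, u \in s -> v \in s -> (forall k, u = inr k -> v <> inr k) ->
      y u v = y' u v) ->
  osum y s = osum y' s.
Proof.
elim: s => // u s IH U h /=; rewrite IH; last first.
- by move=> a b ha hb; apply: h; rewrite inE ?ha ?hb orbT.
- by case: u U {h} => [e|k] //= /andP[].
congr (_ + _); apply: eq_big_seq => v hv; apply: h; rewrite ?mem_head //.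
  by rewrite inE hv orbT.
move=> k uk vk; move: U; rewrite uk /= => /andP[/negP]; case.
by rewrite mem_pmap; apply/mapP; exists (inr k) => //; rewrite -vk.
Qed.

Lemma replace_osum y i : separate y -> hole_sums_agree y ->
  (forall k, (k < n)%N -> osum y (edges (nth [::] P k)) = osum y (edges (nth [::] P' k))) ->
  osum y (E i) = osum y (E' i).
Proof.
move=> sy hy oy; rewrite !osum_flatten; congr (_ + _).
  apply: eq_osum_uniq => // u v hu hv ne; exact: block_sum_eq sy hy hu hv ne.
apply: eq_big_seq => -[e|k] hu //=; exact: oy (W_lt hu).
Qed.

(** With at most two holes, an edge of the local picture cannot meet both other
    arcs, hence only the sums over whole holes matter. *)
Lemma replace_ordered : (n <= 2)%N -> separate (@sgnx R) -> hole_sums_agree (@sgnx R) ->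
  osum (fun x x' => (\sum_(f <- E 1) sgnx x f) * (\sum_(g <- E 2) sgnx x' g)) (E 0) +
  \sum_(x <- E 0) \sum_(f <- E 1) \sum_(g <- E 2) ordered_at x f g =
  osum (fun x x' => (\sum_(f <- E' 1) sgnx x f) * (\sum_(g <- E' 2) sgnx x' g)) (E' 0) +
  \sum_(x <- E' 0) \sum_(f <- E' 1) \sum_(g <- E' 2) ordered_at x f g.
Proof.
move=> n2 sy hy.
have A (X : diagram R) i u : \sum_(e <- eblock X u) \sum_(f <- flatten (map (eblock X) (W i))) sgnx e f =
    \sum_(v <- W i) block_sum (@sgnx R) X u v.
  by rewrite /block_sum [RHS]exchange_big /=; apply: eq_bigr => e _; rewrite sum_flatten.
have AE i u : i <> 0%N -> u \in W 0 ->
    \sum_(v <- W i) block_sum (@sgnx R) P u v = \sum_(v <- W i) block_sum (@sgnx R) P' u v.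
  move=> i0 hu; apply: eq_big_seq => v hv; apply: (block_sum_eq sy hy hu hv) => k uk vk.
  by move: hv; rewrite vk; apply/negP; apply: (@W_disj 0%N i) => //; [move/esym|rewrite -uk].
(* sums over an arc reduce to the outer edges, or to the holes *)
have Sout (X : diagram R) (e : edge R) i (h : edge R -> int) : X = P \/ X = P' ->
    inl e \in W 0 -> (forall f, sgnx e f = 0 -> h f = 0) ->
    \sum_(f <- flatten (map (eblock X) (W i))) h f =
    \sum_(v <- W i) (if v is inl f then h f else 0).
  move=> hX he h0; rewrite sum_flatten; apply: eq_big_seq => -[f|k] hv /=.
    by rewrite big_seq1.
  rewrite big1_seq // => f /andP[_ hf]; apply: h0.
  by apply: (sy _ _ _ _ hv he f _).2; case: hX hf => ->; auto.
have Sin (X : diagram R) k e i (h : edge R -> int) : X = P \/ X = P' ->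
    inr k \in W 0 -> e \in edges (nth [::] X k) -> (forall l, inr l \notin W i) ->
    (forall f, sgnx e f = 0 -> h f = 0) ->
    \sum_(f <- flatten (map (eblock X) (W i))) h f = 0.
  move=> hX hk he hl h0; rewrite sum_flatten big1_seq // => -[f|l] /andP[_ hv] /=.
    rewrite big_seq1; apply: h0; apply: (sy _ _ _ _ hk hv e _).1.
    by case: hX he => ->; auto.
  by move: (hl l); rewrite hv.
have no_hole k : inr k \in W 0 ->
    (forall l, inr l \notin W 1) \/ (forall l, inr l \notin W 2).
  move=> hk; apply: contrapT => /not_orP[/existsNP[l1 /negP/negbNE h1] /existsNP[l2 /negP/negbNE h2]].
  have d a b i j : i <> j -> inr a \in W i -> inr b \in W j -> a <> b.
    by move=> ij ha hb E0; move: (W_disj ij ha); rewrite E0 hb.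
  have h01 := d _ _ 0%N 1%N (ltac:(done)) hk h1.
  have h02 := d _ _ 0%N 2%N (ltac:(done)) hk h2.
  have h12 := d _ _ 1%N 2%N (ltac:(done)) h1 h2.
  by move: (W_lt hk) (W_lt h1) (W_lt h2); lia.
rewrite !osum_flatten -!addrA; congr (_ + _).
  apply: eq_osum_uniq => // u v hu hv ne.
  have sep (X : diagram R) : \sum_(e <- eblock X u) \sum_(f <- eblock X v)
      (\sum_(f0 <- flatten (map (eblock X) (W 1))) sgnx e f0) *
      (\sum_(g <- flatten (map (eblock X) (W 2))) sgnx f g) =
      (\sum_(e <- eblock X u) \sum_(f0 <- flatten (map (eblock X) (W 1))) sgnx e f0) *
      (\sum_(f <- eblock X v) \sum_(g <- flatten (map (eblock X) (W 2))) sgnx f g).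
    by rewrite big_distrl /=; apply: eq_bigr => e _; rewrite big_distrr.
  by rewrite !sep !A (AE 1%N u) // (AE 2%N v).
rewrite !sum_flatten -!big_split /=; apply: eq_big_seq => -[e|k] hu /=.
  rewrite !big_nil !add0r !big_seq1.
  have or0 f g : sgnx e f = 0 -> ordered_at e f g = 0.
    by rewrite /ordered_at => ->; rewrite mul0r if_same.
  have or1 f g : sgnx e g = 0 -> ordered_at e f g = 0.
    by rewrite /ordered_at => ->; rewrite mulr0 if_same.
  rewrite !(@Sout _ e 1%N _ _ hu); auto; last 2 first.
  - by move=> f f0; rewrite big1 // => g _; exact: or0.
  - by move=> f f0; rewrite big1 // => g _; exact: or0.
  apply: eq_bigr => -[f|//] _.
  by rewrite !(@Sout _ e 2%N _ _ hu); auto; move=> g g0; exact: or1.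
suff Z (X : diagram R) : X = P \/ X = P' ->
    osum (fun x x' => (\sum_(f <- flatten (map (eblock X) (W 1))) sgnx x f) *
       (\sum_(g <- flatten (map (eblock X) (W 2))) sgnx x' g)) (edges (nth [::] X k)) +
    \sum_(x <- edges (nth [::] X k)) \sum_(f <- flatten (map (eblock X) (W 1)))
       \sum_(g <- flatten (map (eblock X) (W 2))) ordered_at x f g = 0.
  by rewrite /E /E' !Z; auto.
move=> hX.
have osum0 (y : edge R -> edge R -> int) s : {in s &, forall x x', y x x' = 0} ->
    osum y s = 0.
  move=> h; rewrite (@eq_osum _ y (fun _ _ => 0)) //.
  by elim: s {h} => //= a s ->; rewrite big1 // addr0.
have [h1|h2] := no_hole k hu.
  rewrite osum0 => [|x x' hx hx'].
    rewrite add0r big1_seq // => x /andP[_ hx].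
    apply: (Sin X k x 1%N) => // f f0; rewrite big1 // => g _.
    by rewrite /ordered_at f0 mul0r if_same.
  by rewrite (Sin X k x 1%N) ?mul0r.
rewrite osum0 => [|x x' hx hx'].
  rewrite add0r big1_seq // => x /andP[_ hx]; rewrite big1 // => f _.
  apply: (Sin X k x 2%N) => // g g0.
  by rewrite /ordered_at g0 mulr0 if_same.
by rewrite (Sin X k x' 2%N) ?mulr0.
Qed.

End Replace.

(** * Affine changing disks *)

Section Affine.
Variable R : realType.
Implicit Types (a b c z : point R) (phi : point R -> point R) (P : diagram R).

Lemma affine_lerp phi t a b : oriented_affine phi ->
  phi (lerp t a b) = lerp t (phi a) (phi b).
Proof.
move=> [k [l [m [n [u [v [_ E]]]]]]]; rewrite !E.
by apply: point_eqP => /=; ring.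
Qed.

Lemma affine_orient phi : oriented_affine phi -> exists2 det : R, 0 < det &
  forall a b c, orient (phi a) (phi b) (phi c) = det * orient a b c.
Proof.
move=> [k [l [m [n [u [v [d0 E]]]]]]]; exists (k * n - l * m) => // a b c.
by rewrite !E /orient /=; ring.
Qed.

Lemma affine_inj phi : oriented_affine phi -> injective phi.
Proof.
move=> [k [l [m [n [u [v [d0 E]]]]]]] a b; rewrite !E => -[e1 e2].
have d1 : k * n - l * m != 0 by rewrite gt_eqF.
by apply: point_eqP; apply: (mulfI d1);
   [have h : n * (k * a.1 + l * a.2) - l * (m * a.1 + n * a.2) =
             n * (k * b.1 + l * b.2) - l * (m * b.1 + n * b.2)
   |have h : k * (m * a.1 + n * a.2) - m * (k * a.1 + l * a.2) =
             k * (m * b.1 + n * b.2) - m * (k * b.1 + l * b.2)];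
   rewrite ?(addIr _ e1) ?(addIr _ e2) //; move: h; lra.
Qed.

Lemma affine_surj phi : oriented_affine phi -> forall y, exists z, phi z = y.
Proof.
move=> [k [l [m [n [u [v [d0 E]]]]]]] y.
have d1 : k * n - l * m != 0 by rewrite gt_eqF.
exists ((n * (y.1 - u) - l * (y.2 - v)) / (k * n - l * m),
        (k * (y.2 - v) - m * (y.1 - u)) / (k * n - l * m)).
by rewrite E; apply: point_eqP => /=; field.
Qed.

Lemma segment_affine phi a b z : oriented_affine phi ->
  segment (phi a) (phi b) (phi z) <-> segment a b z.
Proof.
move=> aff; split=> [[t tI E]|[t tI ->]]; exists t => //.
  by apply: (affine_inj aff); rewrite affine_lerp.
exact: affine_lerp.
Qed.

Definition region phi : set (point R) := [set y | exists2 z, open_disk z & phi z = y].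

Lemma region_open phi : oriented_affine phi -> forall z y, region phi z ->
  exists2 eps : R, 0 < eps <= 1 & forall t, 0 <= t <= eps -> region phi (lerp t z y).
Proof.
move=> aff z' y' [z [z1 z2] <-]; have [y <-] := affine_surj aff y'.
have E (x w : R) : `|x| < 1 -> exists2 eps : R, 0 < eps <= 1 &
    forall t, 0 <= t <= eps -> `|(1 - t) * x + t * w| < 1.
  move=> x1; pose M := 1 + `|w - x|; have M1 : 1 <= M by rewrite lerDl.
  have M0 : 0 < M by lra.
  exists ((1 - `|x|) / (2 * M)) => [|t /andP[t0 t1]].
    apply/andP; split; first by rewrite divr_gt0 //; lra.
    rewrite ler_pdivrMr; [|lra].
    by have := normr_ge0 x; lra.
  have -> : (1 - t) * x + t * w = x + t * (w - x) by ring.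
  apply: le_lt_trans (ler_normD _ _) _; rewrite normrM (ger0_norm t0).
  move: t1; rewrite ler_pdivlMr; last by lra.
  have : t * `|w - x| <= t * M by apply: ler_wpM2l; rewrite // lerDr.
  by lra.
have [e1 /andP[p1 q1] h1] := E z.1 y.1 z1; have [e2 /andP[p2 q2] h2] := E z.2 y.2 z2.
exists (Num.min e1 e2); first by rewrite lt_min p1 p2 /= ge_min q1.
move=> t /andP[t0]; rewrite le_min => /andP[t1 t2].
exists (lerp t z y); last exact: affine_lerp.
by split; [apply: h1; rewrite t0 | apply: h2; rewrite t0].
Qed.

Definition tv phi (v : vertex R) : vertex R := (phi v.1, v.2).
Definition te phi (e : edge R) : edge R := (tv phi e.1, tv phi e.2).

Lemma nth_transport phi P i : nth [::] (transport phi P) i = map (tv phi) (nth [::] P i).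
Proof.
have [h|h] := ltnP i (size P); first by rewrite (nth_map [::]).
by rewrite !nth_default ?size_map.
Qed.

Lemma nb_transport phi P i : nb_vertices (transport phi P) i = nb_vertices P i.
Proof. by rewrite /nb_vertices nth_transport size_map. Qed.

Lemma is_edge_transport phi P e : is_edge (transport phi P) e = is_edge P e.
Proof. by rewrite /is_edge nb_transport. Qed.

Lemma vtx_transport phi P i j : (j < nb_vertices P i)%N ->
  vtx (transport phi P) i j = tv phi (vtx P i j).
Proof. by move=> h; rewrite /vtx nth_transport (nth_map ((0, 0), 0)). Qed.

Lemma edges_transport phi w : edges (map (tv phi) w) = map (te phi) (edges w).
Proof.
rewrite /edges; case: w => [|v w] //=.
by elim: w v => [|u w IH] v //=; rewrite IH.
Qed.

Lemma sgnx_transport phi e f : oriented_affine phi ->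
  sgnx (te phi e) (te phi f) = sgnx e f.
Proof.
move=> /affine_orient[det d0 E]; rewrite /sgnx /ecross /proper /= !E pmulr_rgt0 //.
have M (x y : R) : (det * x * (det * y) < 0) = (x * y < 0).
  by rewrite mulrACA pmulr_rlt0 // mulr_gt0.
by rewrite !M.
Qed.

Lemma on_edge_transport phi P e z : oriented_affine phi -> is_edge P e ->
  on_edge (transport phi P) e (phi z) <-> on_edge P e z.
Proof.
move=> aff He; rewrite /on_edge /pos !vtx_transport ?(ltnW He) //.
exact: segment_affine.
Qed.

Lemma on_edge_transport_ex phi P e y : oriented_affine phi -> is_edge P e ->
  on_edge (transport phi P) e y -> exists2 z, phi z = y & on_edge P e z.
Proof.
move=> aff He on; have [z E] := affine_surj aff y; exists z => //.
by apply/(on_edge_transport z aff He); rewrite E.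
Qed.

(** The open edges of a picture lie in the interior of its disk. *)
Definition open_edges P : Prop := forall e t, is_edge P e -> 0 < t < 1 ->
  open_disk (lerp t (pos P e.1 e.2) (pos P e.1 e.2.+1)).

Section LocalPicture.
Variables (phi : point R -> point R) (C : context R) (P : diagram R).
Hypothesis aff : oriented_affine phi.
Hypothesis holesC : perm_eq (holes C) (iota 0 (size P)).
Hypothesis sizeP : forall k, (k < size P)%N -> (1 < nb_vertices P k)%N.
Hypothesis openP : open_edges P.
Let D := fill C (transport phi P).
Hypothesis gD : generic D.
Hypothesis lookD : looks_like phi D P.

Lemma holesC_transport : perm_eq (holes C) (iota 0 (size (transport phi P))).
Proof. by rewrite size_map. Qed.

Lemma size_transport k : (k < size (transport phi P))%N ->
  (1 < nb_vertices (transport phi P) k)%N.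
Proof. by rewrite size_map nb_transport; exact: sizeP. Qed.

Lemma outer_avoids_region i r z : has_letter C i r.+1 ->
  on_edge D (outer_edge C (transport phi P) i r) z -> ~ region phi z.
Proof.
apply: (outer_avoids holesC_transport size_transport _ _ gD).
  exact: region_open.
by move=> y [x xo <-] Dy; apply/(lookD xo).
Qed.

(** A crossing of an edge of the picture is inside the open disk, where the
    other edges do not enter. *)
Lemma local_separate (i : nat) k j f e :
    inr k \in codes (transport phi P) (nth [::] C i) ->
    inl f \in codes (transport phi P) (nth [::] C j) ->
    e \in edges (nth [::] (transport phi P) k) ->
  sgnx e f = 0.
Proof.
move=> _ /codes_outer[r [hr ->]].
rewrite edges_index => /mapP[c]; rewrite mem_iota add0n nb_transport => hc ->.
have He : is_edge P (k, c) by rewrite /is_edge /=; lia.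
apply/eqP; rewrite sgnx_eq0; apply/negP => cr.
have [v1 v2] := outer_vtx holesC_transport size_transport hr.
have [s1 u1 z1] := proper_meet cr.
move: z1 s1 u1; set s := meet_time _ _ _ _; set u := meet_time _ _ _ _.
rewrite /iedge /= !vtx_transport ?(ltnW He) // -[LHS](affine_lerp _ _ _ aff) => z1 s1 u1.
apply: (outer_avoids_region hr (z := phi (lerp s (vtx P k c).1 (vtx P k c.+1).1))).
  rewrite z1; exists u; first by lra.
  by rewrite /pos v1 v2.
by exists (lerp s (vtx P k c).1 (vtx P k c.+1).1) => //; exact: (openP He s1).
Qed.

Lemma edges_fill i :
  edges (nth [::] D i) = flatten (map (eblock (transport phi P))
    (codes (transport phi P) (nth [::] C i))).
Proof.
rewrite /D nth_fill /blocks edges_codes // => x xC.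
have /(nthP (inr 0%N))[r hr Er] := xC; rewrite -Er.
exact: (block_size holesC_transport size_transport hr).
Qed.

End LocalPicture.

Lemma codes_holes_facts (C : context R) n (X : diagram R)
    (W := fun i => codes X (nth [::] C i)) : perm_eq (holes C) (iota 0 n) ->
  [/\ forall i k, inr k \in W i -> (k < n)%N,
      forall i, uniq (pmap (fun u => if u is inr k then Some k else None) (W i)) &
      forall i j k, i <> j -> inr k \in W i -> inr k \notin W j].
Proof.
move=> pC.
have H i k : inr k \in W i -> exists r, hole_at C k i r.
  by rewrite /W codes_hole => /(nthP (inr 0%N))[r hr Er]; exists r.
split.
- by move=> i k /H[r hk]; apply/(holesP k pC); exists i, r.
- move=> i; rewrite codes_holes.
  have U : uniq (holes C) by rewrite (perm_uniq pC) iota_uniq.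
  have [hi|hi] := ltnP i (size C); last by rewrite nth_default.
  have E : flatten C = flatten (take i C) ++ nth [::] C i ++ flatten (drop i.+1 C).
    by rewrite -{1}(cat_take_drop i C) (drop_nth [::]) // flatten_cat.
  by move: U; rewrite /holes E !pmap_cat !cat_uniq => /and3P[_ _ /and3P[]].
- move=> i j k ij /H[r hk]; apply/negP => /H[r' hk'].
  by have [] := holes_unique pC hk hk'.
Qed.

End Affine.

(** * The moves and the crossing sums *)

Section ComputableSums.

Fixpoint fsum (T : Type) (h : T -> int) (s : seq T) : int :=
  if s is x :: s' then h x + fsum h s' else 0.

Lemma fsumE T (h : T -> int) s : \sum_(x <- s) h x = fsum h s.
Proof. by elim: s => [|x s IH]; rewrite ?big_nil // big_cons IH. Qed.

Fixpoint fosum (T : Type) (y : T -> T -> int) (s : seq T) : int :=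
  if s is x :: s' then fsum (y x) s' + fosum y s' else 0.

Lemma osumE T (y : T -> T -> int) s : osum y s = fosum y s.
Proof. by elim: s => //= x s ->; rewrite fsumE. Qed.

End ComputableSums.

Definition zsgn_if (over : bool) (e f : zedge) : int :=
  if (if over then f.1.2 < e.1.2 else e.1.2 < f.1.2) then zsgnx e f else 0.

Definition zpair_sum (y : zedge -> zedge -> int) (X : zdiagram) k l : int :=
  fsum (fun e => fsum (y e) (zedges (nth [::] X l))) (zedges (nth [::] X k)).

(** The sums over pairs of different arcs of the two sides of a move agree. *)
Definition zagree y (m : move) : bool :=
  let n := iota 0 (size (zsides m).1) in
  all (fun k => all (fun l =>
    (k == l) || (zpair_sum y (zsides m).1 k l == zpair_sum y (zsides m).2 k l)) n) n.

(** The sums over pairs of edges of one arc agree. *)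
Definition zself over (m : move) : bool :=
  all (fun k => fosum (zsgn_if over) (zedges (nth [::] (zsides m).1 k)) ==
                fosum (zsgn_if over) (zedges (nth [::] (zsides m).2 k)))
    (iota 0 (size (zsides m).1)).

Definition zclosed_in (N : Z) (p : zpoint) : bool :=
  [&& - N <= p.1, p.1 <= N, - N <= p.2 & p.2 <= N].

Definition zopen_in (N : Z) (p : zpoint) : bool :=
  [&& - N < p.1, p.1 < N, - N < p.2 & p.2 < N].

Definition zmiddle (a b : zpoint) : zpoint := (a.1 + b.1, a.2 + b.2).

Definition zopen_edge (N : Z) (e : zedge) : bool :=
  [&& zclosed_in N e.1.1, zclosed_in N e.2.1 &
      zopen_in (N + N) (zmiddle e.1.1 e.2.1)].

Definition v0z : zvertex := ((0%BZ, 0%BZ), 0).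

Definition zshape_ok (X X' : zdiagram) : bool :=
  [&& size X == size X',
      all (fun k => [&& (1 < size (nth [::] X k))%N, (1 < size (nth [::] X' k))%N,
        head v0z (nth [::] X k) == head v0z (nth [::] X' k) &
        last v0z (nth [::] X k) == last v0z (nth [::] X' k)]) (iota 0 (size X)) &
      all (all (zopen_edge 2) \o zedges) X && all (all (zopen_edge 2) \o zedges) X'].

Lemma zshape_okP m : zshape_ok (zsides m).1 (zsides m).2.
Proof. by case: m; vm_compute. Qed.

Section EmbeddedDiagrams.
Variable R : realType.

Lemma nth_embd N X k : nth [::] (embd R N X) k = map (embv R N) (nth [::] X k).
Proof.
have [h|h] := ltnP k (size X); first by rewrite (nth_map [::]).
by rewrite !nth_default ?size_map.
Qed.

Lemma nb_embd N X k : nb_vertices (embd R N X) k = size (nth [::] X k).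
Proof. by rewrite /nb_vertices nth_embd size_map. Qed.

Lemma vtx_embd N X i j : (j < size (nth [::] X i))%N ->
  vtx (embd R N X) i j = embv R N (nth v0z (nth [::] X i) j).
Proof. by move=> h; rewrite /vtx nth_embd (nth_map v0z). Qed.

Lemma edges_embd N X k : edges (nth [::] (embd R N X) k) =
  map (embe R N) (zedges (nth [::] X k)).
Proof. by rewrite nth_embd edges_emb. Qed.

Lemma lerp_open (a b : point R) (t : R) : disk a -> disk b ->
  `|a.1 + b.1| < 2 -> `|a.2 + b.2| < 2 -> 0 < t < 1 -> open_disk (lerp t a b).
Proof.
move=> [a1 a2] [b1 b2] m1 m2 /andP[t0 t1].
have E (x y : R) : `|x| <= 1 -> `|y| <= 1 -> `|x + y| < 2 ->
    `|(1 - t) * x + t * y| < 1.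
  rewrite !ler_norml !ltr_norml => /andP[x1 x2] /andP[y1 y2] /andP[z1 z2].
  have k1 : 0 <= (1 - t) * (1 - x) by apply: mulr_ge0; lra.
  have k2 : 0 <= (1 - t) * (1 + x) by apply: mulr_ge0; lra.
  have k3 : 0 <= t * (1 - y) by apply: mulr_ge0; lra.
  have k4 : 0 <= t * (1 + y) by apply: mulr_ge0; lra.
  apply/andP; split.
    have [x3|x3] := ltP (-1) x.
      by have : 0 < (1 - t) * (1 + x) by [apply: mulr_gt0; lra]; lra.
    by have : 0 < t * (1 + y) by [apply: mulr_gt0; lra]; lra.
  have [x3|x3] := ltP x 1.
    by have : 0 < (1 - t) * (1 - x) by [apply: mulr_gt0; lra]; lra.
  by have : 0 < t * (1 - y) by [apply: mulr_gt0; lra]; lra.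
by split; exact: E.
Qed.

Lemma zclosed_disk N p : 0 < N -> zclosed_in N p -> disk (emb R N p).
Proof.
move=> N0 /and4P[h1 h2 h3 h4].
have n0 : 0 < zr R N by rewrite zr_gt0.
have E x : - N <= x -> x <= N -> `|zr R x / zr R N| <= 1.
  move=> g1 g2; rewrite ler_norml ler_pdivrMr // ler_pdivlMr // mulN1r mul1r.
  by rewrite -zrN !zr_le g1.
by split; exact: E.
Qed.

Lemma zopen_disk N p : 0 < N -> zopen_in N p = `[< open_disk (emb R N p) >].
Proof.
move=> N0; have n0 : 0 < zr R N by rewrite zr_gt0.
have E x : `|zr R x / zr R N| < 1 = (- N < x) && (x < N).
  by rewrite ltr_norml ltr_pdivrMr // ltr_pdivlMr // mulN1r mul1r -zrN !zr_lt.
apply/idP/asboolP; rewrite /zopen_in /open_disk /= !E.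
  by move=> /and4P[-> -> -> ->].
by case=> /andP[-> ->] /andP[-> ->].
Qed.

Lemma zmiddle_lt N x y : 0 < N -> - (N + N) < x + y -> x + y < N + N ->
  `|zr R x / zr R N + zr R y / zr R N| < 2.
Proof.
move=> N0 h1 h2; have n0 : 0 < zr R N by rewrite zr_gt0.
rewrite -mulrDl ltr_norml ltr_pdivrMr // ltr_pdivlMr //.
have -> : 2 * zr R N = zr R (N + N) by rewrite zrD; ring.
have -> : - 2 * zr R N = zr R (- (N + N)) by rewrite zrN zrD; ring.
by rewrite -zrD !zr_lt h1.
Qed.

Lemma zopen_edge_lerp N e (t : R) : 0 < N -> zopen_edge N e -> 0 < t < 1 ->
  open_disk (lerp t (emb R N e.1.1) (emb R N e.2.1)).
Proof.
move=> N0 /and3P[h1 h2 /and4P[m1 m2 m3 m4]] tI.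
by apply: lerp_open tI; rewrite ?zmiddle_lt //; exact: zclosed_disk.
Qed.

Lemma zedge_nth (w : zarc) j : (j.+1 < size w)%N -> (nth v0z w j, nth v0z w j.+1) \in zedges w.
Proof.
move=> h; have hz : (j < size (zedges w))%N by rewrite size_zip size_behead; lia.
by move: (mem_nth (v0z, v0z) hz); rewrite /zedges nth_zip_cond hz nth_behead.
Qed.

Lemma zopen_edges N X : 0 < N -> all (all (zopen_edge N) \o zedges) X ->
  open_edges (embd R N X).
Proof.
move=> N0 /allP h [i j] t; rewrite /is_edge nb_embd /= => He tI.
have hi : (i < size X)%N by rewrite ltnNge; apply/negP => h'; rewrite nth_default in He.
rewrite /pos !vtx_embd ?(ltnW He) //=.
have /allP/(_ _ (zedge_nth He)) := h _ (mem_nth [::] hi).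
by move=> /(zopen_edge_lerp N0)/(_ tI).
Qed.

End EmbeddedDiagrams.

Lemma sides1 (R : realType) m : (sides R m).1 = embd R 2%BZ (zsides m).1.
Proof. by rewrite sides_emb. Qed.

Lemma sides2 (R : realType) m : (sides R m).2 = embd R 2%BZ (zsides m).2.
Proof. by rewrite sides_emb. Qed.

Section MoveInvariance.
Variable R : realType.
Implicit Types (D : diagram R) (m : move).

Lemma sides_size m : size (sides R m).1 = size (sides R m).2.
Proof.
by rewrite sides_emb /= !size_map; have /and3P[/eqP-> _ _] := zshape_okP m.
Qed.

Lemma sides_arcs m k : (k < size (sides R m).1)%N ->
  [/\ (1 < nb_vertices (sides R m).1 k)%N, (1 < nb_vertices (sides R m).2 k)%N,
      head ((0, 0), 0) (nth [::] (sides R m).1 k) =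
        head ((0, 0), 0) (nth [::] (sides R m).2 k) &
      last ((0, 0), 0) (nth [::] (sides R m).1 k) =
        last ((0, 0), 0) (nth [::] (sides R m).2 k)].
Proof.
rewrite sides_emb /= size_map => hk.
have /and3P[/eqP sE /allP/(_ k) h _] := zshape_okP m.
move: h; rewrite mem_iota add0n => /(_ hk)/and4P[h1 h2 /eqP h3 /eqP h4].
rewrite !nb_embd !nth_embd; split=> //.
  by move: h1 h2 h3; case: (nth _ _ _) => // a s _; case: (nth _ _ _) => //= b s' _ ->.
move: h1 h2 h4; case: (nth _ _ _) => // a s _; case: (nth _ _ _) => //= b s' _.
by rewrite !last_map => ->.
Qed.

Lemma sides_open m : open_edges (sides R m).1 /\ open_edges (sides R m).2.
Proof.
by rewrite sides_emb /=; have /and3P[_ _ /andP[h1 h2]] := zshape_okP m;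
   split; exact: zopen_edges.
Qed.

Lemma block_sum_sides phi y zy (X : zdiagram) k l :
    (forall e f, y (te phi (embe R 2%BZ e)) (te phi (embe R 2%BZ f)) = zy e f) ->
  block_sum y (transport phi (embd R 2%BZ X)) (inr k) (inr l) = zpair_sum zy X k l.
Proof.
move=> E; rewrite /block_sum /= !nth_transport !edges_transport !edges_embd !big_map.
rewrite /zpair_sum -fsumE; apply: eq_bigr => e _; rewrite -fsumE !big_map.
by apply: eq_bigr => f _; exact: E.
Qed.

Lemma hole_sums_sides m phi y zy :
    (forall e f, y (te phi (embe R 2%BZ e)) (te phi (embe R 2%BZ f)) = zy e f) ->
    zagree zy m ->
  hole_sums_agree (transport phi (sides R m).1) (transport phi (sides R m).2)
    (size (sides R m).1) y.
Proof.
move=> E; rewrite sides_emb /hole_sums_agree /= size_map => /allP h k l hk hl kl.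
rewrite !(block_sum_sides _ _ _ E).
have /allP/(_ l) := h k (ltac:(by rewrite mem_iota)).
by rewrite mem_iota => /(_ hl)/orP[/eqP//|/eqP].
Qed.

Lemma te_sgnx phi e f : oriented_affine phi ->
  sgnx (te phi (embe R 2%BZ e)) (te phi (embe R 2%BZ f)) = zsgnx e f.
Proof. by move=> aff; rewrite sgnx_transport // sgnx_emb. Qed.

Lemma te_sgn_if over phi e f : oriented_affine phi ->
  sgn_if over (te phi (embe R 2%BZ e)) (te phi (embe R 2%BZ f)) = zsgn_if over e f.
Proof. by move=> aff; rewrite /sgn_if te_sgnx. Qed.

(** A move changes a crossing sum as it changes this sum in the model disk. *)
Lemma apply_move_sums m D D' : generic D -> generic D' -> apply_move m D D' ->
  [/\ zagree (fun e f => `|zsgnx e f|) m -> mutual D = mutual D',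
      forall over, zagree (zsgn_if over) m -> zself over m ->
        self_sum over D = self_sum over D' &
      zagree zsgnx m -> (size (sides R m).1 <= 2)%N -> ordered D = ordered D'].
Proof.
move=> gD gD' [phi [C [aff _ pC [DE D'E] [look look']]]].
set P := (sides R m).1 in pC DE look *; set P' := (sides R m).2 in D'E look'.
have pC' : perm_eq (holes C) (iota 0 (size P')) by rewrite -sides_size.
have sP k : (k < size P)%N -> (1 < nb_vertices P k)%N by case/sides_arcs.
have sP' k : (k < size P')%N -> (1 < nb_vertices P' k)%N.
  by rewrite -sides_size => /sides_arcs[].
have [oP oP'] := sides_open m.
rewrite {}DE in gD look *; rewrite {}D'E in gD' look' *.
have EP := edges_fill phi pC sP; have EP' := edges_fill phi pC' sP'.
pose W i := codes (transport phi P) (nth [::] C i).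
have [Wlt Wuniq Wdisj] := codes_holes_facts (transport phi P) pC.
have WE i : codes (transport phi P') (nth [::] C i) = W i.
  apply/esym/codes_eq => -[v|k] //= kC.
  have hk : (k < size P)%N by apply: (Wlt i); rewrite codes_hole.
  rewrite !nth_transport; have [h1 h2 h3 h4] := sides_arcs hk.
  move: h1 h2 h3 h4; rewrite /nb_vertices -/P -/P'.
  case: (nth [::] P k) => // a s _; case: (nth [::] P' k) => //= b s' _ -> h4.
  by rewrite !last_map h4.
have sep : separate (transport phi P) (transport phi P') W (@sgnx R).
  move=> i j k f hi hj e he; suff E : sgnx e f = 0 by rewrite (sgnxC e f) E oppr0.
  case: he => he; first exact: (local_separate aff pC sP oP gD look hi hj he).
  rewrite -!WE in hi hj; exact: (local_separate aff pC' sP' oP' gD' look' hi hj he).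
have sep_of y : (forall e f, sgnx e f = 0 -> y e f = 0) ->
    separate (transport phi P) (transport phi P') W y.
  move=> h i j k f hi hj e he; have [h1 h2] := sep _ _ _ _ hi hj _ he.
  by split; exact: h.
split.
- move=> ag; rewrite /mutual /pair_sum !EP !EP' !WE.
  apply: (replace_sum Wlt Wdisj) => //; first by apply: sep_of => e f ->; rewrite normr0.
  by apply: hole_sums_sides ag => e f; rewrite te_sgnx.
- move=> over ag sf; rewrite /self_sum !EP !EP' !WE.
  apply: (replace_osum Wlt Wuniq).
  + by apply: sep_of => e f; rewrite /sgn_if => ->; rewrite !if_same.
  + by apply: hole_sums_sides ag => e f; exact: te_sgn_if.
  + move=> k hk; rewrite !nth_transport !edges_transport !osum_map.
    move: hk; rewrite /P /P' sides_emb /= size_map => hk.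
    rewrite !edges_embd !osum_map; have /allP/(_ k) := sf.
    rewrite mem_iota => /(_ hk)/eqP; rewrite -!osumE => E.
    have O X : osum (fun u v => sgn_if over (te phi (embe R 2%BZ u)) (te phi (embe R 2%BZ v))) X
        = osum (zsgn_if over) X.
      by apply: eq_osum => e f _ _; exact: te_sgn_if.
    by rewrite !O.
- move=> ag n2; rewrite /ordered !EP !EP' !WE.
  apply: (replace_ordered Wlt Wuniq Wdisj n2 sep).
  by apply: hole_sums_sides ag => e f; rewrite te_sgnx.
Qed.

Definition invariant_under (S : set move) (T : Type) (I : diagram R -> T) : Prop :=
  forall D D', step S D D' -> I D = I D'.

Lemma not_generating (S : set move) (T : Type) (I : diagram R -> T) m :
  invariant_under S I -> I (sides R m).1 <> I (sides R m).2 -> ~ generating_set R S.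
Proof.
move=> inv ne /(_ m) gen; apply: ne.
by elim: gen => [D D' /inv||D D' _ ->|D D' D'' _ -> _ ->].
Qed.

Lemma mutual_invariant (S : set move) :
    (forall m, S m -> zagree (fun e f => `|zsgnx e f|) m) ->
  invariant_under S (@mutual R).
Proof.
move=> h D D' [[gD _ _] [gD' _ _] [/isotopy_same_crossings/mutual_same//||]].
  by move=> /(subdivision_sums gD')[].
by move=> [m Sm /(apply_move_sums gD gD')[E _ _]]; exact: E (h m Sm).
Qed.

Lemma self_sum_invariant over (S : set move) :
    (forall m, S m -> zagree (zsgn_if over) m && zself over m) ->
  invariant_under S (@self_sum R over).
Proof.
move=> h D D' [[gD _ _] [gD' _ _] [/isotopy_same_crossings/self_sum_same//||]].
  by move=> /(subdivision_sums gD')[].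
move=> [m Sm /(apply_move_sums gD gD')[_ E _]].
by have /andP[] := h m Sm; exact: E.
Qed.

Lemma ordered_invariant (S : set move) :
    (forall m, S m -> zagree zsgnx m && (size (zsides m).1 <= 2)%N) ->
  invariant_under S (@ordered R).
Proof.
move=> h D D' [[gD _ _] [gD' _ _] [/isotopy_same_crossings/ordered_same//||]].
  by move=> /(subdivision_sums gD')[].
move=> [m Sm /(apply_move_sums gD gD')[_ _ E]].
by have /andP[] := h m Sm; move=> ? ?; apply: E; rewrite // sides_emb size_map.
Qed.

Lemma mutual_sides (X : zdiagram) : mutual (embd R 2%BZ X) =
  zpair_sum (fun e f => `|zsgnx e f|) X 0 1.
Proof.
rewrite /mutual /pair_sum !edges_embd !big_map /zpair_sum -fsumE.
apply: eq_bigr => e _; rewrite -fsumE big_map; apply: eq_bigr => f _.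
by rewrite sgnx_emb.
Qed.

Lemma self_sum_sides over (X : zdiagram) : self_sum over (embd R 2%BZ X) =
  fosum (zsgn_if over) (zedges (nth [::] X 0)).
Proof.
rewrite /self_sum edges_embd osum_map -osumE; apply: eq_osum => e f _ _.
by rewrite /sgn_if sgnx_emb.
Qed.

Lemma ordered_sides (X : zdiagram) :
    all (fun e => all (fun f => all (fun g => zsgnx e f * zsgnx e g == 0)
      (zedges (nth [::] X 2))) (zedges (nth [::] X 1))) (zedges (nth [::] X 0)) ->
  ordered (embd R 2%BZ X) =
  fosum (fun e e' => fsum (zsgnx e) (zedges (nth [::] X 1)) *
                     fsum (zsgnx e') (zedges (nth [::] X 2))) (zedges (nth [::] X 0)).
Proof.
move=> /allP h; rewrite /ordered !edges_embd osum_map [X in _ + X]big_map.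
rewrite [X in _ + X]big1_seq => [|e /andP[_ he]].
  rewrite addr0 -osumE; apply: eq_osum => e e' _ _; rewrite !big_map -!fsumE.
  by congr (_ * _); apply: eq_bigr => f _; rewrite sgnx_emb.
rewrite big_map big1_seq // => f /andP[_ hf]; rewrite big_map big1_seq // => g /andP[_ hg].
rewrite /ordered_at !sgnx_emb //.
by have /allP/(_ f hf)/allP/(_ g hg)/eqP-> := h e he; rewrite if_same.
Qed.

End MoveInvariance.

(** * Minimality *)

Section Minimality.
Variable R : realType.

Definition move_eqb (m m' : move) : bool :=
  match m, m' with
  | R1a, R1a | R1b, R1b | R1c, R1c | R1d, R1d | R2a, R2a | R2b, R2b
  | R2c, R2c | R2d, R2d | R3a, R3a | R3b, R3b | R3c, R3c | R3d, R3d
  | R3e, R3e | R3f, R3f | R3g, R3g | R3h, R3h => true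
  | _, _ => false
  end.

Lemma move_eqP : Equality.axiom move_eqb.
Proof. by case; case; constructor. Qed.
HB.instance Definition _ := hasDecEq.Build move move_eqP.

Lemma no_type3 (S : set move) (m : move) : m \in [:: R3a; R3h] ->
  (forall m', S m' -> m' \in [:: R1a; R1b; R1c; R1d; R2a; R2b]) -> ~ generating_set R S.
Proof.
move=> mE h; apply: (@not_generating _ _ _ (@ordered R) m).
  by apply: ordered_invariant => m' /h; rewrite !inE; do ! case/orP; move=> /eqP->; vm_compute.
by move: mE; rewrite !inE sides1 sides2 => /orP[] /eqP->; rewrite !ordered_sides.
Qed.

Lemma no_type2 (S : set move) :
  (forall m', S m' -> m' \in [:: R1a; R1b; R1c; R1d; R3a; R3h]) -> ~ generating_set R S.
Proof.
move=> h; apply: (@not_generating _ _ _ (@mutual R) R2a).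
  by apply: mutual_invariant => m' /h; rewrite !inE; do ! case/orP; move=> /eqP->; vm_compute.
by rewrite sides1 sides2 !mutual_sides.
Qed.

Lemma no_over_first (S : set move) :
  (forall m', S m' -> m' \in [:: R1b; R1c; R2a; R2b; R3a; R3h]) -> ~ generating_set R S.
Proof.
move=> h; apply: (@not_generating _ _ _ (@self_sum R true) R1a).
  by apply: self_sum_invariant => m' /h; rewrite !inE; do ! case/orP; move=> /eqP->; vm_compute.
by rewrite sides1 sides2 !self_sum_sides.
Qed.

Lemma no_under_first (S : set move) :
  (forall m', S m' -> m' \in [:: R1a; R1d; R2a; R2b; R3a; R3h]) -> ~ generating_set R S.
Proof.
move=> h; apply: (@not_generating _ _ _ (@self_sum R false) R1b).
  by apply: self_sum_invariant => m' /h; rewrite !inE; do ! case/orP; move=> /eqP->; vm_compute.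
by rewrite sides1 sides2 !self_sum_sides.
Qed.

End Minimality.

(** * Replacing a local picture by another tangle with the same ends *)

Section Glue.
Variable R : realType.
Implicit Types (P Q : diagram R) (z : point R).

Definition same_ends P Q : Prop := size Q = size P /\
  forall k, (k < size P)%N -> pos Q k 0 = pos P k 0 /\ last_pos Q k = last_pos P k.

Lemma tangle_size P k : tangle P -> (k < size P)%N -> (1 < nb_vertices P k)%N.
Proof. by case=> gP _ _; exact: generic_size. Qed.

Lemma is_edge_size P e : is_edge P e -> (e.1 < size P)%N.
Proof.
move=> He; rewrite ltnNge; apply/negP => h.
by move: He; rewrite /is_edge /nb_vertices nth_default.
Qed.

(** The image of the open disk is open, so it cannot touch the boundary of a
    disk that contains it. *)
Lemma region_in_open phi : oriented_affine phi -> (forall z, disk z -> disk (phi z)) ->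
  forall z, region phi z -> open_disk z.
Proof.
move=> aff dd z rz; have [eps /andP[e0 e1] h] := region_open aff (2 * z.1, 2 * z.2) rz.
have [|y [y1 y2] Ey] := h eps; first by rewrite lexx ltW.
have [] : disk (lerp eps z (2 * z.1, 2 * z.2)).
  by rewrite -Ey; apply: dd; split; exact: ltW.
rewrite /lerp /=.
have E (x : R) : (1 - eps) * x + eps * (2 * x) = (1 + eps) * x by ring.
have lt1 (x : R) : `|(1 + eps) * x| <= 1 -> `|x| < 1.
  have p0 : 0 < 1 + eps by rewrite addr_gt0.
  rewrite normrM (gtr0_norm p0) mulrC -ler_pdivlMr // => /le_lt_trans; apply.
  by rewrite ltr_pdivrMr // mul1r ltrDl.
by rewrite !E => /lt1 k1 /lt1 k2.
Qed.

End Glue.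

Section Glue.
Variable R : realType.
Implicit Types (P Q : diagram R) (z : point R).

(** An assembled diagram shows the local picture as soon as the other edges
    stay away from it. *)
Lemma looks_fill phi C P : oriented_affine phi -> perm_eq (holes C) (iota 0 (size P)) ->
    (forall k, (k < size P)%N -> (1 < nb_vertices P k)%N) ->
    (forall i r z, has_letter C i r.+1 ->
      on_edge (fill C (transport phi P)) (outer_edge C (transport phi P) i r) z -> ~ region phi z) ->
  looks_like phi (fill C (transport phi P)) P.
Proof.
move=> aff hC sP out z oz.
have hT : perm_eq (holes C) (iota 0 (size (transport phi P))) by rewrite size_map.
have sT k : (k < size (transport phi P))%N -> (1 < nb_vertices (transport phi P) k)%N.
  by rewrite size_map nb_transport; exact: sP.
split=> [[e He on]|[[k c] He on]].
  have [[k [r [c [hk hc Ee]]]]|[r [hr Ee]]] := (fill_edgeP hT sT e).1 He.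
    by exists (k, c); rewrite // Ee (inner_on hk) in on.
  by rewrite Ee in on; case: (out _ _ _ hr on); exists z.
have [i [r hk]] := (holesP k hT).1 (is_edge_size He).
exists (inner_edge C (transport phi P) i r c); last by rewrite (inner_on hk).
by apply/(fill_edgeP hT sT); left; exists k, r, c.
Qed.

Section Base.
Variables (phi : point R -> point R) (C : context R) (P : diagram R).
Hypothesis aff : oriented_affine phi.
Hypothesis disk_phi : forall z, disk z -> disk (phi z).
Hypothesis holesC : perm_eq (holes C) (iota 0 (size P)).
Hypothesis tP : tangle P.
Local Notation glue X := (fill C (transport phi X)).
Hypothesis tD : tangle (glue P).
Hypothesis lookP : looks_like phi (glue P) P.

(** The edges that leave the local picture do not cross other edges. The level
    of such an edge is stored in the last vertex of an arc of the picture, and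
    may change with the picture. *)
Hypothesis exits_free : forall k i r i' r', hole_at C k i r ->
  has_letter C i r.+1 -> has_letter C i' r'.+1 ->
  crosses (glue P) (outer_edge C (transport phi P) i r)
                   (outer_edge C (transport phi P) i' r') = false.

Let gD := tangle_generic tD.

Section Other.
Variable Q : diagram R.
Hypothesis tQ : tangle Q.
Hypothesis eQ : same_ends P Q.

Let gQ := tangle_generic tQ.
Local Notation tr X := (transport phi X).

Let hP : perm_eq (holes C) (iota 0 (size (tr P))). Proof. by rewrite size_map. Qed.
Let hQ : perm_eq (holes C) (iota 0 (size (tr Q))). Proof. by rewrite size_map eQ.1. Qed.
Let sP k : (k < size (tr P))%N -> (1 < nb_vertices (tr P) k)%N.
Proof. by rewrite size_map nb_transport; exact: tangle_size. Qed.
Let sQ k : (k < size (tr Q))%N -> (1 < nb_vertices (tr Q) k)%N.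
Proof. by rewrite size_map nb_transport; exact: tangle_size. Qed.

Let hole_lt k i r : hole_at C k i r -> (k < size P)%N.
Proof. by move=> h; apply/(holesP k holesC); exists i, r. Qed.

Let nbP k : (k < size P)%N -> (1 < nb_vertices P k)%N. Proof. exact: tangle_size. Qed.
Let nbQ k : (k < size P)%N -> (1 < nb_vertices Q k)%N.
Proof. by move=> h; apply: tangle_size => //; rewrite eQ.1. Qed.

Lemma block_last_pos i r : has_letter C i r ->
  (block_last C (tr Q) i r).1 = (block_last C (tr P) i r).1.
Proof.
move=> hr; rewrite /block_last; case L : (letter C i r) => [v|k] //=.
have hk : (k < size P)%N by exact: (@hole_lt k i r).
have [_ E] := eQ.2 k hk.
have F (X : diagram R) : (1 < nb_vertices X k)%N ->
    (last ((0, 0), 0) (nth [::] (tr X) k)).1 = phi (last_pos X k).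
  move=> n1; rewrite -nth_last -[nth _ _ _]/(vtx (tr X) k _) nth_transport size_map.
  by rewrite vtx_transport // prednK // ltnW.
by rewrite !F ?nbP ?nbQ // E.
Qed.

Lemma block_head_pos i r : has_letter C i r ->
  (block_head C (tr Q) i r).1 = (block_head C (tr P) i r).1.
Proof.
move=> hr; rewrite /block_head; case L : (letter C i r) => [v|k] //=.
have hk : (k < size P)%N by exact: (@hole_lt k i r).
have [E _] := eQ.2 k hk.
have F (X : diagram R) : (1 < nb_vertices X k)%N ->
    (head ((0, 0), 0) (nth [::] (tr X) k)).1 = phi (pos X k 0).
  by move=> n1; rewrite -nth0 -[nth _ _ _]/(vtx (tr X) k _) vtx_transport // ltnW.
by rewrite !F ?nbP ?nbQ // E.
Qed.

Local Notation outP i r := (outer_edge C (tr P) i r).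
Local Notation outQ i r := (outer_edge C (tr Q) i r).
Local Notation innQ i r c := (inner_edge C (tr Q) i r c).

Lemma outer_pos i r : has_letter C i r.+1 ->
  pos (glue Q) i (outQ i r).2 = pos (glue P) i (outP i r).2 /\
  pos (glue Q) i (outQ i r).2.+1 = pos (glue P) i (outP i r).2.+1.
Proof.
move=> hr; have hr' : has_letter C i r by exact: ltnW hr.
have [p1 p2] := outer_vtx hP sP hr; have [q1 q2] := outer_vtx hQ sQ hr.
by rewrite /pos p1 p2 q1 q2 block_last_pos // block_head_pos.
Qed.

Lemma outer_on i r : has_letter C i r.+1 ->
  on_edge (glue Q) (outQ i r) = on_edge (glue P) (outP i r).
Proof. by move=> hr; have [E1 E2] := outer_pos hr; rewrite /on_edge E1 E2. Qed.

Lemma outer_edge_P i r : has_letter C i r.+1 -> is_edge (glue P) (outP i r).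
Proof. by move=> hr; apply/(fill_edgeP hP sP); right; exists r. Qed.

Lemma outer_edge_Q i r : has_letter C i r.+1 -> is_edge (glue Q) (outQ i r).
Proof. by move=> hr; apply/(fill_edgeP hQ sQ); right; exists r. Qed.

Lemma inner_edge_Q k i r c : hole_at C k i r -> is_edge Q (k, c) -> is_edge (glue Q) (innQ i r c).
Proof.
by move=> hk hc; apply/(fill_edgeP hQ sQ); left; exists k, r, c; rewrite is_edge_transport.
Qed.

Lemma outer_not_region i r z : has_letter C i r.+1 -> on_edge (glue Q) (outQ i r) z ->
  ~ region phi z.
Proof.
move=> hr; rewrite outer_on //.
by apply: (outer_avoids_region aff holesC nbP gD lookP hr).
Qed.

Lemma inner_on_Q k i r c z : hole_at C k i r -> is_edge Q (k, c) ->
  on_edge (glue Q) (innQ i r c) z -> exists2 y, phi y = z & on_edge Q (k, c) y.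
Proof.
move=> hk hc; rewrite (inner_on hk) ?is_edge_transport //.
exact: on_edge_transport_ex.
Qed.

Lemma inner_vtx_Q k i r c : hole_at C k i r -> (c < nb_vertices Q k)%N ->
  pos (glue Q) i (vindex C (tr Q) i r c) = phi (pos Q k c).
Proof.
move=> hk hc; rewrite /pos (inner_pos hk) ?nb_transport //.
by rewrite vtx_transport.
Qed.

Lemma inner_vtx_P k i r c : hole_at C k i r -> (c < nb_vertices P k)%N ->
  pos (glue P) i (vindex C (tr P) i r c) = phi (pos P k c).
Proof.
move=> hk hc; rewrite /pos (inner_pos hk) ?nb_transport //.
by rewrite vtx_transport.
Qed.

Let edge_cases e : is_edge (glue Q) e ->
  (exists k r c, [/\ hole_at C k e.1 r, is_edge Q (k, c) & e = innQ e.1 r c]) \/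
  (exists r, has_letter C e.1 r.+1 /\ e = outQ e.1 r).
Proof.
move=> /(fill_edgeP hQ sQ)[[k [r [c [h1 h2 h3]]]]|]; last by right.
by left; exists k, r, c; rewrite is_edge_transport in h2.
Qed.

(** A point of an inner edge outside the region is an end of the arc. *)
Lemma inner_outside k i r c z : hole_at C k i r -> is_edge Q (k, c) ->
    on_edge (glue Q) (innQ i r c) z -> ~ region phi z ->
  (z = phi (pos Q k 0) /\ z = phi (pos P k 0)) \/
  (z = phi (last_pos Q k) /\ z = phi (last_pos P k)).
Proof.
move=> hk hc on nr; have [y yz ony] := inner_on_Q hk hc on.
have no : ~ open_disk y by move=> oy; apply: nr; exists y.
have [E1 E2] := eQ.2 k (hole_lt hk).
by case: ((tangle_ends tQ hc ony).1 no) => /= E; [left | right]; rewrite -yz E ?E1 ?E2.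
Qed.

Let vertex_cases i j : (j < nb_vertices (glue Q) i)%N ->
  (exists k r c, [/\ hole_at C k i r, (c < nb_vertices Q k)%N & j = vindex C (tr Q) i r c]) \/
  (exists r v, [/\ has_letter C i r, letter C i r = inl v & j = vindex C (tr Q) i r 0]).
Proof.
move=> /(fill_index)[r [c [hr hc ->]]].
move: hc; case L : (letter C i r) => [v|k] /= hc.
  right; exists r, v; split=> //; by move: hc; rewrite ltnS leqn0 => /eqP->.
by left; exists k, r, c; rewrite -(nb_transport phi).
Qed.

Lemma letter_pos (X : diagram R) i r v : perm_eq (holes C) (iota 0 (size X)) ->
    (forall k, (k < size X)%N -> (1 < nb_vertices X k)%N) ->
    has_letter C i r -> letter C i r = inl v ->
  (vindex C X i r 0 < nb_vertices (fill C X) i)%N /\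
  pos (fill C X) i (vindex C X i r 0) = v.1.
Proof.
move=> hX sX hr L; have h0 : (0 < size (block X (letter C i r)))%N by rewrite L.
by have [h1 h2] := fill_vertex hr h0; split=> //; rewrite /pos h2 L.
Qed.

Let on_some_edge (D : diagram R) i j : generic D -> (j < nb_vertices D i)%N ->
  trace D (pos D i j).
Proof.
move=> g hj; have sz : (1 < nb_vertices D i)%N.
  by apply: (generic_size g); rewrite ltnNge; apply/negP => h;
     move: hj; rewrite /nb_vertices nth_default.
case: j hj => [|j] hj.
  by exists (i, 0%N) => //; exact: segment_l.
by exists (i, j) => //; exact: segment_r.
Qed.

(* An isolated vertex of the context stays off the local picture. *)
Let outer_vertex_off i r v k i' r' c : has_letter C i r -> letter C i r = inl v ->
  hole_at C k i' r' -> is_edge Q (k, c) -> ~ on_edge (glue Q) (innQ i' r' c) v.1.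
Proof.
move=> hr L hk hc on.
have [h1 h2] := letter_pos hP sP hr L.
have [rg|nrg] := pselect (region phi v.1).
  have := on_some_edge gD h1; rewrite h2 => tv1; have [y oy yv] := rg.
  have : trace (transport phi P) (phi y) by apply/(lookP oy); rewrite yv.
  rewrite yv => -[[k2 c2] He2 on2].
  have [i2 [r2 hk2]] := (holesP k2 hP).1 (is_edge_size He2).
  rewrite -(inner_on hk2 He2) -h2 in on2.
  have Hin : is_edge (glue P) (inner_edge C (tr P) i2 r2 c2).
    by apply/(fill_edgeP hP sP); left; exists k2, r2, c2.
  have [/= Ei Ej] := generic_vertices gD h1 Hin on2; subst i2.
  have hc2 : (c2.+1 < size (block (tr P) (letter C i r2)))%N by rewrite hk2.2.
  have h0 : (0 < size (block (tr P) (letter C i r)))%N by rewrite L.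
  have Er : r2 = r.
    case: Ej; first by case/(vindex_inj hk2.1 (ltnW hc2) hr h0).
    by rewrite -vindexS => /(vindex_inj hk2.1 hc2 hr h0)[].
  by move: hk2.2; rewrite Er L.
have [n1 n2] : (0 < nb_vertices P k)%N /\ ((nb_vertices P k).-1 < nb_vertices P k)%N.
  by have := nbP (hole_lt hk); lia.
have other c' : (c' < nb_vertices P k)%N -> v.1 <> phi (pos P k c').
  move=> hc'; rewrite -(inner_vtx_P hk hc') -h2 => E.
  have hv : (vindex C (tr P) i' r' c' < nb_vertices (glue P) i')%N.
    by apply: (fill_vertex hk.1 _).1; rewrite hk.2 /= -/(nb_vertices _ _) nb_transport.
  have [Ei Ej] := pos_inj gD h1 hv E; subst i'.
  have := vindex_inj hr _ hk.1 _ Ej; rewrite L hk.2 /= -/(nb_vertices _ _) nb_transport.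
  by case=> // Er _; move: hk.2; rewrite -Er L.
by case: (inner_outside hk hc on nrg) => -[_]; apply: other.
Qed.

(** The arcs of the new picture have the same ends as those of the old one, and
    its other vertices are in the region, which the other edges avoid. *)
Lemma glue_vertices i j e : (j < nb_vertices (glue Q) i)%N -> is_edge (glue Q) e ->
  on_edge (glue Q) e (pos (glue Q) i j) -> e.1 = i /\ (e.2 = j \/ e.2.+1 = j).
Proof.
case: e => e1 e2; move=> hj He on.
have [[k [r [c [hk hc Ej]]]]|[r [v [hr L Ej]]]] := vertex_cases hj;
  have [[k' [r' [c' [hk' hc' Ee]]]]|[r' [hr' Ee]]] := edge_cases He.
- rewrite Ej (inner_vtx_Q hk hc) [(e1, e2)]Ee in on.
  have [y /(affine_inj aff) Ey ony] := inner_on_Q hk' hc' on; rewrite Ey in ony.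
  have [/= Ek Ec] := generic_vertices gQ hc hc' ony; rewrite Ek in hk'.
  have [Ei Er] := holes_unique holesC hk' hk.
  case: Ee => ->; rewrite /= Ej Ei Er -vindexS; split=> //.
  by case: Ec => ->; [left|right].
- rewrite Ej (inner_vtx_Q hk hc) [(e1, e2)]Ee in on.
  have nrg := outer_not_region hr' on.
  have hkl := hole_lt hk; have nP := nbP hkl; have nQ := nbQ hkl.
  have no : ~ open_disk (pos Q k c) by move=> o; apply: nrg; exists (pos Q k c).
  have ontr := on_some_edge gQ hc; have [[k2 c2] Hc2 on2] := ontr.
  have [/= Ek2 _] := generic_vertices gQ hc Hc2 on2; rewrite Ek2 in Hc2 on2.
  have n0Q : (0 < nb_vertices Q k)%N by lia.
  have nlQ : ((nb_vertices Q k).-1 < nb_vertices Q k)%N by lia.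
  have n0P : (0 < nb_vertices P k)%N by lia.
  have nlP : ((nb_vertices P k).-1 < nb_vertices P k)%N by lia.
  have Bsz (X : diagram R) : size (block (tr X) (letter C i r)) = nb_vertices X k.
    by rewrite hk.2 /= -/(nb_vertices _ _) nb_transport.
  have [E0 E1] := eQ.2 k hkl.
  have HoP := outer_edge_P hr'.
  have hr0 : has_letter C e1 r' by exact: ltnW hr'.
  have b0 := block_size hP sP hr0; have b0' := block_size hP sP hr'.
  rewrite outer_on // in on.
  case: ((tangle_ends tQ Hc2 on2).1 no) => /= E.
    have [Ec] := pos_inj gQ hc n0Q E; rewrite E E0 -(inner_vtx_P hk n0P) in on.
    have l0 : (0 < size (block (tr P) (letter C i r)))%N by rewrite Bsz.
    have hv : (vindex C (tr P) i r 0 < nb_vertices (glue P) i)%N.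
      by apply: (fill_vertex hk.1 _).1; rewrite Bsz.
    have [/= Ei Er] := generic_vertices gD hv HoP on; split=> //; right.
    rewrite Ei in hr' hr0 b0 b0' Er Ee; case: Ee => E2.
    have bp : ((size (block (tr P) (letter C i r'))).-1 < size (block (tr P) (letter C i r')))%N
      by rewrite prednK.
    case: Er => Er.
      have [Er' Ez] := vindex_inj hr0 bp hk.1 l0 Er.
      by move: Ez; rewrite Er' Bsz; lia.
    rewrite -(vindex_next hP sP hr0) in Er.
    have [Er' _] := vindex_inj hr' b0' hk.1 l0 Er.
    by rewrite /= E2 -(vindex_next hQ sQ hr0) Er' Ej Ec.
  have [Ec] := pos_inj gQ hc nlQ E; rewrite E E1 -(inner_vtx_P hk nlP) in on.
  have ltl : ((nb_vertices P k).-1 < size (block (tr P) (letter C i r)))%N by rewrite Bsz.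
  have hv : (vindex C (tr P) i r (nb_vertices P k).-1 < nb_vertices (glue P) i)%N.
    by apply: (fill_vertex hk.1 _).1; rewrite Bsz.
  have [/= Ei Er] := generic_vertices gD hv HoP on; split=> //; left.
  rewrite Ei in hr' hr0 b0 b0' Er Ee; case: Ee => E2.
    have bp : ((size (block (tr P) (letter C i r'))).-1 < size (block (tr P) (letter C i r')))%N
      by rewrite prednK.
  case: Er => Er.
    have [Er' _] := vindex_inj hr0 bp hk.1 ltl Er.
    by rewrite E2 Er' Bsz Ej Ec.
  rewrite -(vindex_next hP sP hr0) in Er.
  have [_ Ez] := vindex_inj hr' b0' hk.1 ltl Er.
  by move: Ez; lia.
- exfalso; rewrite Ej Ee (letter_pos hQ sQ hr L).2 in on.
  exact: (outer_vertex_off hr L hk' hc').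
- rewrite Ej {1}Ee (letter_pos hQ sQ hr L).2 outer_on // in on.
  have [hv Ev] := letter_pos hP sP hr L; rewrite -Ev in on.
  have HoP := outer_edge_P hr'.
  have hr0 : has_letter C e1 r' by exact: ltnW hr'.
  have b0 := block_size hP sP hr0; have b0' := block_size hP sP hr'.
  have [/= Ei Er] := generic_vertices gD hv HoP on; split=> //.
  rewrite Ei in hr' hr0 b0 b0' Er Ee; case: Ee => E2.
    have bp : ((size (block (tr P) (letter C i r'))).-1 < size (block (tr P) (letter C i r')))%N
      by rewrite prednK.
  have l1 : (0 < size (block (tr P) (letter C i r)))%N by rewrite L.
  case: Er => Er.
    have [Er' _] := vindex_inj hr0 bp hr l1 Er.
    by left; rewrite E2 Er' L Ej.
  rewrite -(vindex_next hP sP hr0) in Er.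
  have [Er' _] := vindex_inj hr' b0' hr l1 Er.
  by right; rewrite E2 -(vindex_next hQ sQ hr0) Er' Ej.
Qed.

Lemma glue_edges e : is_edge (glue Q) e -> pos (glue Q) e.1 e.2 <> pos (glue Q) e.1 e.2.+1.
Proof.
move=> He; have [[k [r [c [hk hc Ee]]]]|[r [hr Ee]]] := edge_cases He.
  have hc0 : (c < nb_vertices Q k)%N by exact: ltnW hc.
  have -> : e.2 = vindex C (tr Q) e.1 r c by rewrite {1}Ee.
  have hc1 : (c.+1 < nb_vertices Q k)%N by exact: hc.
  rewrite -vindexS (inner_vtx_Q hk hc0) (inner_vtx_Q hk hc1) => /(affine_inj aff).
  exact: (generic_edges gQ hc).
have -> : e.2 = (outQ e.1 r).2 by rewrite {1}Ee.
have [-> ->] := outer_pos hr.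
exact: (generic_edges gD (outer_edge_P hr)).
Qed.

Lemma glue_size i : (i < size (glue Q))%N -> (1 < nb_vertices (glue Q) i)%N.
Proof.
rewrite size_map -(size_map (fun w => flatten (map (block (tr P)) w)) C) => hi.
have He : is_edge (glue P) (i, 0%N) by exact: (generic_size gD hi).
have [[k [r [c [hk _ _]]]]|[r [hr _]]] := (fill_edgeP hP sP (i, 0%N)).1 He.
  have hc : is_edge Q (k, 0%N) by exact: nbQ (hole_lt hk).
  by have := inner_edge_Q hk hc; rewrite /is_edge /=; lia.
by have := outer_edge_Q hr; rewrite /is_edge /=; lia.
Qed.

(** Two edges through a vertex are consecutive. *)
Let vertex_adjacent e f i j z : is_edge (glue Q) e -> is_edge (glue Q) f ->
  (j < nb_vertices (glue Q) i)%N -> z = pos (glue Q) i j ->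
  on_edge (glue Q) e z -> on_edge (glue Q) f z -> adjacent e f.
Proof.
move=> He Hf hj -> /(glue_vertices hj He)[e1 e2] /(glue_vertices hj Hf)[f1 f2].
by rewrite /adjacent e1 f1 eqxx /=; apply/andP; lia.
Qed.

Let end_vertex k i r c z : hole_at C k i r -> is_edge Q (k, c) ->
    on_edge (glue Q) (innQ i r c) z -> ~ region phi z ->
  exists2 j, (j < nb_vertices (glue Q) i)%N & z = pos (glue Q) i j.
Proof.
move=> hk hc on nr; have n1 := nbQ (hole_lt hk).
have vt c' : (c' < nb_vertices Q k)%N -> z = phi (pos Q k c') ->
    exists2 j, (j < nb_vertices (glue Q) i)%N & z = pos (glue Q) i j.
  move=> hc' ->; exists (vindex C (tr Q) i r c'); last by rewrite (inner_vtx_Q hk hc').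
  by apply: (fill_vertex hk.1 _).1; rewrite hk.2 /= -/(nb_vertices _ _) nb_transport.
by case: (inner_outside hk hc on nr) => -[Ez _]; apply: vt Ez; lia.
Qed.

Let outer_end i r z : has_letter C i r.+1 ->
    z = pos (glue P) i (outP i r).2 \/ z = pos (glue P) i (outP i r).2.+1 ->
  exists2 j, (j < nb_vertices (glue Q) i)%N & z = pos (glue Q) i j.
Proof.
move=> hr; have [<- <-] := outer_pos hr; have He := outer_edge_Q hr.
by case=> ->; [exists (outQ i r).2 => //; exact: ltnW | exists (outQ i r).2.+1].
Qed.

Let inner_eq k i r c k' i' r' c' : hole_at C k i r -> hole_at C k' i' r' ->
  (k, c) = (k', c') -> innQ i r c = innQ i' r' c'.
Proof.
by move=> hk hk' [E ->]; rewrite -{}E in hk'; case: (holes_unique holesC hk hk') => -> ->.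
Qed.

Let outer_inj (X : diagram R) i r i' r' : perm_eq (holes C) (iota 0 (size X)) ->
    (forall k, (k < size X)%N -> (1 < nb_vertices X k)%N) ->
    has_letter C i r.+1 -> has_letter C i' r'.+1 ->
  outer_edge C X i r = outer_edge C X i' r' -> i = i' /\ r = r'.
Proof.
move=> hX sX hr hr' [Ei Ej]; rewrite -{i'}Ei in hr' Ej *; split=> //.
have h1 : has_letter C i r by exact: ltnW hr.
have h2 : has_letter C i r' by exact: ltnW hr'.
have b1 := block_size hX sX h1; have b2 := block_size hX sX h2.
by case: (vindex_inj h1 _ h2 _ Ej); rewrite ?prednK.
Qed.

Let outer_crossing i r i' r' z : has_letter C i r.+1 -> has_letter C i' r'.+1 ->
    on_edge (glue Q) (outQ i r) z -> on_edge (glue Q) (outQ i' r') z ->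
    ~~ adjacent (outQ i r) (outQ i' r') ->
  crossing (glue P) (outP i r) (outP i' r').
Proof.
move=> hr hr' on on' nadj.
have onP := on; have onP' := on'; rewrite !outer_on // in onP onP'.
have He := outer_edge_P hr; have He' := outer_edge_P hr'.
split=> //; last by exists z.
apply/negP => adj.
have ne : outP i r <> outP i' r'.
  move=> /(outer_inj hP sP hr hr')[Ei Er]; move: nadj.
  by rewrite Ei Er /adjacent eqxx leqnSn.
suff [j hj Ez] : exists2 j, (j < nb_vertices (glue Q) i)%N & z = pos (glue Q) i j.
  by move/negP: nadj; apply; apply: (vertex_adjacent _ _ hj Ez) => //; exact: outer_edge_Q.
apply: (outer_end hr).
case/adjacentP: adj => // E; [right | left];
  apply: (generic_two_points gD He He' ne onP onP').
- exact: segment_r.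
- by rewrite E; exact: segment_l.
- exact: segment_l.
- have -> : (outP i r).2 = (outP i' r').2.+1 by rewrite E.
  have Ei : i = i' by case: E.
  by rewrite [X in pos _ X]Ei; exact: segment_r.
Qed.

(** A crossing is either inside the local picture or between two edges that
    are not affected by a change of this picture. *)
Lemma glue_crossing e f : crossing (glue Q) e f ->
  (exists k r c k' r' c', [/\ hole_at C k e.1 r, hole_at C k' f.1 r',
     e = innQ e.1 r c, f = innQ f.1 r' c' & crossing Q (k, c) (k', c')]) \/
  (exists r r', [/\ has_letter C e.1 r.+1, has_letter C f.1 r'.+1,
     e = outQ e.1 r, f = outQ f.1 r' & crossing (glue P) (outP e.1 r) (outP f.1 r')]).
Proof.
move=> [He Hf nadj [z [ez fz]]].
have inside k i r c : hole_at C k i r -> is_edge Q (k, c) ->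
    on_edge (glue Q) (innQ i r c) z -> region phi z.
  move=> hk hc on; apply: contrapT => nr; have [j hj Ez] := end_vertex hk hc on nr.
  by move/negP: nadj; apply; apply: vertex_adjacent hj Ez ez fz.
have [[k [r [c [hk hc Ee]]]]|[r [hr Ee]]] := edge_cases He;
  have [[k' [r' [c' [hk' hc' Ef]]]]|[r' [hr' Ef]]] := edge_cases Hf.
- left; exists k, r, c, k', r', c'; split=> //.
  rewrite {}Ee in ez nadj; rewrite {}Ef in fz nadj.
  have [y yz ony] := inner_on_Q hk hc ez; have [y' yz' ony'] := inner_on_Q hk' hc' fz.
  have Ey : y = y' by apply: (affine_inj aff); rewrite yz yz'.
  split=> //; last by exists y; split=> //; rewrite Ey.
  apply/negP => /and3P[/= /eqP Ek h1 h2]; rewrite -{}Ek in hk'.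
  have [Ei Er] := holes_unique holesC hk hk'; move/negP: nadj; apply.
  by rewrite /adjacent /= Ei Er eqxx /vindex -!addnS !leq_add2l h1.
- by rewrite Ef in fz; rewrite Ee in ez; case: (outer_not_region hr' fz); apply: inside hk hc ez.
- by rewrite Ef in fz; rewrite Ee in ez; case: (outer_not_region hr ez); apply: inside hk' hc' fz.
- right; exists r, r'; split=> //; rewrite {}Ee in ez nadj; rewrite {}Ef in fz nadj.
  exact: (outer_crossing hr hr' ez fz nadj).
Qed.

(** In the region all three edges belong to the new picture, and outside, if
    the common point is not a vertex, none of them does. *)
Lemma glue_no_triple e f g z :
  is_edge (glue Q) e -> is_edge (glue Q) f -> is_edge (glue Q) g ->
  e <> f -> f <> g -> e <> g ->
  on_edge (glue Q) e z -> on_edge (glue Q) f z -> ~ on_edge (glue Q) g z.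
Proof.
move=> He Hf Hg ef fg eg ez fz gz.
have novtx i j : (j < nb_vertices (glue Q) i)%N -> z <> pos (glue Q) i j.
  move=> hj Ez; rewrite Ez in ez fz gz.
  have [e1 e2] := glue_vertices hj He ez; have [f1 f2] := glue_vertices hj Hf fz.
  have [g1 g2] := glue_vertices hj Hg gz.
  have ne (a b : nat * nat) : a.1 = i -> b.1 = i -> a <> b -> a.2 <> b.2.
    by case: a b => [? ?] [? ?] /= -> -> h E; apply: h; rewrite E.
  have := ne _ _ e1 f1 ef; have := ne _ _ f1 g1 fg; have := ne _ _ e1 g1 eg.
  by lia.
have [rg|nrg] := pselect (region phi z).
  have inner h : is_edge (glue Q) h -> on_edge (glue Q) h z ->
      exists k r c, [/\ hole_at C k h.1 r, is_edge Q (k, c) & h = innQ h.1 r c].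
    move=> Hh on; have [//|[r [hr Eh]]] := edge_cases Hh.
    by rewrite Eh in on; case: (outer_not_region hr on).
  have [k [r [c [hk hc Ee]]]] := inner e He ez.
  have [k' [r' [c' [hk' hc' Ef]]]] := inner f Hf fz.
  have [k2 [r2 [c2 [hk2 hc2 Eg]]]] := inner g Hg gz.
  rewrite Ee in ez ef eg; rewrite Ef in fz ef fg; rewrite Eg in gz fg eg.
  have [y yz ony] := inner_on_Q hk hc ez; have [y' yz' ony'] := inner_on_Q hk' hc' fz.
  have [y2 yz2 ony2] := inner_on_Q hk2 hc2 gz.
  have E1 : y' = y by apply: (affine_inj aff); rewrite yz yz'.
  have E2 : y2 = y by apply: (affine_inj aff); rewrite yz yz2.
  rewrite E1 in ony'; rewrite E2 in ony2.
  apply: (generic_no_triple gQ hc hc' hc2 _ _ _ ony ony' ony2) => E.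
  + exact: ef (inner_eq hk hk' E).
  + exact: fg (inner_eq hk' hk2 E).
  + exact: eg (inner_eq hk hk2 E).
have outer h : is_edge (glue Q) h -> on_edge (glue Q) h z ->
    exists r, has_letter C h.1 r.+1 /\ h = outQ h.1 r.
  move=> Hh on; have [[k [r [c [hk hc Eh]]]]|//] := edge_cases Hh.
  rewrite Eh in on; have [j hj Ez] := end_vertex hk hc on nrg.
  by case: (novtx _ _ hj Ez).
have [r [hr Ee]] := outer e He ez; have [r' [hr' Ef]] := outer f Hf fz.
have [r2 [hr2 Eg]] := outer g Hg gz.
rewrite Ee outer_on // in ez; rewrite Ef outer_on // in fz; rewrite Eg outer_on // in gz.
have ne (a b : nat * nat) s s' : has_letter C a.1 s.+1 -> has_letter C b.1 s'.+1 ->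
    a = outQ a.1 s -> b = outQ b.1 s' -> a <> b -> outP a.1 s <> outP b.1 s'.
  by move=> h h' Ea Eb nab /(outer_inj hP sP h h')[E E']; apply: nab; rewrite Ea Eb E E'.
apply: (generic_no_triple gD (outer_edge_P hr) (outer_edge_P hr') (outer_edge_P hr2)
  _ _ _ ez fz gz); exact: ne.
Qed.

Lemma level_inner k i r c : hole_at C k i r -> is_edge Q (k, c) ->
  level (glue Q) (innQ i r c) = level Q (k, c).
Proof.
move=> hk hc; rewrite /level /inner_edge /=.
by rewrite (inner_pos hk) ?nb_transport ?vtx_transport //; exact: ltnW.
Qed.

(** The level of an edge that leaves the picture is stored in the last vertex of
    an arc of the picture; such edges have no crossings. *)
Lemma level_outer i r i' r' : has_letter C i r.+1 -> has_letter C i' r'.+1 ->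
    crosses (glue P) (outP i r) (outP i' r') ->
  level (glue Q) (outQ i r) = level (glue P) (outP i r).
Proof.
move=> hr hr' cr; have hr0 : has_letter C i r by exact: ltnW hr.
rewrite /level (outer_vtx hQ sQ hr).1 (outer_vtx hP sP hr).1 /block_last.
case L : (letter C i r) => [//|k].
by have := exits_free (conj hr0 L) hr hr'; rewrite cr.
Qed.

Lemma glue_levels e f : crossing (glue Q) e f -> level (glue Q) e <> level (glue Q) f.
Proof.
move=> /glue_crossing[[k [r [c [k' [r' [c' [hk hk' Ee Ef cr]]]]]]]|[r [r' [hr hr' Ee Ef cr]]]].
  have [hc hc' _ _] := cr; rewrite Ee Ef (level_inner hk hc) (level_inner hk' hc'); exact: generic_levels cr.
have cs := (crosses_crossing gD (outer_edge_P hr) (outer_edge_P hr')).2 cr.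
rewrite Ee Ef (level_outer hr hr' cs) (level_outer hr' hr) ?(crossesC _ _ (outP e.1 r)) //.
exact: generic_levels cr.
Qed.

Let first_letter i (X : diagram R) : perm_eq (holes C) (iota 0 (size X)) ->
    (forall k, (k < size X)%N -> (1 < nb_vertices X k)%N) ->
  has_letter C i 0 -> pos (fill C X) i 0 = (block_head C X i 0).1.
Proof.
move=> hX sX hr; have := (fill_vertex hr (block_size hX sX hr)).2.
by rewrite /vindex /foff take0 /= addn0 /pos => ->; rewrite /block_head -nth0.
Qed.

Let last_letter i (X : diagram R) : perm_eq (holes C) (iota 0 (size X)) ->
    (forall k, (k < size X)%N -> (1 < nb_vertices X k)%N) ->
  has_letter C i 0 -> last_pos (fill C X) i = (block_last C X i (size (nth [::] C i)).-1).1.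
Proof.
move=> hX sX hr; set w := nth [::] C i in hr *.
have hl : has_letter C i (size w).-1 by rewrite /has_letter -/w prednK.
have b0 := block_size hX sX hl.
rewrite /last_pos; have -> : (nb_vertices (fill C X) i).-1 =
    vindex C X i (size w).-1 (size (block X (letter C i (size w).-1))).-1.
  apply: succn_inj; rewrite -vindex_next // (prednK (n := size w)) // prednK.
    by rewrite /nb_vertices nth_fill /vindex /foff addn0 take_oversize // size_map.
  by apply: leq_trans (fill_vertex hr (block_size hX sX hr)).1; rewrite ltnS.
rewrite /pos (fill_vertex hl _).2 ?prednK //.
by rewrite nth_last.
Qed.

Lemma glue_ends i : pos (glue Q) i 0 = pos (glue P) i 0 /\
  last_pos (glue Q) i = last_pos (glue P) i.
Proof.
have [h|h] := ltnP 0 (size (nth [::] C i)).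
  rewrite !first_letter // !last_letter // block_head_pos // block_last_pos //.
  by rewrite /has_letter prednK.
have E (X : diagram R) : nth [::] (fill C X) i = [::].
  by rewrite nth_fill /blocks; move: h; rewrite leqn0 => /nilP->.
by rewrite /last_pos /pos /vtx /nb_vertices !E.
Qed.

Lemma glue_tangle : tangle (glue Q).
Proof.
split; first by split; [exact: glue_size | exact: glue_edges | exact: glue_vertices |
                        exact: glue_no_triple | exact: glue_levels].
  move=> e z He on; have [[k [r [c [hk hc Ee]]]]|[r [hr Ee]]] := edge_cases He.
    rewrite Ee in on; have [y <- ony] := inner_on_Q hk hc on.
    by apply: disk_phi; exact: (tangle_disk tQ hc ony).
  by rewrite Ee outer_on // in on; exact: (tangle_disk tD (outer_edge_P hr) on).
move=> e z He on; have [E0 E1] := glue_ends e.1; rewrite E0 E1.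
have szP : (1 < nb_vertices (glue P) e.1)%N.
  apply: (generic_size gD); have := is_edge_size He.
  by rewrite !size_map.
have onP j : (j < nb_vertices (glue P) e.1)%N -> z = pos (glue P) e.1 j ->
    exists2 f, is_edge (glue P) f & on_edge (glue P) f z /\ f.1 = e.1.
  move=> hj ->; case: j hj => [|j] hj.
    by exists (e.1, 0%N) => //; split=> //; exact: segment_l.
  by exists (e.1, j) => //; split=> //; exact: segment_r.
split; last first.
  move=> E; have [f Hf [onf Ef]] : exists2 f, is_edge (glue P) f & on_edge (glue P) f z /\ f.1 = e.1.
    by case: E => E; [apply: (onP 0%N) | apply: (onP (nb_vertices (glue P) e.1).-1)] => //; lia.
  by apply/(tangle_ends tD Hf onf); rewrite Ef.
have [[k [r [c [hk hc Ee]]]]|[r [hr Ee]]] := edge_cases He; last first.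
  rewrite Ee outer_on // in on; exact: (tangle_ends tD (outer_edge_P hr) on).1.
move=> no; rewrite Ee in on.
have nr : ~ region phi z by move=> /(region_in_open aff disk_phi).
have nP := nbP (hole_lt hk).
have inP c' : is_edge P (k, c') -> on_edge (glue P) (inner_edge C (tr P) e.1 r c') z ->
    z = pos (glue P) e.1 0 \/ z = last_pos (glue P) e.1.
  move=> hc' onz; apply: (tangle_ends tD (e := inner_edge C (tr P) e.1 r c') _ onz).1 => //.
  by apply/(fill_edgeP hP sP); left; exists k, r, c'; rewrite is_edge_transport.
case: (inner_outside hk hc on nr) => -[_ Ez].
  apply: (inP 0%N) => //; rewrite (inner_on hk) ?is_edge_transport // Ez.
  by apply/on_edge_transport => //; exact: segment_l.
have hl : is_edge P (k, (nb_vertices P k).-2) by rewrite /is_edge /=; lia.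
apply: (inP _ hl); rewrite (inner_on hk) ?is_edge_transport // Ez.
apply/on_edge_transport => //; rewrite /last_pos.
have -> : (nb_vertices P k).-1 = (nb_vertices P k).-2.+1 by lia.
exact: segment_r.
Qed.

Let hQ0 : perm_eq (holes C) (iota 0 (size Q)). Proof. by rewrite eQ.1. Qed.
Let nbQ0 k : (k < size Q)%N -> (1 < nb_vertices Q k)%N. Proof. exact: tangle_size. Qed.

Lemma glue_looks : looks_like phi (glue Q) Q.
Proof. by apply: (looks_fill aff hQ0 nbQ0) => i r z hr; exact: outer_not_region. Qed.

End Other.
End Base.
End Glue.

(** * Moves inside a local picture *)

Section Localize.
Variable R : realType.
Implicit Types (P Q : diagram R) (z : point R) (phi : point R -> point R) (C : context R).

Lemma size_block_shape (X Y : diagram R) x : shape X = shape Y ->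
  size (block X x) = size (block Y x).
Proof. by case: x => [//|k] s; exact: nb_vertices_shape s. Qed.

Lemma blocks_shape C (X Y : diagram R) i : shape X = shape Y ->
  shape (blocks C X i) = shape (blocks C Y i).
Proof.
move=> s; rewrite /shape /blocks -!map_comp; apply: eq_map => x /=.
exact: size_block_shape.
Qed.

Lemma vindex_shape C (X Y : diagram R) i r c : shape X = shape Y ->
  vindex C X i r c = vindex C Y i r c.
Proof.
move=> s; rewrite /vindex /foff !size_flatten; congr (sumn _ + _)%N.
by rewrite /shape !map_take; congr take; exact: blocks_shape.
Qed.

Lemma shape_fill C (X Y : diagram R) : shape X = shape Y ->
  shape (fill C X) = shape (fill C Y).
Proof.
move=> s; rewrite /shape /fill -!map_comp; apply: eq_map => w /=.
rewrite !size_flatten /shape -!map_comp; congr sumn; apply: eq_map => x.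
exact: size_block_shape.
Qed.

Lemma shape_transport phi (X : diagram R) : shape (transport phi X) = shape X.
Proof. by rewrite /shape -map_comp; apply: eq_map => w /=; rewrite size_map. Qed.

Lemma same_ends_sym P Q : same_ends P Q -> same_ends Q P.
Proof. by case=> s h; split=> // k; rewrite s => /h[-> ->]. Qed.

Lemma same_ends_trans P Q X : same_ends P Q -> same_ends Q X -> same_ends P X.
Proof.
case=> s h [s' h']; split; first by rewrite s'.
by move=> k hk; have [<- <-] := h k hk; apply: h'; rewrite s.
Qed.

Lemma trace_transport phi P z : oriented_affine phi ->
  trace (transport phi P) (phi z) <-> trace P z.
Proof.
move=> aff; split=> -[e He on]; exists e.
- by rewrite is_edge_transport in He.
- by apply/(on_edge_transport _ aff); rewrite ?is_edge_transport // in He *.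
- by rewrite is_edge_transport.
- exact/on_edge_transport.
Qed.

Lemma transport_comp phi psi P :
  transport phi (transport psi P) = transport (phi \o psi) P.
Proof.
rewrite /transport -map_comp; apply: eq_map => w /=; rewrite -map_comp.
by apply: eq_map.
Qed.

Lemma affine_comp phi psi : oriented_affine phi -> oriented_affine psi ->
  oriented_affine (phi \o psi).
Proof.
move=> [k [l [m [n [u [v [d0 E]]]]]]] [k' [l' [m' [n' [u' [v' [d0' E']]]]]]].
exists (k * k' + l * m'), (k * l' + l * n'), (m * k' + n * m'), (m * l' + n * n').
exists (k * u' + l * v' + u), (m * u' + n * v' + v); split.
  have -> : (k * k' + l * m') * (m * l' + n * n') - (k * l' + l * n') * (m * k' + n * m')
          = (k * n - l * m) * (k' * n' - l' * m') by ring.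
  exact: mulr_gt0.
by move=> z; rewrite /= E E' /=; apply: point_eqP => /=; ring.
Qed.

Definition word_holes (w : seq (vertex R + nat)) : seq nat :=
  pmap (fun x => if x is inr k then Some k else None) w.

Lemma holes_cat C1 w C2 : holes (C1 ++ w :: C2) = holes C1 ++ word_holes w ++ holes C2.
Proof. by rewrite /holes flatten_cat /= !pmap_cat. Qed.

Lemma split_word k w : k \in word_holes w -> exists w1 w2, w = w1 ++ inr k :: w2.
Proof.
elim: w => [|x w IH] //.
have rest : k \in word_holes w -> exists w1 w2, x :: w = w1 ++ inr k :: w2.
  by move=> /IH[w1 [w2 ->]]; exists (x :: w1), w2.
rewrite /word_holes /=; case E : x => [v|k'] /=; rewrite -?E //.
by rewrite inE => /orP[/eqP->|//]; exists [::], w; rewrite E.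
Qed.

Lemma split_context C k : k \in holes C ->
  exists C1 w1 w2 C2, C = C1 ++ (w1 ++ inr k :: w2) :: C2.
Proof.
elim: C => [|w C IH] //; rewrite (holes_cat [::] w C) /= mem_cat.
case/orP => [/split_word[w1 [w2 ->]]|/IH[C1 [w1 [w2 [C2 ->]]]]].
  by exists [::], w1, w2, C.
by exists (w :: C1), w1, w2, C2.
Qed.

Lemma blocks_agree k w (X Y : diagram R) : k \notin word_holes w ->
  (forall k', k' != k -> nth [::] X k' = nth [::] Y k') ->
  flatten (map (block X) w) = flatten (map (block Y) w).
Proof.
move=> kw E; elim: w kw => [|[v|k'] w IH] //= kw; first by rewrite IH.
by move: kw; rewrite inE negb_or eq_sym => /andP[k'k /IH->]; rewrite E.
Qed.

Lemma fill_agree k C (X Y : diagram R) : k \notin holes C ->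
  (forall k', k' != k -> nth [::] X k' = nth [::] Y k') ->
  fill C X = fill C Y.
Proof.
move=> kC E; elim: C kC => [|w C IH] //=.
rewrite (holes_cat [::] w C) /= mem_cat negb_or => /andP[kw kC].
by rewrite IH //; congr (_ :: _); exact: blocks_agree kw E.
Qed.

(** A hole occurs once, so one more vertex in the picture is one more vertex
    in the assembled diagram. *)
Lemma glue_subdivision phi C Q Q' : oriented_affine phi ->
    perm_eq (holes C) (iota 0 (size Q)) -> subdivision Q Q' ->
  subdivision (fill C (transport phi Q)) (fill C (transport phi Q')).
Proof.
move=> aff hC [Q1 [Q2 [s1 [s2 [a [b [t [tI EQ EQ']]]]]]]].
have uC : uniq (holes C) by rewrite (perm_uniq hC) iota_uniq.
have kC : size Q1 \in holes C.
  by rewrite (perm_mem hC) mem_iota EQ size_cat /= -addSnnS leq_addr.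
have [C1 [w1 [w2 [C2 EC]]]] := split_context kC.
set k := size Q1 in EC kC.
have agree k' : k' != k -> nth [::] (transport phi Q) k' = nth [::] (transport phi Q') k'.
  move=> k'k; rewrite !nth_transport EQ EQ' !nth_cat -/k.
  case: ltnP => // h; have -> : (k' - k = (k' - k.+1).+1)%N by lia.
  by [].
have kX (s : arc R) : nth [::] (transport phi (Q1 ++ s :: Q2)) k = map (tv phi) s.
  by rewrite nth_transport nth_cat ltnn subnn.
move: uC; rewrite EC holes_cat /word_holes pmap_cat /= -/(word_holes w1) -/(word_holes w2).
rewrite -catA cat_uniq => /and3P[_ n1 u2].
have nk1 : k \notin holes C1.
  apply/negP => k1; move/hasPn: n1 => /(_ k); rewrite mem_cat mem_cat inE eqxx orbT.
  by move=> /(_ isT); rewrite /= k1.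
move: u2; rewrite -cat1s -!catA cat_uniq => /and3P[_ n2 u3].
have nkw1 : k \notin word_holes w1.
  by apply/negP => k1; move/hasPn: n2 => /(_ k); rewrite inE eqxx => /(_ isT); rewrite /= k1.
move: u3; rewrite cat1s /= mem_cat negb_or => /andP[/andP[nkw2 nk2] _].
have E X : fill (C1 ++ (w1 ++ inr k :: w2) :: C2) X = fill C1 X ++
    (flatten (map (block X) w1) ++ nth [::] X k ++ flatten (map (block X) w2)) :: fill C2 X.
  by rewrite /fill map_cat /= map_cat flatten_cat.
exists (fill C1 (transport phi Q)), (fill C2 (transport phi Q)).
exists (flatten (map (block (transport phi Q)) w1) ++ map (tv phi) s1).
exists (map (tv phi) s2 ++ flatten (map (block (transport phi Q)) w2)).
exists (tv phi a), (tv phi b), t; split=> //; rewrite E.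
  by rewrite [in nth _ _ k]EQ kX map_cat /= -!catA.
rewrite -(fill_agree nk1 agree) -(fill_agree nk2 agree).
rewrite -(blocks_agree nkw1 agree) -(blocks_agree nkw2 agree).
by rewrite [in nth _ _ k]EQ' kX map_cat /= /tv /= affine_lerp // -!catA.
Qed.

(** A context inside the image of another one. *)
Definition nest phi C C' : context R :=
  map (fun w => flatten (map (fun x => match x with
    | inl v => [:: inl v]
    | inr k => map (fun y => match y with inl v => inl (tv phi v) | inr l => inr l end)
                 (nth [::] C' k) end) w)) C.

Lemma fill_nest phi C C' P : fill (nest phi C C') (transport phi P) =
  fill C (transport phi (fill C' P)).
Proof.
rewrite /fill /nest -map_comp; apply: eq_map => w /=.
elim: w => [|x w IH] //=; rewrite map_cat flatten_cat IH; congr (_ ++ _).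
case: x => [v|k] //=; rewrite -/(fill C' P) nth_transport nth_fill /blocks.
elim: (nth [::] C' k) => [|y u IHu] //=; rewrite IHu map_cat; congr (_ ++ _).
by case: y => [v|l] //=; rewrite nth_transport.
Qed.

Lemma holes_nest phi C C' : perm_eq (holes C) (iota 0 (size C')) ->
  perm_eq (holes (nest phi C C')) (holes C').
Proof.
move=> hC; have -> : holes (nest phi C C') =
    flatten (map (fun k => word_holes (nth [::] C' k)) (holes C)).
  rewrite /holes /nest; elim: (C) => [|w W IH] //=.
  rewrite !pmap_cat map_cat flatten_cat IH; congr (_ ++ _).
  elim: w => [|[v|k] w IHw] //=; rewrite pmap_cat IHw; congr (_ ++ _).
  elim: (nth [::] C' k) => [|[v|l] u IHu] //=.
  by rewrite IHu.
apply: perm_trans (perm_flatten (perm_map _ hC)) _.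
have -> : map (fun k => word_holes (nth [::] C' k)) (iota 0 (size C')) = map word_holes C'.
  by rewrite -[in RHS](mkseq_nth [::] C') -map_comp.
rewrite /holes; elim: (C') => [|w W IH] //=; rewrite pmap_cat perm_cat2l.
exact: IH.
Qed.

Section Base.
Variables (phi : point R -> point R) (C : context R) (P : diagram R).
Hypothesis aff : oriented_affine phi.
Hypothesis disk_phi : forall z, disk z -> disk (phi z).
Hypothesis holesC : perm_eq (holes C) (iota 0 (size P)).
Hypothesis tP : tangle P.
Local Notation glue X := (fill C (transport phi X)).
Hypothesis tD : tangle (glue P).
Hypothesis lookP : looks_like phi (glue P) P.
Hypothesis exits_free : forall k i r i' r', hole_at C k i r ->
  has_letter C i r.+1 -> has_letter C i' r'.+1 ->
  crosses (glue P) (outer_edge C (transport phi P) i r)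
                   (outer_edge C (transport phi P) i' r') = false.

Let glueT Q (tQ : tangle Q) (eQ : same_ends P Q) : tangle (glue Q).
Proof. exact: glue_tangle aff disk_phi holesC tP tD lookP exits_free _ tQ eQ. Qed.

(** The glued diagrams of the times of the isotopy form an isotopy. *)
Lemma glue_isotopy Q Q' : same_ends P Q -> isotopy Q Q' -> isotopy (glue Q) (glue Q').
Proof.
move=> eQ [F [[F0 F1] FT Fc Fe Fl]].
have sF t : 0 <= t <= 1 -> shape (F t) = shape Q by move=> /FT[].
have tF t : 0 <= t <= 1 -> tangle (F t) by move=> /FT[].
have I0 : 0 <= (0 : R) <= 1 by rewrite lexx ler01.
have tQ : tangle Q by rewrite -F0; exact: tF.
have eF t : 0 <= t <= 1 -> same_ends P (F t).
  move=> tI; apply: same_ends_trans eQ _; split.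
    by rewrite -[size (F t)](size_map size) -/(shape _) sF // size_map.
  by move=> k _; exact: Fe.
have sT t : 0 <= t <= 1 -> shape (transport phi (F t)) = shape (transport phi Q).
  by move=> tI; rewrite !shape_transport sF.
exists (fun t => glue (F t)); split.
- by rewrite F0 F1.
- move=> t tI; split; first exact: glueT (tF t tI) (eF t tI).
  by apply: shape_fill; exact: sT.
- move=> i j.
  have nbF t : 0 <= t <= 1 -> nb_vertices (glue (F t)) i = nb_vertices (glue Q) i.
    by move=> tI; apply: nb_vertices_shape; apply: shape_fill; exact: sT.
  have ext (f g : R -> R) : (forall t, 0 <= t <= 1 -> f t = g t) ->
      {within `[0, 1], continuous f} -> {within `[0, 1], continuous g}.
    move=> E; apply: subspace_eq_continuous => t /set_mem /=.
    by rewrite in_itv /=; exact: E.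
  suff [p Ep [p1 p2]] : exists2 p : R -> point R,
      (forall t, 0 <= t <= 1 -> p t = pos (glue (F t)) i j) & continuous_points p.
    by split; [apply: ext p1 | apply: ext p2] => t tI; rewrite Ep.
  have [hj|hj] := ltnP j (nb_vertices (glue Q) i); last first.
    exists (fun=> (0, 0)); last by split; exact: cont01_cst.
    by move=> t tI; rewrite /pos /vtx nth_default // -/(nb_vertices _ _) nbF.
  have [r [c [hr hc Ej]]] := fill_index hj.
  have Ev t : 0 <= t <= 1 ->
      pos (glue (F t)) i j = (nth ((0, 0), 0) (block (transport phi (F t)) (letter C i r)) c).1.
    move=> tI; rewrite Ej (vindex_shape _ _ _ _ (esym (sT t tI))) /pos.
    by rewrite (fill_vertex hr _).2 // (size_block_shape _ (sT t tI)).
  case L : (letter C i r) hc => [v|k] /= hc.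
    exists (fun=> v.1); last by split; exact: cont01_cst.
    by move=> t tI; rewrite Ev // L; case: (c) hc.
  have hcQ : (c < nb_vertices Q k)%N by rewrite -(nb_transport phi).
  exists (fun t => phi (pos (F t) k c)).
    move=> t tI; rewrite Ev // L /= -[nth _ _ c]/(vtx _ k c) vtx_transport //.
    by rewrite (nb_vertices_shape _ (sF t tI)).
  have [c1 c2] := Fc k c; have [a [b [m [n [u [v [_ E]]]]]]] := aff.
  have cst (x : R) : {within `[0, 1], continuous (fun _ : R => x)} by exact: cont01_cst.
  have lin (x y w : R) : {within `[0, 1], continuous
      (fun t => x * (pos (F t) k c).1 + y * (pos (F t) k c).2 + w)}.
    by apply: cont01D => //; apply: cont01D; apply: cont01M.
  by split; [apply: ext (lin a b u) | apply: ext (lin m n v)] => t _; rewrite E.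
- move=> t i tI.
  have [-> ->] := glue_ends phi holesC tP (tF t tI) (eF t tI) i.
  by have [-> ->] := glue_ends phi holesC tP tQ eQ i.
- move=> t e f tI.
  move=> /(glue_crossing aff holesC tP tD lookP (tF t tI) (eF t tI)).
  case=> [[k [r [c [k' [r' [c' [hk hk' Ee Ef cr]]]]]]]|[r [r' [hr hr' Ee Ef cr]]]].
    have [hc hc' _ _] := cr.
    have hcQ := is_edge_shape (sF t tI) hc; have hcQ' := is_edge_shape (sF t tI) hc'.
    have Ee' : e = inner_edge C (transport phi Q) e.1 r c.
      by rewrite {1}Ee /inner_edge (vindex_shape _ _ _ _ (sT t tI)).
    have Ef' : f = inner_edge C (transport phi Q) f.1 r' c'.
      by rewrite {1}Ef /inner_edge (vindex_shape _ _ _ _ (sT t tI)).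
    rewrite {1}Ee {1}Ef (level_inner _ hk hc) (level_inner _ hk' hc').
    rewrite [in RHS]Ee' [in RHS]Ef' (level_inner _ hk hcQ) (level_inner _ hk' hcQ').
    exact: Fl.
  have oe i s : outer_edge C (transport phi (F t)) i s = outer_edge C (transport phi Q) i s.
    by rewrite /outer_edge (vindex_shape _ _ _ _ (sT t tI)) (size_block_shape _ (sT t tI)).
  have gD := tangle_generic tD; have [Hp Hp' _ _] := cr.
  have cs := (crosses_crossing gD Hp Hp').2 cr.
  have cs' : crosses (glue P) (outer_edge C (transport phi P) f.1 r')
      (outer_edge C (transport phi P) e.1 r) by rewrite crossesC.
  have lv X (tX : tangle X) (eX : same_ends P X) :=
    (level_outer holesC tP exits_free tX eX hr hr' cs,
     level_outer holesC tP exits_free tX eX hr' hr cs').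
  have [l1 l2] := lv _ (tF t tI) (eF t tI); have [l3 l4] := lv _ tQ eQ.
  rewrite {1}Ee {1}Ef l1 l2 -l3 -l4 -!oe -Ee -Ef //.
Qed.

Lemma glue_apply_move m Q Q' : tangle Q -> tangle Q' -> same_ends P Q -> same_ends P Q' ->
  apply_move m Q Q' -> apply_move m (glue Q) (glue Q').
Proof.
move=> tQ tQ' eQ eQ' [psi [C' [affp dp hC' [EQ EQ'] [lQ lQ']]]].
have affc : oriented_affine (phi \o psi) by exact: affine_comp.
have comp X A : X = fill C' (transport psi A) ->
    glue X = fill (nest phi C C') (transport (phi \o psi) A).
  by move=> ->; rewrite -transport_comp fill_nest.
have look X A : tangle X -> same_ends P X -> looks_like psi X A ->
    looks_like (phi \o psi) (glue X) A.
  move=> tX eX lX z oz; have o2 : open_disk (psi z).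
    by apply: (region_in_open affp dp); exists z.
  rewrite /= (glue_looks aff holesC tP tD lookP tX eX o2) trace_transport //.
  apply: iff_trans (lX z oz) _; rewrite -transport_comp; apply: iff_sym.
  exact: trace_transport.
exists (phi \o psi), (nest phi C C'); split=> //.
- by move=> z dz; apply: disk_phi; exact: dp.
- apply: perm_trans (holes_nest phi _) hC'.
  by have := eQ.1; rewrite EQ size_map => ->.
- by split; exact: comp.
- by split; exact: look.
Qed.

Hypothesis sides_tangle : forall m, tangle (sides R m).1 /\ tangle (sides R m).2.

Lemma sides_same_ends m : same_ends (sides R m).1 (sides R m).2.
Proof. by case: m; split=> // -[|[|[|k]]]. Qed.

Lemma step_same_ends S Q Q' : step S Q Q' -> same_ends Q Q'.
Proof.
case=> tQ tQ' [].
- move=> [F [[F0 F1] FT _ Fe _]].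
  have I1 : 0 <= (1 : R) <= 1 by rewrite lexx ler01.
  have := (FT 1 I1).2; rewrite F1 => s; split.
    by rewrite -[size Q'](size_map size) -/(shape _) s size_map.
  by move=> k _; rewrite -F1; exact: Fe.
- move=> [Q1 [Q2 [s1 [s2 [a [b [t [tI -> ->]]]]]]]]; split; first by rewrite !size_cat.
  move=> k _; rewrite /last_pos /pos /vtx /nb_vertices !nth_cat.
  case: ltnP => // h; case: (k - size Q1)%N => [|j] //=.
  split; first by case: (s1).
  by rewrite !nth_last !last_cat.
- move=> [m _ [psi [C' [affp dp hC' [-> ->] _]]]].
  have [t1 t2] := sides_tangle m; split; first by rewrite !size_map.
  by move=> k _; exact: (glue_ends psi hC' t1 t2 (sides_same_ends m) k).
Qed.

Lemma glue_step S Q Q' : same_ends P Q -> step S Q Q' -> step S (glue Q) (glue Q').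
Proof.
move=> eQ st; have eQ' := same_ends_trans eQ (step_same_ends st).
have [tQ tQ' ss] := st; split; [exact: glueT | exact: glueT |].
case: ss => [iso|sub|[m Sm ap]].
- by apply: Or31; exact: glue_isotopy.
- by apply: Or32; apply: glue_subdivision; rewrite // eQ.1.
- by apply: Or33; exists m => //; exact: glue_apply_move.
Qed.

(** What can be done in the disk can be done in an affine copy of the disk
    inside a larger diagram. *)
Theorem localize S Q : clos_refl_sym_trans (diagram R) (step S) P Q ->
  clos_refl_sym_trans (diagram R) (step S) (glue P) (glue Q).
Proof.
have ends X Y : clos_refl_sym_trans (diagram R) (step S) X Y -> same_ends X Y.
  elim=> [x y /step_same_ends|x|x y _|x y z _ h1 _ h2] //; first exact: same_ends_sym.
  exact: same_ends_trans h1 h2.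
suff gen X Y : clos_refl_sym_trans (diagram R) (step S) X Y -> same_ends P X ->
    clos_refl_sym_trans (diagram R) (step S) (glue X) (glue Y) by move/gen; apply.
elim=> [x y st eX|x _|x y cl IH eX|x y z c1 IH1 c2 IH2 eX].
- by apply: rst_step; exact: glue_step.
- exact: rst_refl.
- by apply: rst_sym; apply: IH; apply: same_ends_trans eX _; apply: same_ends_sym; exact: ends.
- apply: rst_trans (IH1 eX) (IH2 _).
  exact: same_ends_trans eX (ends _ _ c1).
Qed.

End Base.
End Localize.

(** * A sufficient condition for a tangle *)

Definition turn (T : comPzRingType) (a b c : T * T) : T :=
  (b.1 - a.1) * (c.1 - b.1) + (b.2 - a.2) * (c.2 - b.2).

Section Rigid.
Variable R : realType.
Implicit Types (D : diagram R) (a b c d z : point R).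

(** Conditions that are stable under motions and imply [tangle]: instead of
    vertices on edges, they are about pairs of nonconsecutive edges, which are
    disjoint or cross properly, and about consecutive ones, which do not fold
    back. *)
Record rigid D : Prop := Rigid {
  rigid_size : forall i, (i < size D)%N -> (1 < nb_vertices D i)%N;
  rigid_inner : forall i j, (0 < j)%N -> (j.+1 < nb_vertices D i)%N -> open_disk (pos D i j);
  rigid_ends : forall i, (i < size D)%N -> [/\ disk (pos D i 0), ~ open_disk (pos D i 0),
    disk (last_pos D i) & ~ open_disk (last_pos D i)];
  rigid_edges : forall e, is_edge D e -> pos D e.1 e.2 <> pos D e.1 e.2.+1;
  rigid_open : open_edges D;
  rigid_corners : forall i j, (j.+2 < nb_vertices D i)%N ->
    orient (pos D i j) (pos D i j.+1) (pos D i j.+2) = 0 ->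
    0 < turn (pos D i j) (pos D i j.+1) (pos D i j.+2);
  rigid_pairs : forall e f, is_edge D e -> is_edge D f -> ~~ adjacent e f ->
    (forall z, on_edge D e z -> ~ on_edge D f z) \/ (crosses D e f /\ level D e <> level D f);
  rigid_triples : forall e f g z, is_edge D e -> is_edge D f -> is_edge D g ->
    crosses D e f -> crosses D f g -> crosses D e g ->
    on_edge D e z -> on_edge D f z -> ~ on_edge D g z }.

(** Consecutive edges that meet twice are collinear and fold back. *)
Lemma corner_meet a b c z : b <> c -> a <> b ->
    (orient a b c = 0 -> 0 < turn a b c) ->
  segment a b z -> segment b c z -> z = b.
Proof.
move=> nbc nab h abz bcz; apply: contrapT => zb.
have sq (x y : R) : 0 <= x * x + y * y by rewrite -!expr2 addr_ge0 ?sqr_ge0.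
case: (fold_share abz bcz zb) => on.
  have o' : orient a b c = 0 by rewrite -orient_cycle; exact: orient_seg on.
  have := h o'; rewrite ltNge; apply/negP/negPn; rewrite /turn.
  case: on => u uI ->; rewrite /=.
  have := sq (c.1 - b.1) (c.2 - b.2); set q := _ + _ => q0.
  have : 0 <= u * q by apply: mulr_ge0; lra.
  by rewrite /q; lra.
have := h (orient_seg on); rewrite ltNge; apply/negP/negPn; rewrite /turn.
case: on => u uI ->; rewrite /=.
have := sq (b.1 - a.1) (b.2 - a.2); set q := _ + _ => q0.
have : 0 <= (1 - u) * q by apply: mulr_ge0; lra.
by rewrite /q; lra.
Qed.

Section Sound.
Variable D : diagram R.
Hypothesis rD : rigid D.

Let incident i j : (j < nb_vertices D i)%N ->
  exists2 f, is_edge D f & f.1 = i /\ (f.2 = j \/ f.2.+1 = j).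
Proof.
move=> hj; have sz : (1 < nb_vertices D i)%N.
  apply: (rigid_size rD); rewrite ltnNge; apply/negP => h.
  by move: hj; rewrite /nb_vertices nth_default.
case: j hj => [|j] hj; first by exists (i, 0%N) => //; auto.
by exists (i, j) => //; auto.
Qed.

Let incident_on i j f : f.1 = i -> f.2 = j \/ f.2.+1 = j -> on_edge D f (pos D i j).
Proof. by move=> <- [] <-; [exact: segment_l | exact: segment_r]. Qed.

Let next_meet i j z : is_edge D (i, j.+1) -> on_edge D (i, j) z -> on_edge D (i, j.+1) z ->
  z = pos D i j.+1.
Proof.
move=> He; apply: corner_meet; [exact: (rigid_edges rD He) | | exact: rigid_corners].
by apply: (rigid_edges rD (e := (i, j))); exact: ltnW He.
Qed.

Lemma rigid_vertices i j e : (j < nb_vertices D i)%N -> is_edge D e ->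
  on_edge D e (pos D i j) -> e.1 = i /\ (e.2 = j \/ e.2.+1 = j).
Proof.
move=> hj; have [[i2 j2] Hf [/= f1 f2]] := incident hj; subst i2.
case: e => i1 j1 He on.
have onf : on_edge D (i, j2) (pos D i j) by exact: incident_on.
have nf := rigid_edges rD Hf; have ne := rigid_edges rD He.
have [af|naf] := boolP (adjacent (i1, j1) (i, j2)).
  case/adjacentP: af => -[E1 E2]; subst i1; first by subst j1.
    subst j2; split=> //=; right; case: f2 => // f2.
    by subst j; case: nf => /=; apply/esym; exact: next_meet.
  subst j1; split=> //=; left; case: f2 => // f2.
  by subst j; case: nf => /=; exact: next_meet.
case: (rigid_pairs rD He Hf naf) => [dis|[cr _]]; first by case: (dis _ on onf).
exfalso; move: cr; rewrite crossesC /crosses /proper => /andP[_].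
have := orient_seg on; case: f2 => <-; move=> ->; rewrite ?mul0r ?mulr0 ltxx //.
Qed.

Lemma rigid_no_triple e f g z : is_edge D e -> is_edge D f -> is_edge D g ->
  e <> f -> f <> g -> e <> g -> on_edge D e z -> on_edge D f z -> ~ on_edge D g z.
Proof.
move=> He Hf Hg ef fg eg ez fz gz.
have novtx i j : (j < nb_vertices D i)%N -> z <> pos D i j.
  move=> hj Ez; rewrite Ez in ez fz gz.
  have [e1 e2] := rigid_vertices hj He ez; have [f1 f2] := rigid_vertices hj Hf fz.
  have [g1 g2] := rigid_vertices hj Hg gz.
  have ne (a b : nat * nat) : a.1 = i -> b.1 = i -> a <> b -> a.2 <> b.2.
    by case: a b => [? ?] [? ?] /= -> -> h E; apply: h; rewrite E.
  have := ne _ _ e1 f1 ef; have := ne _ _ f1 g1 fg; have := ne _ _ e1 g1 eg.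
  by lia.
have nx h h' : is_edge D h -> is_edge D h' -> h' = (h.1, h.2.+1) ->
    on_edge D h z -> ~ on_edge D h' z.
  move=> Hh Hh' E on on'; rewrite E in Hh' on'.
  have onh : on_edge D (h.1, h.2) z by case: (h) on.
  by have := novtx _ _ (ltnW Hh') ; apply; exact: next_meet onh on'.
have cr h h' : is_edge D h -> is_edge D h' -> h <> h' -> on_edge D h z -> on_edge D h' z ->
    crosses D h h'.
  move=> Hh Hh' hh' on on'; have [af|naf] := boolP (adjacent h h').
    case/adjacentP: af => // E; first by case: (nx _ _ Hh Hh' E on on').
    by case: (nx _ _ Hh' Hh E on' on).
  by case: (rigid_pairs rD Hh Hh' naf) => [dis|[]//]; case: (dis _ on on').
by apply: (rigid_triples rD He Hf Hg _ _ _ ez fz gz); exact: cr.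
Qed.

Lemma rigid_generic : generic D.
Proof.
split; [exact: rigid_size | exact: rigid_edges | exact: rigid_vertices |
  exact: rigid_no_triple |].
move=> e f [He Hf naf [z [ez fz]]].
by case: (rigid_pairs rD He Hf naf) => [dis|[]//]; case: (dis _ ez fz).
Qed.

Lemma rigid_tangle : tangle D.
Proof.
have vtxP i j : (j < nb_vertices D i)%N -> disk (pos D i j) /\
    (~ open_disk (pos D i j) -> pos D i j = pos D i 0 \/ pos D i j = last_pos D i).
  move=> hj; have hi : (i < size D)%N.
    by rewrite ltnNge; apply/negP => h; move: hj; rewrite /nb_vertices nth_default.
  have [d0 _ d1 _] := rigid_ends rD hi.
  have [->|j0] := posnP j; first by split=> //; left.
  have [h|h] := ltnP j.+1 (nb_vertices D i).
    have o := rigid_inner rD j0 h; split=> //.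
    by case: o => o1 o2; split; exact: ltW.
  have -> : j = (nb_vertices D i).-1 by lia.
  by split=> //; right.
have edgeP e z : is_edge D e -> on_edge D e z ->
    open_disk z \/ exists2 j, (j < nb_vertices D e.1)%N & z = pos D e.1 j.
  move=> He [t tI ->]; have [t0|t0] := eqVneq t 0.
    by right; exists e.2; [exact: ltnW He | rewrite t0 lerp0].
  have [t1|t1] := eqVneq t 1; first by right; exists e.2.+1 => //; rewrite t1 lerp1.
  left; apply: (rigid_open rD He); rewrite !lt_neqAle eq_sym t0 t1 /=; exact: tI.
split; first exact: rigid_generic.
  move=> e z He /(edgeP e z He)[[z1 z2]|[j hj ->]]; last by have [] := vtxP e.1 j hj.
  by split; exact: ltW.
move=> e z He on; split.
  by case: (edgeP e z He on) => // -[j hj ->]; have [] := vtxP e.1 j hj.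
have [_ n0 _ n1] := rigid_ends rD (is_edge_size He).
by case=> ->.
Qed.

End Sound.
End Rigid.

(** * Motions of one vertex on the grid *)

(** The functions 0 to 7 are the values of affine forms that separate two
    segments if they are positive, 8 and 9 those of two segments that cross. *)
Definition gaps_with (T : Type) (z : T) (sub : T -> T -> T) (o : T * T -> T * T -> T * T -> T)
    (s : nat) (a b c d : T * T) : seq T :=
  match s with
  | 0 => [:: sub c.1 a.1; sub d.1 a.1; sub c.1 b.1; sub d.1 b.1]
  | 1 => [:: sub a.1 c.1; sub a.1 d.1; sub b.1 c.1; sub b.1 d.1]
  | 2 => [:: sub c.2 a.2; sub d.2 a.2; sub c.2 b.2; sub d.2 b.2]
  | 3 => [:: sub a.2 c.2; sub a.2 d.2; sub b.2 c.2; sub b.2 d.2]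
  | 4 => [:: o a b c; o a b d]
  | 5 => [:: o b a c; o b a d]
  | 6 => [:: o c d a; o c d b]
  | 7 => [:: o d c a; o d c b]
  | 8 => [:: o a b c; o b a d; o c d b; o d c a]
  | 9 => [:: o b a c; o a b d; o d c b; o c d a]
  | _ => [:: z]
  end.

Definition gaps (T : comPzRingType) : nat -> T * T -> T * T -> T * T -> T * T -> seq T :=
  gaps_with 0 (fun x y => x - y) (@orient T).

Definition status (T : realDomainType) (s : nat) (a b c d : T * T) : bool :=
  all (fun x => 0 < x) (gaps s a b c d).

(** On the grid the same functions are written with the operations of [Z]
    themselves, which evaluate much faster than those of the ring [Z]. *)
Definition zorient (a b c : zpoint) : Z :=
  Z.sub (Z.mul (Z.sub b.1 a.1) (Z.sub c.2 a.2)) (Z.mul (Z.sub b.2 a.2) (Z.sub c.1 a.1)).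

Definition zturn (a b c : zpoint) : Z :=
  Z.add (Z.mul (Z.sub b.1 a.1) (Z.sub c.1 b.1)) (Z.mul (Z.sub b.2 a.2) (Z.sub c.2 b.2)).

Definition zstatus (s : nat) (a b c d : zpoint) : bool :=
  all (Z.ltb 0) (gaps_with Z0 Z.sub zorient s a b c d).

Definition zsame (a b : zpoint) : bool := Z.eqb a.1 b.1 && Z.eqb a.2 b.2.

Definition zinside (N : Z) (a : zpoint) : bool :=
  [&& Z.ltb (Z.opp N) a.1, Z.ltb a.1 N, Z.ltb (Z.opp N) a.2 & Z.ltb a.2 N].

Lemma zinsideE N a : zinside N a = zopen_in N a. Proof. by []. Qed.
Lemma zsameP a b : reflect (a = b) (zsame a b).
Proof. exact: (a =P b). Qed.

Definition one_moves (T : eqType) (l : seq (T * T)) : bool :=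
  (count (fun p => p.1 != p.2) l <= 1)%N.

(** The conditional stops an eager evaluation at the first success. *)
Fixpoint lazy_has (T : Type) (p : T -> bool) (s : seq T) : bool :=
  if s is x :: s' then if p x then true else lazy_has p s' else false.

Lemma lazy_hasE (T : Type) (p : T -> bool) s : lazy_has p s = has p s.
Proof. by elim: s => //= x s ->; case: (p x). Qed.

Definition zpos (D : zdiagram) (i j : nat) : zpoint := (nth v0z (nth [::] D i) j).1.
Definition zlev (D : zdiagram) (i j : nat) : int := (nth v0z (nth [::] D i) j).2.

Definition indices (D : zdiagram) : seq (nat * nat) :=
  flatten [seq [seq (i, j) | j <- iota 0 (size (nth [::] D i)).-1] | i <- iota 0 (size D)].

(** An edge at the start and at the end of a motion, with the number of its
    ends that move. *)
Record strip : Type := Strip {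
  label : nat * nat; tail0 : zpoint; head0 : zpoint; tail1 : zpoint; head1 : zpoint;
  level0 : int; level1 : int; moves : nat }.

Definition strip_of (D E : zdiagram) (e : nat * nat) : strip :=
  let a := zpos D e.1 e.2 in let b := zpos D e.1 e.2.+1 in
  let a' := zpos E e.1 e.2 in let b' := zpos E e.1 e.2.+1 in
  Strip e a b a' b' (zlev D e.1 e.2) (zlev E e.1 e.2) (~~ zsame a a' + ~~ zsame b b').

Definition levels_ok (x y : strip) : bool :=
  [&& level0 x != level0 y, level1 x != level1 y &
      (level0 x < level0 y) == (level1 x < level1 y)].

(** One of the ten lists of affine forms is positive at the start and at the
    end. Levels matter for crossing edges only. *)
Definition pair_ok (x y : strip) : bool :=
  if adjacent (label x) (label y) then true else
  let m := (moves x + moves y)%N in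
  (m <= 1)%N &&
  lazy_has (fun s =>
    if zstatus s (tail0 x) (head0 x) (tail0 y) (head0 y) then
      (if m is 0 then true else zstatus s (tail1 x) (head1 x) (tail1 y) (head1 y)) &&
      ((s < 8)%N || levels_ok x y)
    else false) (iota 0 10).

(** Most pairs are separated by a coordinate, which is fast to decide. *)
Definition zcross (x y : strip) : bool :=
  let st s := zstatus s (tail0 x) (head0 x) (tail0 y) (head0 y) in
  if lazy_has st [:: 0; 1; 2; 3]%N then false else lazy_has st [:: 8; 9]%N.

(** Compares the points where the lines through a and b, p and q meet the line
    through c and d. *)
Definition offset (T : comPzRingType) (a b c d p q : T * T) : T :=
  orient p q c * orient a b d - orient p q d * orient a b c.

Definition triple_ok (x y z : strip) : bool :=
  (moves x + moves y + moves z <= 1)%N &&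
  (0 < offset (tail0 x) (head0 x) (tail0 y) (head0 y) (tail0 z) (head0 z) *
       offset (tail1 x) (head1 x) (tail1 y) (head1 y) (tail1 z) (head1 z)).

Fixpoint triples_ok (X : seq strip) : bool :=
  if X is x :: X' then
    pairwise (fun y z => if zcross y z then triple_ok x y z else true) [seq y <- X' | zcross x y] &&
    triples_ok X'
  else true.

Section Check.
Variables (N : Z) (D E : zdiagram).

Definition edge_ok i j : bool :=
  let a := zpos D i j in let b := zpos D i j.+1 in
  let a' := zpos E i j in let b' := zpos E i j.+1 in
  zinside (Z.add N N) (Z.add a.1 b.1, Z.add a.2 b.2) &&
  (if zsame a a' && zsame b b' then ~~ zsame a b else
   let v := (Z.sub b.1 a.1, Z.sub b.2 a.2) in let v' := (Z.sub b'.1 a'.1, Z.sub b'.2 a'.2) in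
   zinside (Z.add N N) (Z.add a'.1 b'.1, Z.add a'.2 b'.2) &&
   (~~ Z.eqb (Z.sub (Z.mul v.1 v'.2) (Z.mul v.2 v'.1)) Z0 ||
      Z.ltb 0 (Z.add (Z.mul v.1 v'.1) (Z.mul v.2 v'.2)))).

Definition bends (a b c : zpoint) : bool :=
  if Z.eqb (zorient a b c) 0 then Z.ltb 0 (zturn a b c) else true.

Definition corner_ok i j : bool :=
  let a := zpos D i j in let b := zpos D i j.+1 in let c := zpos D i j.+2 in
  let a' := zpos E i j in let b' := zpos E i j.+1 in let c' := zpos E i j.+2 in
  let m := (~~ zsame a a' + ~~ zsame b b' + ~~ zsame c c')%N in
  bends a b c && (if m is 0 then true else
    [&& (m <= 1)%N, bends a' b' c' &
     [|| Z.ltb 0 (zturn a b c) && Z.ltb 0 (zturn a' b' c'),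
         Z.leb 0 (zorient a b c) && Z.leb 0 (zorient a' b' c') |
         Z.leb (zorient a b c) 0 && Z.leb (zorient a' b' c') 0]]).

Definition arc_ok i : bool :=
  let n := size (nth [::] D i) in
  [&& size (nth [::] E i) == n, (1 < n)%N,
      all (fun j => [&& zpos D i j == zpos E i j, zclosed_in N (zpos D i j) &
                        ~~ zopen_in N (zpos D i j)]) [:: 0; n.-1],
      all (fun j => zinside N (zpos D i j) && zinside N (zpos E i j)) (iota 1 n.-2),
      all (edge_ok i) (iota 0 n.-1) & all (corner_ok i) (iota 0 n.-2)].

(** At most one vertex moves along a segment near each pair of edges, so the
    values of the affine forms stay between those at the ends. *)
Definition motion : bool :=
  let X := map (strip_of D E) (indices D) in
  [&& size D == size E, all arc_ok (iota 0 (size D)), pairwise pair_ok X & triples_ok X].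

End Check.

Section Interpolation.
Variable R : realType.
Implicit Types (a b c d p q : point R) (t : R).

Lemma lerp_id t a : lerp t a a = a.
Proof. by apply: point_eqP; rewrite /=; ring. Qed.

Lemma convex_gt0 t (x y : R) : 0 <= t <= 1 -> 0 < x -> 0 < y -> 0 < (1 - t) * x + t * y.
Proof.
move=> /andP[t0 t1] x0 y0; have [->|tn] := eqVneq t 0; first by rewrite mul0r addr0 subr0 mul1r.
by apply: ltr_wpDl; [apply: mulr_ge0; lra | apply: mulr_gt0; rewrite // lt0r tn].
Qed.

Lemma orient_tween t a b c a' b' c' : one_moves [:: (a, a'); (b, b'); (c, c')] ->
  orient (lerp t a a') (lerp t b b') (lerp t c c') =
  (1 - t) * orient a b c + t * orient a' b' c'.
Proof.
rewrite /one_moves /=; have [<-|_] := eqVneq a a'; have [<-|_] := eqVneq b b';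
  have [<-|_] := eqVneq c c'; rewrite ?lerp_id // => _; rewrite /orient /=; ring.
Qed.

(** If one vertex moves, these functions are affine in the time. *)
Lemma gaps_tween t s a b c d a' b' c' d' :
    one_moves [:: (a, a'); (b, b'); (c, c'); (d, d')] ->
  gaps s (lerp t a a') (lerp t b b') (lerp t c c') (lerp t d d') =
  [seq (1 - t) * x.1 + t * x.2 | x <- zip (gaps s a b c d) (gaps s a' b' c' d')].
Proof.
move=> m.
have m1 : one_moves [:: (a, a'); (b, b'); (c, c')].
  by move: m; rewrite /one_moves /=; do 4 case: (_ != _).
have m2 : one_moves [:: (a, a'); (b, b'); (d, d')].
  by move: m; rewrite /one_moves /=; do 4 case: (_ != _).
have m3 : one_moves [:: (c, c'); (d, d'); (a, a')].
  by move: m; rewrite /one_moves /=; do 4 case: (_ != _).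
have m4 : one_moves [:: (c, c'); (d, d'); (b, b')].
  by move: m; rewrite /one_moves /=; do 4 case: (_ != _).
have sw (x y z x' y' z' : point R) : one_moves [:: (x, x'); (y, y'); (z, z')] ->
    one_moves [:: (y, y'); (x, x'); (z, z')].
  by rewrite /one_moves /=; do 3 case: (_ != _).
have n1 := sw _ _ _ _ _ _ m1; have n2 := sw _ _ _ _ _ _ m2.
have n3 := sw _ _ _ _ _ _ m3; have n4 := sw _ _ _ _ _ _ m4.
case: s => [|[|[|[|[|[|[|[|[|[|s]]]]]]]]]]; rewrite /gaps /gaps_with /= ?orient_tween //; last by congr [:: _]; ring.
all: do ![congr cons]; ring.
Qed.

Lemma status_tween t s a b c d a' b' c' d' : 0 <= t <= 1 ->
    one_moves [:: (a, a'); (b, b'); (c, c'); (d, d')] ->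
    status s a b c d -> status s a' b' c' d' ->
  status s (lerp t a a') (lerp t b b') (lerp t c c') (lerp t d d').
Proof.
move=> tI m; rewrite /status gaps_tween //.
elim: (gaps s a b c d) (gaps s a' b' c' d') => [|x u IH] [|y v] //= /andP[x0 u0] /andP[y0 v0].
by rewrite convex_gt0 // IH.
Qed.

Lemma status_disjoint s a b c d z : (s < 8)%N -> status s a b c d ->
  segment a b z -> ~ segment c d z.
Proof.
have C (x y u v t w : R) : 0 <= t <= 1 -> 0 <= w <= 1 -> (1 - t) * x + t * y = (1 - w) * u + w * v ->
    0 < u - x -> 0 < v - x -> 0 < u - y -> 0 < v - y -> False.
  move=> tI wI h k1 k2 k3 k4; have := convex_gt0 wI k1 k2; have := convex_gt0 wI k3 k4.
  by move=> g1 g2; have := convex_gt0 tI g2 g1; lra.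
have O (x y u v : point R) : 0 < orient x y u -> 0 < orient x y v -> segment u v z ->
    orient x y z = 0 -> False.
  by move=> h1 h2 [t tI ->]; rewrite orient_lerp => h; have := convex_gt0 tI h1 h2; lra.
move=> s8 st ab cd; have o1 := orient_seg ab; have o2 := orient_seg cd.
have o3 : orient b a z = 0 by rewrite orientCl o1 oppr0.
have o4 : orient d c z = 0 by rewrite orientCl o2 oppr0.
case: (ab) (cd) => t tI Ez [w wI]; rewrite Ez => E.
have E1 := congr1 fst E; have E2 := congr1 snd E; rewrite /= in E1 E2.
move: s s8 st => [|[|[|[|[|[|[|[|s]]]]]]]] //= _; rewrite /status /gaps /= ?andbT.
- by move=> /and4P[] *; apply: C tI wI E1 _ _ _ _.
- by move=> /and4P[] *; apply: C wI tI (esym E1) _ _ _ _.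
- by move=> /and4P[] *; apply: C tI wI E2 _ _ _ _.
- by move=> /and4P[] *; apply: C wI tI (esym E2) _ _ _ _.
- by move=> /andP[h1 h2]; exact: O h1 h2 cd o1.
- by move=> /andP[h1 h2]; exact: O h1 h2 cd o3.
- by move=> /andP[h1 h2]; exact: O h1 h2 ab o2.
- by move=> /andP[h1 h2]; exact: O h1 h2 ab o4.
Qed.

End Interpolation.

Lemma status_proper (T : realDomainType) s (a b c d : T * T) : (7 < s)%N ->
  status s a b c d -> proper a b c d.
Proof.
have sw (x y z : T * T) : orient y x z = - orient x y z by rewrite /orient; ring.
case: s => [|[|[|[|[|[|[|[|[|[|s]]]]]]]]]] //= _; rewrite /status /proper /=; rewrite ?ltxx // (sw a b) (sw c d) !oppr_gt0 !andbT.
  by move=> /and4P[h1 h2 h3 h4]; rewrite pmulr_rlt0 // h2 nmulr_rlt0.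
by move=> /and4P[h1 h2 h3 h4]; rewrite nmulr_rlt0 // h2 pmulr_rlt0.
Qed.

Section Motion.
Variable R : realType.
Variable N : Z.
Hypothesis N0 : 0 < N.
Implicit Types (D E : zdiagram).
Local Notation em := (emb R N).

Lemma status_emb s (a b c d : zpoint) : status s (em a) (em b) (em c) (em d) = status s a b c d.
Proof.
have n0 : 0 < (zr R N)^-1 by rewrite invr_gt0 zr_gt0.
have S (x y : Z) : (0 < zr R x / zr R N - zr R y / zr R N) = (0 < x - y).
  by rewrite -mulrBl -zrN -zrD pmulr_lgt0 // zr_gt0.
rewrite /status /gaps /emb; case: s => [|[|[|[|[|[|[|[|[|[|s]]]]]]]]]] /=; rewrite ?S ?ltxx //.
all: by rewrite -!/(emb R N _) ?orient_emb_gt0.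
Qed.

Lemma level_embd D e : level (embd R N D) e = zlev D e.1 e.2.
Proof.
rewrite /level /zlev; have [h|h] := ltnP e.2 (size (nth [::] D e.1)).
  by rewrite vtx_embd.
by rewrite /vtx nth_embd (nth_default v0z) // nth_default ?size_map.
Qed.

Lemma mem_indices D e : (e \in indices D) = (e.2.+1 < size (nth [::] D e.1))%N.
Proof.
apply/flattenP/idP => [[s /mapP[i hi ->] /mapP[j hj ->]]|h] /=.
  by move: hj; rewrite mem_iota /= add0n; lia.
have hi : (e.1 < size D)%N.
  by rewrite ltnNge; apply/negP => hD; move: h; rewrite nth_default.
exists [seq (e.1, j) | j <- iota 0 (size (nth [::] D e.1)).-1].
  by apply/mapP; exists e.1; rewrite ?mem_iota.
by case: e h hi => i j /= h hi; apply/mapP; exists j; rewrite // mem_iota; lia.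
Qed.

(** The diagram at time t of the motion from D to E; the levels change at the
    start. *)
Definition tween D E (t : R) : diagram R :=
  mkseq (fun i => mkseq (fun j => (lerp t (em (zpos D i j)) (em (zpos E i j)),
    if t == 0 then zlev D i j else zlev E i j)) (size (nth [::] D i))) (size D).

Lemma one_moves_emb (l : seq (zpoint * zpoint)) : one_moves l ->
  one_moves [seq (em x.1, em x.2) | x <- l].
Proof.
rewrite /one_moves; apply: leq_trans; rewrite count_map; apply: sub_count => -[a b] /=.
by apply: contraNneq => ->.
Qed.

Lemma pairwise_mem (T : eqType) (r : rel T) (s : seq T) x y : pairwise r s ->
  x \in s -> y \in s -> x != y -> r x y || r y x.
Proof.
elim: s => //= z s IH /andP[/allP rz rs]; rewrite !inE.
move=> /orP[/eqP->|xs] /orP[/eqP->|ys] xy; first by rewrite eqxx in xy.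
- by rewrite rz.
- by rewrite rz ?orbT.
- exact: IH.
Qed.

Lemma zcrossC x y : zcross x y = zcross y x.
Proof.
have sw s (a b c d : zpoint) : s \in [:: 0; 1; 2; 3; 8; 9]%N ->
    zstatus s a b c d = zstatus (if odd s then s.-1 else s.+1) c d a b.
  by case: s => [|[|[|[|[|[|[|[|[|[|s]]]]]]]]]] // _; rewrite /zstatus /=; do 4 case: (Z.ltb _ _).
rewrite /zcross !lazy_hasE /= !orbF (sw 0%N) // (sw 1%N) // (sw 2%N) // (sw 3%N) //=.
rewrite (sw 8%N) // (sw 9%N) //=.
by do 6 case: (zstatus _ _ _ _ _).
Qed.

(** Each triple of edges is examined once, in the order of the list; P stands
    for a symmetric property. *)
Lemma triples_mem (I : eqType) (S : I -> strip) (P : I -> I -> I -> Prop) (s : seq I) e f g :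
    (forall x y z, triple_ok (S x) (S y) (S z) -> P x y z) ->
    (forall x y z, P x y z -> P y x z) -> (forall x y z, P x y z -> P x z y) ->
    triples_ok (map S s) -> e \in s -> f \in s -> g \in s ->
    e != f -> f != g -> e != g ->
    zcross (S e) (S f) -> zcross (S f) (S g) -> zcross (S e) (S g) ->
  P e f g.
Proof.
move=> ok P1 P2; elim: s e f g => //= h s IH e f g /andP[pw tr].
rewrite filter_map pairwise_map in pw.
have head x y : x \in s -> y \in s -> x != y -> zcross (S h) (S x) -> zcross (S h) (S y) ->
    zcross (S x) (S y) -> P h x y.
  move=> xs ys xy hx hy cxy; have := pairwise_mem pw (x := x) (y := y).
  rewrite !mem_filter /= hx hy xs ys xy cxy zcrossC cxy => /(_ isT isT isT)/orP[/ok //|/ok].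
  exact: P2.
rewrite !inE => /orP[/eqP->|es] /orP[/eqP->|fs] /orP[/eqP->|gs] ef fg eg cef cfg ceg;
  rewrite ?eqxx // in ef fg eg *.
- exact: head.
- by apply: P1; apply: head; rewrite // zcrossC.
- by apply: P2; apply: P1; apply: head; rewrite // zcrossC.
- exact: IH.
Qed.

Section Path.
Variables D E : zdiagram.
Hypothesis DE : motion N D E.

Let szDE : size E = size D.
Proof. by case/and4P: DE => /eqP. Qed.

Let arcs i : (i < size D)%N -> arc_ok N D E i.
Proof. by move=> hi; case/and4P: DE => _ /allP h _ _; apply: h; rewrite mem_iota. Qed.

Let szi i : size (nth [::] E i) = size (nth [::] D i).
Proof.
have [h|h] := ltnP i (size D); first by case/and5P: (arcs h) => /eqP.
by rewrite !nth_default // szDE.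
Qed.

Lemma nb_tween t i : nb_vertices (tween D E t) i = size (nth [::] D i).
Proof.
rewrite /nb_vertices; have [h|h] := ltnP i (size D).
  by rewrite nth_mkseq // size_mkseq.
by rewrite !nth_default // size_mkseq.
Qed.

Lemma pos_tween t i j : pos (tween D E t) i j = lerp t (em (zpos D i j)) (em (zpos E i j)).
Proof.
rewrite /pos /vtx; have [h|h] := ltnP i (size D); last first.
  have EX : nth [::] (tween D E t) i = [::] by rewrite nth_default // size_mkseq.
  have ED : nth [::] D i = [::] by rewrite nth_default.
  have EE : nth [::] E i = [::] by rewrite nth_default // szDE.
  rewrite /zpos EX ED EE !nth_nil lerp_id.
  by rewrite /emb /= zr0 mul0r.
rewrite nth_mkseq //; have [h'|h'] := ltnP j (size (nth [::] D i)).
  by rewrite nth_mkseq.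
rewrite nth_default ?size_mkseq // /zpos !(nth_default v0z) ?szi // lerp_id.
by rewrite /emb /= zr0 mul0r.
Qed.

Lemma level_tween t e : level (tween D E t) e =
  if t == 0 then zlev D e.1 e.2 else zlev E e.1 e.2.
Proof.
rewrite /level /vtx; have [h|h] := ltnP e.1 (size D); last first.
  have EX : nth [::] (tween D E t) e.1 = [::] by rewrite nth_default // size_mkseq.
  have ED : nth [::] D e.1 = [::] by rewrite nth_default.
  have EE : nth [::] E e.1 = [::] by rewrite nth_default // szDE.
  rewrite /zlev EX ED EE !nth_nil.
  by rewrite if_same.
rewrite nth_mkseq //; have [h'|h'] := ltnP e.2 (size (nth [::] D e.1)).
  by rewrite nth_mkseq.
rewrite nth_default ?size_mkseq // /zlev !(nth_default v0z) ?szi //.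
by rewrite if_same.
Qed.

Lemma tween0 : tween D E 0 = embd R N D.
Proof.
apply: (@eq_from_nth _ [::]); first by rewrite size_mkseq size_map.
rewrite size_mkseq => i hi; rewrite nth_mkseq // nth_embd.
apply: (@eq_from_nth _ ((0, 0), 0)); first by rewrite size_mkseq size_map.
rewrite size_mkseq => j hj; rewrite nth_mkseq // (nth_map v0z) // eqxx lerp0.
by [].
Qed.

Lemma tween1 : tween D E 1 = embd R N E.
Proof.
apply: (@eq_from_nth _ [::]); first by rewrite size_mkseq size_map szDE.
rewrite size_mkseq => i hi; rewrite nth_mkseq // nth_embd.
apply: (@eq_from_nth _ ((0, 0), 0)); first by rewrite size_mkseq size_map szi.
rewrite size_mkseq => j hj; rewrite nth_mkseq // (nth_map v0z) ?szi // oner_eq0 lerp1.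
by [].
Qed.

Let S := strip_of D E.

Let edge_size t e : is_edge (tween D E t) e = (e \in indices D).
Proof. by rewrite /is_edge nb_tween mem_indices. Qed.

Let moves4 (a b c d a' b' c' d' : zpoint) :
    (~~ zsame a a' + ~~ zsame b b' + (~~ zsame c c' + ~~ zsame d d') <= 1)%N ->
  one_moves [:: (a, a'); (b, b'); (c, c'); (d, d')].
Proof.
have E1 x y : zsame x y = (x == y) by [].
by rewrite /one_moves /= !E1; do 4 case: (_ == _).
Qed.

Let status_exclusive s s' (a b c d : zpoint) : (s < 8)%N -> (7 < s')%N ->
  status s a b c d -> status s' a b c d -> False.
Proof.
move=> s8 s8'; rewrite -!status_emb => h /(status_proper s8') /proper_meet[].
set m := meet_time _ _ _ _; set m' := meet_time _ _ _ _ => /andP[m0 m1] /andP[n0 n1] Em.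
have I (x : R) : 0 < x -> x < 1 -> 0 <= x <= 1 by move=> x0 x1; rewrite !ltW.
apply: (status_disjoint s8 h (z := lerp m (em a) (em b))); first by exists m; rewrite ?I.
by rewrite Em; exists m'; rewrite ?I.
Qed.

(** Two nonconsecutive edges either never meet, or cross all the time. *)
Lemma tween_pair e f : e \in indices D -> f \in indices D -> ~~ adjacent e f ->
  (forall t z, 0 <= t <= 1 -> on_edge (tween D E t) e z -> ~ on_edge (tween D E t) f z) \/
  [/\ zcross (S e) (S f), levels_ok (S e) (S f) &
      forall t, 0 <= t <= 1 -> crosses (tween D E t) e f].
Proof.
have half e' f' : ~~ adjacent e' f' -> pair_ok (S e') (S f') ->
    (forall t z, 0 <= t <= 1 -> on_edge (tween D E t) e' z -> ~ on_edge (tween D E t) f' z) \/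
    [/\ zcross (S e') (S f'), levels_ok (S e') (S f') &
        forall t, 0 <= t <= 1 -> crosses (tween D E t) e' f'].
  move=> naf; rewrite /pair_ok [label _]/= [label _]/= (negbTE naf).
  set m := (moves _ + moves _)%N; case/andP=> m1.
  rewrite lazy_hasE => /hasP[s _]; case: ifP => // st0 /andP[st1 lv].
  rewrite /S /strip_of /= in st0 st1.
  have st t : 0 <= t <= 1 -> status s (pos (tween D E t) e'.1 e'.2)
      (pos (tween D E t) e'.1 e'.2.+1) (pos (tween D E t) f'.1 f'.2)
      (pos (tween D E t) f'.1 f'.2.+1).
    move=> tI; rewrite !pos_tween; apply: status_tween => //; rewrite ?status_emb //.
      exact: (one_moves_emb (moves4 m1)).
    move: st1; case Em : m => [|m'] //= _; move: Em; rewrite /m /S /strip_of /=.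
    by case: zsameP => [<-|//]; case: zsameP => [<-|//]; case: zsameP => [<-|//];
       case: zsameP => [<-|//].
  have [s8|s8] := ltnP s 8.
    by left => t z tI; exact: status_disjoint s8 (st t tI).
  right; move: lv; rewrite ltnNge s8 [X in X -> _]/= => lv; split=> //.
    rewrite /zcross !lazy_hasE; case: hasP => [[s' hs' st']|_].
      have s'8 : (s' < 8)%N by move: hs'; rewrite !inE => /or4P[] /eqP->.
      by case: (status_exclusive s'8 s8 st' st0).
    apply/hasP; exists s => //; rewrite !inE.
    by move: s s8 st0 {st st1} => [|[|[|[|[|[|[|[|[|[|s]]]]]]]]]].
  by move=> t tI; exact: status_proper s8 (st t tI).
move=> He Hf naf; case/and4P: DE => _ _ pw _; rewrite pairwise_map in pw.
have nef : e != f by apply: contraNneq naf => ->; rewrite /adjacent eqxx leqnSn.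
have /orP[ok|ok] := pairwise_mem pw He Hf nef; first exact: half.
rewrite adjacentC in naf; case: (half f e naf ok) => [dis|[cr lv ct]].
  by left=> t z tI ez fz; exact: (dis t z tI fz ez).
right; split; [by rewrite zcrossC | | by move=> t tI; rewrite crossesC; exact: ct].
move: lv; rewrite /levels_ok => /and3P[l1 l2 /eqP l3].
rewrite eq_sym l1 eq_sym l2 /=; apply/eqP; move: l1 l2 l3.
by case: (ltgtP (level0 (S f))) => //; case: (ltgtP (level1 (S f))).
Qed.

Lemma offset_tween t (a b c d p q a' b' c' d' p' q' : point R) :
    one_moves [:: (a, a'); (b, b'); (c, c'); (d, d'); (p, p'); (q, q')] ->
  offset (lerp t a a') (lerp t b b') (lerp t c c') (lerp t d d') (lerp t p p') (lerp t q q') =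
  (1 - t) * offset a b c d p q + t * offset a' b' c' d' p' q'.
Proof.
rewrite /one_moves /=; have [<-|_] := eqVneq a a'; have [<-|_] := eqVneq b b';
  have [<-|_] := eqVneq c c'; have [<-|_] := eqVneq d d'; have [<-|_] := eqVneq p p';
  have [<-|_] := eqVneq q q'; rewrite ?lerp_id // => _; rewrite /offset /orient /=; ring.
Qed.

(** On the line through c and d, the coordinates of the points where the two
    other lines pass are the ratios of these numbers, and [offset] is the
    determinant that vanishes if they are equal. *)
Lemma offset_meet (a b c d p q z : point R) : offset a b c d p q != 0 ->
  segment a b z -> segment c d z -> ~ segment p q z.
Proof.
move=> o ab [u uI Ez] pq; move: o; rewrite /offset; apply/negP/negPn/eqP.
have := orient_seg ab; have := orient_seg pq; rewrite Ez !orient_lerp.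
set A := orient a b c; set B := orient a b d; set P := orient p q c; set Q := orient p q d.
move=> h1 h2; have [u0|u0] := eqVneq u 0.
  have A0 : A = 0 by rewrite u0 in h2; lra.
  have P0 : P = 0 by rewrite u0 in h1; lra.
  by rewrite A0 P0; ring.
apply: (mulfI u0); rewrite mulr0 mulrBr.
have -> : u * (P * B) = P * (u * B) by ring.
have -> : u * (Q * A) = (u * Q) * A by ring.
have -> : u * B = - (1 - u) * A by lra.
have -> : u * Q = - (1 - u) * P by lra.
by ring.
Qed.

Lemma offset_emb (a b c d p q : zpoint) : offset (em a) (em b) (em c) (em d) (em p) (em q) =
  zr R (offset a b c d p q) / zr R N ^+ 4.
Proof.
by rewrite /offset !orient_emb !zrE -!exprVn; ring.
Qed.

Let mid_emb a b : 0 < N -> zopen_in (N + N) (zmiddle a b) ->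
  `|(em a).1 + (em b).1| < 2 /\ `|(em a).2 + (em b).2| < 2.
Proof. by move=> _ /and4P[h1 h2 h3 h4]; split; exact: zmiddle_lt. Qed.

Let convex_lt (t x y k : R) : 0 <= t <= 1 -> `|x| < k -> `|y| < k -> `|(1 - t) * x + t * y| < k.
Proof.
move=> tI; rewrite !ltr_norml => /andP[x1 x2] /andP[y1 y2].
have X1 : 0 < k - x by lra. have X2 : 0 < k + x by lra.
have Y1 : 0 < k - y by lra. have Y2 : 0 < k + y by lra.
have := convex_gt0 tI X1 Y1; have := convex_gt0 tI X2 Y2; lra.
Qed.

(** The scalar product of two consecutive edges is affine in the time if an
    outer vertex moves, and concave if the middle one does. *)
Lemma turn_tween t (a b c a' b' c' : point R) : 0 <= t <= 1 ->
    one_moves [:: (a, a'); (b, b'); (c, c')] ->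
  (1 - t) * turn a b c + t * turn a' b' c' <= turn (lerp t a a') (lerp t b b') (lerp t c c').
Proof.
move=> tI.
have q0 : 0 <= t * (1 - t) * ((b'.1 - b.1) ^+ 2 + (b'.2 - b.2) ^+ 2).
  by apply: mulr_ge0; [apply: mulr_ge0; lra | rewrite addr_ge0 // sqr_ge0].
have eqW (x y : R) : x = y -> x <= y by move=> ->.
rewrite /one_moves /=; have [<-|_] := eqVneq b b'.
  have [<-|_] := eqVneq a a'; have [<-|_] := eqVneq c c'; rewrite ?lerp_id // => _;
  by apply: eqW; rewrite /turn /=; ring.
have [<-|_] := eqVneq a a'; have [<-|_] := eqVneq c c'; rewrite ?lerp_id // => _.
by rewrite -subr_ge0; apply: le_trans q0 _; apply: eqW; rewrite /turn /=; ring.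
Qed.

Let disk_vertex t i j : 0 <= t <= 1 -> (j < size (nth [::] D i))%N ->
  [/\ disk (pos (tween D E t) i j),
      (0 < j)%N -> (j.+1 < size (nth [::] D i))%N -> open_disk (pos (tween D E t) i j) &
      (j == 0)%N || (j == (size (nth [::] D i)).-1) -> ~ open_disk (pos (tween D E t) i j)].
Proof.
move=> tI hj; have hi : (i < size D)%N.
  by rewrite ltnNge; apply/negP => h; move: hj; rewrite nth_default.
have /and5P[_ n1 /allP ends /allP inn _] := arcs hi.
have op : (0 < j)%N -> (j.+1 < size (nth [::] D i))%N -> open_disk (pos (tween D E t) i j).
  move=> j0 jn; have /inn/andP[] : j \in iota 1 (size (nth [::] D i)).-2.
    by rewrite mem_iota j0 /=; lia.
  rewrite !zinsideE !(zopen_disk R) // => /asboolP[p1 p2] /asboolP[q1 q2].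
  by rewrite pos_tween; split; exact: convex_lt.
have cl : (j == 0)%N || (j == (size (nth [::] D i)).-1) ->
    disk (pos (tween D E t) i j) /\ ~ open_disk (pos (tween D E t) i j).
  move=> je; have /ends/and3P[/eqP Ep c] : j \in [:: 0; (size (nth [::] D i)).-1]%N.
    by rewrite !inE.
  rewrite (zopen_disk R) // => /asboolPn no; rewrite pos_tween -Ep lerp_id; split=> //.
  exact: zclosed_disk.
split=> //; last by case/cl.
have [j0|j0] := posnP j; first by case: cl; rewrite // j0.
have [jn|jn] := ltnP j.+1 (size (nth [::] D i)).
  by have [w1 w2] := op j0 jn; split; exact: ltW.
by case: cl => //; apply/orP; right; apply/eqP; lia.
Qed.

Lemma tween_zcross t e f : 0 <= t <= 1 -> e \in indices D -> f \in indices D ->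
  crosses (tween D E t) e f -> zcross (S e) (S f).
Proof.
move=> tI He Hf cr; have naf : ~~ adjacent e f.
  by apply/negP => /(adjacent_crossesF (tween D E t)); rewrite cr.
case: (tween_pair He Hf naf) => [dis|[]//].
have [/andP[s0 s1] /andP[u0 u1] E1] := proper_meet cr; exfalso.
set a := pos _ e.1 e.2 in s0 s1 E1; set b := pos _ e.1 e.2.+1 in s0 s1 E1.
apply: (dis t (lerp (meet_time a b (pos (tween D E t) f.1 f.2)
  (pos (tween D E t) f.1 f.2.+1)) a b) tI).
  by eexists; last reflexivity; rewrite !ltW.
by rewrite E1; eexists; last reflexivity; rewrite !ltW.
Qed.

Let arc_in e : e \in indices D -> (e.1 < size D)%N.
Proof.
rewrite mem_indices => h; rewrite ltnNge; apply/negP => hD.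
by move: h; rewrite nth_default.
Qed.

Let edge_in e : e \in indices D -> edge_ok N D E e.1 e.2.
Proof.
move=> He; have /and5P[_ n1 _ _ /andP[/allP edg _]] := arcs (arc_in He).
by apply: edg; rewrite mem_iota; move: He; rewrite mem_indices; lia.
Qed.

(** A segment of vectors that are not opposite does not meet the origin. *)
Let moving_vector t (x y x' y' : Z) : 0 <= t <= 1 ->
    (x * y' - y * x' != 0) || (0 < x * x' + y * y') ->
    (1 - t) * zr R x + t * zr R x' = 0 -> (1 - t) * zr R y + t * zr R y' = 0 -> False.
Proof.
move=> tI h v1 v2; have cr : zr R (x * y' - y * x') = 0.
  rewrite !zrE; have [t0|t0] := eqVneq t 0.
    have -> : zr R x = 0 by rewrite t0 in v1; lra.
    have -> : zr R y = 0 by rewrite t0 in v2; lra.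
    by ring.
  apply: (mulfI t0); rewrite mulr0.
  have -> : t * (zr R x * zr R y' - zr R y * zr R x') =
    zr R x * (t * zr R y') - zr R y * (t * zr R x') by ring.
  have -> : t * zr R y' = - (1 - t) * zr R y by lra.
  have -> : t * zr R x' = - (1 - t) * zr R x by lra.
  by ring.
case/orP: h => [|]; first by rewrite -(zr_eq R) zr0 cr eqxx.
rewrite -(zr_gt0 R) !zrE; move: (zr R x) (zr R y) (zr R x') (zr R y') v1 v2 => X Y X' Y' v1 v2.
move=> d0; have q0 : 0 <= X * X + Y * Y by rewrite -!expr2 addr_ge0 ?sqr_ge0.
have [t1|t1] := eqVneq t 0.
  have X0 : X = 0 by rewrite t1 in v1; lra.
  have Y0 : Y = 0 by rewrite t1 in v2; lra.
  by move: d0; rewrite X0 Y0 !mul0r addr0 ltxx.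
have tp : 0 < t by rewrite lt0r t1; case/andP: tI.
have k1 : 0 < t * (X * X' + Y * Y') by apply: mulr_gt0.
have k2 : 0 <= (1 - t) * (X * X + Y * Y) by apply: mulr_ge0 => //; lra.
have : X * ((1 - t) * X + t * X') + Y * ((1 - t) * Y + t * Y') = 0 by rewrite v1 v2 !mulr0 addr0.
lra.
Qed.

Let edge_facts e : e \in indices D ->
  let a := zpos D e.1 e.2 in let b := zpos D e.1 e.2.+1 in
  let a' := zpos E e.1 e.2 in let b' := zpos E e.1 e.2.+1 in
  [/\ zopen_in (N + N) (zmiddle a b), zopen_in (N + N) (zmiddle a' b') &
      ((b.1 - a.1) * (b'.2 - a'.2) - (b.2 - a.2) * (b'.1 - a'.1) != 0) ||
      (0 < (b.1 - a.1) * (b'.1 - a'.1) + (b.2 - a.2) * (b'.2 - a'.2))].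
Proof.
move=> He; have := edge_in He; rewrite /edge_ok.
set a := zpos D _ _; set b := zpos D _ _; set a' := zpos E _ _; set b' := zpos E _ _.
case/andP=> h; case: ifP => [/andP[/zsameP<- /zsameP<-] nab|_ /andP[h' hv]]; last by split.
split=> //; apply/orP; right; rewrite lt0r -!expr2 addr_ge0 ?sqr_ge0 // andbT.
rewrite paddr_eq0 ?sqr_ge0 // !sqrf_eq0 !subr_eq0; apply: contra nab => /andP[/eqP e1 /eqP e2].
by apply/zsameP; rewrite [a]surjective_pairing [b]surjective_pairing e1 e2.
Qed.

Lemma tween_edge t e : 0 <= t <= 1 -> e \in indices D ->
  pos (tween D E t) e.1 e.2 <> pos (tween D E t) e.1 e.2.+1.
Proof.
move=> tI He; have [_ _ h] := edge_facts He; rewrite !pos_tween => eqp.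
have e1 := congr1 fst eqp; have e2 := congr1 snd eqp; rewrite /emb /= in e1 e2.
have n0 : zr R N != 0 by rewrite gt_eqF // zr_gt0.
apply: (moving_vector tI h); rewrite /= !zrE; apply: (mulIf (invr_neq0 n0)); rewrite mul0r; lra.
Qed.

Let corner_facts (a b c a' b' c' : zpoint) (m := (~~ zsame a a' + ~~ zsame b b' + ~~ zsame c c')%N) :
    bends a b c && (if m is 0 then true else
      [&& (m <= 1)%N, bends a' b' c' &
       [|| Z.ltb 0 (zturn a b c) && Z.ltb 0 (zturn a' b' c'),
           Z.leb 0 (zorient a b c) && Z.leb 0 (zorient a' b' c') |
           Z.leb (zorient a b c) 0 && Z.leb (zorient a' b' c') 0]]) ->
  [/\ one_moves [:: (a, a'); (b, b'); (c, c')],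
      (orient a b c != 0) || (0 < turn a b c), (orient a' b' c' != 0) || (0 < turn a' b' c') &
      [|| (0 < turn a b c) && (0 < turn a' b' c'), (0 <= orient a b c) && (0 <= orient a' b' c') |
          (orient a b c <= 0) && (orient a' b' c' <= 0)]].
Proof.
have B x y z : bends x y z -> (orient x y z != 0) || (0 < turn x y z).
  by rewrite /bends -[Z.eqb _ _]/(orient x y z == 0); case: ifP.
have E1 x y : zsame x y = (x == y) by [].
case/andP=> b0; case Em : m => [|m'].
  move: Em; rewrite /m; case: (zsameP a a') => [<-|//]; case: (zsameP b b') => [<-|//].
  case: (zsameP c c') => [<-|//] _ _; split; [|exact: B|exact: B|].
    by rewrite /one_moves /= !eqxx.
  by apply/orP; right; rewrite !andbb; exact: le_total.
case/and3P => m1 b1 h; split; [|exact: B|exact: B|exact: h].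
by move: m1; rewrite -Em /m /one_moves /= !E1; do 3 case: (_ == _).
Qed.

(** If the three points are collinear at an inner time and do not change their
    side, then they are collinear all the time, and the edge goes straight on at
    both ends of the motion. *)
Lemma tween_corner t i j : 0 <= t <= 1 -> (j.+2 < size (nth [::] D i))%N ->
  let X := tween D E t in orient (pos X i j) (pos X i j.+1) (pos X i j.+2) = 0 ->
  0 < turn (pos X i j) (pos X i j.+1) (pos X i j.+2).
Proof.
move=> tI hj; have hi : (i < size D)%N.
  by rewrite ltnNge; apply/negP => h; move: hj; rewrite nth_default.
have /and5P[_ _ _ _ /andP[_ /allP cor]] := arcs hi.
have /cor : j \in iota 0 (size (nth [::] D i)).-2 by rewrite mem_iota; lia.
rewrite /= !pos_tween => /corner_facts[].
move: (zpos D i j) (zpos D i j.+1) (zpos D i j.+2) => a b c.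
move: (zpos E i j) (zpos E i j.+1) (zpos E i j.+2) => a' b' c'.
move=> m h0 h1 h; have m' := one_moves_emb m; rewrite /= in m'.
have t2 : 0 < (zr R N ^+ 2)^-1 by rewrite invr_gt0 exprn_gt0 // zr_gt0.
have TE (x y z : zpoint) : turn (em x) (em y) (em z) = zr R (turn x y z) / zr R N ^+ 2.
  by rewrite /turn /emb !zrE -exprVn /=; ring.
rewrite orient_tween // !orient_emb; move: (orient a b c) (orient a' b' c') h0 h1 h => o o' h0 h1 h hz.
have hz' : (1 - t) * zr R o + t * zr R o' = 0.
  by apply: (mulIf (lt0r_neq0 t2)); rewrite mul0r; lra.
apply: lt_le_trans (turn_tween tI m'); rewrite !TE.
suff : 0 < (1 - t) * zr R (turn a b c) + t * zr R (turn a' b' c').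
  by move=> k; have := mulr_gt0 k t2; lra.
have pos0 x : (0 <= zr R x) = (0 <= x) by rewrite -(zr0 R) zr_le.
have neg0 x : (zr R x <= 0) = (x <= 0) by rewrite -(zr0 R) zr_le.
have fin : 0 < turn a b c -> 0 < turn a' b' c' ->
    0 < (1 - t) * zr R (turn a b c) + t * zr R (turn a' b' c').
  by move=> k k'; apply: convex_gt0; rewrite ?zr_gt0.
have [t0|t0] := eqVneq t 0.
  have : zr R o == 0 by rewrite t0 in hz'; apply/eqP; lra.
  rewrite -(zr0 R) zr_eq => /eqP o0; move: h0; rewrite o0 eqxx /= -(zr_gt0 R) => k.
  by rewrite t0 mul0r addr0 subr0 mul1r.
have [t1|t1] := eqVneq t 1.
  have : zr R o' == 0 by rewrite t1 in hz'; apply/eqP; lra.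
  rewrite -(zr0 R) zr_eq => /eqP o0; move: h1; rewrite o0 eqxx /= -(zr_gt0 R) => k.
  by rewrite t1 mul1r subrr mul0r add0r.
have tp : 0 < t by rewrite lt0r t0; case/andP: tI.
have tq : 0 < 1 - t by rewrite subr_gt0 lt_neqAle t1; case/andP: tI.
have both : zr R o = 0 -> zr R o' = 0 -> 0 < (1 - t) * zr R (turn a b c) + t * zr R (turn a' b' c').
  move=> /eqP + /eqP; rewrite -(zr0 R) !zr_eq => /eqP o0 /eqP o0'.
  by apply: fin; [move: h0; rewrite o0 | move: h1; rewrite o0']; rewrite eqxx.
case/or3P: h => /andP[k k'].
- exact: fin.
- rewrite -pos0 in k; rewrite -pos0 in k'.
  have g1 := mulr_ge0 (ltW tq) k; have g2 := mulr_ge0 (ltW tp) k'.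
  have z1 : (1 - t) * zr R o = 0 by lra.
  have z2 : t * zr R o' = 0 by lra.
  apply: both; first by apply: (mulfI (lt0r_neq0 tq)); rewrite mulr0.
  by apply: (mulfI (lt0r_neq0 tp)); rewrite mulr0.
- rewrite -neg0 in k; rewrite -neg0 in k'.
  have g1 := mulr_ge0_le0 (ltW tq) k; have g2 := mulr_ge0_le0 (ltW tp) k'.
  have z1 : (1 - t) * zr R o = 0 by lra.
  have z2 : t * zr R o' = 0 by lra.
  apply: both; first by apply: (mulfI (lt0r_neq0 tq)); rewrite mulr0.
  by apply: (mulfI (lt0r_neq0 tp)); rewrite mulr0.
Qed.

Let moves6 (a b c d p q a' b' c' d' p' q' : zpoint) :
    (~~ zsame a a' + ~~ zsame b b' + (~~ zsame c c' + ~~ zsame d d') +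
     (~~ zsame p p' + ~~ zsame q q') <= 1)%N ->
  one_moves [:: (a, a'); (b, b'); (c, c'); (d, d'); (p, p'); (q, q')].
Proof.
have E1 x y : zsame x y = (x == y) by [].
by rewrite /one_moves /= !E1; do 6 case: (_ == _).
Qed.

(** The order of the crossings on an edge is given by the sign of [offset],
    which is affine in the time. *)
Lemma tween_triple t e f g z : 0 <= t <= 1 -> triple_ok (S e) (S f) (S g) ->
  on_edge (tween D E t) e z -> on_edge (tween D E t) f z -> ~ on_edge (tween D E t) g z.
Proof.
move=> tI /andP[m]; rewrite /S /strip_of /= in m *; have {}m := one_moves_emb (moves6 m).
move=> vv; apply: offset_meet; rewrite !pos_tween offset_tween // !offset_emb.
move: vv; set v := offset _ _ _ _ _ _; set v' := offset _ _ _ _ _ _.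
rewrite -(zr_gt0 R) zrM => vv.
have n4 : 0 < (zr R N ^+ 4)^-1 by rewrite invr_gt0 exprn_gt0 // zr_gt0.
rewrite !mulrA -mulrDl mulf_neq0 ?(lt0r_neq0 n4) //.
have [vp|vn|v0] := ltrgt0P (zr R v).
- by rewrite pmulr_rgt0 // in vv; rewrite lt0r_neq0 // convex_gt0.
- rewrite nmulr_rgt0 // in vv; rewrite -oppr_eq0 lt0r_neq0 // opprD -!mulrN.
  by rewrite convex_gt0 ?oppr_gt0.
- by rewrite v0 mul0r ltxx in vv.
Qed.

Lemma motion_rigid t : 0 <= t <= 1 -> rigid (tween D E t).
Proof.
move=> tI; split.
- move=> i; rewrite size_mkseq nb_tween => hi.
  by case/and5P: (arcs hi).
- move=> i j j0; rewrite nb_tween => jn.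
  by have [_ op _] := disk_vertex tI (ltnW jn); exact: op.
- move=> i; rewrite size_mkseq => hi; have /and5P[_ n1 _ _ _] := arcs hi.
  rewrite /last_pos nb_tween.
  have [d0 _ c0] := disk_vertex tI (ltnW n1).
  have hl : ((size (nth [::] D i)).-1 < size (nth [::] D i))%N by lia.
  have [d1 _ c1] := disk_vertex tI hl; split=> //; first exact: c0.
  by apply: c1; rewrite eqxx orbT.
- by move=> e; rewrite edge_size; exact: tween_edge.
- move=> e s; rewrite edge_size => He sI; have := He; rewrite mem_indices => he.
  have [d0 _ _] := disk_vertex tI (ltnW he); have [d1 _ _] := disk_vertex tI he.
  have [/(mid_emb N0)[m1 m2] /(mid_emb N0)[m3 m4] _] := edge_facts He.
  have mid (x y x' y' : R) : `|x + y| < 2 -> `|x' + y'| < 2 ->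
      `|((1 - t) * x + t * x') + ((1 - t) * y + t * y')| < 2.
    move=> h h'; have -> : (1 - t) * x + t * x' + ((1 - t) * y + t * y') =
      (1 - t) * (x + y) + t * (x' + y') by ring.
    exact: convex_lt.
  by apply: lerp_open => //; rewrite !pos_tween /=; exact: mid.
- by move=> i j; rewrite nb_tween; exact: tween_corner.
- move=> e f; rewrite !edge_size => He Hf naf.
  case: (tween_pair He Hf naf) => [dis|[_ /and3P[l1 l2 _] ct]]; first by left=> z; exact: dis.
  right; split; first exact: ct.
  by rewrite !level_tween; case: ifP => _; exact/eqP.
- move=> e f g z; rewrite !edge_size => He Hf Hg cef cfg ceg.
  have ne x y : crosses (tween D E t) x y -> x != y.
    by apply: contraTneq => ->; rewrite adjacent_crossesF // /adjacent eqxx leqnSn.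
  case/and4P: DE => _ _ _ tr.
  apply: (triples_mem (P := fun e f g => on_edge (tween D E t) e z ->
    on_edge (tween D E t) f z -> ~ on_edge (tween D E t) g z) _ _ _ tr He Hf Hg);
    do ?[exact: ne | exact: (tween_zcross tI)].
  + by move=> x y w; exact: tween_triple.
  + by move=> x y w h hy hx; exact: h.
  + by move=> x y w h hx hw hy; exact: (h hx hy hw).
Qed.

Lemma motion_isotopy : isotopy (embd R N D) (embd R N E).
Proof.
exists (tween D E); split.
- by rewrite tween0 tween1.
- move=> t tI; split; first exact: rigid_tangle (motion_rigid tI).
  rewrite -tween0 /shape /tween -!map_comp; apply: eq_map => i /=.
  by rewrite !size_mkseq.
- move=> i j.
  have cid : {within `[0, 1], continuous (fun t : R => t)}.
    by apply: continuous_subspaceT => x; exact: cvg_id.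
  have cst (x : R) : {within `[0, 1], continuous (fun _ : R => x)} by exact: cont01_cst.
  have C (x y : R) : {within `[0, 1], continuous (fun t : R => (1 - t) * x + t * y)}.
    apply: cont01D; apply: cont01M => //.
    by apply: cont01D => //; exact: cont01N.
  have F (f g : R -> R) : f = g -> {within `[0, 1], continuous g} ->
    {within `[0, 1], continuous f} by move=> ->.
  by split; apply: (F _ _ _ (C _ _)); apply/funext => t; rewrite pos_tween.
- move=> t i _; rewrite -tween0 /last_pos !nb_tween !pos_tween.
  have [hi|hi] := ltnP i (size D); last first.
    by rewrite /zpos !(nth_default [::] hi) !(nth_default [::] (s := E)) ?szDE // !nth_nil !lerp_id.
  have /and5P[_ _ /and3P[/and3P[/eqP -> _ _] /and3P[/eqP -> _ _] _] _ _] := arcs hi.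
  by rewrite !lerp_id.
- move=> t e f tI [He Hf naf [z [ez fz]]]; rewrite !edge_size in He Hf.
  case: (tween_pair He Hf naf) => [dis|[_ /and3P[_ _ /eqP lv] _]]; first by case: (dis t z tI ez fz).
  by rewrite !level_tween !level_embd; case: ifP.
Qed.

Lemma motion_tangles : tangle (embd R N D) /\ tangle (embd R N E).
Proof.
rewrite -tween0 -tween1; split; apply: rigid_tangle; apply: motion_rigid;
  by rewrite ?lexx ?ler01.
Qed.

End Path.
End Motion.

(** * Certificates *)

Definition zcontext : Type := seq (seq (zvertex + nat)).

Definition zfill (C : zcontext) (X : zdiagram) : zdiagram :=
  map (fun w => flatten (map (fun x =>
    match x with inl v => [:: v] | inr k => nth [::] X k end) w)) C.

Definition zholes (C : zcontext) : seq nat :=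
  pmap (fun x => if x is inr k then Some k else None) (flatten C).

(** The points of X have coordinates in half units, those of the image are on
    the grid. *)
Definition zmap (p q u r s v : Z) (a : zpoint) : zpoint :=
  (p * a.1 + q * a.2 + u, r * a.1 + s * a.2 + v).

Definition ztransport (f : zpoint -> zpoint) (X : zdiagram) : zdiagram :=
  map (map (fun v => (f v.1, v.2))) X.

Definition zlast (X : zdiagram) (x : zvertex + nat) : zpoint :=
  match x with inl v => v.1 | inr k => (last v0z (nth [::] X k)).1 end.
Definition zhead (X : zdiagram) (x : zvertex + nat) : zpoint :=
  match x with inl v => v.1 | inr k => (head v0z (nth [::] X k)).1 end.

Definition links (C : zcontext) : seq ((zvertex + nat) * (zvertex + nat)) :=
  flatten [seq zip w (behead w) | w <- C].

Definition corners (f : zpoint -> zpoint) : seq zpoint :=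
  map f [:: (-2, -2); (2, -2); (2, 2); (-2, 2)]%BZ.

(** Some line has the parallelogram with these corners on its left side and
    the segment from a to b on its right side. *)
Definition avoids (ks : seq zpoint) (a b : zpoint) : bool :=
  lazy_has (fun l : zpoint * zpoint =>
      [&& all (fun k => 0 <= orient l.1 l.2 k) ks, has (fun k => 0 < orient l.1 l.2 k) ks,
          orient l.1 l.2 a <= 0 & orient l.1 l.2 b <= 0])
    [:: (a, b), (b, a) & zip ks (rot 1 ks)].

Definition placed (N : Z) (f : zpoint -> zpoint) (det : Z) (C : zcontext) (X : zdiagram) : bool :=
  let Y := ztransport f X in let L := links C in
  [&& 0 < det, all (zclosed_in N) (corners f), perm_eq (zholes C) (iota 0 (size X)),
      all (fun l => avoids (corners f) (zlast Y l.1) (zhead Y l.2)) L &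
      all (fun l => if l.1 is inr _ then all (fun l' =>
        ~~ proper (zlast Y l.1) (zhead Y l.2) (zlast Y l'.1) (zhead Y l'.2)) L else true) L].

Section Placed.
Variable R : realType.
Variable N : Z.
Hypothesis N0 : 0 < N.

Definition embl (x : zvertex + nat) : vertex R + nat :=
  match x with inl v => inl (embv R N v) | inr k => inr k end.
Definition embC (C : zcontext) : context R := map (map embl) C.

Lemma fill_emb C X : fill (embC C) (embd R N X) = embd R N (zfill C X).
Proof.
rewrite /fill /embC /embd /zfill -!map_comp; apply: eq_map => w /=.
rewrite map_flatten -!map_comp; congr flatten; apply: eq_map => -[v|k] //=.
by rewrite -/(embd R N X) nth_embd.
Qed.

Lemma holes_emb C : holes (embC C) = zholes C.
Proof.
rewrite /holes /embC /zholes; elim: C => [|w C IH] //=; rewrite !pmap_cat IH; congr (_ ++ _).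
by elim: w => [|[v|k] w IHw] //=; rewrite IHw.
Qed.

Variables p q u r s v : Z.
Let f := zmap p q u r s v.

Definition affine_of (z : point R) : point R :=
  (2 * zr R p / zr R N * z.1 + 2 * zr R q / zr R N * z.2 + zr R u / zr R N,
   2 * zr R r / zr R N * z.1 + 2 * zr R s / zr R N * z.2 + zr R v / zr R N).

Let n0 : zr R N != 0. Proof. by rewrite gt_eqF // zr_gt0. Qed.

Lemma affine_of_emb a : affine_of (emb R 2%BZ a) = emb R N (f a).
Proof.
by rewrite /affine_of /emb /f /zmap /= zr2 !zrE; congr pair; field.
Qed.

Lemma transport_emb X : transport affine_of (embd R 2%BZ X) = embd R N (ztransport f X).
Proof.
rewrite /transport /embd /ztransport -!map_comp; apply: eq_map => w /=.
by rewrite -!map_comp; apply: eq_map => x /=; rewrite affine_of_emb.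
Qed.

Hypothesis det0 : 0 < p * s - q * r.

Lemma affine_of_oriented : oriented_affine affine_of.
Proof.
exists (2 * zr R p / zr R N), (2 * zr R q / zr R N), (2 * zr R r / zr R N),
  (2 * zr R s / zr R N), (zr R u / zr R N), (zr R v / zr R N); split=> //.
have -> : 2 * zr R p / zr R N * (2 * zr R s / zr R N) -
    2 * zr R q / zr R N * (2 * zr R r / zr R N) =
    4 * zr R (p * s - q * r) * (zr R N ^+ 2)^-1 by rewrite !zrE; field.
by rewrite mulr_gt0 ?invr_gt0 ?exprn_gt0 ?mulr_gt0 ?zr_gt0.
Qed.

Let cornerP (x y : Z) :
  affine_of (zr R x / 2, zr R y / 2) = emb R N (f (x, y)).
Proof. by rewrite -affine_of_emb /emb /= zr2. Qed.

(* The barycentric weights of a point of the square are the products of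
   half sums of 1 and of its coordinates up to sign. *)
Let bary (F : point R -> R) z : (exists x y w : R, forall z, F z = x * z.1 + y * z.2 + w) ->
  4 * F z = (1 - z.1) * (1 - z.2) * F (-1, -1) + (1 + z.1) * (1 - z.2) * F (1, -1) +
            (1 + z.1) * (1 + z.2) * F (1, 1) + (1 - z.1) * (1 + z.2) * F (-1, 1).
Proof. by move=> [x [y [w E]]]; rewrite !E /=; ring. Qed.

Let unit_le (x : R) : `|x| <= 1 -> 0 <= 1 - x /\ 0 <= 1 + x.
Proof. by rewrite ler_norml => /andP[x1 x2]; split; lra. Qed.

Let unit_lt (x : R) : `|x| < 1 -> 0 < 1 - x /\ 0 < 1 + x.
Proof. by rewrite ltr_norml => /andP[x1 x2]; split; lra. Qed.

Let half1 : zr R 2%BZ / 2 = 1. Proof. by rewrite zr2 divff. Qed.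
Let half2 : zr R (-2)%BZ / 2 = -1.
Proof. by rewrite (_ : (-2)%BZ = - 2%BZ) // zrN zr2; field. Qed.

Let corner_vals : [/\ affine_of (-1, -1) = emb R N (f (-2, -2)%BZ),
  affine_of (1, -1) = emb R N (f (2, -2)%BZ), affine_of (1, 1) = emb R N (f (2, 2)%BZ) &
  affine_of (-1, 1) = emb R N (f (-2, 2)%BZ)].
Proof. by rewrite -!cornerP /= half1 half2. Qed.

Let corner_val (F : point R -> Prop) : (forall k, k \in corners f -> F (emb R N k)) ->
  [/\ F (affine_of (-1, -1)), F (affine_of (1, -1)), F (affine_of (1, 1)) & F (affine_of (-1, 1))].
Proof.
have [-> -> -> ->] := corner_vals.
by move=> h; split; apply: h; rewrite !inE eqxx ?orbT.
Qed.

Lemma affine_of_disk : all (zclosed_in N) (corners f) -> forall z, disk z -> disk (affine_of z).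
Proof.
move=> /allP cl z [z1 z2].
have [c1 c2 c3 c4] := corner_val (F := @disk R) (fun k hk => zclosed_disk R N0 (cl k hk)).
have bd (F : point R -> R) : (exists x y w : R, forall z, F z = x * z.1 + y * z.2 + w) ->
    `|F (-1, -1)| <= 1 -> `|F (1, -1)| <= 1 -> `|F (1, 1)| <= 1 -> `|F (-1, 1)| <= 1 ->
    `|F z| <= 1.
  move=> /(bary z); move: (F z) (F (-1, -1)) (F (1, -1)) (F (1, 1)) (F (-1, 1)).
  move=> x x1 x2 x3 x4; have [a1 a2] := unit_le z1; have [b1 b2] := unit_le z2.
  move=> + /unit_le[p1 q1] /unit_le[p2 q2] /unit_le[p3 q3] /unit_le[p4 q4].
  have := mulr_ge0 a1 b1; have := mulr_ge0 a2 b1; have := mulr_ge0 a2 b2; have := mulr_ge0 a1 b2.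
  have : (1 - z.1) * (1 - z.2) + (1 + z.1) * (1 - z.2) + (1 + z.1) * (1 + z.2) +
    (1 - z.1) * (1 + z.2) = 4 by ring.
  move: (_ * _) ((1 + z.1) * (1 - z.2)) ((1 + z.1) * (1 + z.2)) ((1 - z.1) * (1 + z.2)).
  move=> k1 k2 k3 k4 tot w4 w3 w2 w1 E; rewrite ler_norml.
  have u1 := mulr_ge0 w1 p1; have u2 := mulr_ge0 w2 p2; have u3 := mulr_ge0 w3 p3.
  have u4 := mulr_ge0 w4 p4; have v1 := mulr_ge0 w1 q1; have v2 := mulr_ge0 w2 q2.
  have v3 := mulr_ge0 w3 q3; have v4 := mulr_ge0 w4 q4.
  by apply/andP; split; lra.
case: c1 c2 c3 c4 => a1 b1 [a2 b2] [a3 b3] [a4 b4].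
split; [apply: (bd (fun z => (affine_of z).1)) | apply: (bd (fun z => (affine_of z).2))] => //=.
  by eexists; eexists; eexists => ?; reflexivity.
by eexists; eexists; eexists => ?; reflexivity.
Qed.

(** An affine form that is nonnegative at the corners of a parallelogram, and not
    zero at all of them, is positive inside. *)
Lemma avoids_region a b z : avoids (corners f) a b -> segment (emb R N a) (emb R N b) z ->
  ~ region affine_of z.
Proof.
rewrite /avoids lazy_hasE => /hasP[[g h] _ /and4P[/allP ge0 /hasP[k0 hk0 gt0] la lb]] on.
have n2 : 0 < (zr R N ^+ 2)^-1 by rewrite invr_gt0 exprn_gt0 // zr_gt0.
have val x : (0 <= orient (emb R N g) (emb R N h) (emb R N x)) = (0 <= orient g h x).
  by rewrite orient_emb pmulr_lge0 // -(zr0 R) zr_le.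
have val' x : (orient (emb R N g) (emb R N h) (emb R N x) <= 0) = (orient g h x <= 0).
  by rewrite orient_emb pmulr_lle0 // -(zr0 R) zr_le.
move=> [y [y1 y2] Ey]; subst z.
have le0 : orient (emb R N g) (emb R N h) (affine_of y) <= 0.
  case: on => t /andP[t0 t1] ->; rewrite orient_lerp.
  by rewrite -oppr_ge0 opprD -!mulrN addr_ge0 // mulr_ge0 ?subr_ge0 // oppr_ge0 val'.
pose F z := orient (emb R N g) (emb R N h) (affine_of z).
have aff : exists x y w : R, forall z, F z = x * z.1 + y * z.2 + w.
  rewrite /F /orient /affine_of; move: (emb R N g) (emb R N h) => G H.
  exists ((H.1 - G.1) * (2 * zr R r / zr R N) - (H.2 - G.2) * (2 * zr R p / zr R N)),
    ((H.1 - G.1) * (2 * zr R s / zr R N) - (H.2 - G.2) * (2 * zr R q / zr R N)),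
    ((H.1 - G.1) * (zr R v / zr R N - G.2) - (H.2 - G.2) * (zr R u / zr R N - G.1)) => z /=.
  by ring.
have [c1 c2 c3 c4] : [/\ 0 <= F (-1, -1), 0 <= F (1, -1), 0 <= F (1, 1) & 0 <= F (-1, 1)].
  apply: (corner_val (F := fun x => 0 <= orient (emb R N g) (emb R N h) x)) => k hk.
  by rewrite val; exact: ge0.
have pos : 0 < F (-1, -1) + F (1, -1) + F (1, 1) + F (-1, 1).
  rewrite lt0r; apply/andP; split; last lra.
  apply/eqP => z0.
  have [d1 d2 d3 d4] : [/\ F (-1, -1) <= 0, F (1, -1) <= 0, F (1, 1) <= 0 & F (-1, 1) <= 0].
    by split; lra.
  have : orient (emb R N g) (emb R N h) (emb R N k0) <= 0.
    move: d1 d2 d3 d4; rewrite /F; have [-> -> -> ->] := corner_vals.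
    by move: hk0; rewrite !inE => /or4P[] /eqP->.
  by rewrite val' leNgt gt0.
have := bary y aff; move: le0; rewrite -/(F y).
have [a1 a2] := unit_lt y1; have [b1 b2] := unit_lt y2.
have w1 := mulr_gt0 a1 b1; have w2 := mulr_gt0 a2 b1; have w3 := mulr_gt0 a2 b2.
have w4 := mulr_gt0 a1 b2.
move: w1 w2 w3 w4 c1 c2 c3 c4 pos.
move: ((1 - y.1) * (1 - y.2)) ((1 + y.1) * (1 - y.2)) ((1 + y.1) * (1 + y.2)) ((1 - y.1) * (1 + y.2)).
move: (F y) (F (-1, -1)) (F (1, -1)) (F (1, 1)) (F (-1, 1)).
move=> x x1 x2 x3 x4 k1 k2 k3 k4 w1 w2 w3 w4 c1 c2 c3 c4 pos le0 E.
have m1 := mulr_ge0 (ltW w1) c1; have m2 := mulr_ge0 (ltW w2) c2.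
have m3 := mulr_ge0 (ltW w3) c3; have m4 := mulr_ge0 (ltW w4) c4.
have sum0 : k1 * x1 + k2 * x2 + k3 * x3 + k4 * x4 <= 0 by rewrite -E mulr_ge0_le0.
have Z (k y0 : R) : 0 < k -> 0 <= k * y0 -> k * y0 <= 0 -> y0 = 0.
  by move=> kp h0 h1; apply: (mulfI (lt0r_neq0 kp)); rewrite mulr0; apply/le_anti/andP.
have l1 : k1 * x1 <= 0 by lra.
have l2 : k2 * x2 <= 0 by lra.
have l3 : k3 * x3 <= 0 by lra.
have l4 : k4 * x4 <= 0 by lra.
move: pos; rewrite (Z _ _ w1 m1 l1) (Z _ _ w2 m2 l2) (Z _ _ w3 m3 l3) (Z _ _ w4 m4 l4).
by rewrite !addr0 ltxx.
Qed.

End Placed.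

(** The point p is on the line through a and b, strictly between them. *)
Definition between (a b p : zpoint) : bool :=
  [&& orient a b p == 0,
      0 < (p.1 - a.1) * (b.1 - a.1) + (p.2 - a.2) * (b.2 - a.2) &
      (p.1 - a.1) * (b.1 - a.1) + (p.2 - a.2) * (b.2 - a.2) <
      (b.1 - a.1) * (b.1 - a.1) + (b.2 - a.2) * (b.2 - a.2)].

Definition change (D : zdiagram) (i : nat) (g : zarc -> zarc) : zdiagram :=
  take i D ++ g (nth [::] D i) :: drop i.+1 D.

Definition insert (D : zdiagram) (i j : nat) (p : zpoint) : zdiagram :=
  change D i (fun w => take j.+1 w ++ (p, (nth v0z w j).2) :: drop j.+1 w).

Definition can_insert (D : zdiagram) (i j : nat) (p : zpoint) : bool :=
  [&& (i < size D)%N, (j.+1 < size (nth [::] D i))%N & between (zpos D i j) (zpos D i j.+1) p].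

(** The positions of a local picture are given by the first vertices of its
    arcs; n is the list of the numbers of their vertices. *)
Fixpoint cut_arc (hs : seq (nat * nat)) (n : seq nat) (i j skip : nat) (w : zarc) :
    seq (zvertex + nat) :=
  if w is v :: w' then
    if skip is s.+1 then cut_arc hs n i j.+1 s w'
    else let k := index (i, j) hs in
      if (k < size hs)%N then inr k :: cut_arc hs n i j.+1 (nth 0%N n k).-1 w'
      else inl v :: cut_arc hs n i j.+1 0 w'
  else [::].

Definition cut (D : zdiagram) (hs : seq (nat * nat)) (X : zdiagram) : zcontext :=
  [seq cut_arc hs (map size X) i 0 0 (nth [::] D i) | i <- iota 0 (size D)].

(** [Mv] moves a vertex, [Sub] and [Del] insert and delete one in a straight
    edge, [Lv] changes the levels, and [App] applies a move, or its inverse. *)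
Inductive op : Type :=
  | Mv of nat & nat & Z & Z
  | Sub of nat & nat & Z & Z
  | Del of nat & nat
  | Lv of seq (seq nat)
  | App of move & bool & Z & Z & Z & Z & Z & Z & seq (nat * nat).

Definition guard (b : bool) (D : zdiagram) : option zdiagram := if b then Some D else None.

Definition run (N : Z) (o : op) (D : zdiagram) : option zdiagram :=
  match o with
  | Mv i j x y =>
      let E := change D i (fun w => set_nth v0z w j ((x, y), zlev D i j)) in
      guard (motion N D E) E
  | Sub i j x y =>
      let E := insert D i j (x, y) in
      if can_insert D i j (x, y) then guard (motion N E E) E else None
  | Del i j =>
      let E := change D i (fun w => take j.+1 w ++ drop j.+2 w) in
      let p := zpos D i j.+1 in
      if can_insert E i j p && (insert E i j p == D) then guard (motion N E E) E else None
  | Lv l =>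
      let E := [seq [seq (y.1.1, Posz y.2 - 1) | y <- zip x.1 x.2] | x <- zip D l] in
      guard (motion N D E) E
  | App m fwd p q u r s v hs =>
      let X := if fwd then (zsides m).1 else (zsides m).2 in
      let X' := if fwd then (zsides m).2 else (zsides m).1 in
      let f := zmap p q u r s v in
      let C := cut D hs X in
      let D1 := zfill C (ztransport f X) in
      let D2 := zfill C (ztransport f X') in
      if placed N f (p * s - q * r) C X && motion N D D1 then guard (motion N D2 D2) D2 else None
  end.

Fixpoint run_all (N : Z) (l : seq op) (D : zdiagram) : option zdiagram :=
  if l is o :: l' then
    if run N o D is Some D' then run_all N l' D' else None
  else Some D.

Definition uses (o : op) : seq move := if o is App m _ _ _ _ _ _ _ _ then [:: m] else [::].

Section Soundness.
Variable R : realType.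

Definition reaches (S : set move) (D D' : diagram R) : Prop :=
  clos_refl_sym_trans (diagram R) (step S) D D'.

Lemma sides_tangle m : tangle (sides R m).1 /\ tangle (sides R m).2.
Proof.
have N0 : 0 < (2%BZ : Z) by [].
rewrite (sides_emb R m) /=.
have [m1 m2] : motion 2%BZ (zsides m).1 (zsides m).1 /\ motion 2%BZ (zsides m).2 (zsides m).2.
  by case: m; split; vm_compute.
by split; [exact: (motion_tangles R N0 m1).1 | exact: (motion_tangles R N0 m2).1].
Qed.

Section Grid.
Variable N : Z.
Hypothesis N0 : 0 < N.
Local Notation em D := (embd R N D).

Lemma embv0 : embv R N v0z = ((0, 0), 0).
Proof. by rewrite /embv /emb /= zr0 mul0r. Qed.

Lemma letter_emb C i r : has_letter (embC R N C) i r ->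
  letter (embC R N C) i r = embl R N (nth (inr 0%N) (nth [::] C i) r).
Proof.
rewrite /has_letter /letter /embC => h; have hi : (i < size C)%N.
  by rewrite ltnNge; apply/negP => hC; move: h; rewrite nth_default // size_map.
by rewrite (nth_map [::]) // in h *; rewrite (nth_map (inr 0%N)) // -(size_map (embl R N)).
Qed.

Lemma mem_links C i r : has_letter (embC R N C) i r.+1 ->
  (nth (inr 0%N) (nth [::] C i) r, nth (inr 0%N) (nth [::] C i) r.+1) \in links C.
Proof.
rewrite /has_letter /embC => h; have hi : (i < size C)%N.
  by rewrite ltnNge; apply/negP => hC; move: h; rewrite nth_default // size_map.
rewrite (nth_map [::]) // size_map in h.
apply/flattenP; exists (zip (nth [::] C i) (behead (nth [::] C i))).
  by apply: map_f; exact: mem_nth.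
have hz : (r < size (zip (nth [::] C i) (behead (nth [::] C i))))%N.
  by rewrite size_zip size_behead; lia.
apply/(nthP (inr 0%N, inr 0%N)); exists r => //.
by rewrite nth_zip_cond hz /= nth_behead.
Qed.

Lemma block_ends C Y i r : has_letter (embC R N C) i r ->
  (block_last (embC R N C) (em Y) i r).1 = emb R N (zlast Y (nth (inr 0%N) (nth [::] C i) r)) /\
  (block_head (embC R N C) (em Y) i r).1 = emb R N (zhead Y (nth (inr 0%N) (nth [::] C i) r)).
Proof.
move=> hr; rewrite /block_last /block_head letter_emb //.
case: (nth _ _ r) => [v|k] //=; rewrite nth_embd -embv0 last_map; split=> //.
by case: (nth [::] Y k).
Qed.

(** The context is that of a grid diagram, and the conditions of [localize] hold
    by [placed]. *)
Lemma placed_reaches S p q u r s v C X X' :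
    let f := zmap p q u r s v in
    placed N f (p * s - q * r) C X -> tangle (em (zfill C (ztransport f X))) ->
    tangle (embd R 2%BZ X) -> reaches S (embd R 2%BZ X) (embd R 2%BZ X') ->
  reaches S (em (zfill C (ztransport f X))) (em (zfill C (ztransport f X'))).
Proof.
rewrite /=; set f := zmap p q u r s v => /and5P[det0 cl holesX /allP out /allP ex] tD tX.
rewrite -!(fill_emb R N) -!(transport_emb R N0) in tD *.
have aff := affine_of_oriented R N0 u v det0.
have hC : perm_eq (holes (embC R N C)) (iota 0 (size (embd R 2%BZ X))).
  by rewrite holes_emb size_map.
have sX k : (k < size (embd R 2%BZ X))%N -> (1 < nb_vertices (embd R 2%BZ X) k)%N.
  exact: tangle_size.
set phi := @affine_of R N p q u r s v in aff tD *.
have dphi z : disk z -> disk (phi z) by exact: affine_of_disk.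
have hT : perm_eq (holes (embC R N C)) (iota 0 (size (transport phi (embd R 2%BZ X)))).
  by rewrite size_map.
have sT k : (k < size (transport phi (embd R 2%BZ X)))%N ->
    (1 < nb_vertices (transport phi (embd R 2%BZ X)) k)%N.
  by rewrite size_map nb_transport; exact: sX.
have ends i k : has_letter (embC R N C) i k.+1 ->
    let l := (nth (inr 0%N) (nth [::] C i) k, nth (inr 0%N) (nth [::] C i) k.+1) in
    pos (fill (embC R N C) (transport phi (embd R 2%BZ X))) i
      (outer_edge (embC R N C) (transport phi (embd R 2%BZ X)) i k).2 =
      emb R N (zlast (ztransport f X) l.1) /\
    pos (fill (embC R N C) (transport phi (embd R 2%BZ X))) i
      (outer_edge (embC R N C) (transport phi (embd R 2%BZ X)) i k).2.+1 =
      emb R N (zhead (ztransport f X) l.2).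
  move=> hk; have [E1 E2] := outer_vtx hT sT hk; rewrite /pos E1 E2 transport_emb //.
  by have [-> _] := block_ends (ztransport f X) (ltnW hk); have [_ ->] := block_ends (ztransport f X) hk.
apply: (localize aff dphi hC tX tD); last exact: sides_tangle.
  apply: (looks_fill aff hC sX) => i k z hk.
  rewrite /on_edge; have [-> ->] := ends i k hk.
  by apply: avoids_region => //; have := out _ (mem_links hk).
move=> k i c i' c' hk hc hc'; rewrite /crosses.
have [-> ->] := ends i c hc; have [-> ->] := ends i' c' hc'; rewrite proper_emb //.
have := ex _ (mem_links hc); rewrite /=.
have := hk.2; rewrite letter_emb ?(ltnW hc) //; last exact: ltnW hc.
case: (nth _ _ c) => [//|k'] _ /allP/(_ _ (mem_links hc')).
by move/negbTE.
Qed.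

Lemma insert_subdivision D i j p : can_insert D i j p -> subdivision (em D) (em (insert D i j p)).
Proof.
move=> /and3P[hi hj /and3P[/eqP l0 d0 d1]].
set w := nth [::] D i in hj.
pose a := nth v0z w j; pose b := nth v0z w j.+1.
have Ew : w = take j w ++ [:: a, b & drop j.+2 w].
  by rewrite -{1}(cat_take_drop j w) (drop_nth v0z) ?(ltnW hj) // (drop_nth v0z hj).
have ED : D = take i D ++ w :: drop i.+1 D by rewrite -{1}(cat_take_drop i D) (drop_nth [::]).
exists (em (take i D)), (em (drop i.+1 D)), (map (embv R N) (take j w)), (map (embv R N) (drop j.+2 w)).
exists (embv R N a), (embv R N b).
have Eins : insert D i j p =
    take i D ++ (take j w ++ [:: a, (p, a.2), b & drop j.+2 w]) :: drop i.+1 D.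
  rewrite /insert /change -/w (take_nth v0z) ?(ltnW hj) // (drop_nth v0z hj).
  by rewrite cat_rcons.
have Ea : zpos D i j = a.1 by []; have Eb : zpos D i j.+1 = b.1 by [].
rewrite {}Ea {}Eb in l0 d0 d1; move: d0 d1; rewrite -(zr_gt0 R) -(zr_lt R).
set d := zr R _; set q := zr R _ => d0 dq.
have q0 : 0 < q by exact: lt_trans dq.
have l0' : (zr R b.1.1 - zr R a.1.1) * (zr R p.2 - zr R a.1.2) -
           (zr R b.1.2 - zr R a.1.2) * (zr R p.1 - zr R a.1.1) = 0.
  by have := congr1 (zr R) l0; rewrite /orient !zrE.
exists (d / q); split.
- by rewrite divr_gt0 // ltr_pdivrMr // mul1r.
- transitivity (em (take i D ++ (take j w ++ [:: a, b & drop j.+2 w]) :: drop i.+1 D)).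
    by rewrite -Ew -ED.
  by rewrite /embd map_cat /= map_cat.
rewrite Eins /embd map_cat /= map_cat /=.
suff -> : embv R N (p, a.2) = (lerp (d / q) (embv R N a).1 (embv R N b).1, (embv R N a).2) by [].
have n0 : zr R N != 0 by rewrite gt_eqF // zr_gt0.
have qn : q != 0 by rewrite gt_eqF.
have key (x y z : Z) : d * (zr R y - zr R x) = q * (zr R z - zr R x) ->
    zr R z / zr R N = (1 - d / q) * (zr R x / zr R N) + d / q * (zr R y / zr R N).
  move=> h; have -> : zr R z = zr R x + d / q * (zr R y - zr R x).
    by rewrite mulrAC h mulrAC divff // mul1r; ring.
  by ring.
congr pair; apply: point_eqP; rewrite /emb /=; apply: key; rewrite /d /q !zrE.
  apply/eqP; rewrite -subr_eq0; apply/eqP.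
  transitivity ((zr R b.1.2 - zr R a.1.2) * ((zr R b.1.1 - zr R a.1.1) * (zr R p.2 - zr R a.1.2) -
           (zr R b.1.2 - zr R a.1.2) * (zr R p.1 - zr R a.1.1))); first by ring.
  by rewrite l0' mulr0.
apply/eqP; rewrite -subr_eq0; apply/eqP.
transitivity (- (zr R b.1.1 - zr R a.1.1) * ((zr R b.1.1 - zr R a.1.1) * (zr R p.2 - zr R a.1.2) -
         (zr R b.1.2 - zr R a.1.2) * (zr R p.1 - zr R a.1.1))); first by ring.
by rewrite l0' mulr0.
Qed.

Lemma motion_reaches S D E : motion N D E ->
  tangle (em E) /\ reaches S (em D) (em E).
Proof.
move=> mDE; have [tD tE] := motion_tangles R N0 mDE; split=> //.
by apply: rst_step; split=> //; apply: Or31; exact: motion_isotopy.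
Qed.

(** An operation is a sequence of steps, if the moves that it uses are. *)
Lemma run_reaches S o D D' :
    (forall m, m \in uses o -> reaches S (sides R m).1 (sides R m).2) ->
    tangle (em D) -> run N o D = Some D' ->
  tangle (em D') /\ reaches S (em D) (em D').
Proof.
have gd (b : bool) E : guard b E = Some D' -> b /\ E = D' by case: b => //= -[->].
case: o => [i j x y|i j x y|i j|l|m fwd p q u r s v hs] us tD /=.
- by case/gd => mo <-; exact: motion_reaches.
- case: ifP => // sp /gd[mo <-]; have [tE _] := motion_tangles R N0 mo; split=> //.
  by apply: rst_step; split=> //; apply: Or32; exact: insert_subdivision.
- case: ifP => // /andP[sp /eqP ED] /gd[mo <-].
  have [tE _] := motion_tangles R N0 mo; split=> //.
  apply: rst_sym; apply: rst_step; split=> //; apply: Or32; rewrite -[in em D]ED.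
  exact: insert_subdivision.
- by case/gd => mo <-; exact: motion_reaches.
case: ifP => // /andP[pl mo1] /gd[mo2 <-].
have [t1 r1] := motion_reaches S mo1; have [t2 _] := motion_tangles R N0 mo2.
split=> //; apply: rst_trans r1 _; apply: placed_reaches pl t1 _ _.
  by have [ts ts'] := sides_tangle m; rewrite sides_emb in ts ts'; case: (fwd).
have := us m; rewrite inE eqxx => /(_ isT); rewrite sides_emb.
by case: (fwd) => //; exact: rst_sym.
Qed.

Lemma run_all_reaches S l D D' :
    (forall m, m \in flatten (map uses l) -> reaches S (sides R m).1 (sides R m).2) ->
    tangle (em D) -> run_all N l D = Some D' -> reaches S (em D) (em D').
Proof.
elim: l D => [|o l IH] D us tD /=; first by case=> ->; exact: rst_refl.
case E : (run N o D) => [E'|] // run'.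
have us1 m : m \in uses o -> reaches S (sides R m).1 (sides R m).2.
  by move=> hm; apply: us; rewrite /= mem_cat hm.
have [tE r1] := run_reaches us1 tD E.
apply: rst_trans r1 (IH _ _ tE run') => m hm.
by apply: us; rewrite /= mem_cat hm orbT.
Qed.

End Grid.
Definition scale (K : Z) (X : zdiagram) : zdiagram :=
  map (map (fun x => ((K * x.1.1, K * x.1.2), x.2))) X.

Lemma emb_scale K X : 0 < K -> embd R (2%BZ * K) (scale K X) = embd R 2%BZ X.
Proof.
move=> K0; have k0 : zr R K != 0 by rewrite gt_eqF // zr_gt0.
rewrite /embd /scale -!map_comp; apply: eq_map => w /=; rewrite -map_comp.
have E2 : zr R (2%BZ * K) = 2 * zr R K by rewrite zrM zr2.
apply: eq_map => x; rewrite /embv /emb E2 zr2 /= !zrM.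
by congr pair; apply: point_eqP; rewrite /=; field; rewrite k0.
Qed.

(** Operations on the grid of step 1 / (2 K) that lead from one side of a move
    to the other. *)
Definition certifies (K : Z) (l : seq op) (m : move) : bool :=
  (0 < K) && (run_all (2%BZ * K) l (scale K (zsides m).1) == Some (scale K (zsides m).2)).

Theorem certifies_reaches S K l m : certifies K l m ->
    (forall m', m' \in flatten (map uses l) -> reaches S (sides R m').1 (sides R m').2) ->
  reaches S (sides R m).1 (sides R m).2.
Proof.
move=> /andP[K0 /eqP rn] us; have [t1 _] := sides_tangle m; rewrite sides_emb in t1 *.
rewrite -!(emb_scale _ K0) in t1 *; apply: run_all_reaches us t1 rn.
by rewrite mulr_gt0.
Qed.

End Soundness.

(** * The derivations *)

Section Operations.
Local Open Scope nat_scope.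

(** The kink derivations: a move of type II obtained from a move of type I, of
    type II and of type III. *)
Definition R2c_from_1a_2a_3a : seq op :=
  [:: Sub 0 1 (-800) 640; Mv 0 1 (-800) (-640); App R1a true 400 0 (-800) 0 320 0 [:: (0, 1)];
     Mv 0 3 0 (-320); Mv 0 2 400 320; Mv 0 3 400 (-320); Sub 0 2 400 (-80); Sub 0 2 400 0;
     Sub 0 2 400 80; Sub 1 0 800 80; Sub 1 2 800 (-80);
     App R2a true (-200) 0 600 0 (-40) 0 [:: (1, 1); (0, 3)]; Sub 0 4 700 (-20); Sub 0 3 700 20;
     Mv 0 5 700 0; Del 0 4; Mv 1 1 700 440; Mv 1 1 600 800; Del 1 0; Mv 1 2 700 (-440);
     Mv 1 2 600 (-800); Del 1 1; Mv 0 5 950 (-490); Mv 0 5 1200 (-960); Mv 0 4 950 490;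
     Mv 0 4 1200 960; Mv 0 6 440 (-232); Mv 0 6 480 (-384); Del 0 5; Mv 0 3 440 232;
     Mv 0 3 480 384; Lv [:: [:: 1; 2; 2; 2; 1; 2; 1; 1; 1]; [:: 1; 1; 1]]; Del 0 2;
     Mv 0 5 200 (-160); Lv [:: [:: 1; 3; 2; 1; 2; 2; 1; 1]; [:: 1; 1; 1]]; Del 0 4;
     Mv 0 2 200 160; Lv [:: [:: 1; 3; 3; 1; 2; 1; 1]; [:: 1; 1; 1]]; Del 0 1; Mv 1 1 100 0;
     Sub 1 0 450 800; Sub 1 2 450 (-800); Mv 1 1 100 240; Mv 1 3 100 (-400); Del 1 1;
     Sub 0 3 (-100) 80; Sub 0 3 300 (-240); Sub 0 1 300 240; Sub 0 1 50 40;
     Sub 0 1 (-100) (-80); Mv 0 4 300 80; Mv 0 2 (-100) (-240);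
     App R3a true 100 (-50) 100 80 120 (-80) [:: (0, 2); (0, 7); (1, 1)]; Del 0 6; Del 0 6;
     Mv 0 2 (-325) (-420); Del 0 1; Mv 0 3 675 380; Del 0 2; Sub 1 1 100 (-144);
     Mv 1 2 (-600) 0; Mv 1 1 0 320; Mv 1 3 0 (-320); Mv 0 2 (-80) (-64); Del 0 1;
     Sub 0 3 (-160) 128; Sub 0 1 (-160) (-128); Mv 0 4 600 (-512); Mv 0 4 0 (-64);
     Mv 0 3 600 512; Mv 0 3 0 64; Mv 0 4 (-80) (-64); Mv 0 3 (-80) 64; Sub 0 5 (-200) 160;
     Sub 0 1 (-200) (-160); App R1a false 80 0 (-160) 0 64 0 [:: (0, 3)]; Del 0 1;
     Lv [:: [:: 1; 2; 1; 2; 2; 1; 1]; [:: 1; 1; 1; 1; 1]]; Del 0 3; Mv 1 1 100 800; Del 1 0;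
     Mv 1 2 100 (-800); Del 1 1; Mv 0 2 800 0; Mv 0 3 0 320;
     Lv [:: [:: 1; 2; 2; 2; 1; 1]; [:: 1; 1; 1]]; Del 0 2; Mv 0 3 0 800;
     Lv [:: [:: 1; 2; 2; 2; 1]; [:: 1; 1; 1]]; Del 0 2; Mv 0 1 0 (-800);
     Lv [:: [:: 2; 2; 2; 1]; [:: 1; 1; 1]]; Del 0 0; Mv 1 1 (-800) 0;
     Lv [:: [:: 2; 2; 2]; [:: 1; 1; 1]]].

Lemma R2c_from_1a_2a_3a_valid : certifies 800 R2c_from_1a_2a_3a R2c.
Proof. by vm_compute. Qed.

Definition R2c_from_1a_2b_3a : seq op :=
  [:: Sub 1 1 400 (-320); Mv 1 1 400 320; App R1a true (-200) 0 400 0 (-160) 0 [:: (1, 1)];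
     Mv 1 3 0 160; Mv 1 2 (-200) (-160); Mv 1 3 (-200) 160; Sub 1 2 (-200) 40; Sub 1 2 (-200) 0;
     Sub 1 2 (-200) (-40); Sub 0 0 (-400) (-40); Sub 0 2 (-400) 40;
     App R2b true 100 0 (-300) 0 20 0 [:: (0, 1); (1, 3)]; Sub 1 4 (-350) 10;
     Sub 1 3 (-350) (-10); Mv 1 5 (-350) 0; Del 1 4; Mv 0 1 (-350) (-220); Mv 0 1 (-300) (-400);
     Del 0 0; Mv 0 2 (-350) 220; Mv 0 2 (-300) 400; Del 0 1; Mv 1 5 (-475) 245;
     Mv 1 5 (-600) 480; Mv 1 4 (-475) (-245); Mv 1 4 (-600) (-480); Mv 1 6 (-220) 116;
     Mv 1 6 (-240) 192; Del 1 5; Mv 1 3 (-220) (-116); Mv 1 3 (-240) (-192); Del 1 2;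
     Mv 1 5 (-100) 80; Lv [:: [:: 2; 2; 1]; [:: 1; 2; 1; 1; 1; 1; 1; 1]]; Del 1 4;
     Mv 1 2 (-100) (-80); Lv [:: [:: 3; 2; 1]; [:: 1; 2; 2; 1; 1; 1; 1]]; Del 1 1;
     Mv 0 1 (-50) 0; Sub 0 0 (-225) (-400); Sub 0 2 (-225) 400; Mv 0 1 0 (-160); Mv 0 3 0 160;
     Sub 1 3 100 (-80); Sub 1 3 (-100) 80; Sub 1 1 (-100) (-80); Sub 1 1 100 80;
     App R3a true 0 (-50) 0 80 0 0 [:: (0, 1); (1, 2); (1, 6)]; Del 1 1; Del 1 1; Del 1 3;
     Del 1 3; Mv 0 2 300 0; Sub 1 3 80 (-64); Sub 1 1 80 64; Mv 1 4 (-300) 256; Mv 1 4 0 32;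
     Mv 1 3 (-300) (-256); Mv 1 3 0 (-32); Mv 1 4 40 32; Mv 1 3 40 (-32); Sub 1 5 100 (-80);
     Sub 1 1 100 80; App R1a false (-40) 0 80 0 (-32) 0 [:: (1, 3)]; Del 1 1; Del 1 3;
     Mv 0 1 (-50) (-400); Del 0 0; Mv 0 2 (-50) 400; Del 0 1; Mv 1 2 (-400) 0; Mv 1 3 0 (-160);
     Del 1 2; Mv 1 3 0 (-400); Del 1 2; Mv 1 1 0 400; Lv [:: [:: 2; 2; 1]; [:: 1; 1; 1; 1]];
     Del 1 0; Mv 0 1 400 0; Lv [:: [:: 2; 2; 2]; [:: 1; 1; 1]]].

Lemma R2c_from_1a_2b_3a_valid : certifies 400 R2c_from_1a_2b_3a R2c.
Proof. by vm_compute. Qed.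

Definition R2d_from_1b_2a_3a : seq op :=
  [:: Sub 1 0 400 (-320); Mv 1 2 400 320; App R1b true 200 0 400 0 160 0 [:: (1, 1)];
     Mv 1 2 0 160; Mv 1 3 (-200) (-160); Mv 1 2 (-200) 160; Sub 1 2 (-200) 40; Sub 1 3 (-200) 0;
     Sub 1 4 (-200) (-40); Sub 0 1 (-400) (-40); Sub 0 0 (-400) 40;
     App R2a true (-100) 0 (-300) 0 (-20) 0 [:: (1, 3); (0, 1)]; Sub 1 3 (-350) 10;
     Sub 1 5 (-350) (-10); Mv 1 5 (-350) 0; Del 1 4; Mv 0 3 (-350) (-220); Mv 0 3 (-300) (-400);
     Del 0 2; Mv 0 1 (-350) 220; Mv 0 1 (-300) 400; Del 0 0; Mv 1 4 (-475) 245;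
     Mv 1 4 (-600) 480; Mv 1 5 (-475) (-245); Mv 1 5 (-600) (-480); Mv 1 3 (-220) 116;
     Mv 1 3 (-240) 192; Del 1 2; Mv 1 5 (-220) (-116); Mv 1 5 (-240) (-192); Del 1 4;
     Mv 1 2 (-100) 80; Del 1 1; Mv 1 4 (-100) (-80);
     Lv [:: [:: 2; 3; 1]; [:: 1; 1; 1; 2; 2; 1; 1]]; Del 1 3; Mv 0 1 (-50) 0;
     Sub 0 1 (-225) (-400); Sub 0 0 (-225) 400; Mv 0 3 0 (-160); Mv 0 1 0 160;
     Sub 1 1 100 (-80); Sub 1 2 (-100) 80; Sub 1 5 (-100) (-80); Sub 1 6 100 80;
     App R3a false 0 50 0 (-80) 0 0 [:: (0, 1); (1, 6); (1, 2)]; Del 1 6; Del 1 5; Del 1 2;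
     Del 1 1; Mv 0 2 300 0; Sub 1 1 80 (-64); Sub 1 4 80 64; Mv 1 3 (-300) 256; Mv 1 3 0 32;
     Mv 1 4 (-300) (-256); Mv 1 4 0 (-32); Mv 1 3 40 32; Mv 1 4 40 (-32); Sub 1 1 100 (-80);
     Sub 1 6 100 80; App R1b false 40 0 80 0 32 0 [:: (1, 3)];
     Lv [:: [:: 1; 2; 2; 1; 1]; [:: 1; 1; 1; 1; 1; 1; 1; 1]]; Del 1 4; Del 1 1;
     Mv 0 3 (-50) (-400); Lv [:: [:: 1; 2; 2; 2; 1]; [:: 1; 1; 1; 1; 1; 1]]; Del 0 2;
     Mv 0 1 (-50) 400; Lv [:: [:: 2; 2; 2; 1]; [:: 1; 1; 1; 1; 1; 1]]; Del 0 0; Mv 1 3 (-400) 0;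
     Mv 1 2 0 (-160); Del 1 1; Mv 1 1 0 (-400); Del 1 0; Mv 1 2 0 400; Del 1 1; Mv 0 1 400 0;
     Lv [:: [:: 2; 2; 2]; [:: 1; 1; 1]]].

Lemma R2d_from_1b_2a_3a_valid : certifies 400 R2d_from_1b_2a_3a R2d.
Proof. by vm_compute. Qed.

Definition R2d_from_1b_2b_3a : seq op :=
  [:: Sub 0 0 (-800) 640; Mv 0 2 (-800) (-640);
     App R1b true (-400) 0 (-800) 0 (-320) 0 [:: (0, 1)]; Mv 0 2 0 (-320); Mv 0 3 400 320;
     Mv 0 2 400 (-320); Sub 0 2 400 (-80); Sub 0 3 400 0; Sub 0 4 400 80; Sub 1 1 800 80;
     Sub 1 0 800 (-80); App R2b true 200 0 600 0 40 0 [:: (0, 3); (1, 1)]; Sub 0 3 700 (-20);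
     Sub 0 5 700 20; Mv 0 5 700 0; Del 0 4; Mv 1 3 700 440; Mv 1 3 600 800; Del 1 2;
     Mv 1 1 700 (-440); Mv 1 1 600 (-800); Del 1 0; Mv 0 4 950 (-490); Mv 0 4 1200 (-960);
     Mv 0 5 950 490; Mv 0 5 1200 960; Mv 0 3 440 (-232); Mv 0 3 480 (-384);
     Lv [:: [:: 1; 1; 2; 2; 1; 2; 1; 2; 1; 1]; [:: 1; 1; 1]]; Del 0 2; Mv 0 5 440 232;
     Mv 0 5 480 384; Lv [:: [:: 1; 1; 2; 1; 2; 2; 2; 1; 1]; [:: 1; 1; 1]]; Del 0 4;
     Mv 0 2 200 (-160); Lv [:: [:: 1; 2; 2; 1; 2; 3; 1; 1]; [:: 1; 1; 1]]; Del 0 1;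
     Mv 0 4 200 160; Lv [:: [:: 1; 2; 1; 3; 3; 1; 1]; [:: 1; 1; 1]]; Del 0 3; Mv 1 1 100 0;
     Sub 1 1 450 800; Sub 1 0 450 (-800); Mv 1 3 100 240; Mv 1 1 100 (-400); Del 1 1;
     Sub 0 1 (-100) 80; Sub 0 2 300 (-240); Sub 0 5 300 240; Sub 0 6 50 40;
     Sub 0 7 (-100) (-80); Mv 0 6 300 80; Mv 0 8 (-100) (-240);
     App R3a false (-100) 50 100 (-80) (-120) (-80) [:: (0, 6); (0, 2); (1, 1)]; Del 0 2;
     Del 0 1; Mv 0 6 (-325) (-420); Del 0 5; Mv 0 4 675 380; Del 0 3; Sub 1 1 100 (-144);
     Mv 1 2 (-600) 0; Mv 1 3 0 320; Mv 1 1 0 (-320); Mv 0 4 (-80) (-64); Del 0 3;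
     Sub 0 1 (-160) 128; Sub 0 4 (-160) (-128); Mv 0 3 600 (-512); Mv 0 3 0 (-64);
     Mv 0 4 600 512; Mv 0 4 0 64; Mv 0 3 (-80) (-64); Mv 0 4 (-80) 64; Sub 0 1 (-200) 160;
     Sub 0 6 (-200) (-160); App R1b false (-80) 0 (-160) 0 (-64) 0 [:: (0, 3)];
     Lv [:: [:: 1; 2; 1; 1; 2; 2; 1; 1]; [:: 1; 1; 1; 1; 1]]; Del 0 4;
     Lv [:: [:: 1; 2; 2; 1; 2; 1; 1]; [:: 1; 1; 1; 1; 1]]; Del 0 1; Mv 1 3 100 800; Del 1 2;
     Mv 1 1 100 (-800); Del 1 0; Mv 0 3 800 0; Mv 0 2 0 320;
     Lv [:: [:: 1; 2; 2; 2; 1; 1]; [:: 1; 1; 1]]; Del 0 1; Mv 0 1 0 800;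
     Lv [:: [:: 2; 2; 2; 1; 1]; [:: 1; 1; 1]]; Del 0 0; Mv 0 2 0 (-800);
     Lv [:: [:: 2; 2; 2; 1]; [:: 1; 1; 1]]; Del 0 1; Mv 1 1 (-800) 0;
     Lv [:: [:: 2; 2; 2]; [:: 1; 1; 1]]].

Lemma R2d_from_1b_2b_3a_valid : certifies 800 R2d_from_1b_2b_3a R2d.
Proof. by vm_compute. Qed.

Definition R2d_from_1d_2a_3h : seq op :=
  [:: Sub 1 0 400 (-320); Mv 1 2 400 320; App R1d true 200 0 400 0 160 0 [:: (1, 1)];
     Mv 1 2 0 160; Mv 1 3 (-200) (-160); Mv 1 2 (-200) 160; Sub 1 2 (-200) 40; Sub 1 3 (-200) 0;
     Sub 1 4 (-200) (-40); Sub 0 1 (-400) (-40); Sub 0 0 (-400) 40;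
     App R2a true (-100) 0 (-300) 0 (-20) 0 [:: (1, 3); (0, 1)]; Sub 1 3 (-350) 10;
     Sub 1 5 (-350) (-10); Mv 1 5 (-350) 0; Del 1 4; Mv 0 3 (-350) (-220); Mv 0 3 (-300) (-400);
     Del 0 2; Mv 0 1 (-350) 220; Mv 0 1 (-300) 400; Del 0 0; Mv 1 4 (-475) 245;
     Mv 1 4 (-600) 480; Mv 1 5 (-475) (-245); Mv 1 5 (-600) (-480); Mv 1 3 (-220) 116;
     Mv 1 3 (-240) 192; Del 1 2; Mv 1 5 (-220) (-116); Mv 1 5 (-240) (-192); Del 1 4;
     Mv 1 2 (-100) 80; Del 1 1; Mv 1 4 (-100) (-80);
     Lv [:: [:: 3; 2; 1]; [:: 1; 2; 1; 1; 1; 1; 1]]; Del 1 3; Mv 0 1 (-50) 0;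
     Sub 0 1 (-225) (-400); Sub 0 0 (-225) 400; Mv 0 3 0 (-160); Mv 0 1 0 160;
     Sub 1 1 100 (-80); Sub 1 2 (-100) 80; Sub 1 5 (-100) (-80); Sub 1 6 100 80;
     App R3h false 0 50 0 (-80) 0 0 [:: (0, 1); (1, 2); (1, 6)]; Del 1 6; Del 1 5; Del 1 2;
     Del 1 1; Mv 0 2 300 0; Sub 1 1 80 (-64); Sub 1 4 80 64; Mv 1 3 (-300) 256; Mv 1 3 0 32;
     Mv 1 4 (-300) (-256); Mv 1 4 0 (-32); Mv 1 3 40 32; Mv 1 4 40 (-32); Sub 1 1 100 (-80);
     Sub 1 6 100 80; App R1d false 40 0 80 0 32 0 [:: (1, 3)]; Del 1 4; Del 1 1;
     Mv 0 3 (-50) (-400); Del 0 2; Mv 0 1 (-50) 400; Del 0 0; Mv 1 3 (-400) 0; Mv 1 2 0 (-160);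
     Lv [:: [:: 2; 2; 1]; [:: 1; 1; 1; 1; 1; 1]]; Del 1 1; Mv 1 1 0 (-400); Del 1 0;
     Mv 1 2 0 400; Del 1 1; Mv 0 1 400 0; Lv [:: [:: 2; 2; 2]; [:: 1; 1; 1]]].

Lemma R2d_from_1d_2a_3h_valid : certifies 400 R2d_from_1d_2a_3h R2d.
Proof. by vm_compute. Qed.

Definition R2d_from_1d_2b_3h : seq op :=
  [:: Sub 0 0 (-800) 640; Mv 0 2 (-800) (-640);
     App R1d true (-400) 0 (-800) 0 (-320) 0 [:: (0, 1)]; Mv 0 2 0 (-320); Mv 0 3 400 320;
     Mv 0 2 400 (-320); Sub 0 2 400 (-80); Sub 0 3 400 0; Sub 0 4 400 80; Sub 1 1 800 80;
     Sub 1 0 800 (-80); App R2b true 200 0 600 0 40 0 [:: (0, 3); (1, 1)]; Sub 0 3 700 (-20);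
     Sub 0 5 700 20; Mv 0 5 700 0; Del 0 4; Mv 1 3 700 440; Mv 1 3 600 800; Del 1 2;
     Mv 1 1 700 (-440); Mv 1 1 600 (-800); Del 1 0; Mv 0 4 950 (-490); Mv 0 4 1200 (-960);
     Mv 0 5 950 490; Mv 0 5 1200 960; Mv 0 3 440 (-232); Mv 0 3 480 (-384);
     Lv [:: [:: 1; 2; 2; 2; 1; 2; 1; 1; 1; 1]; [:: 1; 1; 1]]; Del 0 2; Mv 0 5 440 232;
     Mv 0 5 480 384; Lv [:: [:: 1; 2; 2; 1; 2; 2; 1; 1; 1]; [:: 1; 1; 1]]; Del 0 4;
     Mv 0 2 200 (-160); Del 0 1; Mv 0 4 200 160; Lv [:: [:: 1; 3; 1; 2; 2; 1; 1]; [:: 1; 1; 1]];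
     Del 0 3; Mv 1 1 100 0; Sub 1 0 450 (-800); Sub 1 2 450 800; Mv 1 1 100 (-240);
     Mv 1 3 100 400; Del 1 1; Sub 0 3 (-100) (-80); Sub 0 3 300 240; Sub 0 1 300 (-240);
     Sub 0 1 50 (-40); Sub 0 1 (-100) 80; Mv 0 4 300 (-80); Mv 0 2 (-100) 240;
     App R3h false 100 50 100 (-80) 120 80 [:: (0, 2); (0, 7); (1, 1)]; Del 0 6; Del 0 6;
     Mv 0 2 (-325) 420; Del 0 1; Mv 0 3 675 (-380); Del 0 2; Sub 1 1 100 144; Mv 1 2 (-600) 0;
     Mv 1 1 0 (-320); Mv 1 3 0 320; Mv 0 2 (-80) 64; Del 0 1; Sub 0 1 (-160) 128;
     Sub 0 4 (-160) (-128); Mv 0 3 600 (-512); Mv 0 3 0 (-64); Mv 0 4 600 512; Mv 0 4 0 64;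
     Mv 0 3 (-80) (-64); Mv 0 4 (-80) 64; Sub 0 1 (-200) 160; Sub 0 6 (-200) (-160);
     App R1d false (-80) 0 (-160) 0 (-64) 0 [:: (0, 3)];
     Lv [:: [:: 1; 2; 1; 1; 2; 2; 1; 1]; [:: 1; 1; 1; 1; 1]]; Del 0 4;
     Lv [:: [:: 1; 2; 2; 1; 2; 1; 1]; [:: 1; 1; 1; 1; 1]]; Del 0 1; Mv 1 3 100 800; Del 1 2;
     Mv 1 1 100 (-800); Del 1 0; Mv 0 3 800 0; Mv 0 2 0 320;
     Lv [:: [:: 1; 2; 2; 2; 1; 1]; [:: 1; 1; 1]]; Del 0 1; Mv 0 1 0 800;
     Lv [:: [:: 2; 2; 2; 1; 1]; [:: 1; 1; 1]]; Del 0 0; Mv 0 2 0 (-800);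
     Lv [:: [:: 2; 2; 2; 1]; [:: 1; 1; 1]]; Del 0 1; Mv 1 1 (-800) 0;
     Lv [:: [:: 2; 2; 2]; [:: 1; 1; 1]]].

Lemma R2d_from_1d_2b_3h_valid : certifies 800 R2d_from_1d_2b_3h R2d.
Proof. by vm_compute. Qed.

Definition R2c_from_1c_2a_3h : seq op :=
  [:: Sub 0 1 (-800) 640; Mv 0 1 (-800) (-640); App R1c true 400 0 (-800) 0 320 0 [:: (0, 1)];
     Mv 0 3 0 (-320); Mv 0 2 400 320; Mv 0 3 400 (-320); Sub 0 2 400 (-80); Sub 0 2 400 0;
     Sub 0 2 400 80; Sub 1 0 800 80; Sub 1 2 800 (-80);
     App R2a true (-200) 0 600 0 (-40) 0 [:: (1, 1); (0, 3)]; Sub 0 4 700 (-20); Sub 0 3 700 20;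
     Mv 0 5 700 0; Del 0 4; Mv 1 1 700 440; Mv 1 1 600 800; Del 1 0; Mv 1 2 700 (-440);
     Mv 1 2 600 (-800); Del 1 1; Mv 0 5 950 (-490); Mv 0 5 1200 (-960); Mv 0 4 950 490;
     Mv 0 4 1200 960; Mv 0 6 440 (-232); Mv 0 6 480 (-384); Del 0 5; Mv 0 3 440 232;
     Mv 0 3 480 384; Lv [:: [:: 1; 1; 2; 2; 1; 2; 2; 1; 1]; [:: 1; 1; 1]]; Del 0 2;
     Mv 0 5 200 (-160); Del 0 4; Mv 0 2 200 160; Lv [:: [:: 1; 2; 2; 1; 3; 1; 1]; [:: 1; 1; 1]];
     Del 0 1; Mv 1 1 100 0; Sub 1 1 450 (-800); Sub 1 0 450 800; Mv 1 3 100 (-240);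
     Mv 1 1 100 400; Del 1 1; Sub 0 1 (-100) (-80); Sub 0 2 300 240; Sub 0 5 300 (-240);
     Sub 0 6 50 (-40); Sub 0 7 (-100) 80; Mv 0 6 300 (-80); Mv 0 8 (-100) 240;
     App R3h true (-100) (-50) 100 80 (-120) 80 [:: (0, 6); (0, 2); (1, 1)]; Del 0 2; Del 0 1;
     Mv 0 6 (-325) 420; Del 0 5; Mv 0 4 675 (-380); Del 0 3; Sub 1 1 100 144; Mv 1 2 (-600) 0;
     Mv 1 3 0 (-320); Mv 1 1 0 320; Mv 0 4 (-80) 64; Del 0 3; Sub 0 3 (-160) 128;
     Sub 0 1 (-160) (-128); Mv 0 4 600 (-512); Mv 0 4 0 (-64); Mv 0 3 600 512; Mv 0 3 0 64;
     Mv 0 4 (-80) (-64); Mv 0 3 (-80) 64; Sub 0 5 (-200) 160; Sub 0 1 (-200) (-160);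
     App R1c false 80 0 (-160) 0 64 0 [:: (0, 3)]; Del 0 1;
     Lv [:: [:: 1; 2; 1; 2; 2; 1; 1]; [:: 1; 1; 1; 1; 1]]; Del 0 3; Mv 1 1 100 800; Del 1 0;
     Mv 1 2 100 (-800); Del 1 1; Mv 0 2 800 0; Mv 0 3 0 320;
     Lv [:: [:: 1; 2; 2; 2; 1; 1]; [:: 1; 1; 1]]; Del 0 2; Mv 0 3 0 800;
     Lv [:: [:: 1; 2; 2; 2; 1]; [:: 1; 1; 1]]; Del 0 2; Mv 0 1 0 (-800);
     Lv [:: [:: 2; 2; 2; 1]; [:: 1; 1; 1]]; Del 0 0; Mv 1 1 (-800) 0;
     Lv [:: [:: 2; 2; 2]; [:: 1; 1; 1]]].

Lemma R2c_from_1c_2a_3h_valid : certifies 800 R2c_from_1c_2a_3h R2c.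
Proof. by vm_compute. Qed.

Definition R2c_from_1c_2b_3h : seq op :=
  [:: Sub 1 1 400 (-320); Mv 1 1 400 320; App R1c true (-200) 0 400 0 (-160) 0 [:: (1, 1)];
     Mv 1 3 0 160; Mv 1 2 (-200) (-160); Mv 1 3 (-200) 160; Sub 1 2 (-200) 40; Sub 1 2 (-200) 0;
     Sub 1 2 (-200) (-40); Sub 0 0 (-400) (-40); Sub 0 2 (-400) 40;
     App R2b true 100 0 (-300) 0 20 0 [:: (0, 1); (1, 3)]; Sub 1 4 (-350) 10;
     Sub 1 3 (-350) (-10); Mv 1 5 (-350) 0; Del 1 4; Mv 0 1 (-350) (-220); Mv 0 1 (-300) (-400);
     Del 0 0; Mv 0 2 (-350) 220; Mv 0 2 (-300) 400; Del 0 1; Mv 1 5 (-475) 245;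
     Mv 1 5 (-600) 480; Mv 1 4 (-475) (-245); Mv 1 4 (-600) (-480); Mv 1 6 (-220) 116;
     Mv 1 6 (-240) 192; Del 1 5; Mv 1 3 (-220) (-116); Mv 1 3 (-240) (-192); Del 1 2;
     Mv 1 5 (-100) 80; Lv [:: [:: 2; 3; 1]; [:: 1; 1; 1; 1; 2; 2; 1; 1]]; Del 1 4;
     Mv 1 2 (-100) (-80); Del 1 1; Mv 0 1 (-50) 0; Sub 0 0 (-225) (-400); Sub 0 2 (-225) 400;
     Mv 0 1 0 (-160); Mv 0 3 0 160; Sub 1 3 100 (-80); Sub 1 3 (-100) 80; Sub 1 1 (-100) (-80);
     Sub 1 1 100 80; App R3h true 0 (-50) 0 80 0 0 [:: (0, 1); (1, 6); (1, 2)]; Del 1 1;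
     Del 1 1; Del 1 3; Del 1 3; Mv 0 2 300 0; Sub 1 3 80 (-64); Sub 1 1 80 64;
     Mv 1 4 (-300) 256; Mv 1 4 0 32; Mv 1 3 (-300) (-256); Mv 1 3 0 (-32); Mv 1 4 40 32;
     Mv 1 3 40 (-32); Sub 1 5 100 (-80); Sub 1 1 100 80;
     App R1c false (-40) 0 80 0 (-32) 0 [:: (1, 3)]; Del 1 1;
     Lv [:: [:: 1; 2; 2; 1; 1]; [:: 1; 1; 1; 1; 1; 1; 1]]; Del 1 3; Mv 0 1 (-50) (-400);
     Lv [:: [:: 2; 2; 2; 1; 1]; [:: 1; 1; 1; 1; 1; 1]]; Del 0 0; Mv 0 2 (-50) 400;
     Lv [:: [:: 2; 2; 2; 1]; [:: 1; 1; 1; 1; 1; 1]]; Del 0 1; Mv 1 2 (-400) 0; Mv 1 3 0 (-160);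
     Del 1 2; Mv 1 3 0 (-400); Del 1 2; Mv 1 1 0 400; Del 1 0; Mv 0 1 400 0;
     Lv [:: [:: 2; 2; 2]; [:: 1; 1; 1]]].

Lemma R2c_from_1c_2b_3h_valid : certifies 400 R2c_from_1c_2b_3h R2c.
Proof. by vm_compute. Qed.

Definition R2b_from_1d_2c_3c : seq op :=
  [:: Sub 1 0 400 (-320); Mv 1 2 400 320; App R1d true 200 0 400 0 160 0 [:: (1, 1)];
     Mv 1 2 0 160; Mv 1 3 (-200) (-160); Mv 1 2 (-200) 160; Sub 1 2 (-200) 40; Sub 1 3 (-200) 0;
     Sub 1 4 (-200) (-40); Sub 0 0 (-400) (-40); Sub 0 2 (-400) 40;
     App R2c true 100 0 (-300) 0 20 0 [:: (0, 1); (1, 3)]; Sub 1 3 (-350) 10;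
     Sub 1 5 (-350) (-10); Mv 1 5 (-350) 0; Del 1 4; Mv 0 1 (-350) (-220); Mv 0 1 (-300) (-400);
     Del 0 0; Mv 0 2 (-350) 220; Mv 0 2 (-300) 400; Del 0 1; Mv 1 4 (-475) 245;
     Mv 1 4 (-600) 480; Mv 1 5 (-475) (-245); Mv 1 5 (-600) (-480); Mv 1 3 (-220) 116;
     Mv 1 3 (-240) 192; Del 1 2; Mv 1 5 (-220) (-116); Mv 1 5 (-240) (-192); Del 1 4;
     Mv 1 2 (-100) 80; Del 1 1; Mv 1 4 (-100) (-80);
     Lv [:: [:: 2; 3; 1]; [:: 1; 2; 1; 1; 1; 1; 1]]; Del 1 3; Mv 0 1 (-50) 0;
     Sub 0 0 (-225) (-400); Sub 0 2 (-225) 400; Mv 0 1 0 (-160); Mv 0 3 0 160;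
     Sub 1 1 100 (-80); Sub 1 2 (-100) 80; Sub 1 5 (-100) (-80); Sub 1 6 100 80;
     App R3c true 0 (-50) 0 80 0 0 [:: (0, 1); (1, 2); (1, 6)]; Del 1 6; Del 1 5; Del 1 2;
     Del 1 1; Mv 0 2 300 0; Sub 1 1 80 (-64); Sub 1 4 80 64; Mv 1 3 (-300) 256; Mv 1 3 0 32;
     Mv 1 4 (-300) (-256); Mv 1 4 0 (-32); Mv 1 3 40 32; Mv 1 4 40 (-32); Sub 1 1 100 (-80);
     Sub 1 6 100 80; App R1d false 40 0 80 0 32 0 [:: (1, 3)]; Del 1 4; Del 1 1;
     Mv 0 1 (-50) (-400); Lv [:: [:: 2; 2; 2; 1; 1]; [:: 1; 1; 1; 1; 1; 1]]; Del 0 0;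
     Mv 0 2 (-50) 400; Lv [:: [:: 2; 2; 2; 1]; [:: 1; 1; 1; 1; 1; 1]]; Del 0 1; Mv 1 3 (-400) 0;
     Mv 1 2 0 (-160); Del 1 1; Mv 1 1 0 (-400); Del 1 0; Mv 1 2 0 400; Del 1 1; Mv 0 1 400 0;
     Lv [:: [:: 2; 2; 2]; [:: 1; 1; 1]]].

Lemma R2b_from_1d_2c_3c_valid : certifies 400 R2b_from_1d_2c_3c R2b.
Proof. by vm_compute. Qed.

Definition R2a_from_1c_2d_3c : seq op :=
  [:: Sub 0 1 (-400) 320; Mv 0 1 (-400) (-320); App R1c true 200 0 (-400) 0 160 0 [:: (0, 1)];
     Mv 0 3 0 (-160); Mv 0 2 200 160; Mv 0 3 200 (-160); Sub 0 2 200 (-40); Sub 0 2 200 0;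
     Sub 0 2 200 40; Sub 1 1 400 40; Sub 1 0 400 (-40);
     App R2d true (-100) 0 300 0 (-20) 0 [:: (1, 1); (0, 3)]; Sub 0 4 350 (-10); Sub 0 3 350 10;
     Mv 0 5 350 0; Del 0 4; Mv 1 3 350 220; Mv 1 3 300 400; Del 1 2; Mv 1 1 350 (-220);
     Mv 1 1 300 (-400); Del 1 0; Mv 0 5 475 (-245); Mv 0 5 600 (-480); Mv 0 4 475 245;
     Mv 0 4 600 480; Mv 0 6 220 (-116); Mv 0 6 240 (-192); Del 0 5; Mv 0 3 220 116;
     Mv 0 3 240 192; Del 0 2; Mv 0 5 100 (-80);
     Lv [:: [:: 1; 1; 1; 1; 2; 2; 1; 1]; [:: 3; 2; 1]]; Del 0 4; Mv 0 2 100 80; Del 0 1;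
     Mv 1 1 50 0; Sub 1 1 225 400; Sub 1 0 225 (-400); Mv 1 3 0 160; Mv 1 1 0 (-160);
     Sub 0 3 (-100) 80; Sub 0 3 100 (-80); Sub 0 1 100 80; Sub 0 1 (-100) (-80);
     App R3c false 0 (-50) 0 80 0 0 [:: (1, 1); (0, 6); (0, 2)]; Del 0 1; Del 0 1; Del 0 3;
     Del 0 3; Mv 1 2 (-300) 0; Sub 0 3 (-80) 64; Sub 0 1 (-80) (-64); Mv 0 4 300 (-256);
     Mv 0 4 0 (-32); Mv 0 3 300 256; Mv 0 3 0 32; Mv 0 4 (-40) (-32); Mv 0 3 (-40) 32;
     Sub 0 5 (-100) 80; Sub 0 1 (-100) (-80); App R1c false 40 0 (-80) 0 32 0 [:: (0, 3)];
     Del 0 1; Lv [:: [:: 1; 1; 1; 1; 1; 1; 1]; [:: 1; 2; 2; 1; 1]]; Del 0 3; Mv 1 3 50 400;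
     Lv [:: [:: 1; 1; 1; 1; 1; 1]; [:: 1; 2; 2; 2; 1]]; Del 1 2; Mv 1 1 50 (-400);
     Lv [:: [:: 1; 1; 1; 1; 1; 1]; [:: 2; 2; 2; 1]]; Del 1 0; Mv 0 2 400 0; Mv 0 3 0 160;
     Del 0 2; Mv 0 3 0 400; Del 0 2; Mv 0 1 0 (-400); Del 0 0; Mv 1 1 (-400) 0;
     Lv [:: [:: 1; 1; 1]; [:: 2; 2; 2]]].

Lemma R2a_from_1c_2d_3c_valid : certifies 400 R2a_from_1c_2d_3c R2a.
Proof. by vm_compute. Qed.

Definition R2a_from_1a_2d_3d : seq op :=
  [:: Sub 0 1 (-400) 320; Mv 0 1 (-400) (-320); App R1a true 200 0 (-400) 0 160 0 [:: (0, 1)];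
     Mv 0 3 0 (-160); Mv 0 2 200 160; Mv 0 3 200 (-160); Sub 0 2 200 (-40); Sub 0 2 200 0;
     Sub 0 2 200 40; Sub 1 1 400 40; Sub 1 0 400 (-40);
     App R2d true (-100) 0 300 0 (-20) 0 [:: (1, 1); (0, 3)]; Sub 0 4 350 (-10); Sub 0 3 350 10;
     Mv 0 5 350 0; Del 0 4; Mv 1 3 350 220; Mv 1 3 300 400; Del 1 2; Mv 1 1 350 (-220);
     Mv 1 1 300 (-400); Del 1 0; Mv 0 5 475 (-245); Mv 0 5 600 (-480); Mv 0 4 475 245;
     Mv 0 4 600 480; Mv 0 6 220 (-116); Mv 0 6 240 (-192); Del 0 5; Mv 0 3 220 116;
     Mv 0 3 240 192; Del 0 2; Mv 0 5 100 (-80);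
     Lv [:: [:: 1; 2; 1; 1; 1; 1; 1; 1]; [:: 2; 2; 1]]; Del 0 4; Mv 0 2 100 80;
     Lv [:: [:: 1; 2; 2; 1; 1; 1; 1]; [:: 2; 3; 1]]; Del 0 1; Mv 1 1 50 0; Sub 1 1 225 400;
     Sub 1 0 225 (-400); Mv 1 3 0 160; Mv 1 1 0 (-160); Sub 0 3 (-100) 80; Sub 0 3 100 (-80);
     Sub 0 1 100 80; Sub 0 1 (-100) (-80);
     App R3d false 0 (-50) 0 80 0 0 [:: (1, 1); (0, 2); (0, 6)]; Del 0 1; Del 0 1; Del 0 3;
     Del 0 3; Mv 1 2 (-300) 0; Sub 0 3 (-80) 64; Sub 0 1 (-80) (-64); Mv 0 4 300 (-256);
     Mv 0 4 0 (-32); Mv 0 3 300 256; Mv 0 3 0 32; Mv 0 4 (-40) (-32); Mv 0 3 (-40) 32;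
     Sub 0 5 (-100) 80; Sub 0 1 (-100) (-80); App R1a false 40 0 (-80) 0 32 0 [:: (0, 3)];
     Del 0 1; Del 0 3; Mv 1 3 50 400; Del 1 2; Mv 1 1 50 (-400);
     Lv [:: [:: 1; 1; 1; 1; 1; 1]; [:: 2; 2; 2; 1]]; Del 1 0; Mv 0 2 400 0; Mv 0 3 0 160;
     Del 0 2; Mv 0 3 0 400; Del 0 2; Mv 0 1 0 (-400); Del 0 0; Mv 1 1 (-400) 0;
     Lv [:: [:: 1; 1; 1]; [:: 2; 2; 2]]].

Lemma R2a_from_1a_2d_3d_valid : certifies 400 R2a_from_1a_2d_3d R2a.
Proof. by vm_compute. Qed.

Definition R2b_from_1b_2c_3d : seq op :=
  [:: Sub 1 0 400 (-320); Mv 1 2 400 320; App R1b true 200 0 400 0 160 0 [:: (1, 1)];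
     Mv 1 2 0 160; Mv 1 3 (-200) (-160); Mv 1 2 (-200) 160; Sub 1 2 (-200) 40; Sub 1 3 (-200) 0;
     Sub 1 4 (-200) (-40); Sub 0 0 (-400) (-40); Sub 0 2 (-400) 40;
     App R2c true 100 0 (-300) 0 20 0 [:: (0, 1); (1, 3)]; Sub 1 3 (-350) 10;
     Sub 1 5 (-350) (-10); Mv 1 5 (-350) 0; Del 1 4; Mv 0 1 (-350) (-220); Mv 0 1 (-300) (-400);
     Del 0 0; Mv 0 2 (-350) 220; Mv 0 2 (-300) 400; Del 0 1; Mv 1 4 (-475) 245;
     Mv 1 4 (-600) 480; Mv 1 5 (-475) (-245); Mv 1 5 (-600) (-480); Mv 1 3 (-220) 116;
     Mv 1 3 (-240) 192; Del 1 2; Mv 1 5 (-220) (-116); Mv 1 5 (-240) (-192); Del 1 4;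
     Mv 1 2 (-100) 80; Del 1 1; Mv 1 4 (-100) (-80);
     Lv [:: [:: 3; 2; 1]; [:: 1; 1; 1; 2; 2; 1; 1]]; Del 1 3; Mv 0 1 (-50) 0;
     Sub 0 0 (-225) (-400); Sub 0 2 (-225) 400; Mv 0 1 0 (-160); Mv 0 3 0 160;
     Sub 1 1 100 (-80); Sub 1 2 (-100) 80; Sub 1 5 (-100) (-80); Sub 1 6 100 80;
     App R3d true 0 (-50) 0 80 0 0 [:: (0, 1); (1, 6); (1, 2)]; Del 1 6; Del 1 5; Del 1 2;
     Del 1 1; Mv 0 2 300 0; Sub 1 1 80 (-64); Sub 1 4 80 64; Mv 1 3 (-300) 256; Mv 1 3 0 32;
     Mv 1 4 (-300) (-256); Mv 1 4 0 (-32); Mv 1 3 40 32; Mv 1 4 40 (-32); Sub 1 1 100 (-80);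
     Sub 1 6 100 80; App R1b false 40 0 80 0 32 0 [:: (1, 3)];
     Lv [:: [:: 1; 2; 2; 1; 1]; [:: 1; 1; 1; 1; 1; 1; 1; 1]]; Del 1 4; Del 1 1;
     Mv 0 1 (-50) (-400); Lv [:: [:: 2; 2; 2; 1; 1]; [:: 1; 1; 1; 1; 1; 1]]; Del 0 0;
     Mv 0 2 (-50) 400; Lv [:: [:: 2; 2; 2; 1]; [:: 1; 1; 1; 1; 1; 1]]; Del 0 1; Mv 1 3 (-400) 0;
     Mv 1 2 0 (-160); Del 1 1; Mv 1 1 0 (-400); Del 1 0; Mv 1 2 0 400; Del 1 1; Mv 0 1 400 0;
     Lv [:: [:: 2; 2; 2]; [:: 1; 1; 1]]].

Lemma R2b_from_1b_2c_3d_valid : certifies 400 R2b_from_1b_2c_3d R2b.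
Proof. by vm_compute. Qed.

(** The zigzag derivations of moves of type I. *)
Definition R1b_from_1c_2c : seq op :=
  [:: Sub 0 0 0 64; Mv 0 1 64 (-64); Sub 0 0 32 (-96); Mv 0 1 16 (-32); Sub 0 0 12 (-56);
     Mv 0 1 13 (-34); Mv 0 1 14 (-12); Mv 0 1 16 32; Sub 0 0 12 (-8); Mv 0 1 (-16) 32;
     Sub 0 0 (-8) (-48); Mv 0 1 (-16) (-32); Sub 0 1 (-16) 0; Sub 0 4 16 0;
     App R2c true (-16) 0 0 0 (-16) 0 [:: (0, 4); (0, 1)]; Sub 0 2 8 8; Sub 0 5 (-8) 8;
     Mv 0 4 (-4) 16; Mv 0 5 4 16; App R1c false 0 (-4) 0 8 0 8 [:: (0, 3)]; Mv 0 1 8 (-64);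
     Del 0 0; Mv 0 2 4 4; Del 0 1; Mv 0 2 0 0; Del 0 1; Mv 0 3 24 (-32); Del 0 2;
     Mv 0 2 (-64) (-64); Mv 0 1 (-64) 64; Mv 0 3 (-32) 32; Lv [:: [:: 1; 1; 2; 2; 1]]; Del 0 2;
     Lv [:: [:: 1; 1; 2; 1]]].

Lemma R1b_from_1c_2c_valid : certifies 64 R1b_from_1c_2c R1b.
Proof. by vm_compute. Qed.

Definition R1d_from_1a_2c : seq op :=
  [:: Sub 0 0 0 64; Mv 0 1 64 (-64); Sub 0 0 32 (-96); Mv 0 1 16 (-32); Sub 0 0 12 (-56);
     Mv 0 1 13 (-34); Mv 0 1 14 (-12); Mv 0 1 16 32; Sub 0 0 12 (-8); Mv 0 1 (-16) 32;
     Sub 0 0 (-8) (-48); Mv 0 1 (-16) (-32); Sub 0 1 (-16) 0; Sub 0 4 16 0;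
     App R2c true 16 0 0 0 16 0 [:: (0, 1); (0, 4)]; Sub 0 2 8 8; Sub 0 5 (-8) 8;
     Mv 0 4 (-4) 16; Mv 0 5 4 16; App R1a false 0 (-4) 0 8 0 8 [:: (0, 3)]; Mv 0 1 8 (-64);
     Lv [:: [:: 2; 2; 1; 1; 1; 1; 1; 1; 1]]; Del 0 0; Mv 0 2 4 4; Del 0 1; Mv 0 2 0 0; Del 0 1;
     Mv 0 3 24 (-32); Del 0 2; Mv 0 2 (-64) (-64); Mv 0 1 (-64) 64; Mv 0 3 (-32) 32; Del 0 2;
     Lv [:: [:: 1; 1; 0; 1]]].

Lemma R1d_from_1a_2c_valid : certifies 64 R1d_from_1a_2c R1d.
Proof. by vm_compute. Qed.

Definition R1a_from_1d_2d : seq op :=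
  [:: Sub 0 0 0 64; Mv 0 1 (-64) (-64); Sub 0 0 (-32) (-96); Mv 0 1 (-16) (-32);
     Sub 0 0 (-12) (-56); Mv 0 1 (-13) (-34); Mv 0 1 (-14) (-12); Mv 0 1 (-16) 32;
     Sub 0 0 (-12) (-8); Mv 0 1 16 32; Sub 0 0 8 (-48); Mv 0 1 16 (-32); Sub 0 1 16 0;
     Sub 0 4 (-16) 0; App R2d true (-16) 0 0 0 (-16) 0 [:: (0, 1); (0, 4)]; Sub 0 2 (-8) 8;
     Sub 0 5 8 8; Mv 0 4 4 16; Mv 0 5 (-4) 16; App R1d false 0 4 0 (-8) 0 8 [:: (0, 3)];
     Mv 0 1 (-8) (-64); Lv [:: [:: 2; 2; 1; 1; 1; 1; 1; 1; 1]]; Del 0 0; Mv 0 2 (-4) 4; Del 0 1;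
     Mv 0 2 0 0; Del 0 1; Mv 0 3 (-24) (-32); Del 0 2; Mv 0 2 64 (-64); Mv 0 1 64 64;
     Mv 0 3 32 32; Del 0 2; Lv [:: [:: 1; 1; 0; 1]]].

Lemma R1a_from_1d_2d_valid : certifies 64 R1a_from_1d_2d R1a.
Proof. by vm_compute. Qed.

Definition R1c_from_1b_2d : seq op :=
  [:: Sub 0 0 0 64; Mv 0 1 (-64) (-64); Sub 0 0 (-32) (-96); Mv 0 1 (-16) (-32);
     Sub 0 0 (-12) (-56); Mv 0 1 (-13) (-34); Mv 0 1 (-14) (-12); Mv 0 1 (-16) 32;
     Sub 0 0 (-12) (-8); Mv 0 1 16 32; Sub 0 0 8 (-48); Mv 0 1 16 (-32); Sub 0 1 16 0;
     Sub 0 4 (-16) 0; App R2d true 16 0 0 0 16 0 [:: (0, 4); (0, 1)]; Sub 0 2 (-8) 8;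
     Sub 0 5 8 8; Mv 0 4 4 16; Mv 0 5 (-4) 16; App R1b false 0 4 0 (-8) 0 8 [:: (0, 3)];
     Mv 0 1 (-8) (-64); Del 0 0; Mv 0 2 (-4) 4; Del 0 1; Mv 0 2 0 0; Del 0 1;
     Mv 0 3 (-24) (-32); Del 0 2; Mv 0 2 64 (-64); Mv 0 1 64 64; Mv 0 3 32 32;
     Lv [:: [:: 1; 1; 2; 2; 1]]; Del 0 2; Lv [:: [:: 1; 1; 2; 1]]].

Lemma R1c_from_1b_2d_valid : certifies 64 R1c_from_1b_2d R1c.
Proof. by vm_compute. Qed.

(** The derivations of moves of type III by a change of sign of one crossing. *)
Definition R3b_from_2c_2d_3a : seq op :=
  [:: Sub 0 1 31200 36400; Sub 0 0 (-31200) 36400; Mv 0 3 31200 20800; Mv 0 1 (-31200) 20800;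
     Mv 0 2 0 20800; Del 0 1; Sub 1 0 5200 10400; Mv 1 1 (-2600) 15600;
     Sub 1 0 (-27300) (-44200); Mv 1 1 (-20800) 0; Sub 1 2 24700 59800; Mv 1 3 0 41600;
     Sub 0 1 10400 20800; Sub 2 0 0 0; Sub 2 1 (-20800) 41600; Mv 1 2 (-8528) 19552;
     Sub 0 1 (-8736) 20800; Sub 0 2 (-8320) 20800; Sub 0 3 (-6240) 20800; Sub 0 4 (-4160) 20800;
     Sub 0 5 0 20800; Sub 0 6 4160 20800; Mv 0 6 (-1040) 18720; Mv 0 7 2080 16640;
     Sub 2 1 (-9568) 19136; Sub 2 1 (-9360) 18720; Sub 2 1 (-8320) 16640; Sub 2 1 (-7280) 14560;
     Sub 2 1 (-5200) 10400; Sub 2 1 (-3120) 6240; Mv 2 3 (-4160) 12480; Mv 2 2 (-1040) 10400;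
     App R2c true (-1560) 1560 (-2600) (-3120) (-1040) 15600 [:: (0, 5); (2, 2)];
     Mv 0 5 (-5200) 16640;
     Lv [:: [:: 1; 2; 1; 2; 2; 2; 2; 1; 1; 1; 1]; [:: 1; 2; 1; 1; 1]; [:: 1; 1; 1; 1; 1; 1; 1; 1; 1; 1]];
     Del 0 4; Mv 0 4 (-6240) 16640; Del 0 3; Mv 2 4 (-6864) 17056; Del 2 3;
     Mv 2 4 (-7696) 18720; Del 2 3; Mv 1 2 (-8060) 19240; Sub 1 1 (-9334) 17316;
     Sub 1 3 (-7254) 21476; Mv 1 2 (-8320) 17680; Mv 1 4 (-7280) 19760; Mv 1 3 (-7696) 18928;
     Lv [:: [:: 1; 2; 1; 3; 2; 1; 1; 1; 1]; [:: 1; 1; 2; 2; 1; 1; 1]; [:: 1; 1; 1; 1; 1; 1; 1; 1]];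
     Del 1 2; Sub 2 3 (-8840) 18720; Sub 2 3 (-6760) 18720; Sub 0 3 (-8060) 20280;
     Sub 0 4 (-7410) 18980; Sub 0 5 (-7020) 18200; Mv 0 4 (-8320) 19760; Mv 0 6 (-7280) 17680;
     App R3a true 260 390 (-7800) (-520) 260 18720 [:: (0, 4); (1, 2); (2, 4)];
     Mv 0 6 (-6175) 15470; Del 0 5; Del 2 3; Del 2 3; Sub 1 2 (-7878) 18564;
     Mv 1 3 (-6500) 18200; Mv 0 5 (-7488) 18304; Del 0 4; Mv 0 4 (-7488) 19136; Del 0 3;
     Mv 1 3 (-4160) 16640; Mv 1 2 (-12480) 8320;
     Lv [:: [:: 1; 2; 1; 2; 2; 1; 1; 1; 1]; [:: 1; 1; 1; 2; 1; 1; 1]; [:: 1; 1; 1; 1; 1; 1; 1; 1]];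
     Del 1 1; Mv 1 3 (-2080) 29120;
     Lv [:: [:: 1; 2; 1; 2; 2; 1; 1; 1; 1]; [:: 1; 1; 2; 2; 1; 1]; [:: 1; 1; 1; 1; 1; 1; 1; 1]];
     Del 1 2;
     Lv [:: [:: 1; 2; 2; 2; 2; 1; 1; 1; 1]; [:: 1; 1; 2; 1; 1]; [:: 1; 1; 1; 1; 1; 1; 1; 1]];
     Del 0 1; Sub 0 2 (-6240) 16640; Sub 0 3 (-6032) 16224; Sub 0 1 (-12480) 20800; Del 2 4;
     Sub 2 3 (-5200) 18720; Sub 2 3 (-4784) 18720; Sub 2 6 (-11440) 22880;
     App R2d false 520 (-1560) (-8840) 1040 1040 19760 [:: (0, 2); (2, 5)]; Del 0 4; Del 0 2;
     Mv 0 2 (-18720) 18720; Del 0 1; Mv 0 2 (-17680) 16640; Del 0 1; Mv 0 3 3120 16640;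
     Lv [:: [:: 1; 2; 2; 2; 1; 1; 1]; [:: 1; 1; 2; 1; 1]; [:: 1; 1; 1; 1; 1; 1; 1; 1; 1; 1]];
     Del 0 2; Del 2 3; Del 2 4; Mv 2 5 (-13000) 30160; Del 2 4; Mv 2 4 (-10920) 30160; Del 2 3;
     Mv 2 2 (-520) 9360; Del 2 1; Mv 1 2 (-18200) 26000; Sub 0 2 1664 15808;
     Mv 0 2 (-14768) 18304; Del 0 1; Sub 2 1 (-624) 11232; Mv 2 3 (-10712) 26416; Del 2 2;
     Mv 0 2 4160 20800; Del 0 1; Mv 2 2 (-3120) 6240; Del 2 1; Del 2 1; Del 2 0; Mv 0 2 0 20800;
     Lv [:: [:: 1; 2; 2; 1; 1]; [:: 1; 1; 2; 1; 1]; [:: 1; 1]]; Del 0 1; Mv 0 1 (-36400) 10400;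
     Lv [:: [:: 2; 2; 1; 1]; [:: 1; 1; 2; 1; 1]; [:: 1; 1]]; Del 0 0; Mv 1 1 (-35100) (-39000);
     Del 1 0; Mv 1 2 16900 65000; Lv [:: [:: 2; 1; 1]; [:: 1; 2; 2; 1]; [:: 1; 1]]; Del 1 1;
     Sub 0 0 (-12480) 14080; Mv 0 1 0 (-52000); Mv 0 2 52000 (-26000);
     Lv [:: [:: 2; 2; 2; 1]; [:: 1; 2; 1]; [:: 1; 1]]; Del 0 1; Mv 1 1 (-10400) (-20800);
     Lv [:: [:: 3; 2; 1]; [:: 2; 2; 1]; [:: 1; 1]]; Del 1 0;
     Lv [:: [:: 3; 3; 3]; [:: 2; 2]; [:: 1; 1]]].

Lemma R3b_from_2c_2d_3a_valid : certifies 52000 R3b_from_2c_2d_3a R3b.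
Proof. by vm_compute. Qed.

Definition R3c_from_2c_2d_3a : seq op :=
  [:: Mv 0 1 0 24; Sub 1 0 8 16; Sub 1 1 10 20; Sub 1 2 20 40; Sub 1 3 30 60; Sub 1 4 50 100;
     Sub 1 5 70 140; Mv 1 5 30 100; Mv 1 6 30 140; Sub 2 0 (-8) 16; Sub 2 0 (-10) 20;
     Sub 2 0 (-20) 40; Sub 2 0 (-30) 60; Sub 2 0 (-50) 100; Sub 2 0 (-70) 140; Mv 2 2 (-30) 100;
     Mv 2 1 (-30) 140; App R2d true (-30) 0 0 0 (-20) 100 [:: (1, 4); (2, 1)]; Mv 1 4 (-5) 70;
     Del 1 3; Mv 1 3 (-10) 60; Del 1 2; Mv 2 3 (-10) 52; Del 2 2; Mv 2 3 (-2) 36; Del 2 2;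
     Mv 0 1 0 30; Sub 0 0 (-20) 27; Sub 0 2 20 27; Mv 0 1 (-20) 40; Mv 0 3 20 40;
     Sub 1 2 (-10) 60; Sub 2 2 10 60; App R3a false 10 0 0 0 10 40 [:: (0, 1); (1, 2); (2, 3)];
     Del 1 2; Del 2 2; Mv 0 2 0 80; Mv 0 1 (-100) 40; Del 0 0; Mv 0 2 100 40; Del 0 1; Del 1 0;
     Sub 1 1 (-10) 60; Sub 1 2 (-12) 64; Sub 1 0 (-10) (-20); Del 2 3; Sub 2 2 10 60;
     Sub 2 2 12 64; Sub 2 5 10 (-20); App R2c false 10 0 0 0 20 20 [:: (1, 1); (2, 4)]; Del 1 3;
     Del 1 1; Mv 1 1 (-55) (-70); Del 1 0; Mv 1 1 (-65) (-50); Del 1 0; Mv 1 2 35 150; Del 1 1;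
     Del 2 2; Del 2 3; Mv 2 4 55 (-70); Del 2 3; Mv 2 3 65 (-50); Del 2 2; Mv 2 1 (-35) 150;
     Del 2 0; Mv 0 1 0 (-100); Sub 1 1 22 140; Mv 1 1 (-39) (-30); Del 1 0; Sub 2 0 (-22) 140;
     Mv 2 2 39 (-30); Del 2 1; Mv 1 1 70 140; Del 1 0; Mv 2 1 (-70) 140; Del 2 0;
     Lv [:: [:: 3; 3; 3]; [:: 2; 2]; [:: 1; 1]]].

Lemma R3c_from_2c_2d_3a_valid : certifies 100 R3c_from_2c_2d_3a R3c.
Proof. by vm_compute. Qed.

Definition R3f_from_2c_2d_3a : seq op :=
  [:: Sub 0 0 (-31200) 36400; Sub 0 2 31200 36400; Mv 0 1 (-31200) 20800; Mv 0 3 31200 20800;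
     Mv 0 2 0 20800; Del 0 1; Sub 2 0 (-5200) 10400; Mv 2 1 2600 15600; Sub 2 1 27300 (-44200);
     Mv 2 2 20800 0; Sub 2 0 (-24700) 59800; Mv 2 1 0 41600; Sub 0 1 (-10400) 20800;
     Sub 1 0 0 0; Sub 1 0 20800 41600; Mv 2 2 8528 19552; Sub 0 2 8736 20800;
     Sub 0 2 8320 20800; Sub 0 2 6240 20800; Sub 0 2 4160 20800; Sub 0 2 0 20800;
     Sub 0 2 (-4160) 20800; Mv 0 4 1040 18720; Mv 0 3 (-2080) 16640; Sub 1 1 9568 19136;
     Sub 1 2 9360 18720; Sub 1 3 8320 16640; Sub 1 4 7280 14560; Sub 1 5 5200 10400;
     Sub 1 6 3120 6240; Mv 1 6 4160 12480; Mv 1 7 1040 10400;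
     App R2c true 1560 1560 2600 (-3120) 1040 15600 [:: (0, 3); (1, 5)]; Mv 0 5 5200 16640;
     Del 0 4; Mv 0 5 6240 16640;
     Lv [:: [:: 1; 1; 1; 2; 2; 2; 1; 2; 1; 1]; [:: 1; 1; 1; 2; 1; 1; 1; 1; 1; 1]; [:: 1; 1; 1; 1; 1]];
     Del 0 4; Mv 1 5 6864 17056; Del 1 4; Mv 1 4 7696 18720;
     Lv [:: [:: 1; 1; 1; 2; 3; 1; 2; 1; 1]; [:: 1; 1; 1; 2; 2; 1; 1; 1; 1]; [:: 1; 1; 1; 1; 1]];
     Del 1 3; Mv 2 2 8060 19240; Sub 2 2 9334 17316; Sub 2 1 7254 21476; Mv 2 4 8320 17680;
     Mv 2 2 7280 19760; Mv 2 3 7696 18928; Del 2 2; Sub 1 3 8840 18720; Sub 1 4 6760 18720;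
     Sub 0 4 8060 20280; Sub 0 4 7410 18980; Sub 0 4 7020 18200; Mv 0 7 8320 19760;
     Mv 0 5 7280 17680; App R3a true 260 (-390) 7800 520 260 18720 [:: (0, 5); (1, 4); (2, 2)];
     Mv 0 5 6175 15470; Del 0 4; Del 1 4; Del 1 3; Sub 2 2 7878 18564; Mv 2 3 6500 18200;
     Mv 0 5 7488 18304; Del 0 4; Mv 0 5 7488 19136; Del 0 4; Mv 2 3 4160 16640;
     Mv 2 4 12480 8320; Del 2 3; Mv 2 2 2080 29120; Del 2 1;
     Lv [:: [:: 1; 1; 1; 2; 3; 2; 2; 1; 1]; [:: 1; 1; 1; 2; 1; 1; 1; 1]; [:: 1; 1; 1; 1; 1]];
     Del 0 5; Sub 0 4 6240 16640; Sub 0 4 6032 16224; Sub 0 7 12480 20800; Del 1 1;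
     Sub 1 2 5200 18720; Sub 1 3 4784 18720; Sub 1 1 11440 22880;
     App R2d false (-520) (-1560) 8840 1040 (-1040) 19760 [:: (0, 6); (1, 2)]; Del 0 4; Del 0 5;
     Mv 0 6 18720 18720; Del 0 5; Mv 0 5 17680 16640;
     Lv [:: [:: 1; 1; 1; 2; 2; 2; 1; 1]; [:: 1; 1; 1; 1; 1; 2; 1; 1; 1; 1]; [:: 1; 1; 1; 1; 1]];
     Del 0 4; Mv 0 3 (-3120) 16640;
     Lv [:: [:: 1; 1; 2; 2; 2; 1; 1]; [:: 1; 1; 1; 1; 1; 2; 1; 1; 1; 1]; [:: 1; 1; 1; 1; 1]];
     Del 0 2;
     Lv [:: [:: 1; 1; 2; 2; 1; 1]; [:: 1; 1; 1; 1; 2; 2; 1; 1; 1; 1]; [:: 1; 1; 1; 1; 1]];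
     Del 1 4; Del 1 2; Mv 1 2 13000 30160; Del 1 1; Mv 1 2 10920 30160;
     Lv [:: [:: 1; 1; 2; 2; 1; 1]; [:: 1; 2; 2; 1; 1; 1; 1]; [:: 1; 1; 1; 1; 1]]; Del 1 1;
     Mv 1 3 520 9360; Del 1 2; Mv 2 2 18200 26000; Sub 0 2 (-1664) 15808; Mv 0 4 14768 18304;
     Del 0 3; Sub 1 2 624 11232; Mv 1 2 10712 26416;
     Lv [:: [:: 1; 1; 1; 3; 1; 1]; [:: 1; 2; 2; 1; 1; 1]; [:: 1; 1; 1; 1; 1]]; Del 1 1;
     Mv 0 3 (-4160) 20800;
     Lv [:: [:: 1; 1; 3; 3; 1; 1]; [:: 1; 2; 1; 1; 1]; [:: 1; 1; 1; 1; 1]]; Del 0 2;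
     Mv 1 2 3120 6240; Lv [:: [:: 1; 1; 3; 1; 1]; [:: 1; 2; 2; 1; 1]; [:: 1; 1; 1; 1; 1]];
     Del 1 1; Lv [:: [:: 1; 1; 3; 1; 1]; [:: 2; 2; 1; 1]; [:: 1; 1; 1; 1; 1]]; Del 1 0;
     Lv [:: [:: 1; 1; 3; 1; 1]; [:: 2; 2; 1]; [:: 1; 1; 1; 1; 1]]; Del 1 0; Mv 0 2 0 20800;
     Lv [:: [:: 1; 3; 3; 1; 1]; [:: 2; 1]; [:: 1; 1; 1; 1; 1]]; Del 0 1; Mv 0 2 36400 10400;
     Lv [:: [:: 1; 3; 3; 1]; [:: 2; 1]; [:: 1; 1; 1; 1; 1]]; Del 0 1; Mv 2 3 35100 (-39000);
     Del 2 2; Mv 2 1 (-16900) 65000; Del 2 0; Sub 0 1 12480 14080; Mv 0 2 0 (-52000);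
     Mv 0 1 (-52000) (-26000); Lv [:: [:: 3; 3; 2; 1]; [:: 2; 1]; [:: 1; 1; 1]]; Del 0 0;
     Mv 2 1 10400 (-20800); Del 2 0; Lv [:: [:: 3; 3; 3]; [:: 2; 2]; [:: 1; 1]]].

Lemma R3f_from_2c_2d_3a_valid : certifies 52000 R3f_from_2c_2d_3a R3f.
Proof. by vm_compute. Qed.

Definition R3d_from_2a_2b_3b : seq op :=
  [:: Sub 0 1 31200 36400; Sub 0 0 (-31200) 36400; Mv 0 3 31200 20800; Mv 0 1 (-31200) 20800;
     Mv 0 2 0 20800; Del 0 1; Sub 2 0 5200 10400; Mv 2 1 (-2600) 15600;
     Sub 2 0 (-27300) (-44200); Mv 2 1 (-20800) 0; Sub 2 2 24700 59800; Mv 2 3 0 41600;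
     Sub 0 1 10400 20800; Sub 1 0 0 0; Sub 1 0 (-20800) 41600; Mv 2 2 (-8528) 19552;
     Sub 0 1 (-8736) 20800; Sub 0 2 (-8320) 20800; Sub 0 3 (-6240) 20800; Sub 0 4 (-4160) 20800;
     Sub 0 5 0 20800; Sub 0 6 4160 20800; Mv 0 6 (-1040) 18720; Mv 0 7 2080 16640;
     Sub 1 1 (-9568) 19136; Sub 1 2 (-9360) 18720; Sub 1 3 (-8320) 16640; Sub 1 4 (-7280) 14560;
     Sub 1 5 (-5200) 10400; Sub 1 6 (-3120) 6240; Mv 1 6 (-4160) 12480; Mv 1 7 (-1040) 10400;
     App R2b true (-1560) 1560 (-2600) (-3120) (-1040) 15600 [:: (0, 5); (1, 5)];
     Mv 0 5 (-5200) 16640;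
     Lv [:: [:: 1; 2; 1; 2; 2; 2; 2; 1; 1; 1; 1]; [:: 1; 1; 1; 2; 1; 1; 1; 1; 1; 1]; [:: 1; 1; 1; 1; 1]];
     Del 0 4; Mv 0 4 (-6240) 16640; Del 0 3; Mv 1 5 (-6864) 17056; Del 1 4;
     Mv 1 4 (-7696) 18720;
     Lv [:: [:: 1; 2; 1; 3; 2; 1; 1; 1; 1]; [:: 1; 1; 1; 2; 2; 1; 1; 1; 1]; [:: 1; 1; 1; 1; 1]];
     Del 1 3; Mv 2 2 (-8060) 19240; Sub 2 1 (-9334) 17316; Sub 2 3 (-7254) 21476;
     Mv 2 2 (-8320) 17680; Mv 2 4 (-7280) 19760; Mv 2 3 (-7696) 18928; Del 2 2;
     Sub 1 3 (-8840) 18720; Sub 1 4 (-6760) 18720; Sub 0 3 (-8060) 20280; Sub 0 4 (-7410) 18980;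
     Sub 0 5 (-7020) 18200; Mv 0 4 (-8320) 19760; Mv 0 6 (-7280) 17680;
     App R3b true 260 390 (-7800) (-520) 260 18720 [:: (0, 4); (1, 4); (2, 2)];
     Mv 0 6 (-6175) 15470; Del 0 5; Del 1 4; Del 1 3; Sub 2 2 (-7878) 18564;
     Mv 2 3 (-6500) 18200; Mv 0 5 (-7488) 18304; Del 0 4; Mv 0 4 (-7488) 19136; Del 0 3;
     Mv 2 3 (-4160) 16640; Mv 2 2 (-12480) 8320; Del 2 1; Mv 2 3 (-2080) 29120; Del 2 2;
     Lv [:: [:: 1; 2; 2; 3; 2; 1; 1; 1; 1]; [:: 1; 1; 1; 2; 1; 1; 1; 1]; [:: 1; 1; 1; 1; 1]];
     Del 0 1; Sub 0 2 (-6240) 16640; Sub 0 3 (-6032) 16224; Sub 0 1 (-12480) 20800; Del 1 1;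
     Sub 1 2 (-5200) 18720; Sub 1 3 (-4784) 18720; Sub 1 1 (-11440) 22880;
     App R2a false (-520) 1560 (-8840) (-1040) (-1040) 19760 [:: (1, 2); (0, 2)];
     Lv [:: [:: 1; 1; 1; 1; 2; 2; 2; 1; 1; 1; 1]; [:: 1; 1; 1; 1; 1; 2; 1; 1; 1; 1]; [:: 1; 1; 1; 1; 1]];
     Del 0 4; Del 0 2; Mv 0 2 (-18720) 18720; Del 0 1; Mv 0 2 (-17680) 16640;
     Lv [:: [:: 1; 2; 2; 2; 1; 1; 1; 1]; [:: 1; 1; 1; 1; 1; 2; 1; 1; 1; 1]; [:: 1; 1; 1; 1; 1]];
     Del 0 1; Mv 0 3 3120 16640;
     Lv [:: [:: 1; 2; 2; 2; 1; 1; 1]; [:: 1; 1; 1; 1; 1; 2; 1; 1; 1; 1]; [:: 1; 1; 1; 1; 1]];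
     Del 0 2;
     Lv [:: [:: 1; 2; 2; 1; 1; 1]; [:: 1; 1; 1; 1; 2; 2; 1; 1; 1; 1]; [:: 1; 1; 1; 1; 1]];
     Del 1 4; Del 1 2; Mv 1 2 (-13000) 30160; Del 1 1; Mv 1 2 (-10920) 30160;
     Lv [:: [:: 1; 2; 2; 1; 1; 1]; [:: 1; 2; 2; 1; 1; 1; 1]; [:: 1; 1; 1; 1; 1]]; Del 1 1;
     Mv 1 3 (-520) 9360; Del 1 2; Mv 2 2 (-18200) 26000; Sub 0 2 1664 15808;
     Mv 0 2 (-14768) 18304; Del 0 1; Sub 1 2 (-624) 11232; Mv 1 2 (-10712) 26416;
     Lv [:: [:: 1; 3; 1; 1; 1; 1]; [:: 1; 2; 2; 1; 1; 1]; [:: 1; 1; 1; 1; 1]]; Del 1 1;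
     Mv 0 2 4160 20800; Lv [:: [:: 1; 3; 3; 1; 1; 1]; [:: 1; 2; 1; 1; 1]; [:: 1; 1; 1; 1; 1]];
     Del 0 1; Mv 1 2 (-3120) 6240;
     Lv [:: [:: 1; 3; 1; 1; 1]; [:: 1; 2; 2; 1; 1]; [:: 1; 1; 1; 1; 1]]; Del 1 1;
     Lv [:: [:: 1; 3; 1; 1; 1]; [:: 2; 2; 1; 1]; [:: 1; 1; 1; 1; 1]]; Del 1 0;
     Lv [:: [:: 1; 3; 1; 1; 1]; [:: 2; 2; 1]; [:: 1; 1; 1; 1; 1]]; Del 1 0; Mv 0 2 0 20800;
     Lv [:: [:: 1; 3; 3; 1; 1]; [:: 2; 1]; [:: 1; 1; 1; 1; 1]]; Del 0 1; Mv 0 1 (-36400) 10400;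
     Lv [:: [:: 3; 3; 1; 1]; [:: 2; 1]; [:: 1; 1; 1; 1; 1]]; Del 0 0; Mv 2 1 (-35100) (-39000);
     Del 2 0; Mv 2 2 16900 65000; Del 2 1; Sub 0 0 (-12480) 14080; Mv 0 1 0 (-52000);
     Mv 0 2 52000 (-26000); Lv [:: [:: 2; 3; 3; 1]; [:: 2; 1]; [:: 1; 1; 1]]; Del 0 1;
     Mv 2 1 (-10400) (-20800); Del 2 0; Lv [:: [:: 3; 3; 3]; [:: 2; 2]; [:: 1; 1]]].

Lemma R3d_from_2a_2b_3b_valid : certifies 52000 R3d_from_2a_2b_3b R3d.
Proof. by vm_compute. Qed.

Definition R3h_from_2c_2d_3d : seq op :=
  [:: Mv 0 1 0 24; Sub 1 0 8 16; Sub 1 0 10 20; Sub 1 0 20 40; Sub 1 0 30 60; Sub 1 0 50 100;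
     Sub 1 0 70 140; Mv 1 2 30 100; Mv 1 1 30 140; Sub 2 0 (-8) 16; Sub 2 1 (-10) 20;
     Sub 2 2 (-20) 40; Sub 2 3 (-30) 60; Sub 2 4 (-50) 100; Sub 2 5 (-70) 140; Mv 2 5 (-30) 100;
     Mv 2 6 (-30) 140; App R2c true (-30) 0 0 0 (-20) 100 [:: (1, 1); (2, 4)]; Mv 1 3 (-5) 70;
     Del 1 2; Mv 1 3 (-10) 60; Del 1 2; Mv 2 4 (-10) 52; Del 2 3; Mv 2 3 (-2) 36; Del 2 2;
     Mv 0 1 0 30; Sub 0 0 (-20) 27; Sub 0 2 20 27; Mv 0 1 (-20) 40; Mv 0 3 20 40;
     Sub 1 2 (-10) 60; Sub 2 2 10 60; App R3d false 10 0 0 0 10 40 [:: (0, 1); (1, 3); (2, 2)];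
     Del 1 2; Del 2 2; Mv 0 2 0 80; Mv 0 1 (-100) 40; Del 0 0; Mv 0 2 100 40; Del 0 1; Del 1 3;
     Sub 1 2 (-10) 60; Sub 1 2 (-12) 64; Sub 1 5 (-10) (-20); Del 2 0; Sub 2 1 10 60;
     Sub 2 2 12 64; Sub 2 0 10 (-20); App R2d false 10 0 0 0 20 20 [:: (1, 4); (2, 1)]; Del 1 2;
     Del 1 3; Mv 1 4 (-55) (-70); Del 1 3; Mv 1 3 (-65) (-50); Del 1 2; Mv 1 1 35 150; Del 1 0;
     Del 2 3; Del 2 1; Mv 2 1 55 (-70); Del 2 0; Mv 2 1 65 (-50); Del 2 0; Mv 2 2 (-35) 150;
     Del 2 1; Mv 0 1 0 (-100); Sub 1 0 22 140; Mv 1 2 (-39) (-30); Del 1 1; Sub 2 1 (-22) 140;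
     Mv 2 1 39 (-30); Del 2 0; Mv 1 1 70 140; Del 1 0; Mv 2 1 (-70) 140; Del 2 0;
     Lv [:: [:: 3; 3; 3]; [:: 2; 2]; [:: 1; 1]]].

Lemma R3h_from_2c_2d_3d_valid : certifies 100 R3h_from_2c_2d_3d R3h.
Proof. by vm_compute. Qed.

Definition R3e_from_2c_2d_3h : seq op :=
  [:: Sub 0 1 31200 36400; Sub 0 0 (-31200) 36400; Mv 0 3 31200 20800; Mv 0 1 (-31200) 20800;
     Mv 0 2 0 20800; Del 0 1; Sub 2 0 5200 10400; Mv 2 1 (-2600) 15600;
     Sub 2 0 (-27300) (-44200); Mv 2 1 (-20800) 0; Sub 2 2 24700 59800; Mv 2 3 0 41600;
     Sub 0 1 10400 20800; Sub 1 0 0 0; Sub 1 1 (-20800) 41600; Mv 2 2 (-8528) 19552;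
     Sub 0 1 (-8736) 20800; Sub 0 2 (-8320) 20800; Sub 0 3 (-6240) 20800; Sub 0 4 (-4160) 20800;
     Sub 0 5 0 20800; Sub 0 6 4160 20800; Mv 0 6 (-1040) 18720; Mv 0 7 2080 16640;
     Sub 1 1 (-9568) 19136; Sub 1 1 (-9360) 18720; Sub 1 1 (-8320) 16640; Sub 1 1 (-7280) 14560;
     Sub 1 1 (-5200) 10400; Sub 1 1 (-3120) 6240; Mv 1 3 (-4160) 12480; Mv 1 2 (-1040) 10400;
     App R2c true (-1560) 1560 (-2600) (-3120) (-1040) 15600 [:: (0, 5); (1, 2)];
     Mv 0 5 (-5200) 16640;
     Lv [:: [:: 1; 2; 1; 2; 2; 2; 2; 1; 1; 1; 1]; [:: 1; 1; 1; 1; 1; 2; 1; 1; 1; 1]; [:: 1; 1; 1; 1; 1]];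
     Del 0 4; Mv 0 4 (-6240) 16640; Del 0 3; Mv 1 4 (-6864) 17056; Del 1 3;
     Mv 1 4 (-7696) 18720;
     Lv [:: [:: 1; 2; 1; 3; 2; 1; 1; 1; 1]; [:: 1; 1; 1; 2; 2; 1; 1; 1; 1]; [:: 1; 1; 1; 1; 1]];
     Del 1 3; Mv 2 2 (-8060) 19240; Sub 2 1 (-9334) 17316; Sub 2 3 (-7254) 21476;
     Mv 2 2 (-8320) 17680; Mv 2 4 (-7280) 19760; Mv 2 3 (-7696) 18928; Del 2 2;
     Sub 1 3 (-8840) 18720; Sub 1 3 (-6760) 18720; Sub 0 3 (-8060) 20280; Sub 0 4 (-7410) 18980;
     Sub 0 5 (-7020) 18200; Mv 0 4 (-8320) 19760; Mv 0 6 (-7280) 17680;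
     App R3h true 260 390 (-7800) (-520) 260 18720 [:: (0, 4); (1, 4); (2, 2)];
     Mv 0 6 (-6175) 15470; Del 0 5; Del 1 3; Del 1 3; Sub 2 2 (-7878) 18564;
     Mv 2 3 (-6500) 18200; Mv 0 5 (-7488) 18304; Del 0 4; Mv 0 4 (-7488) 19136; Del 0 3;
     Mv 2 3 (-4160) 16640; Mv 2 2 (-12480) 8320; Del 2 1; Mv 2 3 (-2080) 29120; Del 2 2;
     Lv [:: [:: 1; 2; 2; 3; 2; 1; 1; 1; 1]; [:: 1; 1; 1; 2; 1; 1; 1; 1]; [:: 1; 1; 1; 1; 1]];
     Del 0 1; Sub 0 2 (-6240) 16640; Sub 0 3 (-6032) 16224; Sub 0 1 (-12480) 20800; Del 1 4;
     Sub 1 3 (-5200) 18720; Sub 1 3 (-4784) 18720; Sub 1 6 (-11440) 22880;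
     App R2d false 520 (-1560) (-8840) 1040 1040 19760 [:: (0, 2); (1, 5)];
     Lv [:: [:: 1; 1; 1; 1; 2; 2; 2; 1; 1; 1; 1]; [:: 1; 1; 1; 2; 1; 1; 1; 1; 1; 1]; [:: 1; 1; 1; 1; 1]];
     Del 0 4; Del 0 2; Mv 0 2 (-18720) 18720; Del 0 1; Mv 0 2 (-17680) 16640;
     Lv [:: [:: 1; 2; 2; 2; 1; 1; 1; 1]; [:: 1; 1; 1; 2; 1; 1; 1; 1; 1; 1]; [:: 1; 1; 1; 1; 1]];
     Del 0 1; Mv 0 3 3120 16640;
     Lv [:: [:: 1; 2; 2; 2; 1; 1; 1]; [:: 1; 1; 1; 2; 1; 1; 1; 1; 1; 1]; [:: 1; 1; 1; 1; 1]];
     Del 0 2;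
     Lv [:: [:: 1; 2; 2; 1; 1; 1]; [:: 1; 1; 1; 2; 2; 1; 1; 1; 1; 1]; [:: 1; 1; 1; 1; 1]];
     Del 1 3; Del 1 4; Mv 1 5 (-13000) 30160; Del 1 4; Mv 1 4 (-10920) 30160;
     Lv [:: [:: 1; 2; 2; 1; 1; 1]; [:: 1; 1; 1; 2; 2; 1; 1]; [:: 1; 1; 1; 1; 1]]; Del 1 3;
     Mv 1 2 (-520) 9360; Del 1 1; Mv 2 2 (-18200) 26000; Sub 0 2 1664 15808;
     Mv 0 2 (-14768) 18304; Del 0 1; Sub 1 1 (-624) 11232; Mv 1 3 (-10712) 26416;
     Lv [:: [:: 1; 3; 1; 1; 1; 1]; [:: 1; 1; 2; 2; 1; 1]; [:: 1; 1; 1; 1; 1]]; Del 1 2;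
     Mv 0 2 4160 20800; Lv [:: [:: 1; 3; 3; 1; 1; 1]; [:: 1; 1; 2; 1; 1]; [:: 1; 1; 1; 1; 1]];
     Del 0 1; Mv 1 2 (-3120) 6240;
     Lv [:: [:: 1; 3; 1; 1; 1]; [:: 1; 2; 2; 1; 1]; [:: 1; 1; 1; 1; 1]]; Del 1 1;
     Lv [:: [:: 1; 3; 1; 1; 1]; [:: 1; 2; 2; 1]; [:: 1; 1; 1; 1; 1]]; Del 1 1;
     Lv [:: [:: 1; 3; 1; 1; 1]; [:: 2; 2; 1]; [:: 1; 1; 1; 1; 1]]; Del 1 0; Mv 0 2 0 20800;
     Lv [:: [:: 1; 3; 3; 1; 1]; [:: 2; 1]; [:: 1; 1; 1; 1; 1]]; Del 0 1; Mv 0 1 (-36400) 10400;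
     Lv [:: [:: 3; 3; 1; 1]; [:: 2; 1]; [:: 1; 1; 1; 1; 1]]; Del 0 0; Mv 2 1 (-35100) (-39000);
     Del 2 0; Mv 2 2 16900 65000; Del 2 1; Sub 0 0 (-12480) 14080; Mv 0 1 0 (-52000);
     Mv 0 2 52000 (-26000); Lv [:: [:: 2; 3; 3; 1]; [:: 2; 1]; [:: 1; 1; 1]]; Del 0 1;
     Mv 2 1 (-10400) (-20800); Del 2 0; Lv [:: [:: 3; 3; 3]; [:: 2; 2]; [:: 1; 1]]].

Lemma R3e_from_2c_2d_3h_valid : certifies 52000 R3e_from_2c_2d_3h R3e.
Proof. by vm_compute. Qed.

Definition R3g_from_2c_2d_3h : seq op :=
  [:: Sub 0 0 (-31200) 36400; Sub 0 2 31200 36400; Mv 0 1 (-31200) 20800; Mv 0 3 31200 20800;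
     Mv 0 2 0 20800; Del 0 1; Sub 1 0 (-5200) 10400; Mv 1 1 2600 15600; Sub 1 1 27300 (-44200);
     Mv 1 2 20800 0; Sub 1 0 (-24700) 59800; Mv 1 1 0 41600; Sub 0 1 (-10400) 20800;
     Sub 2 0 0 0; Sub 2 0 20800 41600; Mv 1 2 8528 19552; Sub 0 2 8736 20800;
     Sub 0 2 8320 20800; Sub 0 2 6240 20800; Sub 0 2 4160 20800; Sub 0 2 0 20800;
     Sub 0 2 (-4160) 20800; Mv 0 4 1040 18720; Mv 0 3 (-2080) 16640; Sub 2 1 9568 19136;
     Sub 2 2 9360 18720; Sub 2 3 8320 16640; Sub 2 4 7280 14560; Sub 2 5 5200 10400;
     Sub 2 6 3120 6240; Mv 2 6 4160 12480; Mv 2 7 1040 10400;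
     App R2c true 1560 1560 2600 (-3120) 1040 15600 [:: (0, 3); (2, 5)]; Mv 0 5 5200 16640;
     Del 0 4; Mv 0 5 6240 16640;
     Lv [:: [:: 1; 1; 1; 2; 2; 2; 1; 2; 1; 1]; [:: 1; 1; 2; 1; 1]; [:: 1; 1; 1; 1; 1; 1; 1; 1; 1; 1]];
     Del 0 4; Mv 2 5 6864 17056; Del 2 4; Mv 2 4 7696 18720; Del 2 3; Mv 1 2 8060 19240;
     Sub 1 2 9334 17316; Sub 1 1 7254 21476; Mv 1 4 8320 17680; Mv 1 2 7280 19760;
     Mv 1 3 7696 18928;
     Lv [:: [:: 1; 1; 1; 2; 3; 1; 2; 1; 1]; [:: 1; 1; 2; 2; 1; 1; 1]; [:: 1; 1; 1; 1; 1; 1; 1; 1]];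
     Del 1 2; Sub 2 3 8840 18720; Sub 2 4 6760 18720; Sub 0 4 8060 20280; Sub 0 4 7410 18980;
     Sub 0 4 7020 18200; Mv 0 7 8320 19760; Mv 0 5 7280 17680;
     App R3h true 260 (-390) 7800 520 260 18720 [:: (0, 5); (1, 2); (2, 4)]; Mv 0 5 6175 15470;
     Del 0 4; Del 2 4; Del 2 3; Sub 1 2 7878 18564; Mv 1 3 6500 18200; Mv 0 5 7488 18304;
     Del 0 4; Mv 0 5 7488 19136; Del 0 4; Mv 1 3 4160 16640; Mv 1 4 12480 8320; Del 1 3;
     Mv 1 2 2080 29120;
     Lv [:: [:: 1; 1; 1; 2; 2; 1; 2; 1; 1]; [:: 1; 2; 2; 1; 1; 1]; [:: 1; 1; 1; 1; 1; 1; 1; 1]];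
     Del 1 1;
     Lv [:: [:: 1; 1; 1; 2; 2; 2; 2; 1; 1]; [:: 1; 2; 1; 1; 1]; [:: 1; 1; 1; 1; 1; 1; 1; 1]];
     Del 0 5; Sub 0 4 6240 16640; Sub 0 4 6032 16224; Sub 0 7 12480 20800; Del 2 1;
     Sub 2 2 5200 18720; Sub 2 3 4784 18720; Sub 2 1 11440 22880;
     App R2d false (-520) (-1560) 8840 1040 (-1040) 19760 [:: (0, 6); (2, 2)]; Del 0 4; Del 0 5;
     Mv 0 6 18720 18720; Del 0 5; Mv 0 5 17680 16640; Del 0 4; Mv 0 3 (-3120) 16640;
     Lv [:: [:: 1; 1; 2; 2; 2; 1; 1]; [:: 1; 2; 1; 1; 1]; [:: 1; 1; 1; 1; 1; 1; 1; 1; 1; 1]];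
     Del 0 2; Del 2 4; Del 2 2; Mv 2 2 13000 30160; Del 2 1; Mv 2 2 10920 30160; Del 2 1;
     Mv 2 3 520 9360; Del 2 2; Mv 1 2 18200 26000; Sub 0 2 (-1664) 15808; Mv 0 4 14768 18304;
     Del 0 3; Sub 2 2 624 11232; Mv 2 2 10712 26416; Del 2 1; Mv 0 3 (-4160) 20800; Del 0 2;
     Mv 2 2 3120 6240; Del 2 1; Del 2 0; Del 2 0; Mv 0 2 0 20800;
     Lv [:: [:: 1; 2; 2; 1; 1]; [:: 1; 2; 1; 1; 1]; [:: 1; 1]]; Del 0 1; Mv 0 2 36400 10400;
     Lv [:: [:: 1; 2; 2; 1]; [:: 1; 2; 1; 1; 1]; [:: 1; 1]]; Del 0 1; Mv 1 3 35100 (-39000);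
     Del 1 2; Mv 1 1 (-16900) 65000; Lv [:: [:: 1; 2; 1]; [:: 2; 2; 1; 1]; [:: 1; 1]]; Del 1 0;
     Sub 0 1 12480 14080; Mv 0 2 0 (-52000); Mv 0 1 (-52000) (-26000);
     Lv [:: [:: 2; 2; 2; 1]; [:: 2; 1; 1]; [:: 1; 1]]; Del 0 0; Mv 1 1 10400 (-20800);
     Lv [:: [:: 2; 3; 1]; [:: 2; 2; 1]; [:: 1; 1]]; Del 1 0;
     Lv [:: [:: 3; 3; 3]; [:: 2; 2]; [:: 1; 1]]].

Lemma R3g_from_2c_2d_3h_valid : certifies 52000 R3g_from_2c_2d_3h R3g.
Proof. by vm_compute. Qed.

Definition R3d_from_2c_2d_3h : seq op :=
  [:: Mv 0 1 0 24; Sub 1 0 (-8) 16; Sub 1 0 (-10) 20; Sub 1 0 (-20) 40; Sub 1 0 (-30) 60;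
     Sub 1 0 (-50) 100; Sub 1 0 (-70) 140; Mv 1 2 (-30) 100; Mv 1 1 (-30) 140; Sub 2 0 8 16;
     Sub 2 1 10 20; Sub 2 2 20 40; Sub 2 3 30 60; Sub 2 4 50 100; Sub 2 5 70 140; Mv 2 5 30 100;
     Mv 2 6 30 140; App R2d true 30 0 0 0 20 100 [:: (1, 1); (2, 4)]; Mv 1 3 5 70; Del 1 2;
     Mv 1 3 10 60; Del 1 2; Mv 2 4 10 52; Del 2 3; Mv 2 3 2 36; Del 2 2; Mv 0 1 0 30;
     Sub 0 1 20 27; Sub 0 0 (-20) 27; Mv 0 3 20 40; Mv 0 1 (-20) 40; Sub 1 2 10 60;
     Sub 2 2 (-10) 60; App R3h false 10 0 0 0 10 40 [:: (0, 1); (1, 3); (2, 2)]; Del 1 2;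
     Del 2 2; Mv 0 2 0 80; Mv 0 3 100 40; Del 0 2; Mv 0 1 (-100) 40; Del 0 0; Del 1 3;
     Sub 1 2 10 60; Sub 1 2 12 64; Sub 1 5 10 (-20); Del 2 0; Sub 2 1 (-10) 60;
     Sub 2 2 (-12) 64; Sub 2 0 (-10) (-20);
     App R2c false (-10) 0 0 0 (-20) 20 [:: (1, 4); (2, 1)]; Del 1 2; Del 1 3; Mv 1 4 55 (-70);
     Del 1 3; Mv 1 3 65 (-50); Del 1 2; Mv 1 1 (-35) 150; Del 1 0; Del 2 3; Del 2 1;
     Mv 2 1 (-55) (-70); Del 2 0; Mv 2 1 (-65) (-50); Del 2 0; Mv 2 2 35 150; Del 2 1;
     Mv 0 1 0 (-100); Sub 1 0 (-22) 140; Mv 1 2 39 (-30); Del 1 1; Sub 2 1 22 140;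
     Mv 2 1 (-39) (-30); Del 2 0; Mv 1 1 (-70) 140; Del 1 0; Mv 2 1 70 140; Del 2 0;
     Lv [:: [:: 3; 3; 3]; [:: 2; 2]; [:: 1; 1]]].

Lemma R3d_from_2c_2d_3h_valid : certifies 100 R3d_from_2c_2d_3h R3d.
Proof. by vm_compute. Qed.

Definition R3b_from_2a_2b_3d : seq op :=
  [:: Sub 0 0 (-31200) 36400; Sub 0 2 31200 36400; Mv 0 1 (-31200) 20800; Mv 0 3 31200 20800;
     Mv 0 2 0 20800; Del 0 1; Sub 2 0 (-5200) 10400; Mv 2 1 2600 15600; Sub 2 0 27300 (-44200);
     Mv 2 1 20800 0; Sub 2 2 (-24700) 59800; Mv 2 3 0 41600; Sub 0 1 (-10400) 20800;
     Sub 1 0 0 0; Sub 1 1 20800 41600; Mv 2 2 8528 19552; Sub 0 2 8736 20800;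
     Sub 0 2 8320 20800; Sub 0 2 6240 20800; Sub 0 2 4160 20800; Sub 0 2 0 20800;
     Sub 0 2 (-4160) 20800; Mv 0 4 1040 18720; Mv 0 3 (-2080) 16640; Sub 1 1 9568 19136;
     Sub 1 1 9360 18720; Sub 1 1 8320 16640; Sub 1 1 7280 14560; Sub 1 1 5200 10400;
     Sub 1 1 3120 6240; Mv 1 3 4160 12480; Mv 1 2 1040 10400;
     App R2b true 1560 1560 2600 (-3120) 1040 15600 [:: (0, 3); (1, 2)]; Mv 0 5 5200 16640;
     Del 0 4; Mv 0 5 6240 16640;
     Lv [:: [:: 1; 1; 1; 2; 2; 2; 1; 2; 1; 1]; [:: 1; 1; 1; 1; 1; 2; 1; 1; 1; 1]; [:: 1; 1; 1; 1; 1]];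
     Del 0 4; Mv 1 4 6864 17056; Del 1 3; Mv 1 4 7696 18720;
     Lv [:: [:: 1; 1; 1; 2; 3; 1; 2; 1; 1]; [:: 1; 1; 1; 2; 2; 1; 1; 1; 1]; [:: 1; 1; 1; 1; 1]];
     Del 1 3; Mv 2 2 8060 19240; Sub 2 1 9334 17316; Sub 2 3 7254 21476; Mv 2 2 8320 17680;
     Mv 2 4 7280 19760; Mv 2 3 7696 18928; Del 2 2; Sub 1 3 8840 18720; Sub 1 3 6760 18720;
     Sub 0 4 8060 20280; Sub 0 4 7410 18980; Sub 0 4 7020 18200; Mv 0 7 8320 19760;
     Mv 0 5 7280 17680; App R3d true 260 (-390) 7800 520 260 18720 [:: (0, 5); (1, 4); (2, 2)];
     Mv 0 5 6175 15470; Del 0 4; Del 1 3; Del 1 3; Sub 2 2 7878 18564; Mv 2 3 6500 18200;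
     Mv 0 5 7488 18304; Del 0 4; Mv 0 5 7488 19136; Del 0 4; Mv 2 3 4160 16640;
     Mv 2 2 12480 8320; Del 2 1; Mv 2 3 2080 29120; Del 2 2;
     Lv [:: [:: 1; 1; 1; 2; 3; 2; 2; 1; 1]; [:: 1; 1; 1; 2; 1; 1; 1; 1]; [:: 1; 1; 1; 1; 1]];
     Del 0 5; Sub 0 4 6240 16640; Sub 0 4 6032 16224; Sub 0 7 12480 20800; Del 1 4;
     Sub 1 3 5200 18720; Sub 1 3 4784 18720; Sub 1 6 11440 22880;
     App R2a false 520 1560 8840 (-1040) 1040 19760 [:: (1, 5); (0, 6)]; Del 0 4; Del 0 5;
     Mv 0 6 18720 18720; Del 0 5; Mv 0 5 17680 16640;
     Lv [:: [:: 1; 1; 1; 2; 2; 2; 1; 1]; [:: 1; 1; 1; 2; 1; 1; 1; 1; 1; 1]; [:: 1; 1; 1; 1; 1]];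
     Del 0 4; Mv 0 3 (-3120) 16640;
     Lv [:: [:: 1; 1; 2; 2; 2; 1; 1]; [:: 1; 1; 1; 2; 1; 1; 1; 1; 1; 1]; [:: 1; 1; 1; 1; 1]];
     Del 0 2;
     Lv [:: [:: 1; 1; 2; 2; 1; 1]; [:: 1; 1; 1; 2; 2; 1; 1; 1; 1; 1]; [:: 1; 1; 1; 1; 1]];
     Del 1 3; Del 1 4; Mv 1 5 13000 30160; Del 1 4; Mv 1 4 10920 30160;
     Lv [:: [:: 1; 1; 2; 2; 1; 1]; [:: 1; 1; 1; 2; 2; 1; 1]; [:: 1; 1; 1; 1; 1]]; Del 1 3;
     Mv 1 2 520 9360; Del 1 1; Mv 2 2 18200 26000; Sub 0 2 (-1664) 15808; Mv 0 4 14768 18304;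
     Del 0 3; Sub 1 1 624 11232; Mv 1 3 10712 26416;
     Lv [:: [:: 1; 1; 1; 3; 1; 1]; [:: 1; 1; 2; 2; 1; 1]; [:: 1; 1; 1; 1; 1]]; Del 1 2;
     Mv 0 3 (-4160) 20800;
     Lv [:: [:: 1; 1; 3; 3; 1; 1]; [:: 1; 1; 2; 1; 1]; [:: 1; 1; 1; 1; 1]]; Del 0 2;
     Mv 1 2 3120 6240; Lv [:: [:: 1; 1; 3; 1; 1]; [:: 1; 2; 2; 1; 1]; [:: 1; 1; 1; 1; 1]];
     Del 1 1; Lv [:: [:: 1; 1; 3; 1; 1]; [:: 1; 2; 2; 1]; [:: 1; 1; 1; 1; 1]]; Del 1 1;
     Lv [:: [:: 1; 1; 3; 1; 1]; [:: 2; 2; 1]; [:: 1; 1; 1; 1; 1]]; Del 1 0; Mv 0 2 0 20800;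
     Lv [:: [:: 1; 3; 3; 1; 1]; [:: 2; 1]; [:: 1; 1; 1; 1; 1]]; Del 0 1; Mv 0 2 36400 10400;
     Lv [:: [:: 1; 3; 3; 1]; [:: 2; 1]; [:: 1; 1; 1; 1; 1]]; Del 0 1; Mv 2 1 35100 (-39000);
     Del 2 0; Mv 2 2 (-16900) 65000; Del 2 1; Sub 0 1 12480 14080; Mv 0 2 0 (-52000);
     Mv 0 1 (-52000) (-26000); Lv [:: [:: 3; 3; 2; 1]; [:: 2; 1]; [:: 1; 1; 1]]; Del 0 0;
     Mv 2 1 10400 (-20800); Del 2 0; Lv [:: [:: 3; 3; 3]; [:: 2; 2]; [:: 1; 1]]].

Lemma R3b_from_2a_2b_3d_valid : certifies 52000 R3b_from_2a_2b_3d R3b.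
Proof. by vm_compute. Qed.

Definition R3a_from_2c_2d_3b : seq op :=
  [:: Sub 0 0 (-31200) 36400; Sub 0 2 31200 36400; Mv 0 1 (-31200) 20800; Mv 0 3 31200 20800;
     Mv 0 2 0 20800; Del 0 1; Sub 1 0 (-5200) 10400; Mv 1 1 2600 15600; Sub 1 0 27300 (-44200);
     Mv 1 1 20800 0; Sub 1 2 (-24700) 59800; Mv 1 3 0 41600; Sub 0 1 (-10400) 20800;
     Sub 2 0 0 0; Sub 2 0 20800 41600; Mv 1 2 8528 19552; Sub 0 2 8736 20800;
     Sub 0 2 8320 20800; Sub 0 2 6240 20800; Sub 0 2 4160 20800; Sub 0 2 0 20800;
     Sub 0 2 (-4160) 20800; Mv 0 4 1040 18720; Mv 0 3 (-2080) 16640; Sub 2 1 9568 19136;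
     Sub 2 2 9360 18720; Sub 2 3 8320 16640; Sub 2 4 7280 14560; Sub 2 5 5200 10400;
     Sub 2 6 3120 6240; Mv 2 6 4160 12480; Mv 2 7 1040 10400;
     App R2c true 1560 1560 2600 (-3120) 1040 15600 [:: (0, 3); (2, 5)]; Mv 0 5 5200 16640;
     Del 0 4; Mv 0 5 6240 16640;
     Lv [:: [:: 1; 1; 1; 2; 2; 2; 1; 2; 1; 1]; [:: 1; 2; 1; 1; 1]; [:: 1; 1; 1; 1; 1; 1; 1; 1; 1; 1]];
     Del 0 4; Mv 2 5 6864 17056; Del 2 4; Mv 2 4 7696 18720; Del 2 3; Mv 1 2 8060 19240;
     Sub 1 1 9334 17316; Sub 1 3 7254 21476; Mv 1 2 8320 17680; Mv 1 4 7280 19760;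
     Mv 1 3 7696 18928;
     Lv [:: [:: 1; 1; 1; 2; 3; 1; 2; 1; 1]; [:: 1; 1; 2; 2; 1; 1; 1]; [:: 1; 1; 1; 1; 1; 1; 1; 1]];
     Del 1 2; Sub 2 3 8840 18720; Sub 2 4 6760 18720; Sub 0 4 8060 20280; Sub 0 4 7410 18980;
     Sub 0 4 7020 18200; Mv 0 7 8320 19760; Mv 0 5 7280 17680;
     App R3b true 260 (-390) 7800 520 260 18720 [:: (0, 5); (1, 2); (2, 4)]; Mv 0 5 6175 15470;
     Del 0 4; Del 2 4; Del 2 3; Sub 1 2 7878 18564; Mv 1 3 6500 18200; Mv 0 5 7488 18304;
     Del 0 4; Mv 0 5 7488 19136; Del 0 4; Mv 1 3 4160 16640; Mv 1 2 12480 8320;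
     Lv [:: [:: 1; 1; 1; 2; 2; 1; 2; 1; 1]; [:: 1; 1; 1; 2; 1; 1; 1]; [:: 1; 1; 1; 1; 1; 1; 1; 1]];
     Del 1 1; Mv 1 3 2080 29120;
     Lv [:: [:: 1; 1; 1; 2; 2; 1; 2; 1; 1]; [:: 1; 1; 2; 2; 1; 1]; [:: 1; 1; 1; 1; 1; 1; 1; 1]];
     Del 1 2;
     Lv [:: [:: 1; 1; 1; 2; 2; 2; 2; 1; 1]; [:: 1; 1; 2; 1; 1]; [:: 1; 1; 1; 1; 1; 1; 1; 1]];
     Del 0 5; Sub 0 4 6240 16640; Sub 0 4 6032 16224; Sub 0 7 12480 20800; Del 2 1;
     Sub 2 2 5200 18720; Sub 2 3 4784 18720; Sub 2 1 11440 22880;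
     App R2d false (-520) (-1560) 8840 1040 (-1040) 19760 [:: (0, 6); (2, 2)]; Del 0 4; Del 0 5;
     Mv 0 6 18720 18720; Del 0 5; Mv 0 5 17680 16640; Del 0 4; Mv 0 3 (-3120) 16640;
     Lv [:: [:: 1; 1; 2; 2; 2; 1; 1]; [:: 1; 1; 2; 1; 1]; [:: 1; 1; 1; 1; 1; 1; 1; 1; 1; 1]];
     Del 0 2; Del 2 4; Del 2 2; Mv 2 2 13000 30160; Del 2 1; Mv 2 2 10920 30160; Del 2 1;
     Mv 2 3 520 9360; Del 2 2; Mv 1 2 18200 26000; Sub 0 2 (-1664) 15808; Mv 0 4 14768 18304;
     Del 0 3; Sub 2 2 624 11232; Mv 2 2 10712 26416; Del 2 1; Mv 0 3 (-4160) 20800; Del 0 2;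
     Mv 2 2 3120 6240; Del 2 1; Del 2 0; Del 2 0; Mv 0 2 0 20800;
     Lv [:: [:: 1; 2; 2; 1; 1]; [:: 1; 1; 2; 1; 1]; [:: 1; 1]]; Del 0 1; Mv 0 2 36400 10400;
     Lv [:: [:: 1; 2; 2; 1]; [:: 1; 1; 2; 1; 1]; [:: 1; 1]]; Del 0 1; Mv 1 1 35100 (-39000);
     Del 1 0; Mv 1 2 (-16900) 65000; Lv [:: [:: 1; 2; 1]; [:: 1; 2; 2; 1]; [:: 1; 1]]; Del 1 1;
     Sub 0 1 12480 14080; Mv 0 2 0 (-52000); Mv 0 1 (-52000) (-26000);
     Lv [:: [:: 2; 2; 2; 1]; [:: 1; 2; 1]; [:: 1; 1]]; Del 0 0; Mv 1 1 10400 (-20800);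
     Lv [:: [:: 2; 3; 1]; [:: 2; 2; 1]; [:: 1; 1]]; Del 1 0;
     Lv [:: [:: 3; 3; 3]; [:: 2; 2]; [:: 1; 1]]].

Lemma R3a_from_2c_2d_3b_valid : certifies 52000 R3a_from_2c_2d_3b R3a.
Proof. by vm_compute. Qed.

End Operations.

(** * Generation *)

Record derivation : Type := Derivation {
  derived : move; grid : Z; ops : seq op; ops_valid : certifies grid ops derived }.

Definition derivations : seq derivation :=
  [:: Derivation R2c_from_1a_2a_3a_valid;
      Derivation R2c_from_1a_2b_3a_valid;
      Derivation R2d_from_1b_2a_3a_valid;
      Derivation R2d_from_1b_2b_3a_valid;
      Derivation R2d_from_1d_2a_3h_valid;
      Derivation R2d_from_1d_2b_3h_valid;
      Derivation R2c_from_1c_2a_3h_valid;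
      Derivation R2c_from_1c_2b_3h_valid;
      Derivation R2b_from_1d_2c_3c_valid;
      Derivation R2a_from_1c_2d_3c_valid;
      Derivation R2a_from_1a_2d_3d_valid;
      Derivation R2b_from_1b_2c_3d_valid;
      Derivation R1b_from_1c_2c_valid;
      Derivation R1d_from_1a_2c_valid;
      Derivation R1a_from_1d_2d_valid;
      Derivation R1c_from_1b_2d_valid;
      Derivation R3b_from_2c_2d_3a_valid;
      Derivation R3c_from_2c_2d_3a_valid;
      Derivation R3f_from_2c_2d_3a_valid;
      Derivation R3d_from_2a_2b_3b_valid;
      Derivation R3h_from_2c_2d_3d_valid;
      Derivation R3e_from_2c_2d_3h_valid;
      Derivation R3g_from_2c_2d_3h_valid;
      Derivation R3d_from_2c_2d_3h_valid;
      Derivation R3b_from_2a_2b_3d_valid;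
      Derivation R3a_from_2c_2d_3b_valid].

(** A move derived in a pass can be used at once by the later derivations of
    the same pass. *)
Definition pass (ds : seq derivation) (L : seq move) : seq move :=
  foldl (fun L d => if all (mem L) (flatten (map uses (ops d))) then derived d :: L else L)
    L ds.

Definition all_in (K : seq move) : bool :=
  all (fun m => m \in K) [:: R1a; R1b; R1c; R1d; R2a; R2b; R2c; R2d;
                            R3a; R3b; R3c; R3d; R3e; R3f; R3g; R3h].

Definition spans (n : nat) (ds : seq derivation) (L : seq move) : bool :=
  all_in (iter n (pass ds) L).

Section Generation.
Variable R : realType.
Implicit Types (S : set move) (L : seq move).

(** A move is one step in its own model disk: the context is made of holes. *)
Lemma move_reaches S m : S m -> reaches S (sides R m).1 (sides R m).2.
Proof.
move=> Sm; apply: rst_step; have [t1 t2] := sides_tangle R m; split=> //.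
apply: Or33; exists m => //; exists id, [seq [:: inr k] | k <- iota 0 (size (sides R m).1)].
have tid X : transport id X = X :> diagram R.
  rewrite /transport -[RHS]map_id; apply: eq_map => w; rewrite -[RHS]map_id.
  by apply: eq_map => -[].
have fid X : size X = size (sides R m).1 ->
    fill [seq [:: inr k] | k <- iota 0 (size (sides R m).1)] X = X :> diagram R.
  move=> <-; rewrite /fill -map_comp -[RHS](mkseq_nth [::]); apply: eq_map => k /=.
  by rewrite cats0.
split=> //.
- exists 1, 0, 0, 1, 0, 0; split; first by rewrite mulr1 mulr0 subr0 ltr01.
  by move=> z; apply: point_eqP; rewrite /=; ring.
- rewrite /holes; have -> : flatten [seq [:: inr k] | k <- iota 0 (size (sides R m).1)] =
      [seq (inr k : vertex R + nat) | k <- iota 0 (size (sides R m).1)].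
    by elim: (iota _ _) => //= k s ->.
  by elim: (iota _ _) => //= k s; rewrite perm_cons.
- by rewrite !tid !fid // sides_emb !size_map; case: m {Sm t1 t2 fid}.
- by split=> z _; rewrite tid.
Qed.

Lemma spans_generating S n ds L : (forall m, m \in L -> S m) -> spans n ds L ->
  generating_set R S.
Proof.
move=> LS; rewrite /spans.
have one L' : (forall m, m \in L' -> reaches S (sides R m).1 (sides R m).2) ->
    forall m, m \in pass ds L' -> reaches S (sides R m).1 (sides R m).2.
  rewrite /pass; elim: ds L' => [|d ds' IHds] L' hL' //=.
  apply: IHds; case: ifP => // /allP us m'; rewrite inE => /orP[/eqP->|]; last exact: hL'.
  by apply: (certifies_reaches (ops_valid d)) => m2 /us; exact: hL'.
have : forall m, m \in iter n (pass ds) L -> reaches S (sides R m).1 (sides R m).2.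
  elim: n => [|n IH]; last by rewrite iterS; exact: one IH.
  by move=> m /LS; exact: move_reaches.
by move: (iter n _ L) => K KS /allP K16 m; apply: KS; apply: K16; case: m.
Qed.

(** Each of the four moves is the only one of its kind: of type III, of type
    II, and of type I with the crossing first passed over, or under. *)
Lemma minimal_four n ds (a b c d : move) (over := [:: R1a; R1d]) (under := [:: R1b; R1c]) :
    a \in [:: R3a; R3h] -> b \in [:: R2a; R2b] ->
    (c \in over) && (d \in under) || (c \in under) && (d \in over) ->
    spans n ds [:: a; b; c; d] ->
  minimal_generating_set R [set a; b; c; d].
Proof.
move=> ha hb hcd sp; split.
  apply: spans_generating sp => m; rewrite !inE => /or4P[] /eqP->; rewrite /=; tauto.
move=> m Sm; have elt m' : ([set a; b; c; d] `\ m) m' -> [/\ m' \in [:: a; b; c; d] & m' != m].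
  case=> h nm; split; last by apply/eqP.
  by case: h => [[[->|->]|->]|->]; rewrite !inE eqxx ?orbT.
have drop (bad : seq move) : (forall m', m' \in [:: a; b; c; d] -> (m' == m) || (m' \in bad)) ->
    forall m', ([set a; b; c; d] `\ m) m' -> m' \in bad.
  by move=> h m' /elt[/h/orP[/eqP->|//]]; rewrite eqxx.
move: ha hb hcd Sm drop; rewrite !inE.
move=> /orP[]/eqP-> /orP[]/eqP-> /orP[]/andP[/orP[]/eqP-> /orP[]/eqP->] Sm drop;
  case: Sm drop => [[[->|->]|->]|->] drop;
  first [ by apply: no_type2; apply: drop; case
        | by apply: (no_type3 (m := R3a)) => //; apply: drop; case
        | by apply: no_over_first; apply: drop; case
        | by apply: no_under_first; apply: drop; case ].
Qed.

End Generation.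

Theorem mainTheorem5 (R : realType) :
  minimal_generating_set R [set R3a; R2a; R1a; R1b] /\
  minimal_generating_set R [set R3a; R2a; R1a; R1c] /\
  minimal_generating_set R [set R3a; R2a; R1b; R1d] /\
  minimal_generating_set R [set R3a; R2b; R1a; R1b] /\
  minimal_generating_set R [set R3a; R2b; R1a; R1c] /\
  minimal_generating_set R [set R3a; R2b; R1b; R1d] /\
  minimal_generating_set R [set R3h; R2a; R1a; R1c] /\
  minimal_generating_set R [set R3h; R2a; R1b; R1d] /\
  minimal_generating_set R [set R3h; R2a; R1c; R1d] /\
  minimal_generating_set R [set R3h; R2b; R1a; R1c] /\
  minimal_generating_set R [set R3h; R2b; R1b; R1d] /\
  minimal_generating_set R [set R3h; R2b; R1c; R1d].
Proof.
have four := @minimal_four R 6%N derivations.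
by do 11![split; first by apply: four; vm_compute]; apply: four; vm_compute.
Qed.
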